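(* (i) For every $g\in\mathrm{BMOA}$, the integral operator $V_g$ on $H^2$ is weakly asymptotically Toeplitz with weak asymptotic symbol $0$. (ii) For every $g\in H^\infty$, the integral operator $S_g$ on $H^2$ is weakly asymptotically Toeplitz with weak asymptotic symbol $g$.
   Context: $\mathbb{D}$ is the open unit disk, $H^2$ is the Hardy space of $\mathbb{D}$, $H^\infty$ is the algebra of bounded holomorphic functions on $\mathbb{D}$. $\mathrm{BMOA}$ is the space of functions in $H^2$ whose boundary values have bounded mean oscillation on the unit circle $\mathbb{T}$. For $g$ holomorphic in $\mathbb{D}$, $V_gf(z)=\int_0^z f(u)g'(u)\,du$ and $S_gf(z)=\int_0^z f'(u)g(u)\,du$. $V_g$ is bounded on $H^2$ iff $g\in\mathrm{BMOA}$; $S_g$ is bounded on $H^2$ iff $g\in H^\infty$. The shift $S$ on $H^2$ is $Sf(z)=zf(z)$ and $S^*f(z)=(f(z)-f(0))/z$ is its adjoint (this $S$ is not to be confused with $S_g$). For $b\in L^\infty(\mathbb{T})$, the Toeplitz operator $T_b$ on $H^2$ is $T_bf=P_+(bf)$, where $P_+$ is the orthogonal projection of $L^2(\mathbb{T})$ onto $H^2$. A bounded operator $T$ on $H^2$ is weakly asymptotically Toeplitz if $\{S^{*n}TS^n\}_n$ converges in the weak operator topology; the limit is then a Toeplitz operator $T_b$ with $b\in L^\infty(\mathbb{T})$, and $b$ is called the (weak) asymptotic symbol of $T$. *)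

(* Defs.v *)
From HB Require Import structures.
From mathcomp Require Import all_boot all_order all_algebra.
From mathcomp Require Import complex.
From mathcomp Require Import all_classical all_reals all_analysis.

Set Implicit Arguments.
Unset Strict Implicit.
Unset Printing Implicit Defensive.

Import Order.TTheory GRing.Theory Num.Theory.
Import numFieldNormedType.Exports.

Local Open Scope classical_set_scope.
Local Open Scope ring_scope.
Local Open Scope complex_scope.

(* Functions on the unit disk and on the unit circle are total functions
   [R[i] -> R[i]]; only their values on the disk (resp. circle) are relevant. *)

(* The topology of [R[i]] and its structure of normed space over itself, for
   limits and complex derivatives. *)
HB.instance Definition _ (R : realType) := GRing.ComAlgebra.copy R[i] R[i]^o.
HB.instance Definition _ (R : realType) := Vector.copy R[i] R[i]^o.
HB.instance Definition _ (R : realType) := NormedModule.copy R[i] R[i]^o.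

Section HardySpace.
Variable R : realType.
Local Notation C := R[i].
Local Notation mu := (@lebesgue_measure R).
Implicit Types (f g h u F U H b : C -> C) (T L : (C -> C) -> (C -> C)).

(* The norm [`|z|] of [z : C] is an element of C (with null imaginary part);
   [cabs z] is the same number in R. *)
Definition cabs (z : C) : R := complex.Re `|z|.

Definition cis (t : R) : C := cos t +i* sin t.

Definition cintegral (D : set R) (f : R -> C) : C :=
  (\int[mu]_(t in D) complex.Re (f t)) +i* (\int[mu]_(t in D) complex.Im (f t)).

Definition disk : set C := [set z | `|z| < 1].

Definition holomorphic_on_disk f := forall z, disk z -> derivable f z 1.

Definition dilation (r : R) f : C -> C := fun w => f (r%:C * w).

Definition circle_measurable F :=
  measurable_fun setT (fun t : R => complex.Re (F (cis t))) /\
  measurable_fun setT (fun t : R => complex.Im (F (cis t))).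

Definition circle_sqnorm F : \bar R :=
  ((2 * pi)^-1%:E *
    \int[mu]_(t in `[0%R, (2 * pi)%R]) ((cabs (F (cis t))) ^+ 2)%:E)%E.

Definition L2_circle F := circle_measurable F /\ (circle_sqnorm F < +oo)%E.

Definition Linfty_circle F :=
  circle_measurable F /\ exists M : R, {ae mu, forall t, cabs (F (cis t)) <= M}.

Definition circle_inner F H : C :=
  (2 * pi)^-1%:C * cintegral `[0, 2 * pi] (fun t => F (cis t) * (H (cis t))^*).

(* Mean value over an arc, with respect to the arc length. *)
Definition arc_mean F (a b : R) : C :=
  (b - a)^-1%:C * cintegral `[a, b] (fun t => F (cis t)).

(* The arcs of the circle are the images of the intervals [a, b] with
   a < b <= a + 2 pi. *)
Definition BMO_circle F :=
  [/\ circle_measurable F,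
      mu.-integrable `[0, 2 * pi] (fun t => (cabs (F (cis t)))%:E) &
      exists M : R, forall a b : R, a < b -> b <= a + 2 * pi ->
        (\int[mu]_(t in `[a, b]) (cabs (F (cis t) - arc_mean F a b))%:E
           <= (M * (b - a))%:E)%E].

Definition hardy_sqnorm f : \bar R :=
  ereal_sup [set circle_sqnorm (dilation r f) | r in `[0, 1[ ].

Definition H2 f := holomorphic_on_disk f /\ (hardy_sqnorm f < +oo)%E.

Definition Hinfty f :=
  holomorphic_on_disk f /\ exists M : R, forall z, disk z -> cabs (f z) <= M.

(* For f, h in H2 the limit exists: it is both the sum of the a_n (b_n)^*, for
   a_n, b_n the Taylor coefficients, and the L2 inner product of the boundary
   values. *)
Definition hardy_inner f h : C :=
  lim (circle_inner (dilation r f) (dilation r h) @[r --> 1^'-]).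

(* F is (a representative of) the function of radial boundary values of f. *)
Definition boundary_value f F :=
  circle_measurable F /\
  {ae mu, forall t, f (r%:C * cis t) @[r --> (1 : R)^'-] --> F (cis t)}.

Definition BMOA f := H2 f /\ exists2 F, boundary_value f F & BMO_circle F.

(* Linearity and boundedness on H2 imply that T f only depends on the values of f
   on the disk, when T f is itself restricted to the disk. *)
Definition bounded_operator T :=
  [/\ forall f, H2 f -> H2 (T f),
      forall (k : C) f h, H2 f -> H2 h -> forall z, disk z ->
        T (fun w => k * f w + h w) z = k * T f z + T h z &
      exists M : R, forall f, H2 f ->
        (hardy_sqnorm (T f) <= (M ^+ 2)%:E * hardy_sqnorm f)%E].

Definition wot_cvg (Tn : nat -> (C -> C) -> (C -> C)) L :=
  forall f h, H2 f -> H2 h ->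
    hardy_inner (Tn n f) h @[n --> \oo] --> hardy_inner (L f) h.

Definition segment_integral f (z : C) : C :=
  cintegral `[0, 1] (fun t => f (t%:C * z) * z).

Definition V_op g f : C -> C := segment_integral (fun w => f w * derive1 g w).

Definition S_op g f : C -> C := segment_integral (fun w => derive1 f w * g w).

Definition shift f : C -> C := fun z => z * f z.

(* (f z - f 0) / z extends holomorphically to z = 0 with value f'(0). *)
Definition backward_shift f : C -> C :=
  fun z => if z == 0 then derive1 f 0 else (f z - f 0) / z.

(* u = P_+ F, where H2 is seen as a subspace of L2 by boundary values. *)
Definition riesz_projection F u :=
  [/\ L2_circle F, H2 u &
      exists2 U, boundary_value u U &
        forall h H, H2 h -> boundary_value h H ->
          circle_inner (fun w => F w - U w) H = 0].

(* L = T_b, i.e., L f = P_+ (b f) *)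
Definition toeplitz_operator b L :=
  Linfty_circle b /\
  forall f, H2 f -> exists2 F, boundary_value f F &
    riesz_projection (fun w => b w * F w) (L f).

Definition shift_compression T (n : nat) : (C -> C) -> (C -> C) :=
  fun f => iter n backward_shift (T (iter n shift f)).

Definition weakly_asymptotically_toeplitz T :=
  bounded_operator T /\
  exists2 L, bounded_operator L & wot_cvg (shift_compression T) L.

Definition weak_asymptotic_symbol T b :=
  exists L, [/\ bounded_operator L, toeplitz_operator b L &
                wot_cvg (shift_compression T) L].

End HardySpace.

(* Main.v *)
(* The Taylor coefficients of V_g f are (1/k) sum_{m<k} f_m (k-m) g_{k-m}; in the
   compression S^*n V_g S^n the factor 1/k becomes 1/(k+n), so that, once V_g is
   bounded, its compressions tend to 0 coefficientwise and hence weakly. By Leibniz'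
   rule S_g f = f g - f(0) g(0) - V_g f, so those of S_g tend to multiplication by g.

   Boundedness of V_g follows from a holomorphic b such that s = Re b + |g|^2 lies
   between 1 and L: the Laplacian of s^2 |f|^2 is at least 2 s |f g'|^2 - s^2 |f'|^2,
   and the Littlewood-Paley identity turns this into |V_g f| <= C |f|. If g is bounded,
   b = 1 will do. If g is in BMOA with boundary values F, take b = 1 + K - B, where
   Re B is the Poisson integral of |F|^2; that Re B - |g|^2 is bounded is Garsia's
   form of the BMO condition, which follows from the (dyadic, L^2) John-Nirenberg
   inequality and the decay of the Poisson kernel.

   Radial limits of f in H2: a subsequence of the Taylor polynomials converges a.e. on
   the circle (Riesz-Fischer), f is the Poisson integral of the limit, and Poisson
   means converge at Lebesgue points. *)
Require Import Defs.
From HB Require Import structures.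
From mathcomp Require Import all_boot all_order all_algebra.
From mathcomp Require Import complex.
From mathcomp Require Import all_classical all_reals all_analysis.
From mathcomp Require Import measurable_realfun ring lra.

Set Implicit Arguments.
Unset Strict Implicit.
Unset Printing Implicit Defensive.

Import Order.TTheory GRing.Theory Num.Theory.
Import numFieldNormedType.Exports.

Local Open Scope classical_set_scope.
Local Open Scope ring_scope.
Local Open Scope complex_scope.

Local Notation "x ^*" := (Num.conj x) : complex_scope.
Local Notation Re := (@complex.Re _).
Local Notation Im := (@complex.Im _).

Ltac pos := repeat (first [by [] | assumption | by apply: ltW | exact: normr_ge0 | exact: sqr_ge0
  | apply: mulr_ge0 | apply: divr_ge0 | apply: addr_ge0 | apply: exprn_ge0
  | apply: mulr_gt0 | apply: divr_gt0 | apply: addr_gt0 | apply: exprn_gt0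
  | rewrite invr_ge0 | rewrite invr_gt0]).

(** * The modulus and the parametrization of the circle *)

(** Functions are handled through their Taylor coefficients: membership in H2 is a uniform bound on
    the partial sums [energy]. The obstacle is the boundedness of [V_op], because g' is controlled
    only through oscillations of boundary values. One needs a bounded weight whose Laplacian
    contains |g'|^2; |g|^2 may be unbounded for g in BMOA, and adding the harmonic function Re b
    repairs this without changing the Laplacian. No differentiation in the plane takes place: s^2
    |f|^2 is a real combination of products of a holomorphic function and a conjugate, so its circle
    means come from Parseval, and differentiating every factor gives its Laplacian. In the variable
    x = r^2 the Laplacian is inverted by two averagings over [0, x], which produce the 1 / (k + 1)^2
    of |V_g f|^2, while s^2 |f'|^2 costs only L^2 |f|^2. This is done on polynomials, the bounds 1
    and L on s being relaxed to 1/2 and L + 1. For BMOA, g(z) is the best constant for the Poisson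
    mean of |F - c|^2 at z, so one good constant c for each z suffices. *)

Section ComplexModulus.
Variable R : realType.
Local Notation C := R[i].
Implicit Types (z w : C) (x y t : R).

Lemma cabsE z : cabs z = Num.sqrt (Re z ^+ 2 + Im z ^+ 2).
Proof. by rewrite /cabs normc_def. Qed.

Lemma normC_cabs z : `|z| = (cabs z)%:C.
Proof. by rewrite /cabs normc_def. Qed.

Lemma cabs_ge0 z : 0 <= cabs z. Proof. by rewrite cabsE sqrtr_ge0. Qed.

Lemma sqr_cabs z : cabs z ^+ 2 = Re z ^+ 2 + Im z ^+ 2.
Proof. by rewrite cabsE sqr_sqrtr // addr_ge0 ?sqr_ge0. Qed.

Lemma cabs0 : cabs (0 : C) = 0. Proof. by rewrite /cabs normr0. Qed.
Lemma cabs1 : cabs (1 : C) = 1. Proof. by rewrite /cabs normr1. Qed.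

Lemma cabsM z w : cabs (z * w) = cabs z * cabs w.
Proof. by apply: complexI; rewrite rmorphM /= -!normC_cabs normrM. Qed.

Lemma cabsX z n : cabs (z ^+ n) = cabs z ^+ n.
Proof. by elim: n => [|n IH]; rewrite ?expr0 ?cabs1 // !exprS cabsM IH. Qed.

Lemma cabsV z : cabs z^-1 = (cabs z)^-1.
Proof. by apply: complexI; rewrite fmorphV /= -!normC_cabs normfV. Qed.

Lemma cabsN z : cabs (- z) = cabs z. Proof. by rewrite /cabs normrN. Qed.

Lemma cabsJ z : cabs z^* = cabs z.
Proof. by rewrite !cabsE; case: z => a b /=; rewrite sqrrN. Qed.

Lemma conjRe x : (x%:C)^* = x%:C :> C. Proof. exact: conjc_real. Qed.
Lemma conjM z w : (z * w)^* = z^* * w^*. Proof. exact: rmorphM. Qed.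
Lemma conjD z w : (z + w)^* = z^* + w^*. Proof. exact: rmorphD. Qed.
Lemma conjB z w : (z - w)^* = z^* - w^*. Proof. exact: rmorphB. Qed.
Lemma conjX z n : (z ^+ n)^* = z^* ^+ n. Proof. exact: rmorphXn. Qed.
Lemma conj_sum n (F : 'I_n -> C) : (\sum_(k < n) F k)^* = \sum_(k < n) (F k)^*.
Proof. exact: rmorph_sum. Qed.

Lemma cabs_real x : cabs x%:C = `|x|.
Proof. by rewrite cabsE /= expr0n addr0 sqrtr_sqr. Qed.

Lemma cabs_nat n : cabs (n%:R : C) = n%:R.
Proof. by rewrite /cabs normr_nat -(rmorph_nat (real_complex R)). Qed.

Lemma cabsD z w : cabs (z + w) <= cabs z + cabs w.
Proof. by rewrite -lecR rmorphD /= -!normC_cabs ler_normD. Qed.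

Lemma cabsB z w : cabs (z - w) <= cabs z + cabs w.
Proof. by rewrite -(cabsN w) cabsD. Qed.

Lemma cabs_distC z w : cabs (z - w) = cabs (w - z).
Proof. by rewrite -opprB cabsN. Qed.

Lemma cabs_dist z w : cabs z <= cabs w + cabs (z - w).
Proof. by have := cabsD w (z - w); rewrite addrC subrK. Qed.

Lemma cabs_dist3 z w v : cabs (z - w) <= cabs (z - v) + cabs (v - w).
Proof. by have := cabsD (z - v) (v - w); rewrite addrA subrK. Qed.

Lemma cabs_eq0 z : (cabs z == 0) = (z == 0).
Proof.
apply/idP/idP => [/eqP h|/eqP ->]; last by rewrite cabs0.
by rewrite -normr_eq0 normC_cabs h.
Qed.

Lemma cabs_gt0 z : (0 < cabs z) = (z != 0).
Proof. by rewrite lt_def cabs_ge0 andbT cabs_eq0. Qed.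

Lemma cabs_sum I (r : seq I) (P : pred I) (F : I -> C) :
  cabs (\sum_(i <- r | P i) F i) <= \sum_(i <- r | P i) cabs (F i).
Proof.
elim/big_ind2: _ => [|a u b v ha hb|//]; first by rewrite cabs0.
exact: le_trans (cabsD _ _) (lerD ha hb).
Qed.

Lemma normr_Re_le z : `|Re z| <= cabs z.
Proof.
rewrite -(ler_pXn2r (n := 2)) ?nnegrE ?cabs_ge0 // sqr_cabs real_normK ?num_real //.
by rewrite lerDl sqr_ge0.
Qed.

Lemma normr_Im_le z : `|Im z| <= cabs z.
Proof.
rewrite -(ler_pXn2r (n := 2)) ?nnegrE ?cabs_ge0 // sqr_cabs real_normK ?num_real //.
by rewrite lerDr sqr_ge0.
Qed.

Lemma Re_le_cabs z : Re z <= cabs z.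
Proof. exact: le_trans (ler_norm _) (normr_Re_le z). Qed.

Lemma cabs_le_ReIm z : cabs z <= `|Re z| + `|Im z|.
Proof.
rewrite -(ler_pXn2r (n := 2)) ?nnegrE ?cabs_ge0 ?addr_ge0 // sqr_cabs.
rewrite sqrrD !real_normK ?num_real // lerD2r lerDl.
by rewrite mulrn_wge0 // mulr_ge0.
Qed.

Lemma ReD z w : Re (z + w) = Re z + Re w. Proof. by case: z; case: w. Qed.
Lemma ImD z w : Im (z + w) = Im z + Im w. Proof. by case: z; case: w. Qed.
Lemma ReN z : Re (- z) = - Re z. Proof. by case: z. Qed.
Lemma ImN z : Im (- z) = - Im z. Proof. by case: z. Qed.
Lemma ReB z w : Re (z - w) = Re z - Re w. Proof. by rewrite ReD ReN. Qed.
Lemma ImB z w : Im (z - w) = Im z - Im w. Proof. by rewrite ImD ImN. Qed.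
Lemma ReM z w : Re (z * w) = Re z * Re w - Im z * Im w.
Proof. by case: z; case: w. Qed.
Lemma ImM z w : Im (z * w) = Re z * Im w + Im z * Re w.
Proof. by case: z w => [a b] [c d]. Qed.
Lemma ReJ z : Re z^* = Re z. Proof. by case: z. Qed.
Lemma ImJ z : Im z^* = - Im z. Proof. by case: z. Qed.
Lemma ReZ x z : Re (x%:C * z) = x * Re z.
Proof. by rewrite ReM /= mul0r subr0. Qed.
Lemma Re_sum I (r : seq I) (P : pred I) (F : I -> C) :
  Re (\sum_(i <- r | P i) F i) = \sum_(i <- r | P i) Re (F i).
Proof. by elim/big_rec2: _ => [//|i a b _ <-]; rewrite ReD. Qed.

Lemma complex_eq z w : Re z = Re w -> Im z = Im w -> z = w.
Proof. by case: z; case: w => a b c d /= -> ->. Qed.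

Lemma mulJ_cabs z : z * z^* = (cabs z ^+ 2)%:C.
Proof.
apply: complex_eq; rewrite ?ReM ?ImM ReJ ImJ /=; last by ring.
by rewrite sqr_cabs; ring.
Qed.

Lemma cabs_cis t : cabs (cis t) = 1.
Proof. by rewrite cabsE /= cos2Dsin2 sqrtr1. Qed.

Lemma cisD x y : cis (x + y) = cis x * cis y.
Proof. by apply: complex_eq; rewrite ?ReM ?ImM /= ?cosD ?sinD //; ring. Qed.

Lemma cis0 : cis (0 : R) = 1.
Proof. by apply: complex_eq; rewrite /= ?cos0 ?sin0. Qed.

Lemma cisN x : cis (- x) = (cis x)^*.
Proof. by apply: complex_eq; rewrite ?ReJ ?ImJ /= ?cosN ?sinN. Qed.

Lemma cis_neq0 t : cis t != 0 :> C.
Proof. by rewrite -cabs_gt0 cabs_cis. Qed.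

Lemma cisV x : (cis x)^-1 = (cis x)^*.
Proof.
by apply: (mulfI (cis_neq0 x)); rewrite mulfV ?cis_neq0 // mulJ_cabs cabs_cis expr1n.
Qed.

Lemma cis2pi : cis (2 * pi : R) = 1.
Proof.
by apply: complex_eq; rewrite /= mulr_natl ?cos2pi ?sin2pi.
Qed.

Lemma cis_periodic t : cis (t + 2 * pi) = cis t.
Proof. by rewrite cisD cis2pi mulr1. Qed.

Lemma cos_lip x y : `|cos x - cos y| <= `|x - y|.
Proof.
wlog xy : x y / y <= x.
  move=> h; have [/ltW/h|/h//] := ltP x y.
  by rewrite distrC (distrC y x).
have [|c _ ->] := @MVT_segment R cos (fun t => - sin t) y x xy.
  exact/continuous_subspaceT/continuous_cos.
by rewrite normrM normrN ler_piMl // sin_max.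
Qed.

Lemma sin_lip x y : `|sin x - sin y| <= `|x - y|.
Proof. by rewrite -!cosBpihalf (le_trans (cos_lip _ _)) // opprB addrA subrK. Qed.

Lemma cis_lip x y : cabs (cis x - cis y) <= 2 * `|x - y|.
Proof.
rewrite mulr_natl mulr2n; apply: le_trans (cabs_le_ReIm _) _.
by rewrite ReB ImB lerD ?cos_lip ?sin_lip.
Qed.

(** A positive element of C has zero imaginary part, so the epsilon of the C-valued norm may be
    taken in R. *)
Lemma cabs_cvgP (T : Type) (F : set_system T) (FF : Filter F) (f : T -> C) (l : C) :
  f @ F --> l <-> forall e : R, 0 < e -> \forall t \near F, cabs (l - f t) < e.
Proof.
split=> [/cvgrPdist_lt h e e0|h].
  have := h e%:C; rewrite ltcR => /(_ e0); apply: filterS => t.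
  by rewrite normC_cabs ltcR.
apply/cvgrPdist_lt => e e0.
have er : e = (Re e)%:C by rewrite RRe_real // gtr0_real.
have := h (Re e); rewrite -ltcR -er => /(_ e0); apply: filterS => t.
by rewrite -ltcR -normC_cabs -er.
Qed.

Lemma nbhs_cabsP (z : C) (A : set C) :
  nbhs z A <-> exists2 d : R, 0 < d & forall w, cabs (z - w) < d -> A w.
Proof.
rewrite -nbhs_ballE; split=> [[e /= e0 h]|[d d0 h]].
  have er : e = (Re e)%:C by rewrite RRe_real // gtr0_real.
  exists (Re e); first by rewrite -ltcR -er.
  by move=> w hw; apply: h; rewrite /ball /= normC_cabs er ltcR.
exists d%:C; first by rewrite /= ltcR.
by move=> w; rewrite /ball /= normC_cabs ltcR => /h.
Qed.

Lemma Re_cvg (T : Type) (F : set_system T) (FF : Filter F) (f : T -> C) (l : C) :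
  f @ F --> l -> Re (f t) @[t --> F] --> Re l.
Proof.
move=> /cabs_cvgP h; apply/cvgrPdist_lt => e e0.
move: (h e e0); apply: filterS => t; apply: le_lt_trans.
by rewrite -ReB normr_Re_le.
Qed.

Lemma Im_cvg (T : Type) (F : set_system T) (FF : Filter F) (f : T -> C) (l : C) :
  f @ F --> l -> Im (f t) @[t --> F] --> Im l.
Proof.
move=> /cabs_cvgP h; apply/cvgrPdist_lt => e e0.
move: (h e e0); apply: filterS => t; apply: le_lt_trans.
by rewrite -ImB normr_Im_le.
Qed.

Lemma ReIm_cvg (T : Type) (F : set_system T) (FF : Filter F) (f : T -> C) (l : C) :
  Re (f t) @[t --> F] --> Re l -> Im (f t) @[t --> F] --> Im l -> f @ F --> l.
Proof.
move=> /cvgrPdist_lt hr /cvgrPdist_lt hi; apply/cabs_cvgP => e e0.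
have e2 : 0 < e / 2 by rewrite divr_gt0.
move: (hr _ e2) (hi _ e2); apply: filterS2 => t h1 h2.
apply: le_lt_trans (cabs_le_ReIm _) _; rewrite ReB ImB (splitr e) ltrD //.
Qed.

(** Division-free form of differentiability: the inequality is trivial at [w = z], so no punctured
    neighbourhood is left. Goursat's argument and the rules of calculus use this form. *)
Lemma derivable_cabsP (f : C -> C) (z l : C) :
  (derivable f z 1 /\ derive1 f z = l) <->
  (forall e : R, 0 < e -> exists2 d : R, 0 < d & forall w, cabs (w - z) < d ->
      cabs (f w - f z - l * (w - z)) <= e * cabs (w - z)).
Proof.
split=> [[df <-]|h].
  move=> e e0; have : h^-1 *: (f (h + z) - f z) @[h --> (0 : C)^'] --> derive1 f z.
    rewrite derive1E /derive; have -> : (fun h : C => h^-1 *: (f (h + z) - f z)) =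
      (fun h => h^-1 *: ((f \o +%R^~ z) (h *: 1) - f z)).
      by apply/funext => h /=; rewrite /GRing.scale /= mulr1.
    exact: df.
  move=> /cabs_cvgP /(_ _ e0); rewrite near_withinE => /nbhs_cabsP[d d0 hd].
  exists d => // w; have [->|wz] := eqVneq w z.
    by rewrite !subrr mulr0 subr0 cabs0 mulr0.
  have := hd (w - z); rewrite sub0r cabsN => h1 /h1.
  rewrite subr_eq0 => /(_ wz); rewrite subrK /GRing.scale /= => /ltW h2.
  have wz0 : w - z != 0 by rewrite subr_eq0.
  rewrite -ler_pdivrMr ?cabs_gt0 // -cabsV -cabsM.
  apply: le_trans h2; rewrite cabs_distC le_eqVlt; apply/orP; left; apply/eqP.
  congr cabs; by field.
have cv : h^-1 *: (f (h + z) - f z) @[h --> (0 : C)^'] --> l.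
  apply/cabs_cvgP => e e0; rewrite near_withinE; apply/nbhs_cabsP.
  have [d d0 hd] := h (e / 2) ltac:(by rewrite divr_gt0).
  exists d => // w; rewrite sub0r cabsN => wd w0.
  have := hd (w + z); rewrite addrK => /(_ wd).
  rewrite /GRing.scale /= => h1.
  have -> : l - w^-1 * (f (w + z) - f z) = - (w^-1 * (f (w + z) - f z - l * w)).
    by field.
  rewrite cabsN cabsM cabsV mulrC ltr_pdivrMr ?cabs_gt0 //.
  apply: le_lt_trans h1 _; rewrite ltr_pM2r ?cabs_gt0 //; lra.
have E : (fun h : C => h^-1 *: ((f \o +%R^~ z) (h *: 1) - f z)) =
   (fun h => h^-1 *: (f (h + z) - f z)).
  by apply/funext => h' /=; rewrite /GRing.scale /= mulr1.
split; first by apply/cvg_ex; exists l => /=; rewrite E.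
rewrite derive1E /derive; apply/cvg_lim; first exact: norm_hausdorff.
by rewrite E.
Qed.

Lemma diskE z : disk z <-> cabs z < 1.
Proof. by rewrite /disk /= normC_cabs -ltcR. Qed.

End ComplexModulus.

(** * Integrals over segments *)

Section Integral.
Variable R : realType.
Local Notation C := R[i].
Local Notation mu := (@lebesgue_measure R).
Implicit Types (a b c : R) (u v : R -> R) (p q : R -> C).

(** For [b < a] the segment is empty and the integral is 0; there is no sign convention, hence the
    hypotheses [a <= b] in additivity. *)
Definition rint a b u : R := \int[mu]_(t in `[a, b]) u t.
Definition cint a b p : C := cintegral `[a, b] p.
Definition intg a b u : Prop := mu.-integrable `[a, b] (EFin \o u).
Definition cintg a b p : Prop := intg a b (Re \o p) /\ intg a b (Im \o p).

Lemma cintE a b p : cint a b p = rint a b (Re \o p) +i* rint a b (Im \o p).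
Proof. by []. Qed.

Lemma Re_cint a b p : Re (cint a b p) = rint a b (Re \o p). Proof. by []. Qed.
Lemma Im_cint a b p : Im (cint a b p) = rint a b (Im \o p). Proof. by []. Qed.

Lemma eq_rint a b u v : (forall t, a <= t <= b -> u t = v t) -> rint a b u = rint a b v.
Proof. by move=> h; apply: eq_Rintegral => t; rewrite inE /= in_itv /= => /h. Qed.

Lemma eq_cint a b p q : (forall t, a <= t <= b -> p t = q t) -> cint a b p = cint a b q.
Proof. by move=> h; rewrite !cintE; congr Complex; apply: eq_rint => t /h /= ->. Qed.

Lemma eq_intg a b u v : (forall t, a <= t <= b -> u t = v t) -> intg a b u -> intg a b v.
Proof.
move=> h; apply: eq_integrable => // t; rewrite inE /= in_itv /= => /h ->; done.
Qed.

Lemma eq_cintg a b p q : (forall t, a <= t <= b -> p t = q t) -> cintg a b p -> cintg a b q.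
Proof. by move=> h [h1 h2]; split; [move: h1|move: h2]; apply: eq_intg => t /h /= ->. Qed.

Lemma intgD a b u v : intg a b u -> intg a b v -> intg a b (fun t => u t + v t).
Proof. by move=> h1 h2; have := integrableD _ h1 h2; apply. Qed.

Lemma intgZ a b k u : intg a b u -> intg a b (fun t => k * u t).
Proof. by move=> h1; have := integrableZl _ k h1; apply. Qed.

Lemma intgN a b u : intg a b u -> intg a b (fun t => - u t).
Proof. by move=> h1; have := integrableN h1; apply. Qed.

Lemma intgB a b u v : intg a b u -> intg a b v -> intg a b (fun t => u t - v t).
Proof. by move=> h1 h2; apply: intgD => //; apply: intgN. Qed.

Lemma intg_cst a b k : intg a b (fun=> k).
Proof.
apply: continuous_compact_integrable; first exact: segment_compact.
by apply: continuous_subspaceT => x; exact: cvg_cst.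
Qed.

Lemma intg_norm a b u : intg a b u -> intg a b (fun t => `|u t|).
Proof. exact: integrable_norm. Qed.

Lemma intg_sub a b c d u : a <= c -> d <= b -> intg a b u -> intg c d u.
Proof.
move=> ac db; apply: integrableS => // t /=; rewrite !in_itv /= => /andP[h1 h2].
by rewrite (le_trans ac h1) (le_trans h2 db).
Qed.

Lemma intg_le a b u v : measurable_fun setT u -> intg a b v ->
  (forall t, a <= t <= b -> `|u t| <= v t) -> intg a b u.
Proof.
move=> mu' iv h; apply: le_integrable iv => //.
  exact/measurable_EFinP/measurable_funTS.
move=> t; rewrite /= in_itv /= => /h h1; rewrite lee_fin.
by rewrite (le_trans h1) // ler_norm.
Qed.

Lemma intg_cont a b u : {within `[a, b], continuous u} -> intg a b u.
Proof. by move=> h; apply: continuous_compact_integrable => //; exact: segment_compact. Qed.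

Lemma rintD a b u v : intg a b u -> intg a b v ->
  rint a b (fun t => u t + v t) = rint a b u + rint a b v.
Proof. by move=> h1 h2; apply: RintegralD. Qed.

Lemma rintB a b u v : intg a b u -> intg a b v ->
  rint a b (fun t => u t - v t) = rint a b u - rint a b v.
Proof. by move=> h1 h2; apply: RintegralB. Qed.

Lemma rintZ a b k u : intg a b u -> rint a b (fun t => k * u t) = k * rint a b u.
Proof. by move=> h1; apply: RintegralZl. Qed.

Lemma rintN a b u : intg a b u -> rint a b (fun t => - u t) = - rint a b u.
Proof.
by move=> h; rewrite -mulN1r -rintZ //; apply: eq_rint => t _; rewrite mulN1r.
Qed.

Lemma rint_cst a b k : a <= b -> rint a b (fun=> k) = k * (b - a).
Proof.
move=> ab; rewrite /rint Rintegral_cst //= lebesgue_measure_itv /= lte_fin.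
by case: ltgtP ab => //= ->; rewrite subrr.
Qed.

Lemma rint0 a b : rint a b (fun=> 0) = 0.
Proof. by rewrite /rint Rintegral_cst // mul0r. Qed.

Lemma ler_rint a b u v : intg a b u -> intg a b v ->
  (forall t, a <= t <= b -> u t <= v t) -> rint a b u <= rint a b v.
Proof.
by move=> h1 h2 h; apply: le_Rintegral => // t; rewrite /= in_itv /= => /h.
Qed.

Lemma rint_ge0 a b u : (forall t, a <= t <= b -> 0 <= u t) -> 0 <= rint a b u.
Proof. by move=> h; apply: Rintegral_ge0 => t; rewrite /= in_itv /= => /h. Qed.

Lemma rint_point a u : rint a a u = 0.
Proof. by rewrite /rint set_itv1 Rintegral_set1. Qed.

Lemma rint_chasles a b c u : a <= b -> b <= c -> intg a c u ->
  rint a c u = rint a b u + rint b c u.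
Proof.
move=> ab bc iu; rewrite /rint.
have E : `[a, c]%classic = `[a, b]%classic `|` `]b, c]%classic.
  apply/seteqP; split => t /=; rewrite !in_itv /=.
    move=> /andP[h1 h2]; have [h3|h3] := leP t b; first by left; rewrite h1.
    by right; rewrite h2.
  case=> /andP[h1 h2]; first by rewrite h1 (le_trans h2 bc).
  by rewrite h2 (le_trans ab (ltW h1)).
rewrite {1}E Rintegral_setU // -?E //.
  congr (_ + _); apply: Rintegral_itv_obnd_cbnd.
  apply: integrableS iu => // t /=; rewrite !in_itv /= => /andP[h1 ->].
  by rewrite (le_trans ab (ltW h1)).
apply/disj_setPS => t /= [] /=; rewrite !in_itv /= => /andP[_ h1] /andP[h2 _].
by move: (le_lt_trans h1 h2); rewrite ltxx.
Qed.

Lemma rint_sum a b n (u : nat -> R -> R) : (forall k, (k < n)%N -> intg a b (u k)) ->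
  intg a b (fun t => \sum_(k < n) u k t) /\
  rint a b (fun t => \sum_(k < n) u k t) = \sum_(k < n) rint a b (u k).
Proof.
elim: n => [|n IH] h.
  split; first by apply: eq_intg (intg_cst a b 0) => t _; rewrite big_ord0.
  by rewrite big_ord0 -[RHS](rint0 a b); apply: eq_rint => t _; rewrite big_ord0.
have [i1 e1] := IH (fun k kn => h k (ltnW kn)); split.
  apply: eq_intg (intgD i1 (h n (ltnSn n))) => t _.
  by rewrite big_ord_recr.
rewrite big_ord_recr /= -e1 -rintD //; last exact: h.
by apply: eq_rint => t _; rewrite big_ord_recr.
Qed.

Lemma FTC a b u (U : R -> R) : a <= b -> continuous u ->
  (forall t : R, is_derive t 1 U (u t)) -> rint a b u = U b - U a.
Proof.
rewrite le_eqVlt => /predU1P[->|ab] cu dU; first by rewrite rint_point subrr.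
have cU : continuous U.
  move=> t; apply: differentiable_continuous; apply/derivable1_diffP.
  by have [] := dU t.
rewrite /rint /Rintegral (@continuous_FTC2 _ u U) //.
- exact: continuous_subspaceT.
- split; first by move=> t _; have [] := dU t.
  + exact: cvg_at_right_filter (cU a).
  + exact: cvg_at_left_filter (cU b).
- by move=> t _; rewrite derive1E; have [_ ->] := dU t.
Qed.

Lemma cintgD a b p q : cintg a b p -> cintg a b q -> cintg a b (fun t => p t + q t).
Proof.
move=> [h1 h2] [h3 h4]; split.
  by apply: eq_intg (intgD h1 h3) => t _ /=; rewrite ReD.
by apply: eq_intg (intgD h2 h4) => t _ /=; rewrite ImD.
Qed.

Lemma cintgZ a b (k : C) p : cintg a b p -> cintg a b (fun t => k * p t).
Proof.
move=> [h1 h2]; split.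
  by apply: eq_intg (intgB (intgZ (Re k) h1) (intgZ (Im k) h2)) => t _ /=; rewrite ReM.
by apply: eq_intg (intgD (intgZ (Re k) h2) (intgZ (Im k) h1)) => t _ /=; rewrite ImM.
Qed.

Lemma cintgB a b p q : cintg a b p -> cintg a b q -> cintg a b (fun t => p t - q t).
Proof.
move=> h1 h2; apply: cintgD => //.
by apply: eq_cintg (cintgZ (-1) h2) => t _; rewrite mulN1r.
Qed.

Lemma cintg_cst a b (k : C) : cintg a b (fun=> k).
Proof. by split; apply: intg_cst. Qed.

Lemma cintg_sub a b c d p : a <= c -> d <= b -> cintg a b p -> cintg c d p.
Proof. by move=> h1 h2 [h3 h4]; split; [move: h3|move: h4]; apply: intg_sub. Qed.

Definition cmeas p := measurable_fun setT (Re \o p) /\ measurable_fun setT (Im \o p).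

Lemma cmeas_cabs p : cmeas p -> measurable_fun setT (@cabs R \o p).
Proof.
move=> [h1 h2].
have -> : @cabs R \o p = (fun t => Num.sqrt ((Re \o p) t ^+ 2 + (Im \o p) t ^+ 2)).
  by apply/funext => t /=; rewrite cabsE.
have ms : measurable_fun [set: R] (@Num.sqrt R).
  by apply: continuous_measurable_fun; exact: sqrt_continuous.
apply: (measurableT_comp ms).
by apply: measurable_funD; apply: measurable_funX.
Qed.

Lemma cmeasD p q : cmeas p -> cmeas q -> cmeas (fun t => p t + q t).
Proof.
move=> [h1 h2] [h3 h4]; split.
  by rewrite (_ : _ \o _ = (Re \o p) \+ (Re \o q)); [apply: measurable_funD|apply/funext => t /=; rewrite ReD].
by rewrite (_ : _ \o _ = (Im \o p) \+ (Im \o q)); [apply: measurable_funD|apply/funext => t /=; rewrite ImD].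
Qed.

Lemma cmeasM p q : cmeas p -> cmeas q -> cmeas (fun t => p t * q t).
Proof.
move=> [h1 h2] [h3 h4]; split.
  rewrite (_ : _ \o _ = (((Re \o p) \* (Re \o q)) \- ((Im \o p) \* (Im \o q)))); last first.
    by apply/funext => t /=; rewrite ReM.
  by apply: measurable_funB; apply: measurable_funM.
rewrite (_ : _ \o _ = (((Re \o p) \* (Im \o q)) \+ ((Im \o p) \* (Re \o q)))); last first.
  by apply/funext => t /=; rewrite ImM.
by apply: measurable_funD; apply: measurable_funM.
Qed.

Lemma cmeas_cst (k : C) : cmeas (fun=> k).
Proof. by split; apply: measurable_cst. Qed.

Lemma cmeasN p : cmeas p -> cmeas (fun t => - p t).
Proof.
move=> h; rewrite (_ : (fun t => - p t) = (fun t => -1 * p t)); last first.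
  by apply/funext => t; rewrite mulN1r.
by apply: cmeasM => //; apply: cmeas_cst.
Qed.

Lemma cmeasB p q : cmeas p -> cmeas q -> cmeas (fun t => p t - q t).
Proof. by move=> h1 h2; apply: cmeasD => //; apply: cmeasN. Qed.

Lemma cmeasJ p : cmeas p -> cmeas (fun t => (p t)^*).
Proof.
move=> [h1 h2]; split.
  by rewrite (_ : _ \o _ = Re \o p) //; apply/funext => t /=; rewrite ReJ.
rewrite (_ : _ \o _ = (fun t => - (Im \o p) t)); last by apply/funext => t /=; rewrite ImJ.
by apply: measurableT_comp.
Qed.

Lemma cmeas_cont p : continuous (Re \o p) -> continuous (Im \o p) -> cmeas p.
Proof. by move=> h1 h2; split; apply: continuous_measurable_fun. Qed.

Lemma cmeas_cis : cmeas (@cis R).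
Proof. by apply: cmeas_cont; [exact: continuous_cos|exact: continuous_sin]. Qed.

Lemma cintg_le a b p v : cmeas p -> intg a b v ->
  (forall t, a <= t <= b -> cabs (p t) <= v t) -> cintg a b p.
Proof.
move=> [m1 m2] iv h; split; apply: intg_le iv _ => // t /h h1.
  exact: le_trans (normr_Re_le _) h1.
exact: le_trans (normr_Im_le _) h1.
Qed.

Lemma cintD a b p q : cintg a b p -> cintg a b q ->
  cint a b (fun t => p t + q t) = cint a b p + cint a b q.
Proof.
move=> [h1 h2] [h3 h4]; rewrite !cintE.
apply: complex_eq => /=; rewrite -rintD //; apply: eq_rint => t _ /=.
  by rewrite ReD.
by rewrite ImD.
Qed.

Lemma cintZ a b (k : C) p : cintg a b p -> cint a b (fun t => k * p t) = k * cint a b p.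
Proof.
move=> [h1 h2]; apply: complex_eq.
  rewrite ReM !Re_cint Im_cint -!rintZ // -rintB; [|exact: intgZ..].
  by apply: eq_rint => t _ /=; rewrite ReM.
rewrite ImM !Im_cint Re_cint -!rintZ // -rintD; [|exact: intgZ..].
by apply: eq_rint => t _ /=; rewrite ImM.
Qed.

Lemma cintB a b p q : cintg a b p -> cintg a b q ->
  cint a b (fun t => p t - q t) = cint a b p - cint a b q.
Proof.
move=> h1 h2; rewrite -mulN1r -cintZ // -cintD //; last exact: cintgZ.
by apply: eq_cint => t _; rewrite mulN1r.
Qed.

Lemma cint_cst a b (k : C) : a <= b -> cint a b (fun=> k) = k * (b - a)%:C.
Proof.
move=> ab; apply: complex_eq; rewrite ?Re_cint ?Im_cint ?ReM ?ImM /= rint_cst //.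
  by rewrite mulr0 subr0.
by rewrite mulr0 add0r.
Qed.

Lemma cint_sum a b n (p : nat -> R -> C) : (forall k, (k < n)%N -> cintg a b (p k)) ->
  cintg a b (fun t => \sum_(k < n) p k t) /\
  cint a b (fun t => \sum_(k < n) p k t) = \sum_(k < n) cint a b (p k).
Proof.
elim: n => [|n IH] h.
  split; first by apply: eq_cintg (cintg_cst a b 0) => t _; rewrite big_ord0.
  rewrite big_ord0; apply: complex_eq; rewrite ?Re_cint ?Im_cint /= -(rint0 a b);
  by apply: eq_rint => t _ /=; rewrite big_ord0.
have [i1 e1] := IH (fun k kn => h k (ltnW kn)); split.
  apply: eq_cintg (cintgD i1 (h n (ltnSn n))) => t _.
  by rewrite big_ord_recr.
rewrite big_ord_recr /= -e1 -cintD //; last exact: h.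
by apply: eq_cint => t _; rewrite big_ord_recr.
Qed.

Lemma cint_chasles a b c p : a <= b -> b <= c -> cintg a c p ->
  cint a c p = cint a b p + cint b c p.
Proof.
by move=> ab bc [h1 h2]; apply: complex_eq; rewrite ?ReD ?ImD ?Re_cint ?Im_cint;
  apply: rint_chasles.
Qed.

Lemma intg_cabs a b p : cmeas p -> cintg a b p -> intg a b (@cabs R \o p).
Proof.
move=> m [h1 h2]; apply: intg_le (intgD (intg_norm h1) (intg_norm h2)) _ => [|t _].
  exact: cmeas_cabs.
by rewrite /= ger0_norm ?cabs_ge0 // cabs_le_ReIm.
Qed.

(* Rotating the integral onto the positive axis reduces this to real integrands. *)
Lemma cabs_cint a b p : cintg a b p -> intg a b (@cabs R \o p) ->
  cabs (cint a b p) <= rint a b (@cabs R \o p).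
Proof.
move=> hp hc; set I := cint a b p.
have [I0|I0] := eqVneq I 0.
  by rewrite I0 cabs0; apply: rint_ge0 => t _; exact: cabs_ge0.
have c0 : 0 < cabs I by rewrite cabs_gt0.
rewrite -(ler_pM2l c0) -rintZ //.
have -> : cabs I * cabs I = Re (I^* * I) by rewrite [I^* * I]mulrC mulJ_cabs /= expr2.
rewrite /I -cintZ // -/I Re_cint; apply: ler_rint.
- by have [] := cintgZ I^* hp.
- exact: intgZ.
- by move=> t _ /=; apply: le_trans (Re_le_cabs _) _; rewrite cabsM cabsJ.
Qed.

Lemma cabs_cint_le a b p v : a <= b -> cintg a b p -> intg a b v -> 
  (forall t, a <= t <= b -> cabs (p t) <= v t) -> 
  cabs (cint a b p) <= rint a b v.
Proof.
move=> ab hp hv h; set I := cint a b p.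
have [I0|I0] := eqVneq I 0.
  rewrite I0 cabs0; apply: rint_ge0 => t /h; exact: le_trans (cabs_ge0 _).
have c0 : 0 < cabs I by rewrite cabs_gt0.
rewrite -(ler_pM2l c0) -rintZ //.
have -> : cabs I * cabs I = Re (I^* * I) by rewrite [I^* * I]mulrC mulJ_cabs /= expr2.
rewrite /I -cintZ // -/I Re_cint; apply: ler_rint.
- by have [] := cintgZ I^* hp.
- exact: intgZ.
- move=> t /h h1 /=; apply: le_trans (Re_le_cabs _) _.
  by rewrite cabsM cabsJ ler_wpM2l // cabs_ge0.
Qed.

Lemma cabs_cint_bound a b p K : a <= b -> cintg a b p ->
  (forall t, a <= t <= b -> cabs (p t) <= K) -> cabs (cint a b p) <= K * (b - a).
Proof.
move=> ab hp h; rewrite -rint_cst //; apply: cabs_cint_le => //; exact: intg_cst.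
Qed.

Definition ccont (A : set R) p :=
  {within A, continuous (Re \o p)} /\ {within A, continuous (Im \o p)}.

Lemma ccontP (A : set R) p :
  (forall s, A s -> forall e, 0 < e -> exists2 d, 0 < d &
     forall t, A t -> `|s - t| < d -> cabs (p s - p t) < e) -> ccont A p.
Proof.
move=> h; split; apply/subspace_continuousP => s As; apply/cvgrPdist_lt => e e0;
  have [d d0 hd] := h s As e e0; rewrite near_withinE;
  apply/nbhs_ballP; exists d => // t; rewrite /ball /= => st At;
  rewrite -?ReB -?ImB.
  exact: le_lt_trans (normr_Re_le _) (hd t At st).
exact: le_lt_trans (normr_Im_le _) (hd t At st).
Qed.

Lemma ccont_lip (A : set R) p K :
  (forall s t, A s -> A t -> cabs (p s - p t) <= K * `|s - t|) -> ccont A p.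
Proof.
move=> h; apply: ccontP => s As e e0; exists (e / (`|K| + 1)).
  by rewrite divr_gt0 // ltr_wpDl.
move=> t At; rewrite ltr_pdivlMr ?ltr_wpDl // => h1.
apply: le_lt_trans (h _ _ As At) _; apply: le_lt_trans h1.
rewrite mulrC ler_wpM2l //; apply: le_trans (ler_norm K) _; lra.
Qed.

Lemma ccont_cintg a b p : ccont `[a, b] p -> cintg a b p.
Proof. by move=> [h1 h2]; split; apply: intg_cont. Qed.

Lemma ccontM A p q : ccont A p -> ccont A q -> ccont A (fun t => p t * q t).
Proof.
move=> [h1 h2] [h3 h4]; split => t.
  rewrite (_ : _ \o _ = (fun t => (Re \o p) t * (Re \o q) t - (Im \o p) t * (Im \o q) t)); last first.
    by apply/funext => ? /=; rewrite ReM.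
  exact: (continuousB (continuousM (h1 t) (h3 t)) (continuousM (h2 t) (h4 t))).
rewrite (_ : _ \o _ = (fun t => (Re \o p) t * (Im \o q) t + (Im \o p) t * (Re \o q) t)); last first.
  by apply/funext => ? /=; rewrite ImM.
exact: (continuousD (continuousM (h1 t) (h4 t)) (continuousM (h2 t) (h3 t))).
Qed.

Lemma ccont_cst A (k : C) : ccont A (fun=> k).
Proof. by split; apply: continuous_subspaceT => t; exact: cvg_cst. Qed.

Lemma ccont_cis A : ccont A (@cis R).
Proof.
by split; apply: continuous_subspaceT; [exact: continuous_cos|exact: continuous_sin].
Qed.

Lemma cint_cis a b : a <= b -> cint a b (@cis R) = - 'i * (cis b - cis a).
Proof.
move=> ab; have cR : rint a b (@cos R) = sin b - sin a.
  by apply: FTC => //; exact: continuous_cos.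
have cI : rint a b (@sin R) = - cos b - - cos a.
  apply: (FTC (U := fun t => - cos t)) => //; first exact: continuous_sin.
  by move=> t; rewrite -[sin t]opprK; apply: is_deriveN; exact: is_derive_cos.
apply: complex_eq; rewrite ?Re_cint ?Im_cint ?ReM ?ImM ReB ImB /=.
  by rewrite [LHS]cR; ring.
by rewrite [LHS]cI; ring.
Qed.

End Integral.

(** * Goursat's theorem in polar coordinates and Cauchy's formula *)

Section Cousin.
Variable R : realType.
Implicit Types (a b c d x y : R).

Lemma exists_pow2_lt (w e : R) : 0 < e -> exists n, w / 2 ^+ n < e.
Proof.
move=> e0; pose n := Num.bound (`|w| / e); exists n.
have h1 : `|w| / e < n%:R by apply: archi_boundP; rewrite divr_ge0 // ltW.
have h2 : n%:R <= 2 ^+ n :> R by rewrite -natrX ler_nat ltnW // ltn_expl.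
rewrite ltr_pdivrMr ?exprn_gt0 //; apply: le_lt_trans (ler_norm w) _.
by rewrite mulrC -ltr_pdivrMr //; apply: lt_le_trans h1 h2.
Qed.

(* Quadrisection: a property of rectangles that passes from the four quarters to
   the whole and holds for small rectangles around each point holds globally. *)
Lemma rectangle_cousin (P : R -> R -> R -> R -> Prop) a b c d :
  a < b -> c < d ->
  (forall x1 x2 y1 y2, x1 <= x2 -> y1 <= y2 ->
    P x1 ((x1 + x2) / 2) y1 ((y1 + y2) / 2) ->
    P x1 ((x1 + x2) / 2) ((y1 + y2) / 2) y2 ->
    P ((x1 + x2) / 2) x2 y1 ((y1 + y2) / 2) ->
    P ((x1 + x2) / 2) x2 ((y1 + y2) / 2) y2 -> P x1 x2 y1 y2) ->
  (forall x y, a <= x <= b -> c <= y <= d -> exists2 e, 0 < e &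
    forall x1 x2 y1 y2, a <= x1 <= x -> x <= x2 <= b -> c <= y1 <= y -> y <= y2 <= d ->
      x2 - x1 < e -> y2 - y1 < e -> (x2 - x1) * (d - c) = (y2 - y1) * (b - a) ->
      P x1 x2 y1 y2) ->
  P a b c d.
Proof.
move=> ab cd hsplit hloc; apply: contrapT => nP.
pose w n := (b - a) / 2 ^+ n; pose h n := (d - c) / 2 ^+ n.
have w0 n : 0 <= w n by rewrite /w divr_ge0 ?exprn_ge0 ?subr_ge0 ?ltW.
have h0 n : 0 <= h n by rewrite /h divr_ge0 ?exprn_ge0 ?subr_ge0 ?ltW.
have wS n : w n = w n.+1 + w n.+1 by rewrite /w exprS; field; rewrite expf_neq0.
have hS n : h n = h n.+1 + h n.+1 by rewrite /h exprS; field; rewrite expf_neq0.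
pose Q n (p : R * R) := P p.1 (p.1 + w n) p.2 (p.2 + h n).
(* One of the four quarters on which [P] fails; the last one needs no test, since otherwise [hsplit]
   would give [P] on the whole cell. *)
pose child n (p : R * R) : R * R :=
  if ~~ `[< Q n.+1 p >] then p else
  if ~~ `[< Q n.+1 (p.1, p.2 + h n.+1) >] then (p.1, p.2 + h n.+1) else
  if ~~ `[< Q n.+1 (p.1 + w n.+1, p.2) >] then (p.1 + w n.+1, p.2) else
  (p.1 + w n.+1, p.2 + h n.+1).
have childP n p : ~ Q n p -> ~ Q n.+1 (child n p).
  move=> nQ; rewrite /child; case: asboolP => //= q1; case: asboolP => //= q2.
  case: asboolP => //= q3 q4; apply: nQ; rewrite /Q in q1 q2 q3 q4 *.
  have ex : (p.1 + (p.1 + w n)) / 2 = p.1 + w n.+1 by rewrite (wS n); field.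
  have ey : (p.2 + (p.2 + h n)) / 2 = p.2 + h n.+1 by rewrite (hS n); field.
  apply: hsplit; rewrite ?lerDl // ex ey ?(wS n) ?(hS n) ?addrA //.
have child1 n p : p.1 <= (child n p).1 <= p.1 + w n.+1.
  rewrite /child; do 3?[case: ifP => _] => /=; rewrite ?lexx ?lerDl ?w0 //.
have child2 n p : p.2 <= (child n p).2 <= p.2 + h n.+1.
  rewrite /child; do 3?[case: ifP => _] => /=; rewrite ?lexx ?lerDl ?h0 //.
pose s := fix s n := if n is m.+1 then child m (s m) else (a, c).
have nQ n : ~ Q n (s n).
  elim: n => [|n IH]; last exact: childP.
  have ew : a + w 0%N = b by rewrite /w expr0 divr1 addrC subrK.
  have eh : c + h 0%N = d by rewrite /h expr0 divr1 addrC subrK.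
  by move=> q0; apply: nP; rewrite -ew -eh; exact: q0.
(* Nested intervals have a common point, the supremum of their left endpoints; used once for each
   coordinate. *)
have mono (u v : nat -> R) : (forall n, 0 <= v n) -> (forall n, v n = v n.+1 + v n.+1) ->
    (forall n, u n <= u n.+1 <= u n + v n.+1) ->
    exists X, forall n, u n <= X <= u n + v n.
  move=> v0 vS uS.
  have u1 m n : u n <= u (n + m)%N /\ u (n + m)%N + v (n + m)%N <= u n + v n.
    elim: m => [|m [i1 i2]]; first by rewrite addn0.
    have /andP[j1 j2] := uS (n + m)%N; rewrite addnS; split; first exact: le_trans i1 j1.
    by apply: le_trans i2; rewrite (vS (n + m)%N); lra.
  have u2 m n : u m <= u n + v n.
    have [mn|/ltnW nm] := leqP m n.
      have [i1 _] := u1 (n - m)%N m; rewrite subnKC // in i1.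
      by apply: le_trans i1 _; rewrite lerDl.
    have [_ i2] := u1 (m - n)%N n; rewrite subnKC // in i2.
    by apply: le_trans i2; rewrite lerDl.
  exists (sup (range u)) => n; apply/andP; split.
    apply: ub_le_sup; last by exists n.
    by exists (u 0%N + v 0%N) => _ [m _ <-].
  by apply: ge_sup; [exists (u 0%N), 0%N|move=> _ [m _ <-]].
have [X hX] := mono (fun n => (s n).1) w w0 wS (fun n => child1 n (s n)).
have [Y hY] := mono (fun n => (s n).2) h h0 hS (fun n => child2 n (s n)).
have in1 n : a <= (s n).1 /\ (s n).1 + w n <= b.
  elim: n => [|n [i1 i2]] /=; first by rewrite /w expr0 divr1 addrC subrK.
  have /andP[j1 j2] := child1 n (s n); split; first exact: le_trans i1 j1.
  by apply: le_trans i2; rewrite (wS n); lra.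
have in2 n : c <= (s n).2 /\ (s n).2 + h n <= d.
  elim: n => [|n [i1 i2]] /=; first by rewrite /h expr0 divr1 addrC subrK.
  have /andP[j1 j2] := child2 n (s n); split; first exact: le_trans i1 j1.
  by apply: le_trans i2; rewrite (hS n); lra.
have aXb : a <= X <= b.
  have := hX 0%N; have := in1 0%N; move=> /= [_ h2] /andP[h3 h4].
  by rewrite h3 (le_trans h4).
have cYd : c <= Y <= d.
  have := hY 0%N; have := in2 0%N; move=> /= [_ h2] /andP[h3 h4].
  by rewrite h3 (le_trans h4).
have [e e0 he] := hloc X Y aXb cYd.
have [n hn] := exists_pow2_lt (Num.max (b - a) (d - c)) e0.
have p2 : 0 < (2 ^+ n)^-1 :> R by rewrite invr_gt0 exprn_gt0.
apply: (nQ n); rewrite /Q.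
have [i1 i2] := in1 n; have [j1 j2] := in2 n.
have /andP[k1 k2] := hX n; have /andP[l1 l2] := hY n.
apply: he; rewrite ?i1 ?i2 ?j1 ?j2 ?k1 ?k2 ?l1 ?l2 //.
- rewrite addrC addKr; apply: le_lt_trans hn; rewrite ler_pM2r //.
  by rewrite le_max lexx.
- rewrite addrC addKr; apply: le_lt_trans hn; rewrite ler_pM2r //.
  by rewrite le_max lexx orbT.
- by rewrite /w /h; ring.
Qed.

End Cousin.

Section Goursat.
Variable R : realType.
Local Notation C := R[i].
Implicit Types (f h : C -> C) (z w : C) (r t : R).

Definition cdiff f z (l : C) := forall e : R, 0 < e -> exists2 d : R, 0 < d &
  forall w, cabs (w - z) < d -> cabs (f w - f z - l * (w - z)) <= e * cabs (w - z).

Definition ccts f z := forall e : R, 0 < e -> exists2 d : R, 0 < d &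
  forall w, cabs (w - z) < d -> cabs (f w - f z) < e.

Lemma derivable_cdiff f z : derivable f z 1 -> cdiff f z (derive1 f z).
Proof. by move=> h; apply/derivable_cabsP. Qed.

Lemma cdiff_derivable f z l : cdiff f z l -> derivable f z 1.
Proof. by move=> /derivable_cabsP[]. Qed.

Lemma cdiff_derive1 f z l : cdiff f z l -> derive1 f z = l.
Proof. by move=> /derivable_cabsP[]. Qed.

Lemma cdiff_ccts f z l : cdiff f z l -> ccts f z.
Proof.
move=> h e e0; have [d d0 hd] := h 1 ltr01.
have c0 : 0 < 1 + cabs l by rewrite ltr_pwDl ?cabs_ge0.
exists (Num.min d (e / (1 + cabs l))); first by rewrite lt_min d0 divr_gt0.
move=> w; rewrite lt_min => /andP[h1 h2].
have := hd w h1; rewrite mul1r => h3.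
apply: le_lt_trans (cabs_dist _ (l * (w - z))) _.
rewrite ltr_pdivlMr // in h2; apply: le_lt_trans h2.
by move: h3; rewrite cabsM; lra.
Qed.

Lemma polar_dist r t r0 t0 (b : R) : 0 <= r0 <= b ->
  cabs (r%:C * cis t - r0%:C * cis t0) <= `|r - r0| + 2 * b * `|t - t0|.
Proof.
move=> /andP[h1 h2].
have -> : r%:C * cis t - r0%:C * cis t0 = (r - r0)%:C * cis t + r0%:C * (cis t - cis t0).
  by rewrite rmorphB; ring.
apply: le_trans (cabsD _ _) _; rewrite !cabsM !cabs_real. rewrite cabs_cis mulr1 lerD2l.
rewrite ger0_norm //; apply: (le_trans (ler_wpM2l h1 (cis_lip t t0))).
by rewrite (mulrC 2 b) -mulrA ler_wpM2r // mulr_ge0.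
Qed.

Lemma cabs_polar r t : 0 <= r -> cabs (r%:C * cis t) = r.
Proof. by move=> r0; rewrite cabsM cabs_cis mulr1 cabs_real ger0_norm. Qed.

Lemma ccont_circle h a b r : 0 <= r -> (forall t, a <= t <= b -> ccts h (r%:C * cis t)) ->
  ccont `[a, b] (fun t => h (r%:C * cis t)).
Proof.
move=> r0 hc; apply: ccontP => s; rewrite /= in_itv /= => /hc hs e e0.
have [d d0 hd] := hs e e0; exists (d / (1 + 2 * r)).
  by rewrite divr_gt0 //; lra.
move=> t _; rewrite ltr_pdivlMr; last by lra.
move=> h1; rewrite cabs_distC; apply: hd; rewrite -(distrC t) in h1.
apply: le_lt_trans h1; apply: le_trans (@polar_dist r t r s r _) _; first by rewrite r0 lexx.
by rewrite subrr normr0 add0r mulrC ler_wpM2l // lerDr.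
Qed.

Lemma ccont_ray h a b t : 0 <= a -> (forall r, a <= r <= b -> ccts h (r%:C * cis t)) ->
  ccont `[a, b] (fun r => h (r%:C * cis t)).
Proof.
move=> a0 hc; apply: ccontP => s; rewrite /= in_itv /= => hs e e0.
have [d d0 hd] := hc s hs e e0; exists d => // r _ h1.
rewrite cabs_distC; apply: hd; rewrite distrC in h1; apply: le_lt_trans h1.
case/andP: hs => h1 h2.
apply: le_trans (@polar_dist r t s t s _) _; first by rewrite (le_trans a0 h1) lexx.
by rewrite subrr normr0 mulr0 addr0.
Qed.

(** Compactness by quadrisection: continuity bounds [h] near each point, and the maximum of four
    bounds serves for the union of four quarters. *)
Lemma polar_bounded h a b : 0 <= a -> a < b ->
  (forall w, a <= cabs w <= b -> ccts h w) ->
  exists K, forall r t, a <= r <= b -> 0 <= t <= 2 * pi -> cabs (h (r%:C * cis t)) <= K.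
Proof.
move=> a0 ab hc; have pi0 : 0 < 2 * pi :> R by rewrite mulr_gt0 ?pi_gt0.
pose P x1 x2 y1 y2 := exists K, forall r t, x1 <= r <= x2 -> y1 <= t <= y2 ->
  cabs (h (r%:C * cis t)) <= K.
apply: (@rectangle_cousin R P a b 0 (2 * pi)) => //.
  move=> x1 x2 y1 y2 hx hy [K1 h1] [K2 h2] [K3 h3] [K4 h4].
  exists (Num.max (Num.max K1 K2) (Num.max K3 K4)) => r t /andP[r1 r2] /andP[t1 t2].
  rewrite !le_max; have [r3|/ltW r3] := leP r ((x1 + x2) / 2).
    have [t3|/ltW t3] := leP t ((y1 + y2) / 2).
      by rewrite h1 // ?r1 ?r3 ?t1 ?t3.
    by rewrite h2 // ?r1 ?r3 ?t2 ?t3 ?orbT.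
  have [t3|/ltW t3] := leP t ((y1 + y2) / 2).
    by rewrite h3 ?orbT // ?r2 ?r3 ?t1 ?t3.
  by rewrite h4 ?orbT // ?r2 ?r3 ?t2 ?t3.
move=> x y /andP[x1 x2] y12; have x0 : 0 <= x by apply: le_trans x1.
have [|d d0 hd] := hc (x%:C * cis y) _ 1 ltr01; first by rewrite cabs_polar // x1.
have b1 : 0 < 1 + 2 * b by lra.
exists (d / (1 + 2 * b)); first by rewrite divr_gt0.
move=> u1 u2 v1 v2 /andP[_ h1] /andP[h2 _] /andP[_ h3] /andP[h4 _] du dv _.
exists (cabs (h (x%:C * cis y)) + 1) => r t /andP[r1 r2] /andP[t1 t2].
apply: le_trans (cabs_dist _ (h (x%:C * cis y))) _; rewrite lerD2l ltW //; apply: hd.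
apply: le_lt_trans (@polar_dist r t x y b _) _; first by rewrite x0.
have e1 : `|r - x| < d / (1 + 2 * b) by rewrite ltr_norml; apply/andP; split; lra.
have e2 : `|t - y| < d / (1 + 2 * b) by rewrite ltr_norml; apply/andP; split; lra.
have -> : d = d / (1 + 2 * b) + 2 * b * (d / (1 + 2 * b)) by field; rewrite gt_eqF.
by rewrite ltr_leD // ler_wpM2l ?ltW //; lra.
Qed.

(* The closed form is [h(w) dw / w], in polar coordinates. *)
Definition polar_boundary h r1 r2 t1 t2 : C :=
  cint r1 r2 (fun r => (h (r%:C * cis t1) - h (r%:C * cis t2)) * (r^-1)%:C) +
  'i * cint t1 t2 (fun t => h (r2%:C * cis t) - h (r1%:C * cis t)).

Section Annulus.
Variables (h : C -> C) (a b : R).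
Hypotheses (a0 : 0 < a) (ab : a < b).
Hypothesis hd : forall w, a <= cabs w <= b -> exists l, cdiff h w l.

Let hc w : a <= cabs w <= b -> ccts h w.
Proof. by move=> /hd[l /cdiff_ccts]. Qed.

Let ci_circle r t1 t2 : a <= r <= b -> cintg t1 t2 (fun t => h (r%:C * cis t)).
Proof.
move=> hr; apply: ccont_cintg; have r0 : 0 <= r by case/andP: hr => + _; apply/le_trans/ltW.
by apply: ccont_circle => // t _; apply: hc; rewrite cabs_polar.
Qed.

Let ccont_inv : ccont `[a, b] (fun r => (r^-1)%:C).
Proof.
apply: (@ccont_lip _ _ _ (a^-1 * a^-1)) => s t; rewrite /= !in_itv /= => /andP[s1 _] /andP[t1 _].
have s0 : 0 < s by apply: lt_le_trans s1.
have t0 : 0 < t by apply: lt_le_trans t1.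
rewrite -rmorphB cabs_real.
have -> : s^-1 - t^-1 = (s^-1 * t^-1) * (t - s) by field; rewrite !gt_eqF.
rewrite normrM distrC ler_wpM2r // ger0_norm ?mulr_ge0 ?invr_ge0 ?(ltW s0) ?(ltW t0) //.
by apply: ler_pM; rewrite ?invr_ge0 ?(ltW s0) ?(ltW t0) // lef_pV2.
Qed.

Let ci_ray r1 r2 t : a <= r1 -> r2 <= b ->
  cintg r1 r2 (fun r => h (r%:C * cis t) * (r^-1)%:C).
Proof.
move=> h1 h2; apply: (cintg_sub h1 h2); apply: ccont_cintg.
apply: ccontM ccont_inv; apply: ccont_ray; first exact: ltW.
move=> r hr; apply: hc; rewrite cabs_polar //.
by case/andP: hr => + _; apply/le_trans/ltW.
Qed.

Let ci_rays r1 r2 t1 t2 : a <= r1 -> r2 <= b ->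
  cintg r1 r2 (fun r => (h (r%:C * cis t1) - h (r%:C * cis t2)) * (r^-1)%:C).
Proof.
move=> h1 h2; apply: eq_cintg (cintgB (ci_ray t1 h1 h2) (ci_ray t2 h1 h2)) => r _.
by rewrite mulrBl.
Qed.

Let cint_rays r1 r2 t1 t2 : a <= r1 -> r2 <= b ->
  cint r1 r2 (fun r => (h (r%:C * cis t1) - h (r%:C * cis t2)) * (r^-1)%:C) =
  cint r1 r2 (fun r => h (r%:C * cis t1) * (r^-1)%:C) -
  cint r1 r2 (fun r => h (r%:C * cis t2) * (r^-1)%:C).
Proof.
move=> h1 h2; rewrite -cintB; [|exact: ci_ray..].
by apply: eq_cint => r _; rewrite mulrBl.
Qed.

Let cint_circles r1 r2 t1 t2 : a <= r1 <= b -> a <= r2 <= b ->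
  cint t1 t2 (fun t => h (r2%:C * cis t) - h (r1%:C * cis t)) =
  cint t1 t2 (fun t => h (r2%:C * cis t)) - cint t1 t2 (fun t => h (r1%:C * cis t)).
Proof. by move=> h1 h2; rewrite cintB //; apply: ci_circle. Qed.

(** The integrals along the edges shared by two quarters cancel. *)
Let split4 x1 x2 y1 y2 : a <= x1 -> x1 <= x2 -> x2 <= b -> y1 <= y2 ->
  let xm := (x1 + x2) / 2 in let ym := (y1 + y2) / 2 in
  polar_boundary h x1 x2 y1 y2 =
  polar_boundary h x1 xm y1 ym + polar_boundary h x1 xm ym y2 +
  (polar_boundary h xm x2 y1 ym + polar_boundary h xm x2 ym y2).
Proof.
move=> ax x12 xb y12 xm ym.
have x1m : x1 <= xm by rewrite /xm; lra.
have xm2 : xm <= x2 by rewrite /xm; lra.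
have y1m : y1 <= ym by rewrite /ym; lra.
have ym2 : ym <= y2 by rewrite /ym; lra.
have axm : a <= xm by apply: le_trans x1m.
have xmb : xm <= b by apply: le_trans xb.
have ax2 : a <= x2 by apply: le_trans xm2.
have x1b : x1 <= b by apply: le_trans x1m _.
rewrite /polar_boundary !cint_rays // !cint_circles ?ax ?xb ?axm ?xmb ?ax2 //.
rewrite (cint_chasles x1m xm2 (ci_ray y1 ax xb)) (cint_chasles x1m xm2 (ci_ray y2 ax xb)).
rewrite (cint_chasles y1m ym2 (@ci_circle x1 _ _ _)) ?ax //.
rewrite (cint_chasles y1m ym2 (@ci_circle x2 _ _ _)) ?ax2 //.
by ring.
Qed.

(** The affine part of [h] at the chosen point contributes nothing: its constant cancels in the
    differences, and its linear part gives opposite terms on the rays and on the arcs. Only the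
    error [E] remains. *)
Let local_bound x1 x2 y1 y2 x y l e :
  a <= x1 <= x -> x <= x2 <= b -> y1 <= y <= y2 -> 0 <= e ->
  (forall r t, x1 <= r <= x2 -> y1 <= t <= y2 ->
    cabs (h (r%:C * cis t) - h (x%:C * cis y) - l * (r%:C * cis t - x%:C * cis y)) <= e) ->
  cabs (polar_boundary h x1 x2 y1 y2) <= (2 * e / a) * (x2 - x1) + 2 * e * (y2 - y1).
Proof.
move=> /andP[ax x1x] /andP[xx2 xb] /andP[y1y yy2] e0 he.
have x12 : x1 <= x2 by apply: le_trans xx2.
have y12 : y1 <= y2 by apply: le_trans yy2.
have x1b : x1 <= b by apply: le_trans xb.
have ax2 : a <= x2 by apply: le_trans x12.
pose E w := h w - h (x%:C * cis y) - l * (w - x%:C * cis y).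
have hE w w' : h w - h w' = (E w - E w') + l * (w - w') by rewrite /E; ring.
have iA : cintg x1 x2 (fun r => (E (r%:C * cis y1) - E (r%:C * cis y2)) * (r^-1)%:C).
  apply: eq_cintg (cintgB (@ci_rays x1 x2 y1 y2 ax xb) (cintg_cst x1 x2 (l * (cis y1 - cis y2)))).
  move=> r /andP[r1 _]; have r0 : r%:C != 0.
    by rewrite -cabs_gt0 cabs_real normr_gt0 gt_eqF // (lt_le_trans a0) // (le_trans ax).
  by rewrite hE fmorphV /=; field.
have iB : cintg y1 y2 (fun t => E (x2%:C * cis t) - E (x1%:C * cis t)).
  have := cintgB (@ci_circle x2 y1 y2 _) (@ci_circle x1 y1 y2 _).
  rewrite ax ax2 xb x1b => /(_ isT isT) i1.
  apply: eq_cintg (cintgB i1 (cintgZ (l * (x2%:C - x1%:C)) (ccont_cintg (ccont_cis _)))) => t _.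
  by rewrite hE; ring.
have -> : polar_boundary h x1 x2 y1 y2 =
   cint x1 x2 (fun r => (E (r%:C * cis y1) - E (r%:C * cis y2)) * (r^-1)%:C) +
   'i * cint y1 y2 (fun t => E (x2%:C * cis t) - E (x1%:C * cis t)).
  rewrite /polar_boundary.
  rewrite (@eq_cint _ _ _ _ (fun r => (E (r%:C * cis y1) - E (r%:C * cis y2)) * (r^-1)%:C
     + l * (cis y1 - cis y2))); last first.
    move=> r /andP[r1 _]; have r0 : r%:C != 0.
      by rewrite -cabs_gt0 cabs_real normr_gt0 gt_eqF // (lt_le_trans a0) // (le_trans ax).
    by rewrite hE fmorphV /=; field.
  rewrite (cintD iA (cintg_cst _ _ _)) cint_cst //.
  rewrite [cint y1 y2 _](@eq_cint _ _ _ _ (fun t => (E (x2%:C * cis t) - E (x1%:C * cis t))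
     + (l * (x2%:C - x1%:C)) * cis t)); last by move=> t _; rewrite hE; ring.
  have ic : cintg y1 y2 (@cis R) by apply: ccont_cintg (ccont_cis _).
  rewrite (cintD iB (cintgZ _ ic)) cintZ // cint_cis // rmorphB.
  have ii : 'i * 'i = -1 :> C by rewrite -expr2 sqr_i.
  set A := cint _ _ _; set B := cint _ _ _.
  have -> : 'i * (B + l * (x2%:C - x1%:C) * (- 'i * (cis y2 - cis y1))) =
     'i * B - ('i * 'i) * (l * (x2%:C - x1%:C) * (cis y2 - cis y1)) by ring.
  by rewrite ii /=; ring.
apply: le_trans (cabsD _ _) _; rewrite lerD //.
  apply: cabs_cint_bound => // r rx.
  have r1 : a <= r by case/andP: rx => + _; apply: le_trans.
  rewrite cabsM cabs_real ger0_norm ?invr_ge0 ?(le_trans (ltW a0)) //.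
  apply: ler_pM; rewrite ?cabs_ge0 ?invr_ge0 ?(le_trans (ltW a0)) //.
    apply: le_trans (cabsB _ _) _; rewrite mulr_natl mulr2n lerD ?he //.
      by rewrite lexx.
    by rewrite lexx andbT.
  by rewrite lef_pV2 // posrE (lt_le_trans a0).
rewrite cabsM; have -> : cabs ('i : C) = 1 by rewrite cabsE /= expr0n expr1n add0r sqrtr1.
rewrite mul1r; apply: cabs_cint_bound => // t ty.
apply: le_trans (cabsB _ _) _; rewrite mulr_natl mulr2n lerD ?he //.
  by rewrite lexx andbT.
by rewrite lexx.
Qed.

(** The boundary integral over the full rectangle of radii and angles is at most e times its area
    for every e, hence 0. The rays at angles 0 and 2 pi coincide, so only the two circles are
    left. *)
Lemma goursat_annulus :
  cint 0 (2 * pi) (fun t => h (b%:C * cis t)) = cint 0 (2 * pi) (fun t => h (a%:C * cis t)).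
Proof.
have pi0 : 0 < 2 * pi :> R by rewrite mulr_gt0 ?pi_gt0.
have b0 : 0 < b by apply: lt_trans ab.
have key e : 0 < e -> cabs (polar_boundary h a b 0 (2 * pi)) <= e * ((b - a) * (2 * pi)).
  move=> e0.
  pose P x1 x2 y1 y2 := a <= x1 -> x2 <= b ->
    cabs (polar_boundary h x1 x2 y1 y2) <= e * ((x2 - x1) * (y2 - y1)).
  suff : P a b 0 (2 * pi) by move=> /(_ (lexx _) (lexx _)); rewrite subr0.
  apply: rectangle_cousin => //.
    move=> x1 x2 y1 y2 x12 y12 p1 p2 p3 p4 ax xb.
    have h1 : (x1 + x2) / 2 <= b by lra.
    have h2 : a <= (x1 + x2) / 2 by lra.
    rewrite split4 //; apply: le_trans (cabsD _ _) _.
    apply: le_trans (lerD (cabsD _ _) (cabsD _ _)) _.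
    apply: le_trans (lerD (lerD (p1 ax h1) (p2 ax h1)) (lerD (p3 h2 xb) (p4 h2 xb))) _.
    by rewrite le_eqVlt; apply/orP; left; apply/eqP; field.
  move=> x y /andP[ax xb] hy; have x0 : 0 < x by apply: lt_le_trans ax.
  have [|l hl] := @hd (x%:C * cis y); first by rewrite cabs_polar ?ax ?xb ?(ltW x0).
  (* [k] is the ratio of the sides, [c1 * (x2 - x1)] bounds the distance to the base point in a
     cell, and [c2] is the factor coming out of [local_bound]; the tolerance [e * k / (c1 * c2)]
     then yields exactly e times the area of the cell. *)
  pose k := 2 * pi / (b - a); have k0 : 0 < k by rewrite divr_gt0 // subr_gt0.
  pose c1 := 1 + 2 * b * k; have bk0 : 0 < 2 * b * k by rewrite mulr_gt0 // mulr_gt0.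
  have c10 : 0 < c1 by rewrite /c1; lra.
  pose c2 := 2 / a + 2 * k; have c20 : 0 < c2 by apply: addr_gt0; [apply: divr_gt0|apply: mulr_gt0].
  have ek0 : 0 < e * k by apply: mulr_gt0.
  have cc0 : 0 < c1 * c2 by apply: mulr_gt0.
  have [d d0 hdd] := hl (e * k / (c1 * c2)) (divr_gt0 ek0 cc0).
  exists (d / c1); first by rewrite divr_gt0.
  move=> x1 x2 y1 y2 hx1 hx2 hy1 hy2 dx dy eqr ax1 x2b.
  (* The cells keep the proportions of the rectangle, so the square of their diameter is comparable
     with their area. *)
  have eqy : y2 - y1 = k * (x2 - x1).
    rewrite /k; have bne : b - a != 0 by rewrite subr_eq0 gt_eqF.
    have -> : y2 - y1 = (x2 - x1) * (2 * pi - 0) / (b - a) by rewrite eqr; field.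
    by field.
  have x12 : 0 <= x2 - x1 by lra.
  have dist r t : x1 <= r <= x2 -> y1 <= t <= y2 ->
      cabs (r%:C * cis t - x%:C * cis y) <= c1 * (x2 - x1).
    move=> /andP[r1 r2] /andP[t1 t2]; apply: le_trans (@polar_dist r t x y b _) _.
      by rewrite xb ltW.
    have e1 : `|r - x| <= x2 - x1 by rewrite ler_norml; apply/andP; split; lra.
    have e2 : `|t - y| <= k * (x2 - x1) by rewrite -eqy ler_norml; apply/andP; split; lra.
    have b20 : 0 <= 2 * b by apply: mulr_ge0 => //; exact: ltW.
    have := ler_wpM2l b20 e2; rewrite /c1; lra.
  apply: le_trans (@local_bound x1 x2 y1 y2 x y l (e * k / c2 * (x2 - x1)) _ _ _ _ _) _ => //.
  - by case/andP: hy1 => _ ->; case/andP: hy2.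
  - by pos.
  - move=> r t hr ht; apply: le_trans (hdd _ _) _.
      apply: le_lt_trans (dist r t hr ht) _.
      by rewrite mulrC -ltr_pdivlMr.
    apply: le_trans (ler_wpM2l _ (dist r t hr ht)) _.
      by pos.
    rewrite le_eqVlt; apply/orP; left; apply/eqP; field.
    by rewrite !gt_eqF.
  rewrite eqy le_eqVlt; apply/orP; left; apply/eqP.
  rewrite (_ : 2 * _ / a * _ + _ = (2 / a + 2 * k) * (e * k / c2 * (x2 - x1) * (x2 - x1))); last first.
    by field; rewrite !gt_eqF.
  by rewrite -/c2; field; rewrite gt_eqF.
have z0 : polar_boundary h a b 0 (2 * pi) = 0.
  apply/eqP; rewrite -cabs_eq0 eq_le cabs_ge0 andbT; apply/ler_addgt0Pl => e e0.
  have A0 : 0 < (b - a) * (2 * pi) by rewrite mulr_gt0 // subr_gt0.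
  rewrite addr0; apply: le_trans (key (e / ((b - a) * (2 * pi))) _) _; first by rewrite divr_gt0.
  by rewrite mulfVK // gt_eqF.
move: z0; rewrite /polar_boundary cint_rays ?lexx // cint_circles ?lexx ?(ltW ab) //.
have -> : @cis R (2 * pi) = cis 0 by rewrite cis2pi cis0.
rewrite subrr add0r => /eqP; rewrite mulf_eq0 => /orP[|].
  by rewrite eq_complex /= oner_eq0 andbF.
by rewrite subr_eq0 => /eqP.
Qed.

End Annulus.

End Goursat.

(** * Means over the circle and rules for complex derivatives *)

Section Cauchy.
Variable R : realType.
Local Notation C := R[i].
Local Notation mu := (@lebesgue_measure R).
Implicit Types (f g : C -> C) (z w : C) (r t : R) (p : R -> C).

Lemma exists_geometric_lt (K q e : R) : 0 <= q < 1 -> 0 < e -> exists n, K * q ^+ n < e.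
Proof.
move=> /andP[q0 q1] e0.
have h : K * q ^+ n @[n --> \oo] --> K * 0.
  by apply: cvgMr; apply: cvg_expr; rewrite ger0_norm.
rewrite mulr0 in h; move/cvgrPdist_lt: h => /(_ e e0) [N _ hN].
exists N; have := hN N (leqnn N); rewrite /= sub0r normrN; exact: le_lt_trans (ler_norm _).
Qed.

Lemma le_geometric_eq0 (x K q : R) : 0 <= q < 1 -> (forall n, x <= K * q ^+ n) -> x <= 0.
Proof.
move=> q01 h; apply/ler_addgt0Pl => e e0; rewrite addr0.
by have [n hn] := exists_geometric_lt K q01 e0; apply: le_trans (h n) (ltW hn).
Qed.

Lemma twopi_gt0 : 0 < 2 * pi :> R. Proof. by rewrite mulr_gt0 ?pi_gt0. Qed.

Definition cmean p : C := ((2 * pi)^-1)%:C * cint 0 (2 * pi) p.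
Definition rmean (u : R -> R) : R := (2 * pi)^-1 * rint 0 (2 * pi) u.
Local Notation cper p := (cintg 0 (2 * pi) p).

Lemma eq_cmean p q : (forall t, 0 <= t <= 2 * pi -> p t = q t) -> cmean p = cmean q.
Proof. by move=> h; rewrite /cmean (eq_cint h). Qed.

Lemma cmeanD p q : cper p -> cper q -> cmean (fun t => p t + q t) = cmean p + cmean q.
Proof. by move=> h1 h2; rewrite /cmean cintD // mulrDr. Qed.

Lemma cmeanB p q : cper p -> cper q -> cmean (fun t => p t - q t) = cmean p - cmean q.
Proof. by move=> h1 h2; rewrite /cmean cintB // mulrBr. Qed.

Lemma cmeanZ k p : cper p -> cmean (fun t => k * p t) = k * cmean p.
Proof. by move=> h1; rewrite /cmean cintZ // mulrCA. Qed.

Lemma cmean_cst k : cmean (fun=> k) = k.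
Proof.
have t0 := twopi_gt0; rewrite /cmean cint_cst ?(ltW t0) // subr0 mulrCA -rmorphM /=.
by rewrite mulVf ?gt_eqF // mulr1.
Qed.

Lemma cmean_sum n (p : nat -> R -> C) : (forall k, (k < n)%N -> cper (p k)) ->
  cmean (fun t => \sum_(k < n) p k t) = \sum_(k < n) cmean (p k).
Proof. by move=> h; rewrite /cmean (cint_sum h).2 mulr_sumr. Qed.

Lemma cabs_cmean_le p (v : R -> R) : cper p -> intg 0 (2 * pi) v ->
  (forall t, 0 <= t <= 2 * pi -> cabs (p t) <= v t) -> cabs (cmean p) <= rmean v.
Proof.
move=> h1 h2 h3; have t0 := twopi_gt0.
rewrite /cmean cabsM cabs_real ger0_norm ?invr_ge0 ?(ltW t0) //.
rewrite /rmean ler_pM2l ?invr_gt0 //; apply: cabs_cint_le => //; exact: ltW.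
Qed.

Lemma rmean_cst k : rmean (fun=> k) = k.
Proof.
have t0 := twopi_gt0; rewrite /rmean rint_cst ?(ltW t0) // subr0 mulrCA.
by rewrite mulVf ?gt_eqF // mulr1.
Qed.

Lemma cabs_cmean_bound p K : cper p ->
  (forall t, 0 <= t <= 2 * pi -> cabs (p t) <= K) -> cabs (cmean p) <= K.
Proof. by move=> h1 h2; rewrite -(rmean_cst K); apply: cabs_cmean_le => //; exact: intg_cst. Qed.

Lemma cvg_rint (a b K : R) (u_ : nat -> R -> R) (u : R -> R) :
  (forall n, intg a b (u_ n)) -> intg a b u ->
  (forall n t, a <= t <= b -> `|u_ n t| <= K) ->
  (forall t, a <= t <= b -> u_ n t @[n --> \oo] --> u t) ->
  rint a b (u_ n) @[n --> \oo] --> rint a b u.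
Proof.
move=> h1 h2 h3 h4.
have [] := @dominated_convergence _ _ R mu `[a, b]%classic (measurable_itv _)
  (fun n => EFin \o u_ n) (EFin \o u) (cst K%:E).
- by move=> n; apply: measurable_int (h1 n).
- exact: measurable_int h2.
- apply: aeW => t /=; rewrite in_itv /= => /h4 h.
  by apply: cvg_EFin => //; apply: nearW.
- exact: intg_cst.
- by apply: aeW => t n /=; rewrite in_itv /= lee_fin => /h3.
move=> _ _ h; rewrite /rint /Rintegral; apply: fine_cvg.
rewrite fineK; first exact: h.
by apply: integrable_fin_num.
Qed.

Lemma cvg_cint (a b K : R) (p_ : nat -> R -> C) p :
  (forall n, cintg a b (p_ n)) -> cintg a b p ->
  (forall n t, a <= t <= b -> cabs (p_ n t) <= K) ->
  (forall t, a <= t <= b -> p_ n t @[n --> \oo] --> p t) ->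
  cint a b (p_ n) @[n --> \oo] --> cint a b p.
Proof.
move=> h1 h2 h3 h4; apply: ReIm_cvg.
  apply: (@cvg_rint a b K (fun n => Re \o p_ n)) => [n|//|n t tab|t tab].
  - by have [] := h1 n.
  - by have [] := h2.
  - exact: le_trans (normr_Re_le _) (h3 n t tab).
  - exact: Re_cvg (h4 t tab).
apply: (@cvg_rint a b K (fun n => Im \o p_ n)) => [n|//|n t tab|t tab].
- by have [] := h1 n.
- by have [] := h2.
- exact: le_trans (normr_Im_le _) (h3 n t tab).
- exact: Im_cvg (h4 t tab).
Qed.

Lemma cdiff_near f g z l (d : R) : 0 < d -> (forall w, cabs (w - z) < d -> f w = g w) ->
  cdiff f z l -> cdiff g z l.
Proof.
move=> d0 h hf e e0; have [d' d'0 h'] := hf e e0; exists (Num.min d d').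
  by rewrite lt_min d0.
move=> w; rewrite lt_min => /andP[h1 h2]; rewrite -!h //; first exact: h'.
by rewrite subrr cabs0.
Qed.

Lemma cdiffM f g z l m : cdiff f z l -> cdiff g z m ->
  cdiff (fun w => f w * g w) z (l * g z + f z * m).
Proof.
move=> hf hg e e0; pose k := cabs (g z) + cabs (f z) + 1 + cabs l.
have k0 : 0 < k.
  have := cabs_ge0 (g z); have := cabs_ge0 (f z); have := cabs_ge0 l; rewrite /k; lra.
have ek : 0 < e / k by apply: divr_gt0.
have [d1 d10 h1] := hf _ ek; have [d2 d20 h2] := hg _ ek.
have [d3 d30 h3] := cdiff_ccts hg ek; have [d4 d40 h4] := hf _ ltr01.
exists (Num.min (Num.min d1 d2) (Num.min d3 d4)); first by rewrite !lt_min d10 d20 d30.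
move=> w; rewrite !lt_min => /andP[/andP[w1 w2] /andP[w3 w4]].
have -> : f w * g w - f z * g z - (l * g z + f z * m) * (w - z) =
  (f w - f z - l * (w - z)) * g z + f z * (g w - g z - m * (w - z)) +
  (f w - f z) * (g w - g z) by ring.
have D0 := cabs_ge0 (w - z).
have hfw : cabs (f w - f z) <= (1 + cabs l) * cabs (w - z).
  by have := cabs_dist (f w - f z) (l * (w - z)); have := h4 w w4; rewrite cabsM; lra.
have -> : e * cabs (w - z) = e / k * cabs (w - z) * cabs (g z) +
   cabs (f z) * (e / k * cabs (w - z)) + (1 + cabs l) * cabs (w - z) * (e / k).
  by rewrite /k; field; rewrite gt_eqF.
apply: le_trans (cabsD _ _) (lerD (le_trans (cabsD _ _) (lerD _ _)) _); rewrite cabsM.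
- by apply: ler_wpM2r (h1 w w1); exact: cabs_ge0.
- by apply: ler_wpM2l (h2 w w2); exact: cabs_ge0.
- by apply: ler_pM hfw (ltW (h3 w w3)); exact: cabs_ge0.
Qed.

Lemma cdiffV f z l : f z != 0 -> cdiff f z l ->
  cdiff (fun w => (f w)^-1) z (- l / f z ^+ 2).
Proof.
rewrite -cabs_gt0 => A0 hf e e0; set A := cabs (f z) in A0.
(* Near [z] one has |f w| >= A / 2, hence |1 / f w| <= 2 / A; [k] is the total factor of [e / k] in
   the two error terms below. *)
pose k := 2 / A ^+ 2 + 2 * cabs l / A ^+ 3.
have k0 : 0 < k.
  by apply: ltr_pwDl; [pos|apply: divr_ge0; [apply: mulr_ge0 => //; exact: cabs_ge0|pos]].
have ek : 0 < e / k by apply: divr_gt0.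
have A2 : 0 < A / 2 by apply: divr_gt0.
have [d1 d10 h1] := hf _ ek; have [d2 d20 h2] := cdiff_ccts hf ek.
have [d3 d30 h3] := cdiff_ccts hf A2.
exists (Num.min d1 (Num.min d2 d3)); first by rewrite !lt_min d10 d20.
move=> w; rewrite !lt_min => /andP[w1 /andP[w2 w3]].
have B0 : A / 2 <= cabs (f w).
  by have := cabs_dist (f z) (f w); rewrite cabs_distC; have := h3 w w3; rewrite -/A; lra.
have fw0 : f w != 0 by rewrite -cabs_gt0; apply: lt_le_trans B0.
have fz0 : f z != 0 by rewrite -cabs_gt0.
have -> : (f w)^-1 - (f z)^-1 - - l / f z ^+ 2 * (w - z) =
  - (f w - f z - l * (w - z)) * ((f z)^-1 * (f w)^-1) +
  l * (w - z) * (f w - f z) * ((f z)^-1 ^+ 2 * (f w)^-1).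
  by field; rewrite fw0 fz0.
have D0 := cabs_ge0 (w - z).
have Vw : cabs (f w)^-1 <= 2 / A.
  by rewrite cabsV -[leRHS]invrK lef_pV2 ?posrE ?invr_gt0 ?invf_div //;
    [exact: lt_le_trans B0|apply: divr_gt0].
have -> : e * cabs (w - z) = e / k * cabs (w - z) * (A^-1 * (2 / A)) +
   cabs l * cabs (w - z) * (e / k) * (A^-1 ^+ 2 * (2 / A)).
  by rewrite /k; field; rewrite !gt_eqF // -/A; have := cabs_ge0 l; nra.
apply: le_trans (cabsD _ _) (lerD _ _); rewrite !cabsM ?cabsN ?cabsX !(cabsV (f z)) -/A.
  apply: ler_pM (h1 w w1) _; rewrite ?cabs_ge0 //; first by apply: mulr_ge0; [pos|exact: cabs_ge0].
  by apply: ler_wpM2l Vw; pos.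
apply: ler_pM; [by rewrite !mulr_ge0 ?cabs_ge0|by apply: mulr_ge0; [pos|exact: cabs_ge0]| |].
  by apply: ler_wpM2l (ltW (h2 w w2)); rewrite mulr_ge0 ?cabs_ge0.
by apply: ler_wpM2l Vw; pos.
Qed.

Lemma cdiff_sub f z l k : cdiff f z l -> cdiff (fun w => f w - k) z l.
Proof.
move=> h e e0; have [d d0 hd] := h e e0; exists d => // w /hd.
by rewrite opprB addrA subrK.
Qed.

Lemma cdiff_id z : cdiff id z 1.
Proof.
move=> e e0; exists 1 => // w _; rewrite mul1r subrr cabs0 mulr_ge0 ?cabs_ge0 //.
exact: ltW.
Qed.

Lemma cdiff_exp z n : exists l, cdiff (fun w => w ^+ n) z l.
Proof.
elim: n => [|n [l IH]].
  exists 0 => e e0; exists 1 => // w _; rewrite !expr0 subrr mul0r subr0 cabs0.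
  by rewrite mulr_ge0 ?cabs_ge0 // ltW.
exists (1 * z ^+ n + z * l); have hk := cdiffM (cdiff_id z) IH.
by apply: (cdiff_near ltr01) hk => w _ /=; rewrite exprS.
Qed.

Lemma cper_cisX n : cper (fun t => @cis R t ^+ n).
Proof.
apply: ccont_cintg; elim: n => [|n IH]; first exact: ccont_cst.
rewrite (_ : (fun t => _) = (fun t => cis t * cis t ^+ n)); last first.
  by apply/funext => t; rewrite exprS.
exact: ccontM (ccont_cis _) IH.
Qed.

(** Goursat for w^(n + 1) between the radii 1 and 2 gives 2^(n + 1) I = I, so I = 0. *)
Lemma cint_cisX n : cint 0 (2 * pi) (fun t => @cis R t ^+ n.+1) = 0.
Proof.
have h := @goursat_annulus R (fun w => w ^+ n.+1) 1 2 ltr01 ltac:(lra)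
  (fun w _ => cdiff_exp w n.+1).
move: h; set I := cint _ _ (fun t => cis t ^+ _).
have i1 := cper_cisX n.+1.
have -> : (fun t => ((2 : R)%:C * cis t) ^+ n.+1) = (fun t => (2%:C ^+ n.+1) * cis t ^+ n.+1).
  by apply/funext => t; rewrite exprMn.
have -> : (fun t => ((1 : R)%:C * cis t) ^+ n.+1) = (fun t => cis t ^+ n.+1).
  by apply/funext => t; rewrite mul1r.
rewrite cintZ // -/I => h.
have : ((2 : R)%:C ^+ n.+1 - 1) * I = 0 by rewrite mulrBl h mul1r subrr.
move/eqP; rewrite mulf_eq0 => /orP[|/eqP //].
rewrite subr_eq0 -rmorphXn => /eqP /(congr1 Re) /= h2.
have : 1 < (2 : R) ^+ n.+1 by rewrite exprn_egt1 //; lra.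
by rewrite h2 ltxx.
Qed.

Lemma cmean_cisX n : cmean (fun t => @cis R t ^+ n) = (n == 0%N)%:R.
Proof.
case: n => [|n]; last by rewrite /cmean cint_cisX mulr0.
by rewrite -[RHS]cmean_cst; apply: eq_cmean => t _; rewrite expr0.
Qed.

Lemma cintgJ a b p : cintg a b p -> cintg a b (fun t => (p t)^*).
Proof.
move=> [h1 h2]; split; first by apply: eq_intg h1 => t _ /=; rewrite ReJ.
by apply: eq_intg (intgN h2) => t _ /=; rewrite ImJ.
Qed.

Lemma cmeanJ p : cper p -> cmean (fun t => (p t)^*) = (cmean p)^*.
Proof.
move=> [h1 h2]; rewrite /cmean conjM; congr (_ * _); first exact/esym/conjRe.
apply: complex_eq; rewrite ?ReJ ?ImJ ?Re_cint ?Im_cint.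
  by apply: eq_rint => t _ /=; rewrite ReJ.
by rewrite -rintN //; apply: eq_rint => t _ /=; rewrite ImJ.
Qed.

Lemma cper_cisVX n : cper (fun t => (@cis R t)^-1 ^+ n).
Proof.
by apply: eq_cintg (cintgJ (cper_cisX n)) => t _; rewrite cisV conjX.
Qed.

Lemma cmean_cisVX n : cmean (fun t => (@cis R t)^-1 ^+ n) = (n == 0%N)%:R.
Proof.
have -> : ((n == 0%N)%:R : C) = ((n == 0%N)%:R)^* by exact/esym/conjc_nat.
rewrite -cmean_cisX -cmeanJ; last exact: cper_cisX.
by apply: eq_cmean => t _; rewrite cisV conjX.
Qed.

Lemma ccts_cvg f (T : Type) (F : set_system T) (FF : Filter F) (u : T -> C) w :
  ccts f w -> u @ F --> w -> f (u x) @[x --> F] --> f w.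
Proof.
move=> hf /cabs_cvgP hu; apply/cabs_cvgP => e e0; have [d d0 hd] := hf e e0.
move: (hu d d0); apply: filterS => x hx; rewrite cabs_distC; apply: hd.
by rewrite cabs_distC.
Qed.

Lemma ccont_circle_disk f r : 0 <= r -> (forall w, cabs w = r -> ccts f w) ->
  cper (fun t => f (r%:C * cis t)).
Proof.
move=> r0 h; apply: ccont_cintg; apply: ccont_circle => // t _; apply: h.
by rewrite cabs_polar.
Qed.

(** Only continuity is assumed. This serves to cross the circle through a point where a difference
    quotient is continuous but not known to be differentiable. *)
Lemma circle_integral_cvg f (a b r : R) (s : nat -> R) : 0 < a -> a < b ->
  (forall w, a <= cabs w <= b -> ccts f w) ->
  (forall n, a <= s n <= b) -> a <= r <= b -> s n @[n --> \oo] --> r ->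
  cint 0 (2 * pi) (fun t => f ((s n)%:C * cis t)) @[n --> \oo] -->
  cint 0 (2 * pi) (fun t => f (r%:C * cis t)).
Proof.
move=> a0 ab hc hs hr sr; have [K hK] := polar_bounded (ltW a0) ab hc.
have ge0 x : a <= x <= b -> 0 <= x by case/andP=> + _; apply/le_trans/ltW.
have ci x : a <= x <= b -> cper (fun t => f (x%:C * cis t)).
  by move=> hx; apply: ccont_circle_disk; [exact: ge0|move=> w wx; apply: hc; rewrite wx].
apply: (@cvg_cint _ _ K) => [n|||t ht]; [exact: ci|exact: ci|by move=> n t; apply: hK|].
apply: ccts_cvg; first by apply: hc; rewrite cabs_polar ?ge0.
apply/cabs_cvgP => e e0; move/cvgrPdist_lt: sr => /(_ e e0); apply: filterS => n.
by rewrite -mulrBl -rmorphB cabsM cabs_cis mulr1 cabs_real.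
Qed.

End Cauchy.

(** * Cauchy's formula and Taylor expansions *)

Section PowerSeries.
Variable R : realType.
Local Notation C := R[i].
Implicit Types (f g : C -> C) (z w : C) (r t : R) (p : R -> C) (a b : nat -> C).
Local Notation cper p := (cintg 0 (2 * pi) p).

Definition cd f w := exists l, cdiff f w l.

Lemma cd_ccts f w : cd f w -> ccts f w. Proof. by case=> l /cdiff_ccts. Qed.

Lemma cdM f g w : cd f w -> cd g w -> cd (fun w => f w * g w) w.
Proof. by move=> [l hl] [m hm]; eexists; apply: cdiffM hl hm. Qed.

Lemma cdV f w : f w != 0 -> cd f w -> cd (fun w => (f w)^-1) w.
Proof. by move=> f0 [l hl]; eexists; apply: cdiffV hl. Qed.

Lemma cdX n w : cd (fun w => w ^+ n) w. Proof. exact: cdiff_exp. Qed.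

Lemma cd_sub f k w : cd f w -> cd (fun w => f w - k) w.
Proof. by move=> [l hl]; exists l; apply: cdiff_sub. Qed.

Lemma cd_id w : cd id w. Proof. by exists 1; exact: cdiff_id. Qed.

Lemma cd_near f g w d : 0 < d -> (forall w', cabs (w' - w) < d -> f w' = g w') ->
  cd f w -> cd g w.
Proof. by move=> d0 h [l hl]; exists l; apply: cdiff_near d0 h hl. Qed.

Lemma cd_cper f r : 0 <= r -> (forall w, cabs w = r -> cd f w) ->
  cper (fun t => f (r%:C * cis t)).
Proof. by move=> r0 h; apply: ccont_circle_disk => // w /h /cd_ccts. Qed.

Lemma goursat_radii f r s : 0 < r < 1 -> 0 < s < 1 ->
  (forall w, 0 < cabs w < 1 -> cd f w) ->
  cint 0 (2 * pi) (fun t => f (r%:C * cis t)) = cint 0 (2 * pi) (fun t => f (s%:C * cis t)).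
Proof.
wlog rs : r s / r <= s.
  move=> h; have [/h h'|/ltW/h h'] := leP r s => hr hs hd; first exact: h'.
  by rewrite (h' hs hr hd).
move=> /andP[r0 r1] /andP[s0 s1] hd; move: rs; rewrite le_eqVlt => /predU1P[->//|rs].
symmetry; apply: (goursat_annulus r0 rs) => w /andP[w1 w2]; apply: hd.
by rewrite (lt_le_trans r0 w1) (le_lt_trans w2 s1).
Qed.

Section Disk.
Variable f : C -> C.
Hypothesis hd : forall w, cabs w < 1 -> cd f w.

Section Quotient.
Variable z : C.
Hypothesis z1 : cabs z < 1.
Variable l : C.
Hypothesis hl : cdiff f z l.

(** Difference quotient completed by continuity. Since dw = i w dt on a circle, the factor [w] makes
    the integral in t that of the quotient against dw / i. *)
Let q w := if w == z then z * l else (f w - f z) * (w * (w - z)^-1).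

Let q_cd w : cabs w < 1 -> w != z -> cd q w.
Proof.
move=> w1 wz; have d0 : 0 < cabs (w - z) by rewrite cabs_gt0 subr_eq0.
apply: (@cd_near (fun w => (f w - f z) * (w * (w - z)^-1)) _ _ _ d0).
  move=> w' hw'; rewrite /q; case: eqP => // e; move: hw'.
  by rewrite e cabs_distC ltxx.
apply: cdM; first exact: cd_sub (hd w1).
apply: cdM (cd_id _) _; apply: (@cdV (fun w => w - z)); first by rewrite subr_eq0.
exact: cd_sub (cd_id _).
Qed.

Let q_ccts w : cabs w < 1 -> ccts q w.
Proof.
move=> w1; have [->|wz] := eqVneq w z; last exact: cd_ccts (q_cd w1 wz).
move=> e e0; have e3 : 0 < e / 3 by apply: divr_gt0.
have [d d0 h] := hl e3.
have l0 : 0 < cabs l + 1 by have := cabs_ge0 l; lra.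
have el : 0 < e / 3 / (cabs l + 1) by apply: divr_gt0.
exists (Num.min (Num.min d 1) (e / 3 / (cabs l + 1))); first by rewrite !lt_min d0 el ltr01.
move=> w'; rewrite !lt_min => /andP[/andP[h1 h1'] h2]; rewrite /q eqxx.
case: eqP => [_|/eqP wz]; first by rewrite subrr cabs0.
have wz0 : w' - z != 0 by rewrite subr_eq0.
have -> : (f w' - f z) * (w' * (w' - z)^-1) - z * l =
  (f w' - f z - l * (w' - z)) * (w' - z)^-1 * w' + l * (w' - z) by field.
apply: le_lt_trans (cabsD _ _) _; rewrite !cabsM cabsV.
have c0 : 0 < cabs (w' - z) by rewrite cabs_gt0.
have q1 : cabs (f w' - f z - l * (w' - z)) / cabs (w' - z) <= e / 3.
  by rewrite ler_pdivrMr //; apply: h.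
have q2 : cabs w' <= 2.
  by have := z1; have := cabs_dist w' z; lra.
have q3 : cabs (f w' - f z - l * (w' - z)) / cabs (w' - z) * cabs w' <= e / 3 * 2.
  by apply: ler_pM q1 q2; rewrite ?cabs_ge0 // divr_ge0 ?cabs_ge0.
have q4 : cabs l * cabs (w' - z) < e / 3.
  have := cabs_ge0 (w' - z); rewrite ltr_pdivlMr // in h2; lra.
lra.
Qed.

Let I r := cint 0 (2 * pi) (fun t => q (r%:C * cis t)).

Let q_cper r : 0 <= r < 1 -> cper (fun t => q (r%:C * cis t)).
Proof.
move=> /andP[r0 r1]; apply: ccont_circle_disk => // w wr; apply: q_ccts.
by rewrite wr.
Qed.

Let I_const r s : 0 < r -> r < s -> s < 1 -> (forall w, r <= cabs w <= s -> w != z) ->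
  I s = I r.
Proof.
move=> r0 rs s1 h; apply: (goursat_annulus r0 rs) => w hw; apply: q_cd; last exact: h.
by case/andP: hw => _ /le_lt_trans; apply.
Qed.

Let q0 : q 0 = 0.
Proof. by rewrite /q; case: eqP => [<-|_]; rewrite !mul0r ?mulr0. Qed.

(** The circle shrinks to the origin, where [q] vanishes thanks to its factor [w]. *)
Let I_small r : 0 < r < 1 -> (forall w, 0 < cabs w <= r -> w != z) -> I r = 0.
Proof.
move=> /andP[r0 r1] h; apply/eqP; rewrite -cabs_eq0 eq_le cabs_ge0 andbT.
apply/ler_addgt0Pl => e e0; rewrite addr0; have t0 := twopi_gt0 R.
have et : 0 < e / (2 * pi) by apply: divr_gt0.
have z01 : cabs (0 : C) < 1 by rewrite cabs0.
have [d d0 hq] := q_ccts z01 et.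
pose s := Num.min d r / 2; have m0 : 0 < Num.min d r by rewrite lt_min d0.
have s0 : 0 < s by apply: divr_gt0.
have sd : s < d by have : Num.min d r <= d; [rewrite ge_min lexx|rewrite /s; lra].
have sr : s < r by have : Num.min d r <= r; [rewrite ge_min lexx orbT|rewrite /s; lra].
rewrite (I_const s0 sr r1); last first.
  by move=> w /andP[w1 w2]; apply: h; rewrite w2 (lt_le_trans s0 w1).
have -> : e = e / (2 * pi) * (2 * pi - 0) by rewrite subr0 mulfVK // gt_eqF.
apply: cabs_cint_bound; first exact: ltW.
  by apply: q_cper; rewrite (ltW s0) (lt_trans sr r1).
move=> t _; have := hq (s%:C * cis t); rewrite q0 !subr0 cabs_polar ?(ltW s0) //.
by move=> /(_ sd)/ltW.
Qed.

(** Goursat does not apply across the circle |w| = |z|, as [q] is only continuous at [z]. The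
    integral is constant on either side of that circle, zero inside, and continuous in the
    radius. *)
Lemma cauchy_quotient r : cabs z < r < 1 ->
  cint 0 (2 * pi) (fun t => q (r%:C * cis t)) = 0.
Proof.
move=> /andP[zr r1]; rewrite -/(I r).
have r0 : 0 < r by apply: le_lt_trans zr; exact: cabs_ge0.
have [z0|z0] := eqVneq z 0.
  by apply: I_small; rewrite ?r0 // => w /andP[w0 _]; rewrite z0 -cabs_gt0.
have rho0 : 0 < cabs z by rewrite cabs_gt0.
have neq w : cabs w != cabs z -> w != z by apply: contraNneq => ->.
have lim (x : R) : 0 < x < 1 -> x != cabs z -> I (cabs z) = I x.
  move=> /andP[x0 x1] xz.
  (* Radii starting at [x] and tending to |z| without reaching it, along which the integral keeps
     the value [I x]. *)
  pose s n := cabs z + (x - cabs z) * harmonic n.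
  have hs n : 0 < (harmonic n : R) <= 1.
    by rewrite /harmonic invr_gt0 ltr0n /= invf_le1 ?ltr0n // ler1n.
  have m0 : 0 < Num.min x (cabs z) by rewrite lt_min x0.
  have m1 : Num.max x (cabs z) < 1 by rewrite gt_max x1.
  have hmin : Num.min x (cabs z) < Num.max x (cabs z).
    by rewrite lt_max !gt_min !ltxx /= orbF -neq_lt eq_sym.
  have sb n : Num.min x (cabs z) <= s n <= Num.max x (cabs z).
    have /andP[h1 h2] := hs n; rewrite /s ge_min le_max.
    have [xz1|xz1] := leP x (cabs z); apply/andP; split; apply/orP; by [left; nra|right; nra].
  have sz n : s n != cabs z.
    rewrite /s -subr_eq0 addrC addKr mulf_neq0 ?subr_eq0 //.
    by have /andP[h1 _] := hs n; rewrite gt_eqF.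
  have sI n : I (s n) = I x.
    have /andP[h1 h2] := hs n.
    have [xz1|xz1] := ltP x (cabs z).
      have s1 : s n < cabs z by rewrite /s; nra.
      have s2 : x <= s n by rewrite /s; nra.
      move: s2; rewrite le_eqVlt => /predU1P[<-//|s2].
      apply: I_const => //; first exact: lt_trans z1.
      by move=> w /andP[_ w2]; apply: neq; rewrite lt_eqF // (le_lt_trans w2).
    have xz2 : cabs z < x by rewrite lt_def xz.
    have s1 : cabs z < s n by rewrite /s; nra.
    have s2 : s n <= x by rewrite /s; nra.
    move: s2; rewrite le_eqVlt => /predU1P[->//|s2].
    symmetry; apply: I_const => //; first exact: lt_trans s1.
    by move=> w /andP[w2 _]; apply: neq; rewrite gt_eqF // (lt_le_trans s1).
  have cs : s n @[n --> \oo] --> cabs z.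
    rewrite -[X in _ --> X]addr0 -[X in _ --> _ + X](mulr0 (x - cabs z)).
    by apply: cvgD; [exact: cvg_cst|apply: cvgMr; exact: cvg_harmonic].
  have zb : Num.min x (cabs z) <= cabs z <= Num.max x (cabs z).
    by rewrite ge_min le_max lexx !orbT.
  have cq w : Num.min x (cabs z) <= cabs w <= Num.max x (cabs z) -> ccts q w.
    by move=> /andP[_ h]; apply: q_ccts; apply: le_lt_trans m1.
  have cv := circle_integral_cvg m0 hmin cq sb zb cs.
  have cv2 : I (s n) @[n --> \oo] --> I x.
    by under eq_cvg do rewrite sI; exact: cvg_cst.
  exact: (cvg_unique (@norm_hausdorff _ _) cv cv2).
(* From inside: the circle of radius |z| / 2 does not enclose [z], so [I_small] applies. *)
have Iz : I (cabs z) = 0.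
  have hx : 0 < cabs z / 2 < 1 by have := z1; move=> ?; apply/andP; split; lra.
  have Ix : I (cabs z / 2) = 0.
    apply: I_small => // w /andP[_ w1]; apply: neq; lra.
  by rewrite (lim (cabs z / 2)) //; rewrite lt_eqF //; lra.
by rewrite -(lim r) ?r0 // gt_eqF.
Qed.

End Quotient.
End Disk.

(** The usual 1 / (w - z) multiplied by [w], because circle means are taken against dw / w. *)
Definition cauchy_kernel z w : C := w * (w - z)^-1.

Lemma cauchy_kernel_expand n z w : w != 0 -> w != z ->
  cauchy_kernel z w = \sum_(k < n) z ^+ k * (w ^+ k)^-1 +
    z ^+ n * (w ^+ n)^-1 * cauchy_kernel z w.
Proof.
move=> w0 wz; have wz0 : w - z != 0 by rewrite subr_eq0.
elim: n => [|n IH]; first by rewrite big_ord0 add0r !expr0 invr1 !mul1r.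
rewrite big_ord_recr /= {1}IH -addrA; congr (_ + _).
rewrite /cauchy_kernel !exprS; field.
by rewrite w0 wz0 expf_neq0.
Qed.

Lemma cd_invX n w : w != 0 -> cd (fun w => (w ^+ n)^-1) w.
Proof. by move=> w0; apply: (@cdV (fun w => w ^+ n)); [rewrite expf_neq0|exact: cdX]. Qed.

Lemma cd_kernel z w : w != z -> cd (cauchy_kernel z) w.
Proof.
move=> wz; apply: cdM (cd_id _) _; apply: (@cdV (fun w => w - z)); first by rewrite subr_eq0.
exact: cd_sub (cd_id _).
Qed.

Lemma cabs_kernel_le z w r : cabs z < r -> cabs w = r -> cabs (cauchy_kernel z w) <= r / (r - cabs z).
Proof.
move=> zr wr; rewrite cabsM wr cabsV ler_wpM2l //; first by rewrite -wr cabs_ge0.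
have h : r - cabs z <= cabs (w - z) by have := cabs_dist w z; rewrite wr; lra.
have p : 0 < r - cabs z by lra.
by rewrite lef_pV2 // posrE ?(lt_le_trans p).
Qed.

Section Formula.
Variable f : C -> C.
Hypothesis hd : forall w, cabs w < 1 -> cd f w.

(** Geometric expansion in z / w. It serves twice: with the constant function 1, to evaluate the
    mean of the kernel, and with [f], to get the Taylor expansion. *)
Lemma cmean_kernel z r n K : cabs z < r < 1 ->
  (forall t, 0 <= t <= 2 * pi -> cabs (f (r%:C * cis t)) <= K) ->
  cabs (cmean (fun t => f (r%:C * cis t) * cauchy_kernel z (r%:C * cis t)) -
    \sum_(k < n) cmean (fun t => f (r%:C * cis t) * ((r%:C * cis t) ^+ k)^-1) * z ^+ k)
  <= K * (r / (r - cabs z)) * (cabs z / r) ^+ n.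
Proof.
move=> /andP[zr r1] hK; have r0 : 0 < r by apply: le_lt_trans zr; exact: cabs_ge0.
have wne w : cabs w = r -> w != 0 /\ w != z.
  by move=> wr; rewrite -cabs_gt0 wr r0; split=> //; apply: contraTneq zr => <-; rewrite wr ltxx.
have cf w : cabs w = r -> cd f w by move=> wr; apply: hd; rewrite wr.
have ck k : cper (fun t => f (r%:C * cis t) * ((r%:C * cis t) ^+ k)^-1).
  apply: (@cd_cper (fun w => f w * (w ^+ k)^-1)); first exact: ltW.
  by move=> w wr; apply: cdM (cf w wr) (cd_invX _ _); have [] := wne w wr.
pose rem w := z ^+ n * (f w * (w ^+ n)^-1 * cauchy_kernel z w).
have crem : cper (fun t => rem (r%:C * cis t)).
  apply: cintgZ; apply: (@cd_cper (fun w => f w * (w ^+ n)^-1 * cauchy_kernel z w)); first exact: ltW.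
  by move=> w wr; have [w0 wz] := wne w wr; apply: cdM (cdM (cf w wr) (cd_invX _ w0)) (cd_kernel wz).
have [i1 _] := @cint_sum R 0 (2 * pi) n (fun k t => z ^+ k * (f (r%:C * cis t) * ((r%:C * cis t) ^+ k)^-1))
  (fun k _ => cintgZ (z ^+ k) (ck k)).
have -> : cmean (fun t => f (r%:C * cis t) * cauchy_kernel z (r%:C * cis t)) =
  cmean (fun t => \sum_(k < n) z ^+ k * (f (r%:C * cis t) * ((r%:C * cis t) ^+ k)^-1)) +
  cmean (fun t => rem (r%:C * cis t)).
  rewrite -cmeanD //; apply: eq_cmean => t _.
  have [w0 wz] := wne (r%:C * cis t) (cabs_polar _ (ltW r0)).
  rewrite {1}(cauchy_kernel_expand n w0 wz) mulrDr mulr_sumr; congr (_ + _).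
    by apply: eq_bigr => k _; ring.
  by rewrite /rem; ring.
rewrite (cmean_sum (fun k _ => cintgZ (z ^+ k) (ck k))).
rewrite (eq_bigr (fun k : 'I_n => cmean (fun t => f (r%:C * cis t) * ((r%:C * cis t) ^+ k)^-1) * z ^+ k)); last first.
  by move=> k _; rewrite cmeanZ // mulrC.
rewrite (addrC (\sum_(_ < n) _)) addrK; apply: cabs_cmean_bound => // t ht.
rewrite /rem; have h1 := hK t ht; have := cabs_kernel_le zr (cabs_polar t (ltW r0)).
generalize (cauchy_kernel z (r%:C * cis t)) => kk h2.
rewrite (cabsM (z ^+ n)) (cabsM _ kk) (cabsM (f _)) !cabsX cabsV cabsX cabs_polar ?(ltW r0) //.
have -> : K * (r / (r - cabs z)) * (cabs z / r) ^+ n =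
  cabs z ^+ n * (K * (r ^+ n)^-1 * (r / (r - cabs z))).
  by rewrite exprMn exprVn; ring.
apply: ler_wpM2l; first by rewrite exprn_ge0 ?cabs_ge0.
apply: (ler_pM _ _ _ h2); rewrite ?cabs_ge0 ?mulr_ge0 ?cabs_ge0 ?invr_ge0 ?exprn_ge0 ?(ltW r0) //.
by apply: ler_wpM2r h1; rewrite invr_ge0 exprn_ge0 // ltW.
Qed.

End Formula.

Lemma cmean_inv_pow r k : 0 < r ->
  cmean (fun t => ((r%:C * cis t) ^+ k)^-1) = (k == 0%N)%:R.
Proof.
move=> r0; rewrite (@eq_cmean _ _ (fun t => (r%:C ^+ k)^-1 * (cis t)^-1 ^+ k)); last first.
  by move=> t _; rewrite exprMn invfM exprVn.
rewrite cmeanZ; last exact: cper_cisVX.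
by rewrite cmean_cisVX; case: k => [|k]; rewrite ?mulr0 // expr0 invr1 mulr1.
Qed.

(** In the expansion of the kernel every term but the constant one has mean 0, and the remainder
    tends to 0 geometrically. *)
Lemma cmean_cauchy_kernel z r : cabs z < r < 1 ->
  cmean (fun t => cauchy_kernel z (r%:C * cis t)) = 1.
Proof.
move=> zr; have /andP[zr1 _] := zr.
have r0 : 0 < r by apply: le_lt_trans zr1; exact: cabs_ge0.
apply/eqP; rewrite -subr_eq0 -cabs_eq0 eq_le cabs_ge0 andbT.
have h1 (w : C) : cabs w < 1 -> cd (fun=> 1) w.
  move=> _; exists 0 => e e0; exists 1 => // w' _; rewrite subrr mul0r subr0 cabs0.
  by rewrite mulr_ge0 ?cabs_ge0 // ltW.
apply: (@le_geometric_eq0 _ _ (1 * (r / (r - cabs z)) * (cabs z / r)) (cabs z / r)).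
  by rewrite divr_ge0 ?cabs_ge0 ?(ltW r0) //= ltr_pdivrMr // mul1r.
move=> n; have h2 t : 0 <= t <= 2 * pi -> cabs ((fun=> 1 : C) (r%:C * cis t)) <= 1.
  by rewrite cabs1.
have := cmean_kernel h1 n.+1 zr h2.
rewrite big_ord_recl /= expr0 mulr1 big1 ?addr0; last first.
  move=> i _; rewrite (@eq_cmean _ _ (fun t => ((r%:C * cis t) ^+ (bump 0 i))^-1)).
    by rewrite cmean_inv_pow // mul0r.
  by move=> t _; rewrite mul1r.
have e0 : cmean (fun t => 1 * ((r%:C * cis t) ^+ 0)^-1) = 1.
  by rewrite -[RHS](cmean_cst 1); apply: eq_cmean => t _; rewrite expr0 invr1 mul1r.
have e1 : cmean (fun t => 1 * cauchy_kernel z (r%:C * cis t)) =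
   cmean (fun t => cauchy_kernel z (r%:C * cis t)).
  by apply: eq_cmean => t _; rewrite mul1r.
by rewrite e0 e1 exprS !mulrA.
Qed.

(* Expansions are quantified by a geometric remainder on each smaller disk; see
   [powserP] for the equivalence with pointwise convergence. *)
Definition powser a f := forall rho : R, 0 <= rho < 1 -> exists K q : R,
  [/\ 0 <= K, 0 <= q < 1 & forall n z, cabs z <= rho ->
     cabs (f z - \sum_(k < n) a k * z ^+ k) <= K * q ^+ n].

Section Expansion.
Variable f : C -> C.
Hypothesis hd : forall w, cabs w < 1 -> cd f w.

(** The kernel has mean 1; after subtracting [f z] times it, what remains is the mean of the
    quotient of [cauchy_quotient]. *)
Lemma cauchy_formula z r : cabs z < r < 1 ->
  cmean (fun t => f (r%:C * cis t) * cauchy_kernel z (r%:C * cis t)) = f z.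
Proof.
move=> zr; have /andP[zr1 r1] := zr.
have r0 : 0 < r by apply: le_lt_trans zr1; exact: cabs_ge0.
have wne w : cabs w = r -> w != z.
  by move=> wr; apply: contraTneq zr1 => <-; rewrite wr ltxx.
have [l hl] := hd (lt_trans zr1 r1).
have c1 : cper (fun t => f (r%:C * cis t) * cauchy_kernel z (r%:C * cis t)).
  apply: (@cd_cper (fun w => f w * cauchy_kernel z w)); first exact: ltW.
  by move=> w wr; apply: cdM (hd _) (cd_kernel (wne w wr)); rewrite wr.
have c2 : cper (fun t => f z * cauchy_kernel z (r%:C * cis t)).
  apply: cintgZ; apply: cd_cper; first exact: ltW.
  by move=> w wr; apply: cd_kernel; apply: wne.
apply/eqP; rewrite -subr_eq0 -[X in _ - X]mulr1 -(cmean_cauchy_kernel zr) -cmeanZ.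
  rewrite -cmeanB //.
  rewrite /cmean mulf_eq0; apply/orP; right; apply/eqP.
  rewrite -[RHS](cauchy_quotient hd (lt_trans zr1 r1) hl zr); apply: eq_cint => t _.
  by rewrite (negbTE (wne _ (cabs_polar t (ltW r0)))) -mulrBl.
apply: cd_cper; first exact: ltW.
by move=> w wr; apply: cd_kernel; apply: wne.
Qed.

Lemma holomorphic_powser : exists a, powser a f.
Proof.
(* The radius 1/2 is arbitrary: by Goursat for f(w) / w^k the coefficients do not depend on it,
   which is [ea] below. *)
pose a k := cmean (fun t => f ((1 / 2)%:C * cis t) * (((1 / 2)%:C * cis t) ^+ k)^-1).
exists a => rho /andP[rho0 rho1]; pose r := (1 + rho) / 2.
have r0 : 0 < r by rewrite /r; lra.
have r1 : r < 1 by rewrite /r; lra.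
have rr : rho < r by rewrite /r; lra.
have cw w : 0 <= cabs w <= r -> ccts f w.
  by move=> /andP[_ h]; apply/cd_ccts/hd/le_lt_trans/r1.
have [K hK] := polar_bounded (lexx 0) r0 cw.
have hK' t : 0 <= t <= 2 * pi -> cabs (f (r%:C * cis t)) <= K.
  by move=> ht; apply: hK => //; rewrite (ltW r0) lexx.
have K0 : 0 <= K.
  by apply: le_trans (hK' 0 _); rewrite ?cabs_ge0 // lexx ltW // twopi_gt0.
exists (K * (r / (r - rho))), (rho / r); split.
- by rewrite mulr_ge0 // divr_ge0 ?(ltW r0) //; lra.
- by rewrite divr_ge0 ?(ltW r0) //= ltr_pdivrMr // mul1r.
move=> n z zrho; have zr : cabs z < r by apply: le_lt_trans rr.
have zr1 : cabs z < r < 1 by rewrite zr r1.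
have d0 : 0 < r - rho by rewrite subr_gt0.
have d1 : 0 < r - cabs z by rewrite subr_gt0.
have d2 : (r - cabs z)^-1 <= (r - rho)^-1 by rewrite lef_pV2 ?posrE // lerD2l lerN2.
have h := cmean_kernel hd n zr1 hK'; rewrite cauchy_formula // in h.
have ea (k : nat) : cmean (fun t => f (r%:C * cis t) * ((r%:C * cis t) ^+ k)^-1) = a k.
  rewrite /a; clear -k r0 r1 hd.
  have hk w : 0 < cabs w < 1 -> cd (fun w => f w * (w ^+ k)^-1) w.
    move=> /andP[w0 w1]; apply: cdM (hd w1) (cd_invX _ _).
    by rewrite -cabs_gt0.
  have r01 : 0 < r < 1 by rewrite r0.
  have h01 : 0 < (1 / 2 : R) < 1 by lra.
  exact: (congr1 (fun x => ((2 * pi)^-1)%:C * x) (goursat_radii r01 h01 hk)).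
have eS : \sum_(k < n) a k * z ^+ k = \sum_(k < n)
    cmean (fun t => f (r%:C * cis t) * ((r%:C * cis t) ^+ k)^-1) * z ^+ k.
  by apply: eq_bigr => k _; rewrite ea.
rewrite eS; apply: (le_trans h); clear h eS ea; have z0 := cabs_ge0 z.
apply: ler_pM.
- by apply: mulr_ge0 => //; apply: divr_ge0; apply: ltW.
- by apply: exprn_ge0; apply: divr_ge0 => //; apply: ltW.
- by apply: ler_wpM2l => //; apply: ler_wpM2l => //; exact: ltW.
apply: lerXn2r; [by rewrite nnegrE; apply: divr_ge0 => //; apply: ltW..|].
by apply: ler_wpM2r => //; rewrite invr_ge0 ltW.
Qed.

End Expansion.

End PowerSeries.

#[local] Opaque cabs.

(** * Power series *)

Section Series.
Variable R : realType.
Local Notation C := R[i].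
Implicit Types (f g : C -> C) (z w l : C) (r t : R) (a b u v : nat -> C).

Definition ccvg u l := forall e : R, 0 < e -> exists N, forall n, (N <= n)%N -> cabs (u n - l) < e.

Lemma ccvg_uniq u l m : ccvg u l -> ccvg u m -> l = m.
Proof.
move=> h1 h2; apply/eqP; rewrite -subr_eq0 -cabs_eq0 eq_le cabs_ge0 andbT.
apply/ler_addgt0Pl => e e0; rewrite addr0; have e2 : 0 < e / 2 by apply: divr_gt0.
have [N1 k1] := h1 _ e2; have [N2 k2] := h2 _ e2.
have := k1 _ (leq_maxl N1 N2); have := k2 _ (leq_maxr N1 N2).
rewrite cabs_distC => j2 j1; apply: le_trans (cabs_dist3 _ _ (u (maxn N1 N2))) _.
by rewrite -(cabs_distC (u _)) (cabs_distC _ m) (splitr e) ltW // ltrD // cabs_distC.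
Qed.

Lemma ccvg_ext u v l : (forall n, u n = v n) -> ccvg u l -> ccvg v l.
Proof. by move=> h hu e /hu[N hN]; exists N => n /hN; rewrite h. Qed.

Lemma ccvg_cst l : ccvg (fun=> l) l.
Proof. by move=> e e0; exists 0%N => n _; rewrite subrr cabs0. Qed.

Lemma ccvgD u v l m : ccvg u l -> ccvg v m -> ccvg (fun n => u n + v n) (l + m).
Proof.
move=> h1 h2 e e0; have e2 : 0 < e / 2 by apply: divr_gt0.
have [N1 k1] := h1 _ e2; have [N2 k2] := h2 _ e2; exists (maxn N1 N2) => n.
rewrite geq_max => /andP[/k1 j1 /k2 j2].
rewrite (_ : _ - _ = (u n - l) + (v n - m)); last by ring.
by apply: le_lt_trans (cabsD _ _) _; rewrite (splitr e) ltrD.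
Qed.

Lemma ccvgZ u l k : ccvg u l -> ccvg (fun n => k * u n) (k * l).
Proof.
move=> h e e0; have k0 : 0 < cabs k + 1 by rewrite ltr_wpDl ?cabs_ge0.
have [N hN] := h _ (divr_gt0 e0 k0); exists N => n /hN.
rewrite ltr_pdivlMr // -mulrBr cabsM => j; apply: le_lt_trans j.
by rewrite mulrC ler_wpM2l ?cabs_ge0 // lerDl.
Qed.

Lemma ccvgB u v l m : ccvg u l -> ccvg v m -> ccvg (fun n => u n - v n) (l - m).
Proof.
move=> h1 h2; rewrite -[X in _ - X]mul1r -mulNr; apply: ccvg_ext (ccvgD h1 (ccvgZ (-1) h2)) => n.
by rewrite mulN1r.
Qed.

Lemma ccvgM u v l m : ccvg u l -> ccvg v m -> ccvg (fun n => u n * v n) (l * m).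
Proof.
move=> h1 h2 e e0; have c0 := cabs_ge0 l; have c1 := cabs_ge0 m.
have k0 : 0 < cabs l + cabs m + 1 by rewrite ltr_wpDl // addr_ge0.
have ek : 0 < Num.min 1 (e / (cabs l + cabs m + 1)) by rewrite lt_min ltr01 divr_gt0.
have [N1 k1] := h1 _ ek; have [N2 k2] := h2 _ ek; exists (maxn N1 N2) => n.
rewrite geq_max => /andP[/k1 j1 /k2 j2].
move: j1 j2; rewrite !lt_min => /andP[j1 j1'] /andP[j2 j2'].
rewrite (_ : _ - _ = (u n - l) * (v n - m) + (l * (v n - m) + m * (u n - l))); last by ring.
apply: le_lt_trans (cabsD _ _) _; apply: le_lt_trans (lerD (lexx _) (cabsD _ _)) _.
rewrite !cabsM; move: j1 j1' j2 j2'; rewrite !ltr_pdivlMr //.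
have := cabs_ge0 (u n - l); have := cabs_ge0 (v n - m); move: c0 c1.
move: (cabs l) (cabs m) (cabs (u n - l)) (cabs (v n - m)) => L M x y *; nra.
Qed.

Lemma ccvg_shift u l k : ccvg u l -> ccvg (fun n => u (n + k)%N) l.
Proof. by move=> h e /h[N hN]; exists N => n nN; apply: hN; rewrite (leq_trans nN) // leq_addr. Qed.

Lemma ccvg_unshift u l k : ccvg (fun n => u (n + k)%N) l -> ccvg u l.
Proof.
move=> h e /h[N hN]; exists (N + k)%N => n nN.
by rewrite -(@subnK k n) ?(leq_trans (leq_addl N k)) //; apply: hN; rewrite leq_subRL ?(leq_trans (leq_addl N k)) // addnC.
Qed.

Lemma ccvg_geometric u l (K q : R) : 0 <= q < 1 -> (forall n, cabs (u n - l) <= K * q ^+ n) ->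
  ccvg u l.
Proof.
move=> q01 h e e0; have [N hN] := exists_geometric_lt `|K| q01 e0; exists N => n nN.
apply: le_lt_trans (h n) _; apply: le_lt_trans hN.
case/andP: q01 => q0 /ltW q1.
apply: (@le_trans _ _ (`|K| * q ^+ n)); first by rewrite ler_wpM2r ?exprn_ge0 ?ler_norm.
by rewrite ler_wpM2l // ler_wiXn2l.
Qed.

Lemma ccvg_le u l z K : (forall n, cabs (u n - z) <= K) -> ccvg u l -> cabs (l - z) <= K.
Proof.
move=> h hu; apply/ler_addgt0Pl => e /hu[N /(_ N (leqnn N)) hN].
apply: le_trans (cabs_dist3 _ _ (u N)) _; rewrite cabs_distC; apply: lerD (h N).
exact: ltW.
Qed.

Lemma ccvg_cauchy u :
  (forall e : R, 0 < e -> exists N, forall n, (N <= n)%N -> cabs (u n - u N) < e) ->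
  exists l, ccvg u l.
Proof.
move=> h.
have key (s : nat -> R) : (forall n m, `|s n - s m| <= cabs (u n - u m)) ->
    exists l : R, s n @[n --> \oo] --> l.
  move=> hs; suff: cvgn s by move=> cs; exists (limn s).
  apply/cauchy_cvgP/cauchy_exP => e e0; have [N hN] := h e e0.
  exists (s N); exists N => // n /= nN; rewrite /ball /= distrC.
  by apply: le_lt_trans (hN n nN); apply: hs.
have [|l hl] := key (fun n => Re (u n)).
  by move=> n m; rewrite -ReB; apply: normr_Re_le.
have [|m hm] := key (fun n => Im (u n)).
  by move=> n k; rewrite -ImB; apply: normr_Im_le.
exists (l +i* m) => e e0; have e2 : 0 < e / 2 by apply: divr_gt0.
move/cvgrPdist_lt: hl => /(_ _ e2)[N1 _ k1]; move/cvgrPdist_lt: hm => /(_ _ e2)[N2 _ k2].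
exists (maxn N1 N2) => n; rewrite geq_max => /andP[n1 n2].
have j1 := k1 n n1; have j2 := k2 n n2; rewrite /= in j1 j2.
rewrite cabs_distC; apply: le_lt_trans (cabs_le_ReIm _) _.
by rewrite ReB ImB /= (splitr e) ltrD.
Qed.

(** Cauchy's criterion for a radius of convergence at least 1. *)
Definition pb a := forall r, 0 <= r < 1 -> exists K, forall k, cabs (a k) * r ^+ k <= K.

Definition psum a n z : C := \sum_(k < n) a k * z ^+ k.

Lemma psumS a n z : psum a n.+1 z = psum a n z + a n * z ^+ n.
Proof. by rewrite /psum big_ord_recr. Qed.

Lemma psum0 a z : psum a 0 z = 0. Proof. by rewrite /psum big_ord0. Qed.

Lemma psumSl a n z : psum a n.+1 z = a 0%N + z * psum (fun k => a k.+1) n z.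
Proof.
rewrite /psum big_ord_recl /= expr0 mulr1 mulr_sumr; congr (_ + _).
by apply: eq_bigr => k _; rewrite /bump /= add1n exprS; ring.
Qed.

(** Compare with the bound at the larger radius s = (1 + r) / 2. The ratio is taken halfway between
    r / s and 1, which keeps it positive even for r = 0. *)
Lemma pb_geometric a r : pb a -> 0 <= r < 1 -> exists K q, [/\ 0 <= K, 0 < q < 1 &
  forall k, cabs (a k) * r ^+ k <= K * q ^+ k].
Proof.
move=> h /andP[r0 r1]; pose s := (1 + r) / 2.
have s0 : 0 < s by rewrite /s; lra.
have s1 : s < 1 by rewrite /s; lra.
have rs : r < s by rewrite /s; lra.
have hs : 0 <= s < 1 by rewrite (ltW s0) s1.
have [K hK] := h s hs.
have sp k : 0 < s ^+ k by rewrite exprn_gt0.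
have K0 : 0 <= K by apply: le_trans (hK 0%N); rewrite expr0 mulr1 cabs_ge0.
pose q := (r / s + 1) / 2; have rs1 : r / s < 1 by rewrite ltr_pdivrMr // mul1r.
have rs0 : 0 <= r / s by rewrite divr_ge0 // ltW.
exists K, q; split => //; first by rewrite /q; apply/andP; split; lra.
move=> k; have q0 : 0 <= q by rewrite /q; lra.
rewrite (_ : cabs (a k) * r ^+ k = cabs (a k) * s ^+ k * (r / s) ^+ k); last first.
  by rewrite -mulrA -exprMn mulrCA mulfV ?gt_eqF // mulr1.
apply: ler_pM (hK k) _; first by rewrite mulr_ge0 ?cabs_ge0 // ltW.
  by rewrite exprn_ge0.
by apply: lerXn2r; rewrite ?nnegrE // /q; lra.
Qed.

Lemma sum_geometric (q : R) n m : 0 <= q < 1 -> (n <= m)%N ->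
  \sum_(n <= k < m) q ^+ k <= q ^+ n / (1 - q).
Proof.
move=> /andP[q0 q1] nm; have d0 : 0 < 1 - q by rewrite subr_gt0.
rewrite ler_pdivlMr //.
have -> : (\sum_(n <= k < m) q ^+ k) * (1 - q) = q ^+ n - q ^+ m.
  elim: m nm => [|m IH]; first by rewrite leqn0 => /eqP ->; rewrite big_geq // mul0r subrr.
  rewrite leq_eqVlt => /predU1P[<-|]; first by rewrite big_geq // mul0r subrr.
  by rewrite ltnS => nm; rewrite big_nat_recr //= mulrDl IH // exprS; ring.
by rewrite lerBlDr lerDl exprn_ge0.
Qed.

Lemma psum_tail a z (K q : R) n m : 0 <= q < 1 -> 0 <= K ->
  (forall k, cabs (a k) * cabs z ^+ k <= K * q ^+ k) -> (n <= m)%N ->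
  cabs (psum a m z - psum a n z) <= K / (1 - q) * q ^+ n.
Proof.
move=> q01 K0 h nm; have -> : psum a m z - psum a n z = \sum_(n <= k < m) a k * z ^+ k.
  rewrite /psum -!(big_mkord xpredT (fun k => a k * z ^+ k)).
  by rewrite (@big_cat_nat _ _ _ n 0 m) //= [X in X - _]addrC addrK.
apply: le_trans (cabs_sum _ _ _) _.
rewrite -mulrA (mulrC _^-1); apply: le_trans (ler_wpM2l K0 (sum_geometric q01 nm)).
by rewrite mulr_sumr; apply: ler_sum => k _; rewrite cabsM cabsX.
Qed.

Lemma pb_le a r s : 0 <= r <= s -> (exists K, forall k, cabs (a k) * s ^+ k <= K) ->
  exists K, forall k, cabs (a k) * r ^+ k <= K.
Proof.
move=> /andP[r0 rs] [K hK]; exists K => k; apply: le_trans (hK k).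
by rewrite ler_wpM2l ?cabs_ge0 // lerXn2r // nnegrE // (le_trans r0).
Qed.

Lemma powser_pb a f : powser a f -> pb a.
Proof.
move=> h r hr; have [K [q [K0 /andP[q0 q1] hK]]] := h r hr; exists (2 * K) => k.
have r0 : 0 <= r by case/andP: hr.
have cr : cabs (r%:C : C) = r by rewrite cabs_real ger0_norm.
have -> : cabs (a k) * r ^+ k = cabs (psum a k.+1 r%:C - psum a k r%:C).
  by rewrite psumS addrC addKr cabsM cabsX cr.
have h1 := hK k r%:C; have h2 := hK k.+1 r%:C; rewrite cr lexx in h1 h2.
have := h1 isT; have := h2 isT; rewrite -/(psum _ _ _) -/(psum _ _ _) => j2 j1.
have le1 n : K * q ^+ n <= K by rewrite -[leRHS]mulr1 ler_wpM2l // exprn_ile1 // ltW.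
apply: le_trans (cabs_dist3 _ _ (f r%:C)) _; rewrite mulr_natl mulr2n.
by apply: lerD; [rewrite cabs_distC; apply: le_trans j2 _|apply: le_trans j1 _]; apply: le1.
Qed.

Lemma powser_cvg a f z : powser a f -> cabs z < 1 -> ccvg (fun n => psum a n z) (f z).
Proof.
move=> h z1; have [K [q [K0 q01 hK]]] := h (cabs z) ltac:(by rewrite cabs_ge0).
by apply: (ccvg_geometric (K := K) q01) => n; rewrite cabs_distC; apply: hK.
Qed.

Lemma powserP a f : powser a f <->
  pb a /\ forall z, cabs z < 1 -> ccvg (fun n => psum a n z) (f z).
Proof.
split=> [h|[ha hf] r hr]; first by split; [exact: powser_pb h|move=> z; exact: powser_cvg].
have [K [q [K0 q01 hK]]] := pb_geometric ha hr; case/andP: hr => r0 r1.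
have q01' : 0 <= q < 1 by case/andP: q01 => /ltW -> ->.
have q1 : 0 < 1 - q by case/andP: q01 => _; rewrite subr_gt0.
exists (K / (1 - q)), q; split => //; first by rewrite divr_ge0 // ltW.
move=> n z zr; have hz k : cabs (a k) * cabs z ^+ k <= K * q ^+ k.
  apply: le_trans (hK k); rewrite ler_wpM2l ?cabs_ge0 //.
  by rewrite lerXn2r // nnegrE ?cabs_ge0.
rewrite -/(psum a n z).
have cz := ccvg_shift n (hf z (le_lt_trans zr r1)).
by apply: ccvg_le cz => m /=; apply: (psum_tail q01' K0 hz); rewrite leq_addl.
Qed.

Lemma powser_exists a : pb a -> exists f, powser a f.
Proof.
move=> ha; have H z : exists l, cabs z < 1 -> ccvg (fun n => psum a n z) l.
  (* Outside the disk the value is irrelevant and set to 0. *)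
  have [z1|z1] := ltP (cabs z) 1; last by exists 0.
  have hz : 0 <= cabs z < 1 by rewrite cabs_ge0.
  have [K [q [K0 q01 hK]]] := pb_geometric ha hz.
  have q01' : 0 <= q < 1 by case/andP: q01 => /ltW -> ->.
  have [|l hl] := @ccvg_cauchy (fun n => psum a n z); last by exists l.
  move=> e e0; have [N hN] := exists_geometric_lt (K / (1 - q)) q01' e0.
  by exists N => n nN; apply: le_lt_trans hN; apply: psum_tail.
have [f hf] := choice H; exists f; apply/powserP; split=> // z; exact: hf.
Qed.

Lemma powser_eq a f g z : powser a f -> powser a g -> cabs z < 1 -> f z = g z.
Proof. by move=> h1 h2 z1; apply: ccvg_uniq (powser_cvg h1 z1) (powser_cvg h2 z1). Qed.

Lemma powser_ext a f g : (forall z, cabs z < 1 -> f z = g z) -> powser a f -> powser a g.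
Proof. by move=> h /powserP[h1 h2]; apply/powserP; split=> // z z1; rewrite -h //; apply: h2. Qed.

Lemma powser_extl a b f : (forall k, a k = b k) -> powser a f -> powser b f.
Proof. by move=> /funext ->. Qed.

(* Bernoulli: (1 + x)^k >= 1 + k x, applied to 1/p = 1 + x. *)
Lemma mul_geometric_bounded (p : R) : 0 <= p < 1 -> exists M, 0 <= M /\ forall k, k%:R * p ^+ k <= M.
Proof.
move=> /andP[p0 p1]; move: p0; rewrite le_eqVlt => /predU1P[<-|p0].
  by exists 0; split=> // -[|k]; rewrite ?mul0r // exprS mul0r mulr0.
pose x := p^-1 - 1; have x0 : 0 < x by rewrite subr_gt0 invf_gt1.
exists x^-1; split; first by rewrite invr_ge0 ltW.
move=> k; have h : 1 + k%:R * x <= (p^-1) ^+ k.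
  elim: k => [|k IH]; first by rewrite mul0r addr0 expr0.
  have e : p^-1 = 1 + x by rewrite /x addrC subrK.
  rewrite exprS e; rewrite e in IH.
  have x1 : 0 <= 1 + x by lra.
  apply: le_trans (ler_wpM2l x1 IH); rewrite -natr1.
  have : 0 <= (k%:R : R) by []; have := ltW x0.
  by move: (k%:R : R) x {IH x1 e x0} => y x ? ?; nra.
rewrite exprVn in h; have pk : 0 < p ^+ k by rewrite exprn_gt0.
rewrite -(ler_pM2r x0) mulVf ?gt_eqF // mulrAC -ler_pdivlMr // mul1r.
by apply: le_trans h; rewrite lerDr.
Qed.

End Series.

(** * Operations on power series: derivative, shifts, product, primitive *)

Section Algebra.
Variable R : realType.
Local Notation C := R[i].
Implicit Types (f g : C -> C) (z w l : C) (r t : R) (a b c u v : nat -> C).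

(** A linear factor is absorbed by raising the ratio of the geometric sequence. *)
Lemma mulS_geometric (q : R) : 0 <= q < 1 -> exists M s, [/\ 0 <= M, 0 < s < 1, q <= s &
  forall k, k.+1%:R * q ^+ k <= M * s ^+ k].
Proof.
move=> /andP[q0 q1]; pose s := (1 + q) / 2.
have s0 : 0 < s by rewrite /s; lra.
have s1 : s < 1 by rewrite /s; lra.
have qs : q < s by rewrite /s; lra.
have hp : 0 <= q / s < 1 by rewrite divr_ge0 // ?ltW //= ltr_pdivrMr // mul1r.
have [M [M0 hM]] := mul_geometric_bounded hp; case/andP: hp => p0 p1.
exists (M + 1), s; split; rewrite ?addr_ge0 ?s0 ?s1 ?(ltW qs) // => k.
have -> : q ^+ k = (q / s) ^+ k * s ^+ k by rewrite -exprMn divfK // gt_eqF.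
rewrite mulrA ler_wpM2r ?exprn_ge0 ?(ltW s0) // -natr1 mulrDl mul1r lerD //.
by rewrite exprn_ile1 // ltW.
Qed.

Lemma powserD a b f g : powser a f -> powser b g ->
  powser (fun k => a k + b k) (fun z => f z + g z).
Proof.
move=> /powserP[pa ha] /powserP[pb' hb]; apply/powserP; split.
  move=> r hr; have [K hK] := pa r hr; have [L hL] := pb' r hr; exists (K + L) => k.
  apply: le_trans (lerD (hK k) (hL k)); rewrite -mulrDl ler_wpM2r ?cabsD //.
  by rewrite exprn_ge0 //; case/andP: hr.
move=> z z1; apply: ccvg_ext (ccvgD (ha z z1) (hb z z1)) => n.
by rewrite /psum -big_split /=; apply: eq_bigr => k _; rewrite mulrDl.
Qed.

Lemma powserZ a f (k : C) : powser a f -> powser (fun n => k * a n) (fun z => k * f z).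
Proof.
move=> /powserP[pa ha]; apply/powserP; split.
  move=> r hr; have [K hK] := pa r hr; exists (cabs k * K) => n.
  by rewrite cabsM -mulrA ler_wpM2l ?cabs_ge0.
move=> z z1; apply: ccvg_ext (ccvgZ k (ha z z1)) => n.
by rewrite /psum mulr_sumr; apply: eq_bigr => j _; rewrite mulrA.
Qed.

Definition shiftr_coef a n := if n is m.+1 then a m else 0 : C.

Lemma powser_shift a f : powser a f -> powser (shiftr_coef a) (Defs.shift f).
Proof.
move=> /powserP[pa ha]; apply/powserP; split.
  move=> r hr; have [K hK] := pa r hr; exists (Num.max K 0) => -[|k] /=.
    by rewrite cabs0 mul0r le_max lexx orbT.
  rewrite le_max; apply/orP; left; apply: le_trans (hK k).
  case/andP: hr => r0 /ltW r1; rewrite exprS ler_wpM2l ?cabs_ge0 //.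
  by rewrite ler_piMl // exprn_ge0.
move=> z z1; apply: (@ccvg_unshift _ _ _ 1); apply: ccvg_ext (ccvgZ z (ha z z1)) => n.
by rewrite addn1 psumSl /= add0r.
Qed.

Lemma powser_at0 a f : powser a f -> f 0 = a 0%N.
Proof.
move=> h; have z1 : cabs (0 : C) < 1 by rewrite cabs0.
apply: (ccvg_uniq (powser_cvg h z1)); apply: (@ccvg_unshift _ _ _ 1).
by apply: ccvg_ext (ccvg_cst (a 0%N)) => n; rewrite addn1 psumSl mul0r addr0.
Qed.

Definition deriv_coef a n : C := n.+1%:R * a n.+1.

Lemma pb_deriv a : pb a -> pb (deriv_coef a).
Proof.
move=> ha r hr; pose s := (1 + r) / 2; case/andP: (hr) => r0 r1.
have s0 : 0 < s by rewrite /s; lra.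
have hs : 0 <= s < 1 by rewrite (ltW s0) /s; lra.
apply: (@pb_le _ _ r s); first by rewrite r0 /s; lra.
have [K [q [K0 q01 hK]]] := pb_geometric ha hs.
have hq : 0 <= q < 1 by case/andP: q01 => /ltW -> ->.
have [M [M0 hM]] := mul_geometric_bounded hq.
exists (K * M / s) => k; rewrite ler_pdivlMr // -mulrA -exprSr /deriv_coef cabsM cabs_nat -mulrA.
apply: le_trans (ler_wpM2l _ (hK k.+1)) _ => //.
by rewrite mulrCA ler_wpM2l.
Qed.

(** The factor r^2 on the left avoids the exponent k - 2. By induction, the new remainder is [w]
    times the previous one plus k z^(k - 1) (w - z)^2. *)
Lemma expr_taylor2 (k : nat) (z w : C) (r : R) : 0 < r -> cabs z <= r -> cabs w <= r ->
  r ^+ 2 * cabs (w ^+ k - z ^+ k - k%:R * z ^+ k.-1 * (w - z)) <=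
  k%:R ^+ 2 * r ^+ k * cabs (w - z) ^+ 2.
Proof.
move=> r0 zr wr; elim: k => [|k IH].
  by rewrite !expr0 subrr !mul0r subr0 cabs0 mulr0 expr0n !mul0r.
have e : w ^+ k.+1 - z ^+ k.+1 - k.+1%:R * z ^+ k * (w - z) =
  w * (w ^+ k - z ^+ k - k%:R * z ^+ k.-1 * (w - z)) + k%:R * z ^+ k.-1 * (w - z) ^+ 2.
  by case: k {IH} => [|k]; rewrite ?expr0 ?expr1 -?natr1 /= ?exprS; ring.
rewrite /= e; apply: le_trans (ler_wpM2l _ (cabsD _ _)) _; first by rewrite exprn_ge0 // ltW.
have D0 : 0 <= cabs (w - z) ^+ 2 by rewrite exprn_ge0 ?cabs_ge0.
rewrite mulrDr cabsM cabsM cabsM cabsX cabs_nat (cabsX (w - z)).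
have h1 : r ^+ 2 * (cabs w * cabs (w ^+ k - z ^+ k - k%:R * z ^+ k.-1 * (w - z))) <=
  k%:R ^+ 2 * r ^+ k.+1 * cabs (w - z) ^+ 2.
  rewrite mulrCA; apply: le_trans (ler_wpM2l (cabs_ge0 _) IH) _.
  rewrite (_ : k%:R ^+ 2 * r ^+ k.+1 * cabs (w - z) ^+ 2 =
    r * (k%:R ^+ 2 * r ^+ k * cabs (w - z) ^+ 2)); last by rewrite (exprS r k); ring.
  by apply: ler_wpM2r => //; apply: mulr_ge0 => //; apply: mulr_ge0; apply: exprn_ge0 => //; exact: ltW.
have h2 : r ^+ 2 * (k%:R * cabs z ^+ k.-1 * cabs (w - z) ^+ 2) <=
  k%:R * r ^+ k.+1 * cabs (w - z) ^+ 2.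
  case: k {IH e h1} => [|k] /=; first by rewrite !mul0r mulr0.
  rewrite mulrA ler_wpM2r // mulrCA ler_wpM2l //.
  rewrite -(addn2 k) exprD mulrC ler_wpM2r ?exprn_ge0 ?(ltW r0) //.
  by rewrite lerXn2r // nnegrE ?cabs_ge0 // ltW.
apply: le_trans (lerD h1 h2) _; rewrite -mulrDl -mulrDl ler_wpM2r //.
rewrite ler_wpM2r ?exprn_ge0 ?(ltW r0) // -natr1.
by have : 0 <= (k%:R : R) by []; move: (k%:R : R) => y y0; nra.
Qed.

(** Termwise differentiation. The second-order remainders of the monomials add up to [B] |w - z|^2;
    their factor k^2 is absorbed by raising the geometric ratio twice, from [q] to [s] to [t]. *)
Lemma powser_cdiff a f g z : powser a f -> powser (deriv_coef a) g -> cabs z < 1 ->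
  cdiff f z (g z).
Proof.
move=> ha hg z1; pose r := (1 + cabs z) / 2; have z0 := cabs_ge0 z.
have r0 : 0 < r by rewrite /r; lra.
have r1 : r < 1 by rewrite /r; lra.
have zr : cabs z < r by rewrite /r; lra.
have hr : 0 <= r < 1 by rewrite (ltW r0).
have [K [q [K0 q01 hK]]] := pb_geometric (powser_pb ha) hr.
have hq : 0 <= q < 1 by case/andP: q01 => /ltW -> ->.
have [M [s [M0 s01 qs hM]]] := mulS_geometric hq.
have hs : 0 <= s < 1 by case/andP: s01 => /ltW -> ->.
have [M' [t [M'0 t01 _ hM']]] := mulS_geometric hs.
have ht : 0 <= t < 1 by case/andP: t01 => /ltW -> ->.
have t1 : 0 < 1 - t by case/andP: t01 => _; rewrite subr_gt0.
pose B := K * (M * M') / (1 - t) / r ^+ 2.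
have r20 : 0 < r ^+ 2 by rewrite exprn_gt0.
have B0 : 0 <= B by rewrite /B; pos.
have quad w : cabs w <= r -> cabs (f w - f z - g z * (w - z)) <= B * cabs (w - z) ^+ 2.
  move=> wr; have w1 : cabs w < 1 by apply: le_lt_trans r1.
  have c1 := ccvg_shift 1 (powser_cvg ha w1).
  have c2 := ccvg_shift 1 (powser_cvg ha z1).
  have c3 := ccvgZ (w - z) (powser_cvg hg z1).
  have cv := ccvgB (ccvgB c1 c2) c3.
  rewrite -[X in cabs X]subr0 [g z * _]mulrC.
  apply: ccvg_le cv => n; rewrite subr0 addn1.
  have -> : psum a n.+1 w - psum a n.+1 z - (w - z) * psum (deriv_coef a) n z =
     \sum_(k < n.+1) a k * (w ^+ k - z ^+ k - k%:R * z ^+ k.-1 * (w - z)).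
    have -> : (w - z) * psum (deriv_coef a) n z =
       \sum_(k < n.+1) a k * (k%:R * z ^+ k.-1 * (w - z)).
      rewrite big_ord_recl /= !mul0r mulr0 add0r /psum mulr_sumr; apply: eq_bigr => k _.
      by rewrite /bump /= add1n /deriv_coef; ring.
    by rewrite /psum -!sumrB; apply: eq_bigr => k _; ring.
  apply: le_trans (cabs_sum _ _ _) _.
  have D0 : 0 <= cabs (w - z) ^+ 2 by rewrite exprn_ge0 ?cabs_ge0.
  apply: (@le_trans _ _ (\sum_(k < n.+1) K * (M * M') * t ^+ k / r ^+ 2 * cabs (w - z) ^+ 2)).
    apply: ler_sum => k _; rewrite cabsM -(ler_pM2l r20) mulrCA.
    apply: le_trans (ler_wpM2l (cabs_ge0 _) (expr_taylor2 k r0 (ltW zr) wr)) _.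
    rewrite (_ : r ^+ 2 * _ = K * (M * M') * t ^+ k * cabs (w - z) ^+ 2); last first.
      by field; rewrite gt_eqF.
    rewrite (_ : cabs (a k) * _ = k%:R ^+ 2 * (cabs (a k) * r ^+ k) * cabs (w - z) ^+ 2); last by ring.
    rewrite ler_wpM2r //.
    have k0 : 0 <= (k%:R : R) by [].
    have kS : k%:R <= (k.+1%:R : R) by rewrite ler_nat.
    apply: le_trans (ler_wpM2l _ (hK k)) _; first by rewrite exprn_ge0.
    have j1 : k%:R * q ^+ k <= M * s ^+ k.
      by apply: le_trans (hM k); rewrite ler_wpM2r // exprn_ge0; case/andP: hq.
    have j2 : k%:R * s ^+ k <= M' * t ^+ k.
      by apply: le_trans (hM' k); rewrite ler_wpM2r // exprn_ge0; case/andP: hs.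
    rewrite (_ : k%:R ^+ 2 * _ = K * (k%:R * (k%:R * q ^+ k))); last by ring.
    rewrite -mulrA ler_wpM2l //; apply: le_trans (ler_wpM2l k0 j1) _.
    by rewrite mulrCA -mulrA ler_wpM2l.
  rewrite -mulr_suml ler_wpM2r // /B -mulr_suml ler_wpM2r ?invr_ge0 ?(ltW r20) //.
  rewrite -mulr_sumr ler_wpM2l ?mulr_ge0 //.
  rewrite -(big_mkord xpredT (fun k => t ^+ k)).
  by apply: le_trans (sum_geometric ht (leq0n n.+1)) _; rewrite expr0 mul1r.
move=> e e0; have rz0 : 0 < r - cabs z by rewrite subr_gt0.
have B1 : 0 < B + 1 by rewrite ltr_wpDl.
exists (Num.min (r - cabs z) (e / (B + 1))); first by rewrite lt_min rz0 divr_gt0.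
move=> w; rewrite lt_min => /andP[w1 w2]; have wr : cabs w <= r.
  by apply: le_trans (cabs_dist w z) _; rewrite addrC -lerBrDr ltW.
apply: le_trans (quad w wr) _; rewrite expr2 mulrA ler_wpM2r ?cabs_ge0 //.
rewrite ltr_pdivlMr // in w2; apply: le_trans (ltW w2).
by rewrite mulrC ler_wpM2l ?cabs_ge0 // lerDl.
Qed.

Lemma powser_derive1 a f : powser a f -> powser (deriv_coef a) (derive1 f).
Proof.
move=> ha; have [g hg] := powser_exists (pb_deriv (powser_pb ha)).
apply: (powser_ext _ hg) => z z1; apply/esym/cdiff_derive1.
exact: powser_cdiff ha hg z1.
Qed.

Lemma powser_holomorphic a f : powser a f -> holomorphic_on_disk f.
Proof.
move=> ha z /diskE z1; apply: cdiff_derivable.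
exact: powser_cdiff ha (powser_derive1 ha) z1.
Qed.

Lemma holomorphic_has_powser f : holomorphic_on_disk f -> exists a, powser a f.
Proof.
move=> hf; apply: holomorphic_powser => w w1; exists (derive1 f w).
by apply: derivable_cdiff; apply: hf; apply/diskE.
Qed.

Lemma powser_ccts a f z : powser a f -> cabs z < 1 -> ccts f z.
Proof. by move=> ha z1; apply: cdiff_ccts (powser_cdiff ha (powser_derive1 ha) z1). Qed.

Lemma powser_backward a f : powser a f -> powser (fun k => a k.+1) (backward_shift f).
Proof.
move=> ha; have pa : pb (fun k => a k.+1).
  move=> r hr; case/andP: (hr) => r0 r1; pose s := (1 + r) / 2.
  have s0 : 0 < s by rewrite /s; lra.
  have hs : 0 <= s < 1 by rewrite (ltW s0) /s; lra.
  apply: (@pb_le _ _ r s); first by rewrite r0 /s; lra.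
  have [K hK] := powser_pb ha hs; exists (K / s) => k.
  by rewrite ler_pdivlMr // -mulrA -exprSr.
have [g hg] := powser_exists pa; apply: (powser_ext _ hg) => z z1; rewrite /backward_shift.
case: eqP => [->|/eqP z0].
  rewrite (powser_at0 hg) (powser_at0 (powser_derive1 ha)) /deriv_coef.
  by rewrite mulr1n mul1r.
have e : f z = a 0%N + z * g z.
  apply: (ccvg_uniq (powser_cvg ha z1)); apply: (@ccvg_unshift _ _ _ 1).
  apply: ccvg_ext (ccvgD (ccvg_cst (a 0%N)) (ccvgZ z (powser_cvg hg z1))) => n.
  by rewrite addn1 psumSl.
by rewrite e (powser_at0 ha) addrC addKr mulrC mulKf.
Qed.

Definition conv a b n : C := \sum_(j < n.+1) a j * b (n - j)%N.

Lemma conv_bound a b (r q K L : R) n : 0 <= r -> 0 <= q -> 0 <= K -> 0 <= L ->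
  (forall k, cabs (a k) * r ^+ k <= K * q ^+ k) ->
  (forall k, cabs (b k) * r ^+ k <= L * q ^+ k) ->
  cabs (conv a b n) * r ^+ n <= K * L * (n.+1%:R * q ^+ n).
Proof.
move=> r0 q0 K0 L0 ha hb.
apply: le_trans (ler_wpM2r (exprn_ge0 _ r0) (cabs_sum _ _ _)) _.
rewrite mulr_suml; apply: (@le_trans _ _ (\sum_(j < n.+1) K * L * q ^+ n)).
  apply: ler_sum => j _; have jn : (j <= n)%N by rewrite -ltnS.
  have -> : r ^+ n = r ^+ j * r ^+ (n - j) by rewrite -exprD subnKC.
  rewrite cabsM mulrACA.
  apply: le_trans (ler_pM _ _ (ha j) (hb (n - j)%N)) _; rewrite ?mulr_ge0 ?cabs_ge0 ?exprn_ge0 //.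
  by rewrite mulrACA -exprD subnKC.
by rewrite sumr_const card_ord -[leLHS]mulr_natl mulrCA lexx.
Qed.

Lemma pb_conv a b : pb a -> pb b -> pb (conv a b).
Proof.
move=> ha hb r hr; have r0 : 0 <= r by case/andP: hr.
have [K [q [K0 q01 hK]]] := pb_geometric ha hr.
have [L [p [L0 p01 hL]]] := pb_geometric hb hr.
pose s := Num.max q p; case/andP: q01 => q0 q1; case/andP: p01 => p0 p1.
have hs : 0 <= s < 1 by rewrite le_max (ltW q0) gt_max q1.
have [M [t [M0 t01 _ hM]]] := mulS_geometric hs; have s0 : 0 <= s by case/andP: hs.
exists (K * L * M) => n; apply: le_trans (@conv_bound a b r s K L n r0 s0 K0 L0 _ _) _.
- move=> k; apply: le_trans (hK k) _; rewrite ler_wpM2l // lerXn2r ?nnegrE // ?(ltW q0) //.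
  by rewrite le_max lexx.
- move=> k; apply: le_trans (hL k) _; rewrite ler_wpM2l // lerXn2r ?nnegrE // ?(ltW p0) //.
  by rewrite le_max lexx orbT.
rewrite ler_wpM2l ?mulr_ge0 //; apply: le_trans (hM n) _.
by rewrite ler_piMr // exprn_ile1 //; case/andP: t01 => /ltW ? /ltW.
Qed.

Definition trunc_poly a (n : nat) : {poly C} := \poly_(i < n) a i.

Lemma horner_trunc a n z : (trunc_poly a n).[z] = psum a n z.
Proof. by rewrite /trunc_poly horner_poly. Qed.

Lemma coef_trunc_mul a b n k : (k < n)%N -> (trunc_poly a n * trunc_poly b n)`_k = conv a b k.
Proof.
move=> kn; rewrite coefM; apply: eq_bigr => j _.
have jk : (j <= k)%N by rewrite -ltnS.
by rewrite !coef_poly (leq_ltn_trans jk kn) (leq_ltn_trans (leq_subr j k) kn).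
Qed.

(** The product of two truncations is a polynomial that agrees with the Cauchy product up to degree
    n; its remaining terms, of degree between n and 2 n, are geometrically small. *)
Lemma powserM a b f g : powser a f -> powser b g -> powser (conv a b) (fun z => f z * g z).
Proof.
move=> /powserP[ha hf] /powserP[hb hg]; apply/powserP; split; first exact: pb_conv.
move=> z z1; have cfg := ccvgM (hf z z1) (hg z z1).
have hr : 0 <= cabs z < 1 by rewrite cabs_ge0.
have [K [q [K0 q01 hK]]] := pb_geometric ha hr.
have [L [p [L0 p01 hL]]] := pb_geometric hb hr.
pose s := Num.max q p; case/andP: q01 => q0 q1; case/andP: p01 => p0 p1.
have hs : 0 <= s < 1 by rewrite le_max (ltW q0) gt_max q1.
have s0 : 0 <= s by case/andP: hs.
have [M [t [M0 t01 _ hM]]] := mulS_geometric hs.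
have ht : 0 <= t < 1 by case/andP: t01 => /ltW -> ->.
have t1 : 0 < 1 - t by case/andP: t01 => _; rewrite subr_gt0.
have hK' k : cabs (a k) * cabs z ^+ k <= K * s ^+ k.
  apply: le_trans (hK k) _; rewrite ler_wpM2l // lerXn2r ?nnegrE // ?(ltW q0) //.
  by rewrite le_max lexx.
have hL' k : cabs (b k) * cabs z ^+ k <= L * s ^+ k.
  apply: le_trans (hL k) _; rewrite ler_wpM2l // lerXn2r ?nnegrE // ?(ltW p0) //.
  by rewrite le_max lexx orbT.
have trunc_le (c : nat -> C) n k : cabs (trunc_poly c n)`_k <= cabs (c k).
  by rewrite coef_poly; case: ifP => // _; rewrite cabs0 cabs_ge0.
have cd0 : ccvg (fun n => psum (conv a b) n z - psum a n z * psum b n z) 0.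
  apply: (ccvg_geometric (K := K * L * M / (1 - t)) ht) => n; rewrite subr0 cabs_distC.
  have sz : (size (trunc_poly a n * trunc_poly b n)%R <= n + n)%N.
    apply: (leq_trans (size_polyMleq (trunc_poly a n) (trunc_poly b n))).
    rewrite (leq_trans (leq_pred _)) //.
    by rewrite leq_add // size_poly.
  rewrite -!horner_trunc -hornerM (horner_coef_wide _ sz).
  rewrite -(big_mkord xpredT (fun i => (trunc_poly a n * trunc_poly b n)`_i * z ^+ i)).
  rewrite (@big_cat_nat _ _ _ n) ?leq_addr //= big_mkord.
  rewrite horner_trunc /psum (eq_bigr (fun k : 'I_n => conv a b k * z ^+ k)); last first.
    by move=> k _; rewrite coef_trunc_mul.
  rewrite [X in cabs (X - _)]addrC addrK; apply: le_trans (cabs_sum _ _ _) _.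
  apply: (@le_trans _ _ (\sum_(n <= k < n + n) K * L * M * t ^+ k)).
    apply: ler_sum => k _; rewrite cabsM cabsX coefM.
    have := @conv_bound (fun i => (trunc_poly a n)`_i) (fun i => (trunc_poly b n)`_i)
      (cabs z) s K L k (cabs_ge0 z) s0 K0 L0.
    rewrite /conv => h; apply: le_trans (h _ _) _.
    - move=> i; apply: le_trans (hK' i); apply: ler_wpM2r (trunc_le a n i).
      by rewrite exprn_ge0 ?cabs_ge0.
    - move=> i; apply: le_trans (hL' i); apply: ler_wpM2r (trunc_le b n i).
      by rewrite exprn_ge0 ?cabs_ge0.
    by rewrite -(mulrA (K * L)); apply: ler_wpM2l (hM k); rewrite mulr_ge0.
  rewrite -mulr_sumr; apply: le_trans (ler_wpM2l _ (sum_geometric ht (leq_addr n n))) _.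
    by rewrite !mulr_ge0.
  by rewrite (mulrC (t ^+ n)) mulrA.
rewrite -[X in ccvg _ X]add0r; apply: (ccvg_ext _ (ccvgD cd0 cfg)) => n.
by rewrite subrK.
Qed.

Definition prim_coef c n : C := if n is m.+1 then c m / m.+1%:R else 0.

Lemma cint_expn n : cint 0 1 (fun t => (t%:C : C) ^+ n) = (n.+1%:R)^-1 /\
  cintg 0 1 (fun t => (t%:C : C) ^+ n).
Proof.
have e (t : R) : (t%:C : C) ^+ n = (t ^+ n)%:C by rewrite rmorphXn.
have cn : continuous (fun t : R => t ^+ n) by exact: exprn_continuous.
have ig : cintg 0 1 (fun t => (t%:C : C) ^+ n).
  split; apply: intg_cont; apply: continuous_subspaceT.
    by rewrite (_ : _ \o _ = (fun t : R => t ^+ n)) //; apply/funext => t /=; rewrite e.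
  by rewrite (_ : _ \o _ = (fun=> 0)); [move=> t; exact: cvg_cst|apply/funext => t /=; rewrite e].
split=> //; apply: complex_eq; rewrite ?Re_cint ?Im_cint.
  rewrite (@eq_rint _ _ _ _ (fun t => t ^+ n)); last by move=> t _ /=; rewrite e.
  have dU (t : R) : is_derive t 1 (fun t : R => n.+1%:R^-1 * t ^+ n.+1) (t ^+ n).
    have h : is_derive t 1 (fun t : R => n.+1%:R^-1 * t ^+ n.+1)
        (n.+1%:R^-1 *: (n.+1%:R * t ^+ n)).
      apply: is_deriveZ; apply: DeriveDef; first exact: exprn_derivable.
      by rewrite -derive1E exp_derive1.
    by apply: (is_derive_eq h); rewrite /GRing.scale /= mulKf // pnatr_eq0.
  have F := FTC ler01 cn dU; rewrite F.
  rewrite expr1n expr0n /= mulr0 subr0 mulr1.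
  by rewrite -(rmorph_nat (real_complex R)) -fmorphV.
rewrite (@eq_rint _ _ _ _ (fun=> 0)); last by move=> t _ /=; rewrite e.
by rewrite rint0 -(rmorph_nat (real_complex R)) -fmorphV.
Qed.

(** The remainder of the series is uniformly small on the segment from 0 to [z], so partial sums may
    be integrated term by term. *)
Lemma powser_primitive c f : powser c f -> powser (prim_coef c) (segment_integral f).
Proof.
move=> hc; have pc := powser_pb hc; apply/powserP; split.
  move=> r hr; have [K hK] := pc r hr; exists (Num.max 0 K) => -[|n] /=.
    by rewrite cabs0 mul0r le_max lexx.
  case/andP: hr => r0 /ltW r1; rewrite le_max; apply/orP; right; apply: le_trans (hK n).
  rewrite cabsM cabsV cabs_nat exprS -mulrA ler_wpM2l ?cabs_ge0 //.
  rewrite mulrA ler_piMl ?exprn_ge0 // mulrC ler_pdivrMr ?ltr0n // mul1r.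
  by apply: le_trans r1 _; rewrite ler1n.
move=> z z1; apply: (@ccvg_unshift _ _ _ 1).
have hz : 0 <= cabs z < 1 by rewrite cabs_ge0.
have [K [q [K0 q01 hK]]] := hc (cabs z) hz.
have tz t : 0 <= t <= 1 -> cabs (t%:C * z) <= cabs z.
  by move=> /andP[t0 t1]; rewrite cabsM cabs_real ger0_norm // ler_piMl ?cabs_ge0.
have i1 : cintg 0 1 (fun t => f (t%:C * z) * z).
  apply: ccont_cintg; apply: ccontM (ccont_cst _ _).
  apply: ccontP => s; rewrite /= in_itv /= => hs e e0.
  have [d d0 hd] := powser_ccts hc (le_lt_trans (tz s hs) z1) e0.
  exists d => // t; rewrite in_itv /= => ht st; rewrite cabs_distC; apply: hd.
  rewrite -mulrBl -rmorphB cabsM cabs_real distrC.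
  by apply: le_lt_trans st; rewrite ler_piMr // ltW.
apply: (ccvg_geometric (K := K) q01) => n; rewrite addn1 psumSl /= add0r.
have i2 : cintg 0 1 (fun t => psum c n (t%:C * z) * z).
  have [h _] := @cint_sum R 0 1 n (fun k t => c k * z ^+ k * z * t%:C ^+ k)
     (fun k _ => cintgZ _ (cint_expn k).2).
  apply: eq_cintg h => t _; rewrite /psum mulr_suml; apply: eq_bigr => k _.
  by rewrite exprMn; ring.
have -> : z * psum (fun k => c k / k.+1%:R) n z = cint 0 1 (fun t => psum c n (t%:C * z) * z).
  have [_ h] := @cint_sum R 0 1 n (fun k t => c k * z ^+ k * z * t%:C ^+ k)
     (fun k _ => cintgZ _ (cint_expn k).2).
  rewrite (@eq_cint _ _ _ _ (fun t => \sum_(k < n) c k * z ^+ k * z * t%:C ^+ k)); last first.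
    move=> t _; rewrite /psum mulr_suml; apply: eq_bigr => k _.
    by rewrite exprMn; ring.
  rewrite h /psum mulr_sumr; apply: eq_bigr => k _.
  by rewrite cintZ; [rewrite (cint_expn k).1; ring|exact: (cint_expn k).2].
rewrite cabs_distC /segment_integral -/(cint 0 1 _) -cintB //.
rewrite -[leRHS]mulr1 -[X in _ * X](subr0 1); apply: cabs_cint_bound => //.
  exact: cintgB.
move=> t ht; rewrite -mulrBl cabsM; apply: le_trans (_ : K * q ^+ n * 1 <= _); last by rewrite mulr1.
by apply: ler_pM; rewrite ?cabs_ge0 ?(ltW z1) //; apply: hK; apply: tz.
Qed.

End Algebra.

(** * The Hardy space in terms of Taylor coefficients *)

Section Parseval.
Variable R : realType.
Local Notation C := R[i].
Implicit Types (f g h : C -> C) (z w : C) (r t : R) (a b c u v : nat -> C).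
Local Notation cper p := (cintg 0 (2 * pi) p).

Lemma circle_monomials (r : R) k l : 
  cper (fun t => (r%:C * cis t) ^+ k * ((r%:C * cis t) ^+ l)^*) /\
  cmean (fun t => (r%:C * cis t) ^+ k * ((r%:C * cis t) ^+ l)^*) =
  if k == l then (r ^+ (2 * k))%:C else 0.
Proof.
have e t : (r%:C * cis t) ^+ k * ((r%:C * cis t) ^+ l)^* =
   (r ^+ (k + l))%:C * (cis t ^+ k * (cis t)^-1 ^+ l).
  rewrite conjX conjM conjRe -cisV !exprMn mulrACA -exprD.
  by rewrite rmorphXn.
have key : cper (fun t => @cis R t ^+ k * (cis t)^-1 ^+ l) /\
    cmean (fun t => @cis R t ^+ k * (cis t)^-1 ^+ l) = (k == l)%:R.
  have [lk|kl] := leqP l k.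
    have e2 t : cis t ^+ (k - l) = @cis R t ^+ k * (cis t)^-1 ^+ l.
      by rewrite -{2}(subnK lk) exprD -mulrA -exprMn mulfV ?cis_neq0 // expr1n mulr1.
    split; first by apply: eq_cintg (cper_cisX _ (k - l)) => t _; rewrite e2.
    rewrite -(@eq_cmean _ (fun t => cis t ^+ (k - l))) => [|t _]; last exact: e2.
    by rewrite cmean_cisX subn_eq0 eqn_leq lk andbT.
  have e2 t : (cis t)^-1 ^+ (l - k) = @cis R t ^+ k * (cis t)^-1 ^+ l.
    by rewrite -{2}(subnK (ltnW kl)) addnC exprD mulrA -exprMn mulfV ?cis_neq0 // expr1n mul1r.
  split; first by apply: eq_cintg (cper_cisVX _ (l - k)) => t _; rewrite e2.
  rewrite -(@eq_cmean _ (fun t => (cis t)^-1 ^+ (l - k))) => [|t _]; last exact: e2.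
  by rewrite cmean_cisVX subn_eq0 leqNgt kl (ltn_eqF kl).
split; first by apply: eq_cintg (cintgZ (r ^+ (k + l))%:C key.1) => t _; rewrite e.
rewrite (eq_cmean (fun t _ => e t)) cmeanZ; last exact: key.1.
rewrite key.2; case: eqP => [->|_]; last by rewrite mulr0.
by rewrite mulr1 addnn -mul2n.
Qed.

Definition sesq a b n : C := \sum_(k < n) a k * (b k)^*.
Definition dil_coef (r : R) a k : C := a k * (r ^+ k)%:C.

(** The radius is unrestricted, as the sums are finite; r = 1 is used later on the unit circle
    itself. *)
Lemma parseval_psum a b n (r : R) :
  cper (fun t => psum a n (r%:C * cis t) * (psum b n (r%:C * cis t))^*) /\
  cmean (fun t => psum a n (r%:C * cis t) * (psum b n (r%:C * cis t))^*) =
  sesq (dil_coef r a) (dil_coef r b) n.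
Proof.
pose F k t := \sum_(l < n) (a k * (b l)^*) * ((r%:C * cis t) ^+ k * ((r%:C * cis t) ^+ l)^*).
have iF k : cper (F k) /\ cmean (F k) = \sum_(l < n) (a k * (b l)^*) *
    (if k == l then (r ^+ (2 * k))%:C else 0).
  have i l : cper (fun t => (a k * (b l)^*) * ((r%:C * cis t) ^+ k * ((r%:C * cis t) ^+ l)^*)).
    by apply: cintgZ; exact: (circle_monomials r k l).1.
  split; first by have [] := cint_sum (fun l (_ : (l < n)%N) => i l).
  rewrite /F (cmean_sum (fun l (_ : (l < n)%N) => i l)); apply: eq_bigr => l _.
  by rewrite cmeanZ ?(circle_monomials r k l).2 //; exact: (circle_monomials r k l).1.
have e t : psum a n (r%:C * cis t) * (psum b n (r%:C * cis t))^* = \sum_(k < n) F k t.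
  rewrite /psum conj_sum mulr_suml; apply: eq_bigr => k _; rewrite mulr_sumr.
  by apply: eq_bigr => l _; rewrite conjM; ring.
split.
  have [h _] := cint_sum (fun k (_ : (k < n)%N) => (iF k).1).
  by apply: eq_cintg h => t _; rewrite e.
rewrite (eq_cmean (fun t _ => e t)) (cmean_sum (fun k (_ : (k < n)%N) => (iF k).1)).
apply: eq_bigr => k _; rewrite (iF k).2 (bigD1 k) //= eqxx big1 => [|l lk]; last first.
  by rewrite (_ : (k == l :> nat) = false) ?mulr0 //; apply: contraNF lk => /eqP/val_inj ->.
rewrite addr0 /dil_coef conjM conjRe mulrACA; congr (_ * _).
by rewrite -rmorphM -exprD addnn -mul2n.
Qed.

Lemma powser_cper a f (r : R) : powser a f -> 0 <= r < 1 -> ccont `[0, 2 * pi] (fun t => f (r%:C * cis t)).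
Proof.
move=> ha /andP[r0 r1]; apply: ccont_circle => // t _; apply: powser_ccts ha _.
by rewrite cabs_polar.
Qed.

Lemma ccontJ A p : @ccont R A p -> ccont A (fun t => (p t)^*).
Proof.
move=> [h1 h2]; split => t.
  by rewrite (_ : _ \o _ = Re \o p); [exact: h1|apply/funext => s /=; rewrite ReJ].
rewrite (_ : _ \o _ = (fun s => - (Im \o p) s)); last by apply/funext => s /=; rewrite ImJ.
exact: continuousN (h2 t).
Qed.

Lemma parseval a b f g (r : R) : powser a f -> powser b g -> 0 <= r < 1 ->
  ccvg (sesq (dil_coef r a) (dil_coef r b))
    (cmean (fun t => f (r%:C * cis t) * (g (r%:C * cis t))^*)).
Proof.
move=> ha hb hr; have /andP[r0 r1] := hr.
have [K [q [K0 /andP[q0 q1] hK]]] := ha r hr; have [L [p [L0 /andP[p0 p1] hL]]] := hb r hr.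
pose s := Num.max q p; have s01 : 0 <= s < 1 by rewrite le_max q0 gt_max q1.
(* 3 K L = K * 2 L + K * L: the error on [f] times the bound 2 L for the partial sum of [g], plus
   the bound for [f] times the error on [g]. *)
apply: (ccvg_geometric (K := 3 * K * L) s01) => n.
rewrite -(parseval_psum a b n r).2 cabs_distC.
have ic := ccont_cintg (ccontM (powser_cper ha hr) (ccontJ (powser_cper hb hr))).
rewrite -cmeanB //; last exact: (parseval_psum a b n r).1.
apply: cabs_cmean_bound; first exact: cintgB ic (parseval_psum a b n r).1.
move=> t _; set w := r%:C * cis t.
have wr : cabs w <= r by rewrite cabs_polar.
have f1 := hK n w wr; have g1 := hL n w wr; rewrite -!/(psum _ n w) in f1 g1.
have f0 := hK 0%N w wr; have g0 := hL 0%N w wr; rewrite !big_ord0 !subr0 !expr0 !mulr1 in f0 g0.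
have qs : q ^+ n <= s ^+ n by rewrite lerXn2r ?nnegrE // le_max ?q0 ?lexx.
have ps : p ^+ n <= s ^+ n by rewrite lerXn2r ?nnegrE // le_max ?q0 ?lexx ?orbT.
have p1n : p ^+ n <= 1 by rewrite exprn_ile1 // ltW.
have Q : cabs (psum b n w) <= 2 * L.
  rewrite mulr_natl mulr2n; apply: le_trans (cabs_dist _ (g w)) _; rewrite cabs_distC.
  by apply: lerD => //; apply: le_trans g1 _; rewrite ler_piMr.
rewrite (_ : _ - _ = (f w - psum a n w) * (psum b n w)^* + f w * (g w - psum b n w)^*); last first.
  by rewrite conjB; ring.
apply: le_trans (cabsD _ _) _; rewrite !cabsM !cabsJ.
have -> : 3 * K * L * s ^+ n = K * s ^+ n * (2 * L) + K * (L * s ^+ n) by ring.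
apply: lerD; apply: ler_pM; rewrite ?cabs_ge0 //.
  by apply: le_trans f1 _; rewrite ler_wpM2l.
by apply: le_trans g1 _; rewrite ler_wpM2l.
Qed.

(** Partial sums of the squared norm of H2. Uniform bounds on them replace the infinite sum
    throughout. *)
Definition energy a n : R := \sum_(k < n) cabs (a k) ^+ 2.

Lemma energyS a n : energy a n.+1 = energy a n + cabs (a n) ^+ 2.
Proof. by rewrite /energy big_ord_recr. Qed.

Lemma energy_ge0 a n : 0 <= energy a n.
Proof. by apply: sumr_ge0 => k _; rewrite exprn_ge0 ?cabs_ge0. Qed.

Lemma energy_le a n m : (n <= m)%N -> energy a n <= energy a m.
Proof.
elim: m => [|m IH]; first by rewrite leqn0 => /eqP ->.
rewrite leq_eqVlt => /predU1P[->//|]; rewrite ltnS => /IH h.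
by apply: le_trans h _; rewrite energyS lerDl exprn_ge0 ?cabs_ge0.
Qed.

Lemma sesq_diag a n : sesq a a n = (energy a n)%:C.
Proof. by rewrite /sesq /energy rmorph_sum; apply: eq_bigr => k _; rewrite mulJ_cabs. Qed.

Lemma energy_dil a (r : R) n : 0 <= r <= 1 -> energy (dil_coef r a) n <= energy a n.
Proof.
move=> /andP[r0 r1]; apply: ler_sum => k _; rewrite /dil_coef cabsM cabs_real.
rewrite ger0_norm ?exprn_ge0 // exprMn ler_piMr ?exprn_ge0 ?cabs_ge0 //.
by rewrite exprn_ile1 ?exprn_ge0 // exprn_ile1.
Qed.

Lemma circle_sqnormE a f (r : R) : powser a f -> 0 <= r < 1 ->
  circle_sqnorm (dilation r f) =
  (Re (cmean (fun t => f (r%:C * cis t) * (f (r%:C * cis t))^*)))%:E.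
Proof.
move=> ha hr; have ic := ccont_cintg (ccontM (powser_cper ha hr) (ccontJ (powser_cper ha hr))).
have i1 : intg 0 (2 * pi) (fun t => cabs (f (r%:C * cis t)) ^+ 2).
  by case: ic => + _; apply: eq_intg => t _ /=; rewrite mulJ_cabs.
rewrite /circle_sqnorm /cmean ReZ Re_cint EFinM; congr (_ * _)%E.
rewrite /rint /Rintegral fineK; last first.
  by apply: integrable_fin_num => //; case: ic.
by apply: eq_integral => t _ /=; rewrite mulJ_cabs.
Qed.

Lemma ccvg_Re_le u l M : ccvg u l -> (forall n, Re (u n) <= M) -> Re l <= M.
Proof.
move=> hu h; apply/ler_addgt0Pl => e /hu[N /(_ N (leqnn N)) hN].
have : Re l = Re (u N) - Re (u N - l) by rewrite ReB opprB addrC subrK.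
move=> ->; rewrite addrC; apply: lerD (h N).
by apply: le_trans (ltW hN); rewrite -ReN; apply: le_trans (Re_le_cabs _) _; rewrite cabsN.
Qed.

Lemma ccvg_Re_ge u l M N : ccvg u l -> (forall n, (N <= n)%N -> M <= Re (u n)) -> M <= Re l.
Proof.
move=> hu h; rewrite -lerN2 -ReN -mulN1r.
apply: (ccvg_Re_le (ccvgZ (-1) (ccvg_shift N hu))) => n.
by rewrite mulN1r ReN lerN2 h // leq_addl.
Qed.

End Parseval.

(** * Norm, inner product and weak convergence in terms of coefficients *)

Section Hardy.
Variable R : realType.
Local Notation C := R[i].
Implicit Types (f g h : C -> C) (z w : C) (r t : R) (a b c u v : nat -> C).

(** Lets r tend to 1 without a limit: by Bernoulli's inequality (1 - x)^n >= 1 - n x, and a small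
    [x] contradicts [M < E]. *)
Lemma bernoulli_le (E M : R) n : 0 <= E ->
  (forall r : R, 0 < r < 1 -> E * r ^+ n <= M) -> E <= M.
Proof.
move=> E0 h; rewrite leNgt; apply/negP => ME.
have bern (x : R) : 0 <= x <= 1 -> 1 - n%:R * x <= (1 - x) ^+ n.
  move=> /andP[x0 x1]; elim: n {h} => [|n IH]; first by rewrite mul0r subr0 expr0.
  rewrite exprS -natr1; have y1 : 0 <= 1 - x by rewrite subr_ge0.
  apply: le_trans (ler_wpM2l y1 IH).
  have : 0 <= (n%:R : R) by []; move: (n%:R : R) => y y0; nra.
(* Small enough that n E x < E - M, while 1 - x stays in the open unit interval. *)
pose x := Num.min (1 / 2) ((E - M) / (2 * n%:R * E + 1)).
have d0 : 0 < 2 * n%:R * E + 1 by rewrite ltr_wpDl // !mulr_ge0.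
have x0 : 0 < x by rewrite lt_min !divr_gt0 ?subr_gt0 //.
have x2 : x <= 1 / 2 by rewrite ge_min lexx.
have x3 : x * (2 * n%:R * E + 1) <= E - M.
  by rewrite -ler_pdivlMr // ge_min lexx orbT.
have x01 : 0 <= x <= 1 by rewrite ltW //=; lra.
have r01 : 0 < 1 - x < 1 by lra.
have := le_trans (ler_wpM2l E0 (bern x x01)) (h (1 - x) r01).
have : 0 <= (n%:R : R) by [].
move: x3 x0 E0 ME; clear; move: x (n%:R : R) => x y; nra.
Qed.

(** Parseval at radius r, where dilation only lowers energies, gives one direction; in the other one
    each finite partial sum is recovered as r tends to 1. *)
Lemma hardy_sqnorm_le a f (M : R) : powser a f ->
  (hardy_sqnorm f <= M%:E)%E <-> forall n, energy a n <= M.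
Proof.
move=> ha.
have pr r : 0 <= r < 1 -> ccvg (fun n => (energy (dil_coef r a) n)%:C)
    (cmean (fun t => f (r%:C * cis t) * (f (r%:C * cis t))^*)).
  by move=> hr; apply: ccvg_ext (parseval ha ha hr) => n; rewrite sesq_diag.
split=> h.
  move=> n; apply: (@bernoulli_le _ _ (2 * n)); first exact: energy_ge0.
  move=> r /andP[r0 r1]; have hr : 0 <= r < 1 by rewrite ltW.
  have : (circle_sqnorm (dilation r f) <= M%:E)%E.
    apply: le_trans h; apply: ereal_sup_ubound; exists r; rewrite ?in_itv //=.
  rewrite (circle_sqnormE ha hr) lee_fin; apply: le_trans.
  apply: (ccvg_Re_ge (N := n) (pr r hr)) => m nm /=.
  apply: le_trans (energy_le _ nm); rewrite /energy mulr_suml; apply: ler_sum => k _.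
  rewrite /dil_coef cabsM cabs_real ger0_norm ?exprn_ge0 ?(ltW r0) // exprMn.
  rewrite ler_wpM2l ?exprn_ge0 ?cabs_ge0 // (_ : (r ^+ k) ^+ 2 = r ^+ (2 * k)); last by rewrite -exprM mulnC.
  by rewrite ler_wiXn2l ?(ltW r0) ?(ltW r1) // leq_mul2l /= ltnW.
apply: ge_ereal_sup => _ [r hr <-]; move: hr; rewrite /= in_itv /= => hr.
rewrite (circle_sqnormE ha hr) lee_fin; apply: ccvg_Re_le (pr r hr) _ => n /=.
by apply: le_trans (h n); apply: energy_dil; case/andP: hr => -> /ltW.
Qed.

Lemma hardy_sqnorm_ge0 f : (0 <= hardy_sqnorm f)%E.
Proof.
apply: le_trans (ereal_sup_ubound _); last first.
  by exists 0 => //; rewrite /= in_itv /= lexx ltr01.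
rewrite /circle_sqnorm mule_ge0 ?lee_fin ?invr_ge0 ?(ltW (twopi_gt0 R)) //.
by apply: integral_ge0 => t _; rewrite lee_fin exprn_ge0 ?cabs_ge0.
Qed.

Lemma H2P f : H2 f -> exists a M, [/\ powser a f, hardy_sqnorm f = M%:E, 0 <= M &
  forall n, energy a n <= M].
Proof.
move=> [hf hn]; have [a ha] := holomorphic_has_powser hf.
have fn : hardy_sqnorm f \is a fin_num by rewrite ge0_fin_numE ?hardy_sqnorm_ge0.
exists a, (fine (hardy_sqnorm f)); rewrite fineK //; split=> //.
  exact: fine_ge0 (hardy_sqnorm_ge0 f).
by apply/(hardy_sqnorm_le _ ha); rewrite fineK.
Qed.

Lemma powser_H2 a f (M : R) : powser a f -> (forall n, energy a n <= M) -> H2 f.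
Proof.
move=> ha h; split; first exact: powser_holomorphic ha.
by apply: le_lt_trans (ltry M); apply/(hardy_sqnorm_le _ ha).
Qed.

Lemma bounded_tail (S : nat -> R) (K e : R) : (forall n m, (n <= m)%N -> S n <= S m) ->
  (forall n, S n <= K) -> 0 < e -> exists N, forall n, S n - S N < e.
Proof.
move=> hS hK e0; have hs : has_sup (range S).
  by split; [exists (S 0%N), 0%N|exists K => _ [n _ <-]].
have [_ [N _ <-] hN] := sup_adherent e0 hs; exists N => n.
have : S n <= sup (range S) by apply: ub_le_sup; [case: hs|exists n].
by move: hN; lra.
Qed.

Lemma energy_tail a (M e : R) : (forall n, energy a n <= M) -> 0 < e ->
  exists N, forall n, (N <= n)%N -> energy a n - energy a N < e.
Proof.
move=> h e0; have hS n m : (n <= m)%N -> energy a n <= energy a m by exact: energy_le.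
by have [N hN] := bounded_tail hS h e0; exists N => n _; exact: hN.
Qed.

(** Only smallness of tails matters, so 2 x y <= x^2 + y^2 does the work of Cauchy-Schwarz. *)
Lemma sesq_tail a b n m : (n <= m)%N ->
  cabs (sesq a b m - sesq a b n) <=
  (energy a m - energy a n + (energy b m - energy b n)) / 2.
Proof.
elim: m => [|m IH]; first by rewrite leqn0 => /eqP ->; rewrite !subrr cabs0 addr0 mul0r.
rewrite leq_eqVlt => /predU1P[->|]; first by rewrite !subrr cabs0 addr0 mul0r.
rewrite ltnS => /IH {}IH; rewrite {1}/sesq big_ord_recr /= -/(sesq a b m).
rewrite addrAC; apply: le_trans (cabsD _ _) _; rewrite !energyS cabsM cabsJ.
move: IH; set x := cabs (a m); set y := cabs (b m); set X := cabs (_ - _).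
have : 0 <= (x - y) ^+ 2 by rewrite sqr_ge0.
rewrite sqrrB; move: X x y (energy a m) (energy a n) (energy b m) (energy b n); clear.
move=> X x y p q s u h1 h2; lra.
Qed.

Lemma sesq_cvg a b (A B : R) : (forall n, energy a n <= A) -> (forall n, energy b n <= B) ->
  exists l, ccvg (sesq a b) l.
Proof.
move=> hA hB; apply: ccvg_cauchy => e e0.
have [N1 h1] := energy_tail hA e0; have [N2 h2] := energy_tail hB e0.
exists (maxn N1 N2) => n hn; apply: le_lt_trans (sesq_tail a b hn) _.
move: hn; rewrite geq_max => /andP[n1 n2].
have := h1 n n1; have := h2 n n2.
have := energy_le a (leq_maxl N1 N2); have := energy_le b (leq_maxr N1 N2).
move: (energy a (maxn N1 N2)) (energy b (maxn N1 N2)) (energy a n) (energy b n) => *; lra.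
Qed.

Lemma energy_dil_diff a (r : R) n m : 0 <= r <= 1 -> (n <= m)%N ->
  energy (dil_coef r a) m - energy (dil_coef r a) n <= energy a m - energy a n.
Proof.
move=> /andP[r0 r1]; elim: m => [|m IH]; first by rewrite leqn0 => /eqP ->; rewrite !subrr.
rewrite leq_eqVlt => /predU1P[->|]; first by rewrite !subrr.
rewrite ltnS => /IH {}IH; rewrite !energyS addrAC [leRHS]addrAC; apply: lerD IH _.
rewrite /dil_coef cabsM cabs_real ger0_norm ?exprn_ge0 // exprMn.
by rewrite ler_piMr ?exprn_ge0 ?cabs_ge0 // exprn_ile1 ?exprn_ge0 // exprn_ile1.
Qed.

Lemma half_sum_le (e x1 x2 y1 y2 A B A1 B1 A2 B2 : R) : x1 - x2 <= A - A1 -> y1 - y2 <= B - B1 ->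
  A - A2 <= e -> B - B2 <= e -> A2 <= A1 -> B2 <= B1 -> (x1 - x2 + (y1 - y2)) / 2 <= e.
Proof. lra. Qed.

Lemma expr_near1 N (e : R) : 0 < e -> exists2 d : R, 0 < d <= 1 &
  forall r, 1 - d < r -> r < 1 -> forall k, (k <= N)%N -> 1 - r ^+ k <= e.
Proof.
move=> e0; exists (Num.min 1 (e / N.+1%:R)); first by rewrite lt_min ltr01 divr_gt0 // ge_min lexx.
move=> r r1 r2 k kN.
have b1 : Num.min 1 (e / N.+1%:R) <= 1 by rewrite ge_min lexx.
have b2 : Num.min 1 (e / N.+1%:R) <= e / N.+1%:R by rewrite ge_min lexx orbT.
have r0 : 0 < r by lra.
have h : 1 - r ^+ k <= k%:R * (1 - r).
  elim: k {kN} => [|k IH]; first by rewrite expr0 subrr mul0r.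
  have k1 : r ^+ k <= 1 by rewrite exprn_ile1 // ltW.
  have k0 : 0 <= r ^+ k by rewrite exprn_ge0 // ltW.
  by rewrite exprS -natr1; move: (r ^+ k) (k%:R : R) k1 k0 IH r0 r2 => x y; nra.
apply: le_trans h _; have dd : 1 - r <= e / N.+1%:R.
  by move: (e / _) r1 b2 => q; move: (Num.min _ _) => m *; lra.
apply: (@le_trans _ _ (N.+1%:R * (e / N.+1%:R))); last by rewrite mulrC divfK.
by apply: ler_pM => //; rewrite ?subr_ge0 ?(ltW r2) ?ler_nat ?(leq_trans kN).
Qed.

(** Abel summation: the tails of the dilated sums are small uniformly in r, and the finite part is
    continuous at r = 1. *)
Lemma hardy_innerE a b f g (A B : R) l : powser a f -> powser b g ->
  (forall n, energy a n <= A) -> (forall n, energy b n <= B) -> ccvg (sesq a b) l ->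
  hardy_inner f g = l.
Proof.
move=> ha hb hA hB hl; apply: cvg_lim; first exact: norm_hausdorff.
apply/cabs_cvgP => e e0; have e4 : 0 < e / 4 by apply: divr_gt0.
have [N1 h1] := energy_tail hA e4; have [N2 h2] := energy_tail hB e4.
have [N3 h3] := hl _ e4.
pose N := maxn (maxn N1 N2) N3.
have tail r n : 0 <= r <= 1 -> (N <= n)%N ->
    cabs (sesq (dil_coef r a) (dil_coef r b) n - sesq (dil_coef r a) (dil_coef r b) N) <= e / 4.
  move=> hr nN; apply: le_trans (sesq_tail _ _ nN) _.
  have k1 : (N1 <= N)%N by rewrite /N !leq_max leqnn.
  have k2 : (N2 <= N)%N by rewrite /N !leq_max leqnn orbT.
  have e1 := energy_dil_diff a hr nN; have e2 := energy_dil_diff b hr nN.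
  have e5 := ltW (h1 n (leq_trans k1 nN)); have e6 := ltW (h2 n (leq_trans k2 nN)).
  have e7 := energy_le a k1; have e8 := energy_le b k2.
  exact: half_sum_le e1 e2 e5 e6 e7 e8.
have A0 := le_trans (energy_ge0 a 0) (hA 0%N).
have B0 := le_trans (energy_ge0 b 0) (hB 0%N).
have AB1 : 0 < A + B + 1 by rewrite ltr_wpDl // addr_ge0.
have AB0 : 0 < e / 8 / (A + B + 1) by apply: divr_gt0 => //; apply: divr_gt0.
have [d /andP[d0 d1] hd] := expr_near1 (N + N) AB0.
near=> r; have r1 : r < 1 by near: r; exact: nbhs_left_lt.
have r2 : 1 - d < r by near: r; apply: nbhs_left_gt; lra.
have r00 : 0 <= r by apply: ltW; apply: le_lt_trans r2; rewrite subr_ge0.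
have r0 : 0 <= r < 1 by rewrite r00.
have r01 : 0 <= r <= 1 by rewrite r00 ltW.
have cr := parseval ha hb r0.
rewrite /circle_inner /dilation -/(cmean (fun t => f (r%:C * cis t) * (g (r%:C * cis t))^*)).
set I := cmean _ in cr *.
have t1 : cabs (I - sesq (dil_coef r a) (dil_coef r b) N) <= e / 4.
  by apply: (ccvg_le _ (ccvg_shift N cr)) => n; apply: tail => //; rewrite leq_addl.
have t2 : cabs (l - sesq a b N) <= e / 4.
  by rewrite cabs_distC ltW // h3 // /N leq_max leqnn orbT.
have t3 : cabs (sesq a b N - sesq (dil_coef r a) (dil_coef r b) N) <= e / 8.
  rewrite /sesq -sumrB; apply: le_trans (cabs_sum _ _ _) _.
  apply: (@le_trans _ _ (\sum_(k < N) (cabs (a k) ^+ 2 + cabs (b k) ^+ 2) * (e / 8 / (A + B + 1)))).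
    apply: ler_sum => k _; rewrite /dil_coef conjM conjRe mulrACA -rmorphM -exprD.
    rewrite -[X in X - _]mulr1 -mulrBr -(rmorph1 (real_complex R)) -rmorphB !cabsM cabsJ cabs_real.
    have rk : r ^+ (k + k) <= 1.
      by apply: exprn_ile1; [case/andP: r01|case/andP: r01].
    rewrite ger0_norm ?subr_ge0 //; have kk : (k + k <= N + N)%N by rewrite leq_add // ltnW.
    have hk := hd r r2 r1 (k + k)%N kk.
    apply: ler_pM hk; rewrite ?mulr_ge0 ?cabs_ge0 ?subr_ge0 //.
    by have := cabs_ge0 (a k); have := cabs_ge0 (b k); move: (cabs _) (cabs _); clear => x y *; nra.
  rewrite -mulr_suml big_split /=; have a1 := hA N; have b1 := hB N.
  rewrite -/(energy a N) -/(energy b N); have a0 := energy_ge0 a N; have b0 := energy_ge0 b N.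
  rewrite mulrA ler_pdivrMr; last by lra.
  by rewrite mulrC ler_wpM2l //; [lra|lra].
rewrite cabs_distC in t1.
have t4 := le_trans (cabs_dist3 (sesq a b N) I (sesq (dil_coef r a) (dil_coef r b) N)) (lerD t3 t1).
apply: le_lt_trans (cabs_dist3 l I (sesq a b N)) _; apply: le_lt_trans (lerD t2 t4) _.
by clear -e0; lra.
Unshelve. all: by end_near. Qed.

(** Young's inequality with a weight: the small [d] falls on energies that are merely bounded, 1 / d
    on a tail that can be made as small as needed. *)
Lemma weighted_young (d x y z w : R) : 0 < d -> 0 <= z -> 0 <= w -> w <= x + y ->
  w * z <= d * (x ^+ 2 + y ^+ 2) + z ^+ 2 / d / 2.
Proof.
move=> d0 z0 w0 wxy; pose m := z / d; have zE : z = d * m by rewrite /m mulrC divfK // gt_eqF.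
have m0 : 0 <= m by rewrite /m divr_ge0 // ltW.
have -> : z ^+ 2 / d = d * m ^+ 2 by rewrite zE; field; rewrite gt_eqF.
rewrite zE mulrCA; rewrite -mulrA -mulrDr; apply: ler_wpM2l; first exact: ltW.
have : w * m <= (x + y) * m by rewrite ler_wpM2r.
have := sqr_ge0 (x - y); have := sqr_ge0 (x + y - m); rewrite !expr2; clear; nra.
Qed.

(** With uniformly bounded energies, convergence of each coefficient implies weak convergence:
    beyond a fixed index the pairing is small through the tail of [h], and before it the sum is
    finite. *)
Lemma wot_cvgP (Tn : nat -> (C -> C) -> C -> C) (L : (C -> C) -> C -> C) :
  (forall a f (M : R), powser a f -> (forall n, energy a n <= M) ->
    exists (u : nat -> nat -> C) v (B : R), [/\ forall n, powser (u n) (Tn n f), powser v (L f),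
      forall n m, energy (u n) m <= B, forall m, energy v m <= B &
      forall k, ccvg (fun n => u n k) (v k)]) ->
  wot_cvg Tn L.
Proof.
move=> H f h /H2P[a [M [ha _ _ hM]]] /H2P[b [N [hb _ _ hN]]].
have [u [v [B [hu hv uB vB uv]]]] := H a f M ha hM.
have B0 : 0 <= B := le_trans (energy_ge0 v 0) (vB 0%N).
have N0 : 0 <= N := le_trans (energy_ge0 b 0) (hN 0%N).
have [l hl] := sesq_cvg vB hN; rewrite (hardy_innerE hv hb vB hN hl).
(* With this [d] the two energies, each at most [B], cost e / 4 in [s3]; [B + 1] keeps the
   denominator positive. *)
apply/cabs_cvgP => e e0; pose d := e / (8 * (B + 1)).
have d0 : 0 < d by apply: divr_gt0 => //; lra.
have de : d * B <= e / 8.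
  by rewrite /d; rewrite -mulrA mulrC -mulrA ler_pdivrMl; [rewrite mulrA; nra|lra].
(* Threshold for the tail energy of [b], which gets divided by 2 d and so contributes e / 8 in
   [s4]. *)
have de0 : 0 < d * e / 4 by apply: divr_gt0 => //; apply: mulr_gt0.
have [K hK] := energy_tail hN de0.
have [T hT] : exists T, forall n, (T <= n)%N -> forall k, (k < K)%N ->
    cabs (u n k - v k) * cabs (b k) <= e / 4 / K.+1%:R.
  have eK : 0 < e / 4 / K.+1%:R by apply: divr_gt0 => //; apply: divr_gt0.
  elim: {1}K => [|j [T hT]]; first by exists 0%N.
  have [T' hT'] := ccvgZ (b j) (uv j) eK.
  exists (maxn T T') => n; rewrite geq_max => /andP[n1 n2] k.
  rewrite ltnS leq_eqVlt => /predU1P[->|]; last exact: hT.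
  by have := hT' n n2; rewrite -mulrBr cabsM mulrC => /ltW.
near=> n; have Tn' : (T <= n)%N by near: n; exists T.
have [ln hln] := sesq_cvg (uB n) hN; rewrite (hardy_innerE (hu n) hb (uB n) hN hln).
have cv := ccvgB hl hln; rewrite -[X in cabs X]subr0.
apply: (@le_lt_trans _ _ (e * (3 / 4))); last first.
  by rewrite gtr_pMr //; lra.
apply: (ccvg_le _ (ccvg_shift K cv)) => m; rewrite subr0.
set p := (m + K)%N; have Kp : (K <= p)%N by rewrite /p leq_addl.
have -> : sesq v b p - sesq (u n) b p = \sum_(k < p) (v k - u n k) * (b k)^*.
  by rewrite /sesq -sumrB; apply: eq_bigr => k _; rewrite mulrBl.
apply: le_trans (cabs_sum _ _ _) _.
rewrite -(big_mkord xpredT (fun k => cabs ((v k - u n k) * (b k)^*))).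
rewrite (@big_cat_nat _ _ _ K 0 p) //= big_mkord.
have s1 : \sum_(k < K) cabs ((v k - u n k) * (b k)^*) <= e / 4.
  apply: (@le_trans _ _ (\sum_(k < K) e / 4 / K.+1%:R)).
    apply: ler_sum => k _; rewrite cabsM cabsJ cabs_distC; exact: hT.
  rewrite sumr_const card_ord -[leLHS]mulr_natr -mulrA ler_piMr //; first by rewrite divr_ge0 // ltW.
  by rewrite mulrC ler_pdivrMr ?ltr0n // mul1r ler_nat.
have s2 : \sum_(K <= k < p) cabs ((v k - u n k) * (b k)^*) <=
    d * (energy v p + energy (u n) p) + (energy b p - energy b K) / d / 2.
  have -> : energy b p - energy b K = \sum_(K <= k < p) cabs (b k) ^+ 2.
    rewrite /energy -!(big_mkord xpredT (fun k => cabs (b k) ^+ 2)).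
    by rewrite (@big_cat_nat _ _ _ K 0 p) //= [X in X - _]addrC addrK.
  apply: (@le_trans _ _ (\sum_(K <= k < p) (d * (cabs (v k) ^+ 2 + cabs (u n k) ^+ 2) +
      cabs (b k) ^+ 2 / d / 2))).
    apply: ler_sum => k _; rewrite cabsM cabsJ.
    have := cabsB (v k) (u n k); have := cabs_ge0 (v k - u n k).
    have := cabs_ge0 (v k); have := cabs_ge0 (u n k); have := cabs_ge0 (b k).
    move: (cabs _) (cabs _) (cabs _) (cabs _) => x y z w; clear -d0 => x0 y0 z0 w0 wxy.
    exact: weighted_young.
  rewrite big_split /= -mulr_sumr big_split /= -!mulr_suml lerD2r ler_wpM2l ?(ltW d0) //.
  have le c : \sum_(K <= k < p) cabs (c k) ^+ 2 <= energy c p.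
    rewrite /energy -(big_mkord xpredT (fun k => cabs (c k) ^+ 2)).
    rewrite [leRHS](@big_cat_nat _ _ _ K 0 p) //= lerDr; apply: sumr_ge0 => k _.
    by rewrite exprn_ge0 ?cabs_ge0.
  by rewrite lerD.
have s3 : d * (energy v p + energy (u n) p) <= e / 4.
  apply: le_trans (ler_wpM2l (ltW d0) (lerD (vB p) (uB n p))) _.
  by move: de; clear; move: (d) => x; lra.
have s4 : (energy b p - energy b K) / d / 2 <= e / 8.
  have -> : e / 8 = d * e / 4 / d / 2 by field; rewrite gt_eqF.
  by rewrite !ler_pM2r ?invr_gt0 //; apply: ltW; apply: hK.
have := le_trans (lerD s1 s2) (lerD (lexx _) (lerD s3 s4)); move/le_trans; apply.
by clear -e0; lra.
Unshelve. all: by end_near. Qed.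

End Hardy.

(** * A Carleson-type embedding *)

Section Core.
Variable R : realType.
Local Notation C := R[i].
Implicit Types (z w : C) (r t : R) (p q : {poly C}).

Lemma Re_C z : (Re z)%:C = (z + z^*) / 2 :> C.
Proof. by case: z => x y; apply: complex_eq; simpc => /=; field. Qed.

Lemma sqr_cabsC z : (cabs z)%:C ^+ 2 = z * z^* :> C.
Proof. by rewrite mulJ_cabs rmorphXn. Qed.

Lemma realCX (x : R) n : (x ^+ n)%:C = x%:C ^+ n :> C. Proof. exact: rmorphXn. Qed.
Lemma realC2 : (2 : R)%:C = 2 :> C. Proof. exact: rmorph_nat. Qed.
Lemma realC2V : (2^-1 : R)%:C = 2^-1 :> C. Proof. by rewrite fmorphV rmorph_nat. Qed.
Lemma realCD (x y : R) : (x + y)%:C = x%:C + y%:C :> C. Proof. exact: rmorphD. Qed.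
Lemma realCM (x y : R) : (x * y)%:C = x%:C * y%:C :> C. Proof. exact: rmorphM. Qed.
Definition realC_rules := (realCX, realC2, realC2V, realCD, realCM).

Lemma conj2 : (2 : C)^* = 2. Proof. exact: rmorph_nat. Qed.
Lemma conj2V : (2^-1 : C)^* = 2^-1. Proof. by rewrite fmorphV rmorph_nat. Qed.

(** Uses (Re b)^2 = (|b|^2 + Re b^2) / 2 to write s^2 |f|^2 through products of a holomorphic
    function and a conjugate, the only ones whose circle means Parseval computes. *)
Lemma theta_identity (b g f : C) :
  2^-1 * Re ((b * f) * (b * f)^*) + 2^-1 * Re ((b ^+ 2 * f) * f^*) +
  2 * Re ((b * g * f) * (g * f)^*) + Re ((g ^+ 2 * f) * (g ^+ 2 * f)^*) =
  (Re b + cabs g ^+ 2) ^+ 2 * cabs f ^+ 2.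
Proof.
apply: complexI; rewrite !realC_rules.
rewrite !sqr_cabsC !Re_C !(conjM, conjX) !conjCK.
by field.
Qed.

(* [d dbar (s^2 |f|^2) + s^2 |f'|^2] as a square plus [2 s |f g'|^2]; the first four
   terms are the Laplacians of the four terms of [theta_identity]. *)
Lemma laplacian_identity (b b' g g' f f' : C) :
  let s := Re b + cabs g ^+ 2 in
  2^-1 * Re ((b' * f + b * f') * (b' * f + b * f')^*) +
  2^-1 * Re ((2 * b * b' * f + b ^+ 2 * f') * f'^*) +
  2 * Re ((b' * g * f + b * g' * f + b * g * f') * (g' * f + g * f')^*) +
  Re ((2 * g * g' * f + g ^+ 2 * f') * (2 * g * g' * f + g ^+ 2 * f')^*) +
  s ^+ 2 * cabs f' ^+ 2 =
  2 * cabs ((b' / 2 + g' * g^*) * f + s%:C * f') ^+ 2 + 2 * s * cabs (f * g') ^+ 2.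
Proof.
move=> s; apply: complexI; rewrite /s !realC_rules.
rewrite !sqr_cabsC !Re_C.
rewrite !(conjM, conjX, conjD, conjCK, conj2, conj2V).
by field.
Qed.

End Core.

(** * The embedding for polynomials *)

Section CorePoly.
Variable R : realType.
Local Notation C := R[i].
Implicit Types (z w : C) (r t : R) (p q : {poly C}).

Lemma Re_mulJ z : Re (z * z^*) = cabs z ^+ 2.
Proof. by rewrite mulJ_cabs. Qed.

(** The combination of products in [theta_identity], with free factors: it is applied to values of
    the functions, to values of their derivatives and to coefficients. *)
Definition theta (u1 v1 u2 v2 u3 v3 u4 v4 : C) : R :=
  2^-1 * Re (u1 * v1^*) + 2^-1 * Re (u2 * v2^*) + 2 * Re (u3 * v3^*) + Re (u4 * v4^*).

Lemma Re_cmean (u : R -> C) : Re (cmean u) = rmean (fun t => Re (u t)).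
Proof. by rewrite /cmean ReZ Re_cint. Qed.

Lemma mean_horner (r : R) p q N : (size p <= N)%N -> (size q <= N)%N ->
  intg 0 (2 * pi) (fun t => Re (p.[r%:C * cis t] * q.[r%:C * cis t]^*)) /\
  rmean (fun t => Re (p.[r%:C * cis t] * q.[r%:C * cis t]^*)) =
  \sum_(k < N) Re (p`_k * (q`_k)^*) * r ^+ (2 * k).
Proof.
move=> sp sq; have [h1 h2] := parseval_psum (fun k => p`_k) (fun k => q`_k) N r.
have e t : p.[r%:C * cis t] * q.[r%:C * cis t]^* =
    psum (fun k => p`_k) N (r%:C * cis t) * (psum (fun k => q`_k) N (r%:C * cis t))^*.
  by rewrite (horner_coef_wide _ sp) (horner_coef_wide _ sq).
split; first by have [+ _] := h1; apply: eq_intg => t _ /=; rewrite e.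
rewrite -Re_cmean (eq_cmean (fun t _ => e t)) h2 /sesq Re_sum; apply: eq_bigr => k _.
rewrite /dil_coef conjM conjRe mulrACA -realCM -exprD addnn -mul2n.
by rewrite mulrC ReZ mulrC.
Qed.

Lemma mean_theta (r : R) (p1 q1 p2 q2 p3 q3 p4 q4 : {poly C}) N :
  all (fun p => size p <= N)%N [:: p1; q1; p2; q2; p3; q3; p4; q4] ->
  let F t := let w := r%:C * cis t in
    theta p1.[w] q1.[w] p2.[w] q2.[w] p3.[w] q3.[w] p4.[w] q4.[w] in
  intg 0 (2 * pi) F /\
  rmean F = \sum_(k < N)
    theta p1`_k q1`_k p2`_k q2`_k p3`_k q3`_k p4`_k q4`_k * r ^+ (2 * k).
Proof.
move=> /=; rewrite andbT => /andP[s1 /andP[s2 /and5P[s3 s4 s5 s6 /andP[s7 s8]]]].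
have [i1 e1] := mean_horner r s1 s2; have [i2 e2] := mean_horner r s3 s4.
have [i3 e3] := mean_horner r s5 s6; have [i4 e4] := mean_horner r s7 s8.
have j12 := intgD (intgZ 2^-1 i1) (intgZ 2^-1 i2); have j123 := intgD j12 (intgZ 2 i3).
split; first exact: intgD j123 i4.
rewrite /rmean /theta rintD // rintD //; last exact: intgZ.
rewrite rintD; [|exact: intgZ..].
rewrite !rintZ //.
transitivity (2^-1 * (\sum_(k < N) Re (p1`_k * (q1`_k)^*) * r ^+ (2 * k)) +
  2^-1 * (\sum_(k < N) Re (p2`_k * (q2`_k)^*) * r ^+ (2 * k)) +
  2 * (\sum_(k < N) Re (p3`_k * (q3`_k)^*) * r ^+ (2 * k)) +
  (\sum_(k < N) Re (p4`_k * (q4`_k)^*) * r ^+ (2 * k))).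
  by rewrite -e1 -e2 -e3 -e4 /rmean; ring.
rewrite !mulr_sumr -!big_split /=; apply: eq_bigr => k _; ring.
Qed.

(** The second sum is the integral over t in [0, 1] of the first one at t x. Two applications
    produce the 1 / (k + 1)^2 of the squared coefficients of V_g f. *)
Lemma nonneg_primitive (c : nat -> R) N (X : R) :
  (forall x, 0 <= x <= X -> 0 <= \sum_(k < N) c k * x ^+ k) ->
  forall x, 0 <= x <= X -> 0 <= \sum_(k < N) c k / k.+1%:R * x ^+ k.
Proof.
move=> h x /andP[x0 xX].
have ie k : intg 0 1 (fun t : R => t ^+ k) /\ rint 0 1 (fun t : R => t ^+ k) = k.+1%:R^-1.
  have [e1 [i1 _]] := cint_expn R k.
  have e (t : R) : Re ((t%:C : C) ^+ k) = t ^+ k by rewrite -realCX.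
  split; first by apply: eq_intg i1 => t _ /=; rewrite e.
  have := congr1 Re e1; rewrite Re_cint -(rmorph_nat (real_complex R)) -fmorphV /= => <-.
  by apply: eq_rint => t _ /=; rewrite e.
have [i e] := rint_sum (fun k (_ : (k < N)%N) => intgZ (c k * x ^+ k) (ie k).1).
have -> : \sum_(k < N) c k / k.+1%:R * x ^+ k =
    rint 0 1 (fun t => \sum_(k < N) c k * x ^+ k * t ^+ k).
  rewrite e; apply: eq_bigr => k _; rewrite rintZ ?(ie k).2; last exact: (ie k).1.
  by rewrite mulrAC.
apply: rint_ge0 => t /andP[t0 t1].
rewrite (eq_bigr (fun k : 'I_N => c k * (x * t) ^+ k)); last by move=> k _; rewrite exprMn mulrA.
apply: h; rewrite mulr_ge0 //=; apply: le_trans xX; rewrite ler_piMr //.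
Qed.

Lemma le_rmean (u v : R -> R) : intg 0 (2 * pi) u -> intg 0 (2 * pi) v ->
  (forall t, 0 <= t <= 2 * pi -> u t <= v t) -> rmean u <= rmean v.
Proof.
move=> h1 h2 h; rewrite /rmean ler_wpM2l ?invr_ge0 ?(ltW (twopi_gt0 R)) //.
exact: ler_rint.
Qed.

Lemma Re_natM (u v : C) n : Re ((u *+ n) * (v *+ n)^*) = n%:R ^+ 2 * Re (u * v^*).
Proof.
have e (x : C) : x *+ n = (n%:R)%:C * x by rewrite rmorph_nat mulr_natl.
by rewrite !e conjM conjRe mulrACA -realCM ReZ expr2.
Qed.

Lemma theta_natM (u1 v1 u2 v2 u3 v3 u4 v4 : C) n :
  theta (u1 *+ n) (v1 *+ n) (u2 *+ n) (v2 *+ n) (u3 *+ n) (v3 *+ n) (u4 *+ n) (v4 *+ n) =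
  n%:R ^+ 2 * theta u1 v1 u2 v2 u3 v3 u4 v4.
Proof. by rewrite /theta !Re_natM; ring. Qed.

(** Here [T] is the Laplacian of s^2 |f|^2 (up to the factor 4), [A] the square in
    [laplacian_identity], x = |f g'|^2 and y = |f'|^2. The square is dropped, 2 s >= 1 frees |f
    g'|^2 from its weight, and s <= L bounds the term in |f'|^2. *)
Lemma core_arith (T s A x y L : R) : T + s ^+ 2 * y = 2 * A + 2 * s * x ->
  2^-1 <= s -> s <= L -> 0 <= A -> 0 <= x -> 0 <= y -> x <= T + L ^+ 2 * y.
Proof.
move=> e s1 sL A0 x0 y0.
have h1 : x <= 2 * s * x by rewrite ler_peMl //; lra.
have h2 : s ^+ 2 * y <= L ^+ 2 * y by rewrite ler_wpM2r // lerXn2r ?nnegrE //; lra.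
move: e h1 h2; move: (s ^+ 2 * y) (2 * s * x) (L ^+ 2 * y) => *; lra.
Qed.

(* [s = Re b + |g|^2]; integrating [laplacian_identity] twice against the circle
   means is the Littlewood-Paley identity in the variable [x = r^2]. *)
Lemma carleson_poly (b g f : {poly C}) (rho L : R) N : 0 < rho ->
  (forall z, cabs z <= rho -> 2^-1 <= Re b.[z] + cabs g.[z] ^+ 2 <= L) ->
  (size f <= N)%N -> (size (b * f)%R <= N)%N -> (size (b ^+ 2 * f)%R <= N)%N ->
  (size (g * f)%R <= N)%N -> (size (b * g * f)%R <= N)%N -> (size (g ^+ 2 * f)%R <= N)%N ->
  (size (f * g^`())%R <= N)%N ->
  \sum_(k < N) cabs ((f * g^`())`_k) ^+ 2 / k.+1%:R ^+ 2 * rho ^+ (2 * k.+1) <=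
  2 * L ^+ 2 * \sum_(k < N) cabs f`_k ^+ 2 * rho ^+ (2 * k).
Proof.
move=> rho0 hs sf s1 s2 s3 s4 s5 sd.
have szd p : (size p <= N)%N -> (size p^`() <= N)%N.
  move=> h; have [->|p0] := eqVneq p 0; first by rewrite deriv0 size_poly0.
  by apply: leq_trans (ltnW (lt_size_deriv p0)) h.
have L0 : 0 <= L.
  have z0 : cabs (0 : C) <= rho by rewrite cabs0 ltW.
  by have /andP[h1 h2] := hs 0 z0; apply: le_trans h2; apply: le_trans h1; rewrite invr_ge0.
pose th k := theta (b * f)`_k (b * f)`_k (b ^+ 2 * f)`_k f`_k (b * g * f)`_k (g * f)`_k
  (g ^+ 2 * f)`_k (g ^+ 2 * f)`_k.
pose e2 k := cabs f`_k ^+ 2.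
pose ga k := cabs ((f * g^`())`_k) ^+ 2.
have wr (r : R) t : 0 <= r <= rho -> cabs (r%:C * cis t) <= rho.
  by move=> /andP[r0 rr]; rewrite cabs_polar.
(* Coefficients in x = r^2 of the circle mean of T + L^2 |f'|^2 - |f g'|^2, in the notation of
   [core_arith]; both factors of each product are differentiated, hence the square of k + 1. *)
pose c k := k.+1%:R ^+ 2 * (th k.+1 + L ^+ 2 * e2 k.+1) - ga k.
have hc x : 0 <= x <= rho ^+ 2 -> 0 <= \sum_(k < N) c k * x ^+ k.
  move=> /andP[x0 xX]; pose r := Num.sqrt x.
  have hr : 0 <= r <= rho.
    rewrite sqrtr_ge0 /= -(ler_pXn2r (n := 2)) ?nnegrE ?sqrtr_ge0 ?(ltW rho0) //.
    by rewrite sqr_sqrtr.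
  have xr k : x ^+ k = r ^+ (2 * k) by rewrite exprM sqr_sqrtr.
  have [i1 m1] := @mean_theta r (b * f)^`() (b * f)^`() (b ^+ 2 * f)^`() f^`()
    (b * g * f)^`() (g * f)^`() (g ^+ 2 * f)^`() (g ^+ 2 * f)^`() N
    ltac:(by rewrite /= !szd).
  have [i2 m2] := mean_horner r (szd f sf) (szd f sf).
  have [i3 m3] := mean_horner r sd sd.
  have i4 := intgD i1 (intgZ (L ^+ 2) i2).
  have pw t : 0 <= t <= 2 * pi -> Re ((f * g^`()).[r%:C * cis t] * (f * g^`()).[r%:C * cis t]^*) <=
     theta (b * f)^`().[r%:C * cis t] (b * f)^`().[r%:C * cis t]
      (b ^+ 2 * f)^`().[r%:C * cis t] f^`().[r%:C * cis t]
      (b * g * f)^`().[r%:C * cis t] (g * f)^`().[r%:C * cis t]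
      (g ^+ 2 * f)^`().[r%:C * cis t] (g ^+ 2 * f)^`().[r%:C * cis t] +
     L ^+ 2 * Re (f^`().[r%:C * cis t] * f^`().[r%:C * cis t]^*).
    move=> _; have /andP[h1 h2] := hs _ (wr r t hr); move: h1 h2.
    move: (r%:C * cis t) => w h1 h2.
    have := laplacian_identity b.[w] b^`().[w] g.[w] g^`().[w] f.[w] f^`().[w].
    rewrite /theta.
    have -> : (b * f)^`().[w] = b^`().[w] * f.[w] + b.[w] * f^`().[w] by rewrite derivM !hornerE.
    have -> : (b ^+ 2 * f)^`().[w] = 2 * b.[w] * b^`().[w] * f.[w] + b.[w] ^+ 2 * f^`().[w].
      by rewrite expr2 !derivM !hornerE; ring.
    have -> : (b * g * f)^`().[w] =
        b^`().[w] * g.[w] * f.[w] + b.[w] * g^`().[w] * f.[w] + b.[w] * g.[w] * f^`().[w].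
      by rewrite !derivM !hornerE; ring.
    have -> : (g * f)^`().[w] = g^`().[w] * f.[w] + g.[w] * f^`().[w] by rewrite !derivM !hornerE.
    have -> : (g ^+ 2 * f)^`().[w] = 2 * g.[w] * g^`().[w] * f.[w] + g.[w] ^+ 2 * f^`().[w].
      by rewrite expr2 !derivM !hornerE; ring.
    have -> : (f * g^`()).[w] = f.[w] * g^`().[w] by rewrite hornerM.
    rewrite (Re_mulJ (f.[w] * _)) (Re_mulJ f^`().[w]) => lap.
    by apply: (core_arith lap h1 h2); apply: sqr_ge0.
  have := le_rmean i3 i4 pw; rewrite m3 /rmean rintD //; last exact: intgZ.
  rewrite rintZ // mulrDr mulrCA -/(rmean _) -/(rmean _) m1 m2 => key.
  rewrite -subr_ge0 in key; apply: le_trans key _.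
  rewrite mulr_sumr -big_split -sumrB /=; apply: ler_sum => k _.
  rewrite le_eqVlt; apply/orP; left; apply/eqP.
  by rewrite /c xr /th /e2 /ga !coef_deriv theta_natM !Re_natM !Re_mulJ; ring.
(* Two primitives divide the k-th coefficient by (k + 1)^2: this cancels the factor brought by the
   derivatives and weights |f g'|^2 as required by [V_op]. *)
have h2 := nonneg_primitive hc; have h3 := @nonneg_primitive (fun k => c k / k.+1%:R) N _ h2.
have X0 : 0 < rho ^+ 2 by rewrite exprn_gt0.
have {h3 h2} h4 : 0 <= \sum_(k < N) c k / k.+1%:R / k.+1%:R * (rho ^+ 2) ^+ k.
  by apply: h3; rewrite lexx ltW.
have h5 : \sum_(k < N) ga k / k.+1%:R ^+ 2 * rho ^+ (2 * k.+1) <=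
    \sum_(k < N) (th k.+1 + L ^+ 2 * e2 k.+1) * rho ^+ (2 * k.+1).
  rewrite -subr_ge0 -sumrB; apply: le_trans (mulr_ge0 (ltW X0) h4) _.
  rewrite mulr_sumr; apply: ler_sum => k _; rewrite le_eqVlt; apply/orP; left; apply/eqP.
  rewrite /c mulnS exprD exprM; have : (k.+1%:R : R) != 0 by rewrite pnatr_eq0.
  by move: (k.+1%:R : R) => y y0; field.
apply: le_trans h5 _.
(* The missing term of index 0 is s^2 |f|^2 + L^2 |f|^2 at the origin, hence nonnegative. *)
have dom : \sum_(k < N) (th k.+1 + L ^+ 2 * e2 k.+1) * rho ^+ (2 * k.+1) <=
    \sum_(k < N.+1) (th k + L ^+ 2 * e2 k) * rho ^+ (2 * k).
  rewrite [leRHS]big_ord_recl /= lerDr muln0 expr0 mulr1 addr_ge0 //; last first.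
    by rewrite mulr_ge0 ?sqr_ge0.
  rewrite /th /theta -!horner_coef0 !hornerE.
  by rewrite theta_identity mulr_ge0 ?sqr_ge0.
apply: le_trans dom _.
have wS p : (size p <= N)%N -> (size p <= N.+1)%N by move=> /leq_trans; apply.
have hr : 0 <= rho <= rho by rewrite lexx ltW.
have [i1 m1] := @mean_theta rho (b * f) (b * f) (b ^+ 2 * f) f
    (b * g * f) (g * f) (g ^+ 2 * f) (g ^+ 2 * f) N.+1 ltac:(by rewrite /= !wS).
have [i2 m2] := mean_horner rho (wS _ sf) (wS _ sf).
(* On the circle of radius [rho] the four products recombine into s^2 |f|^2 <= L^2 |f|^2; together
   with the L^2 |f|^2 that comes from |f'|^2 this makes 2 L^2. *)
have pw t : 0 <= t <= 2 * pi -> theta (b * f).[rho%:C * cis t] (b * f).[rho%:C * cis t]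
      (b ^+ 2 * f).[rho%:C * cis t] f.[rho%:C * cis t]
      (b * g * f).[rho%:C * cis t] (g * f).[rho%:C * cis t]
      (g ^+ 2 * f).[rho%:C * cis t] (g ^+ 2 * f).[rho%:C * cis t] <=
     L ^+ 2 * Re (f.[rho%:C * cis t] * (f.[rho%:C * cis t])^*).
  move=> _; have /andP[h1 h2] := hs _ (wr rho t hr); move: h1 h2.
  move: (rho%:C * cis t) => w h1 h2; rewrite /theta !hornerE theta_identity Re_mulJ.
  have s0 : 0 <= Re b.[w] + cabs g.[w] ^+ 2 by apply: le_trans h1; rewrite invr_ge0.
  by rewrite ler_wpM2r ?sqr_ge0 // lerXn2r ?nnegrE.
have := le_rmean i1 (intgZ (L ^+ 2) i2) pw; rewrite m1 /rmean rintZ // mulrCA -/(rmean _) m2 => key.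
have -> : \sum_(k < N.+1) (th k + L ^+ 2 * e2 k) * rho ^+ (2 * k) =
   \sum_(k < N.+1) th k * rho ^+ (2 * k) + L ^+ 2 * \sum_(k < N.+1) e2 k * rho ^+ (2 * k).
  by rewrite mulr_sumr -big_split /=; apply: eq_bigr => k _; ring.
have eN : \sum_(k < N.+1) e2 k * rho ^+ (2 * k) = \sum_(k < N) e2 k * rho ^+ (2 * k).
  by rewrite big_ord_recr /= /e2 nth_default // cabs0 expr0n mul0r addr0.
have key' : \sum_(k < N.+1) th k * rho ^+ (2 * k) <= L ^+ 2 * \sum_(k < N.+1) e2 k * rho ^+ (2 * k).
  apply: le_trans key _; rewrite le_eqVlt; apply/orP; left; apply/eqP; congr (_ * _).
  by apply: eq_bigr => k _; rewrite Re_mulJ.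
apply: le_trans (lerD key' (lexx _)) _; rewrite eN le_eqVlt; apply/orP; left; apply/eqP.
by rewrite /e2; ring.
Qed.

End CorePoly.

(** * The embedding for power series *)

Section CarlesonPower.
Variable R : realType.
Local Notation C := R[i].
Implicit Types (z w : C) (r t : R) (a f : nat -> C).

Lemma geometric_eventually (K q e : R) : 0 <= K -> 0 <= q < 1 -> 0 < e ->
  exists N0, forall n, (N0 <= n)%N -> K * q ^+ n <= e.
Proof.
move=> K0 q01 e0; have [N hN] := exists_geometric_lt K q01 e0; exists N => n nN.
by apply: le_trans (ltW hN); case/andP: q01 => q0 /ltW q1; rewrite ler_wpM2l // ler_wiXn2l.
Qed.

Lemma powser_unif a (F : C -> C) (rho : R) : powser a F -> 0 <= rho < 1 ->
  exists2 K, 0 <= K & forall e, 0 < e -> exists N0, forall n z, (N0 <= n)%N -> cabs z <= rho ->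
   [/\ cabs (F z) <= K, cabs (psum a n z) <= 2 * K & cabs (F z - psum a n z) <= e].
Proof.
move=> ha hr; have [K [q [K0 q01 hK]]] := ha rho hr; exists K => // e e0.
have [N0 hN0] := geometric_eventually K0 q01 e0; exists N0 => n z nN zr.
have F0 := hK 0%N z zr; rewrite big_ord0 subr0 expr0 mulr1 in F0.
have Fn := hK n z zr; rewrite -/(psum a n z) in Fn.
split=> //; last exact: le_trans Fn (hN0 n nN).
rewrite mulr_natl mulr2n; apply: le_trans (cabs_dist _ (F z)) _; rewrite cabs_distC.
apply: lerD => //; apply: le_trans Fn _; rewrite ler_piMr //.
by case/andP: q01 => q0 /ltW q1; rewrite exprn_ile1.
Qed.

Lemma sqr_dist_le (x y K e : R) : 0 <= x -> 0 <= y -> x <= K -> y <= 2 * K -> `|x - y| <= e ->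
  `|x ^+ 2 - y ^+ 2| <= e * (3 * K).
Proof.
move=> x0 y0 xK yK h; rewrite subr_sqr normrM; apply: ler_pM => //.
by rewrite ger0_norm ?addr_ge0 //; lra.
Qed.

Lemma cabs_dist_norm z w : `|cabs z - cabs w| <= cabs (z - w).
Proof.
rewrite ler_norml; apply/andP; split.
  by have := cabs_dist w z; rewrite cabs_distC; lra.
by have := cabs_dist z w; lra.
Qed.

Lemma coef_trunc_deriv (f c : nat -> C) N k : (k.+1 < N)%N ->
  (trunc_poly f N * (trunc_poly c N)^`())`_k = conv f (deriv_coef c) k.
Proof.
move=> kN; rewrite coefM; apply: eq_bigr => j _.
have jk : (j <= k)%N by rewrite -ltnS.
rewrite coef_deriv !coef_poly (leq_ltn_trans jk (ltnW kN)).
by rewrite (leq_ltn_trans _ kN) ?ltnS ?leq_subr // /deriv_coef mulr_natl.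
Qed.

(** On a disk of radius [rho] < 1 the truncations of [g] and [b] keep s between 1/2 and L + 1, so
    [carleson_poly] applies to them; [bernoulli_le] then lets [rho] tend to 1. *)
Lemma carleson_powser (cg cb f : nat -> C) (g b : C -> C) (L M : R) :
  powser cg g -> powser cb b ->
  (forall z, cabs z < 1 -> 1 <= Re (b z) + cabs (g z) ^+ 2 <= L) ->
  (forall n, energy f n <= M) ->
  forall m, energy (prim_coef (conv f (deriv_coef cg))) m <= 2 * (L + 1) ^+ 2 * M.
Proof.
move=> hg hb hs hM m; apply: (@bernoulli_le _ _ _ (2 * m)); first exact: energy_ge0.
move=> rho /andP[rho0 rho1]; have hr : 0 <= rho < 1 by rewrite ltW.
have [K K0 hK] := powser_unif hg hr; have [Kb _ hKb] := powser_unif hb hr.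
have K3 : 0 < 3 * K + 1 by rewrite ltr_wpDl // mulr_ge0.
have V4 : 0 < (4^-1 : R) by [].
(* An error of at most 1/4 is allowed on |g|^2 and on Re b alike; an error e on [g] becomes 3 K e on
   |g|^2 by [sqr_dist_le]. *)
have [N1 h1] := hK _ (divr_gt0 V4 K3); have [N2 h2] := hKb _ V4.
(* More than m + 1 terms are kept, so that truncating leaves the first [m] coefficients of f g'
   unchanged. *)
pose N := maxn (maxn N1 N2) m.+2.
have n1 : (N1 <= N)%N by rewrite /N !leq_max leqnn.
have n2 : (N2 <= N)%N by rewrite /N !leq_max leqnn orbT.
have mN : (m.+1 < N)%N by rewrite /N !leq_max leqnn !orbT.
pose G := trunc_poly cg N; pose B := trunc_poly cb N; pose F := trunc_poly f N.
have close z : cabs z <= rho -> 2^-1 <= Re B.[z] + cabs G.[z] ^+ 2 <= L + 1.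
  move=> zr; rewrite /B /G !horner_trunc.
  have [g1 g2 g3] := h1 N z n1 zr; have [_ _ b3] := h2 N z n2 zr.
  have /andP[s1 s2] := hs z (le_lt_trans zr rho1).
  have d1 : `|cabs (g z) ^+ 2 - cabs (psum cg N z) ^+ 2| <= 4^-1.
    apply: le_trans (sqr_dist_le (cabs_ge0 _) (cabs_ge0 _) g1 g2
      (le_trans (cabs_dist_norm _ _) g3)) _.
    rewrite -mulrA ler_piMr // ?invr_ge0 // mulrC ler_pdivrMr // mul1r; lra.
  have d2 : `|Re (b z) - Re (psum cb N z)| <= 4^-1.
    by rewrite -ReB; apply: le_trans (normr_Re_le _) b3.
  move: d1 d2 s1 s2; clear; rewrite !ler_norml.
  move: (Re _) (Re _) (_ ^+ 2) (_ ^+ 2) => x y u v /andP[? ?] /andP[? ?] ? ?.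
  by apply/andP; split; lra.
pose S := [:: F; B * F; B ^+ 2 * F; G * F; B * G * F; G ^+ 2 * F; F * G^`()].
(* Products of truncations have larger degree than [N]; a single size bound is needed for all of
   them. *)
pose N' := (\max_(p <- S) size p + N)%N.
have sz p : p \in S -> (size p <= N')%N.
  move=> pS; rewrite /N' (leq_trans _ (leq_addr _ _)) //.
  exact: (leq_bigmax_seq p pS isT).
have key := carleson_poly rho0 close
  (sz F ltac:(by rewrite !inE eqxx ?orbT))
  (sz (B * F) ltac:(by rewrite !inE eqxx ?orbT))
  (sz (B ^+ 2 * F) ltac:(by rewrite !inE eqxx ?orbT))
  (sz (G * F) ltac:(by rewrite !inE eqxx ?orbT))
  (sz (B * G * F) ltac:(by rewrite !inE eqxx ?orbT))
  (sz (G ^+ 2 * F) ltac:(by rewrite !inE eqxx ?orbT))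
  (sz (F * G^`()) ltac:(by rewrite !inE eqxx ?orbT)).
apply: le_trans (le_trans _ key) _.
  apply: (@le_trans _ _ (energy (prim_coef (conv f (deriv_coef cg))) m.+1 * rho ^+ (2 * m))).
    by rewrite ler_wpM2r ?exprn_ge0 ?(ltW rho0) // energy_le.
  rewrite /energy big_ord_recl /= cabs0 expr0n /= add0r mulr_suml.
  rewrite -(big_mkord xpredT (fun k => cabs (F * G^`())`_k ^+ 2 / k.+1%:R ^+ 2 * rho ^+ (2 * k.+1))).
  have mN' : (m <= N')%N by rewrite (leq_trans _ (leq_addl _ _)) // ltnW // ltnW.
  rewrite (@big_cat_nat _ _ _ m) //= big_mkord.
  have nn j : 0 <= cabs (F * G^`())`_j ^+ 2 / j.+1%:R ^+ 2 * rho ^+ (2 * j.+1).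
    by apply: mulr_ge0; [apply: divr_ge0; apply: exprn_ge0 => //; apply: cabs_ge0|
      apply: exprn_ge0; apply: ltW].
  apply: (@le_trans _ _ (\sum_(j < m) cabs (F * G^`())`_j ^+ 2 / j.+1%:R ^+ 2 * rho ^+ (2 * j.+1))).
    apply: ler_sum => j _; rewrite coef_trunc_deriv; last first.
      by apply: leq_ltn_trans mN; rewrite ltnS ltnW.
    rewrite cabsM cabsV cabs_nat exprMn exprVn.
    apply: ler_wpM2l; first by apply: divr_ge0; apply: exprn_ge0 => //; apply: cabs_ge0.
    by rewrite ler_wiXn2l ?(ltW rho0) ?(ltW rho1) // leq_mul2l ltn_ord orbT.
  by rewrite lerDl; apply: sumr_ge0 => j _; apply: nn.
apply: ler_wpM2l; first by rewrite mulr_ge0 ?sqr_ge0.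
apply: le_trans (hM N'); apply: ler_sum => k _.
rewrite /F coef_poly; case: ifP => _; last by rewrite cabs0 expr0n mul0r sqr_ge0.
by rewrite ler_piMr ?sqr_ge0 // exprn_ile1 ?(ltW rho0) ?(ltW rho1).
Qed.

End CarlesonPower.

(** * Boundary values in mean square *)

Section Periodic.
Variable R : realType.
Local Notation C := R[i].
Local Notation mu := (@lebesgue_measure R).
Local Notation T := (2 * pi : R).
Implicit Types (u v : R -> R) (a b c : R).

Lemma shift_preimage_itv ba bb a b c :
  (fun x : R => x + c) @^-1` [set` Interval (BSide ba a) (BSide bb b)] =
  [set` Interval (BSide ba (a - c)) (BSide bb (b - c))].
Proof.
apply/seteqP; split => x /=; rewrite !in_itv /=; case: ba; case: bb => /=;
  by rewrite ?lerBlDr ?ltrBlDr ?lerBrDr ?ltrBrDr.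
Qed.

Lemma measurable_shift c : measurable_fun [set: R] (fun x : R => x + c).
Proof. by apply: measurable_funD => //; exact: measurable_cst. Qed.

(** By uniqueness of the measure with the given values on half-open intervals. *)
Lemma lebesgue_measure_shift c (A : set R) : measurable A ->
  pushforward mu ((fun x : R => x + c) : _ -> measurableTypeR R) A = mu A.
Proof.
have mphi : measurable_fun [set: measurableTypeR R] ((fun x : R => x + c) : measurableTypeR R -> measurableTypeR R).
  exact: measurable_shift.
move=> mA; apply/esym/lebesgue_measure_unique => //= _ [[a b]] _ <-.
rewrite /pushforward /= shift_preimage_itv !lebesgue_measure_itv /= !lte_fin.
rewrite ltrD2r; case: ifP => // _; rewrite -!EFinD; congr (_%:E); ring.
Qed.

Lemma ge0_integral_shift c (D : set R) (f : R -> \bar R) : measurable D ->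
  measurable_fun [set: R] f -> (forall t, 0 <= f t)%E ->
  (\int[mu]_(x in (fun x => x + c)%R @^-1` D) f (x + c)%R = \int[mu]_(x in D) f x)%E.
Proof.
move=> mD mf f0.
have mphi : measurable_fun [set: measurableTypeR R] ((fun x : R => x + c) : measurableTypeR R -> measurableTypeR R).
  exact: measurable_shift.
have h := @ge0_integral_pushforward _ _ _ _ R _ mphi mu D f mD (measurable_funTS mf) (fun x _ => f0 x).
rewrite -h; apply: eq_measure_integral => //= A mA AS; exact: lebesgue_measure_shift.
Qed.

Lemma intg_shift c a b u : measurable_fun setT u ->
  intg (a + c) (b + c) u -> intg a b (fun t => u (t + c)).
Proof.
move=> mf /integrableP[_ h]; apply/integrableP; split.
  by apply/measurable_EFinP/measurable_funTS; exact: (measurableT_comp mf (measurable_shift c)).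
apply: le_lt_trans h; rewrite -(@ge0_integral_shift c `[a + c, b + c]%classic (fun x => `|(u x)%:E|%E)) //; last first.
  by apply: (@measurableT_comp _ _ _ _ _ _ (@abse R)) => //; exact/measurable_EFinP.
by rewrite shift_preimage_itv !addrK.
Qed.

Lemma rint_shift c a b u : measurable_fun setT u ->
  intg (a + c) (b + c) u -> rint a b (fun t => u (t + c)) = rint (a + c) (b + c) u.
Proof.
move=> mf ih; rewrite /rint /Rintegral; congr (fine _).
have mphi : measurable_fun [set: measurableTypeR R] ((fun x : R => x + c) : measurableTypeR R -> measurableTypeR R).
  exact: measurable_shift.
have E : ((fun x : R => x + c) @^-1` `[a + c, b + c]) = `[a, b]%classic.
  by rewrite shift_preimage_itv !addrK.
have I : mu.-integrable ((fun x : R => x + c) @^-1` `[a + c, b + c]) ((EFin \o u) \o (fun x => x + c)).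
  by rewrite E; exact: intg_shift.
have h := @integral_pushforward _ _ _ _ R _ mphi mu `[a + c, b + c]%classic (EFin \o u).
rewrite -[LHS]/(\int[mu]_(t in `[a, b]) (((EFin \o u) \o (fun x => x + c)%R) t))%E -E.
rewrite -h //; last by exact/measurable_EFinP.
by apply: eq_measure_integral => //= A mA AS; exact: lebesgue_measure_shift.
Qed.

Lemma intg_cat a b c u : measurable_fun setT u -> a <= b -> b <= c ->
  intg a b u -> intg b c u -> intg a c u.
Proof.
move=> mf ab bc /integrableP[_ h1] /integrableP[_ h2]; apply/integrableP; split.
  by apply/measurable_EFinP/measurable_funTS.
have mn : measurable_fun setT (fun x => `|(EFin \o u) x|%E).
  by apply: (@measurableT_comp _ _ _ _ _ _ (@abse R)) => //; exact/measurable_EFinP.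
have E : `[a, c]%classic = `[a, b]%classic `|` `]b, c]%classic.
  apply/seteqP; split => t /=; rewrite !in_itv /=.
    move=> /andP[k1 k2]; have [h3|h3] := leP t b; first by left; rewrite k1.
    by right; rewrite k2.
  case=> /andP[k1 k2]; first by rewrite k1 (le_trans k2 bc).
  by rewrite k2 (le_trans ab (ltW k1)).
rewrite E ge0_integral_setU //; last first.
- apply/disj_setPS => t /= [] /=; rewrite !in_itv /= => /andP[_ k1] /andP[k2 _].
  by move: (le_lt_trans k1 k2); rewrite ltxx.
- exact: measurable_funTS.
apply: lte_add_pinfty => //; apply: le_lt_trans h2.
apply: ge0_subset_integral => //; first exact: measurable_funTS.
by move=> t /=; rewrite !in_itv /= => /andP[/ltW -> ->].
Qed.

Section PeriodicFun.
Variable u : R -> R.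
Hypothesis mu' : measurable_fun setT u.
Hypothesis pu : forall t, u (t + T) = u t.
Hypothesis iu : intg 0 T u.

Lemma periodic_natmul n t : u (t + n%:R * T) = u t.
Proof.
elim: n t => [|n IH] t; first by rewrite mul0r addr0.
by rewrite (_ : t + n.+1%:R * T = t + n%:R * T + T) ?pu ?IH // -natr1; ring.
Qed.

Lemma intg_periodic_nat n : intg 0 (n%:R * T) u.
Proof.
have T0 : 0 <= T by rewrite ltW // twopi_gt0.
elim: n => [|n IH]; first by rewrite mul0r; apply: intg_sub iu => //.
have nT : 0 <= n%:R * T by rewrite mulr_ge0 // ler0n.
apply: (@intg_cat _ (n%:R * T)) => //.
  by rewrite ler_wpM2r // ler_nat.
rewrite (_ : n.+1%:R * T = n%:R * T + T); last by rewrite -natr1; ring.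
have := @intg_shift (- (n%:R * T)) (n%:R * T) (n%:R * T + T) u mu'.
rewrite subrr addrAC subrr add0r => /(_ iu); apply: eq_intg => t _.
by rewrite -(periodic_natmul n) addrNK.
Qed.

Lemma intg_periodic a b : intg a b u.
Proof.
have T0 := twopi_gt0 R.
have [n hn] : exists n, - a <= n%:R * T /\ b <= n%:R * T.
  have [i hi] : exists i, Num.max (- a) b <= i%:R * T.
    exists (Num.bound `|Num.max (- a) b / T|).
    by rewrite -ler_pdivrMr //; apply: (le_trans (ler_norm _)); apply: ltW; exact: archi_boundP.
  by exists i; split; apply: le_trans hi; rewrite le_max lexx ?orbT.
apply: (@intg_sub _ (- (n%:R * T)) (n%:R * T)); first by rewrite lerNl; case: hn.
  by case: hn.
have nT : 0 <= n%:R * T by rewrite mulr_ge0 // ?ler0n // ltW.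
apply: (@intg_cat _ 0) => //; [by rewrite oppr_le0| |exact: intg_periodic_nat].
have := @intg_shift (n%:R * T) (- (n%:R * T)) 0 u mu'.
rewrite addNr add0r => /(_ (intg_periodic_nat n)); apply: eq_intg => t _.
exact: periodic_natmul.
Qed.

Lemma rint_shift_period a b : rint (a + T) (b + T) u = rint a b u.
Proof.
rewrite -(rint_shift mu') ?intg_periodic //; last exact: intg_periodic.
by apply: eq_rint => t _; rewrite pu.
Qed.

Lemma rint_periodic a : rint a (a + T) u = rint 0 T u.
Proof.
have T0 := twopi_gt0 R; have ip := intg_periodic; have [a0|/ltW a0] := leP 0 a.
  have E : rint T (a + T) u = rint 0 a u by rewrite -(rint_shift_period 0 a) add0r.
  have h1 : a <= a + T by rewrite lerDl ltW.
  have h2 : T <= a + T by rewrite lerDr.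
  have := rint_chasles a0 h1 (ip _ _); rewrite (rint_chasles (ltW T0) h2 (ip _ _)) E.
  by rewrite [LHS]addrC => /addrI.
have E : rint (a + T) T u = rint a 0 u by rewrite -(rint_shift_period a 0) add0r.
have h1 : a <= a + T by rewrite lerDl ltW.
have h2 : a + T <= T by rewrite gerDr.
have := rint_chasles h1 h2 (ip _ _); rewrite (rint_chasles a0 (ltW T0) (ip _ _)) E.
by rewrite [RHS]addrC => /addrI.
Qed.

End PeriodicFun.
End Periodic.

(** * Boundary values as mean-square limits of Taylor polynomials *)

Section Boundary.
Variable R : realType.
Local Notation C := R[i].
Local Notation mu := (@lebesgue_measure R).
Local Notation T := (2 * pi : R).

Lemma ae_imp (P Q : R -> Prop) : (forall t, P t -> Q t) ->
  {ae mu, forall t, P t} -> {ae mu, forall t, Q t}.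
Proof.
move=> h [N [mN N0 hN]]; exists N; split => // t /= ht; apply: hN => /= Pt.
exact/ht/h.
Qed.

Lemma ae_and (P Q : R -> Prop) : {ae mu, forall t, P t} -> {ae mu, forall t, Q t} ->
  {ae mu, forall t, P t /\ Q t}.
Proof.
move=> h1 h2; apply: (negligibleS _ (negligibleU h1 h2)) => t /= /not_andP[]; by [left|right].
Qed.

(** Fatou's lemma for almost everywhere limits; it also supplies the integrability of the limit. *)
Lemma rint_fatou (a b K : R) (v : nat -> R -> R) (w : R -> R) :
  measurable_fun setT w ->
  (forall n, intg a b (v n)) -> (forall n t, 0 <= v n t) -> (forall t, 0 <= w t) ->
  (forall n, rint a b (v n) <= K) ->
  {ae mu, forall t, a <= t <= b -> v n t @[n --> \oo] --> w t} ->
  intg a b w /\ rint a b w <= K.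
Proof.
move=> mw iv v0 w0 vK vw; have mI : measurable `[a, b]%classic by [].
have mv n : measurable_fun `[a, b] (EFin \o v n) by have /integrableP[] := iv n.
have mEw : measurable_fun `[a, b] (EFin \o w) by exact/measurable_EFinP/measurable_funTS.
have key : (\int[mu]_(t in `[a, b]) (w t)%:E <= K%:E)%E.
  rewrite (@ge0_ae_eq_integral _ _ _ mu `[a, b]%classic (EFin \o w)
    (fun t => limn_einf (fun n => (v n t)%:E))) //; first last.
  - apply: ae_imp vw => t h0; rewrite /= in_itv /= => /h0 h; apply/esym.
    have hc : (v n t)%:E @[n --> \oo] --> (w t)%:E by apply: cvg_EFin => //; apply: nearW.
    by have [-> _] := cvg_limn_einf_sup hc.
  - move=> t _; rewrite limn_einf_lim; apply: lime_ge; first exact: is_cvg_einfs.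
    by apply: nearW => n; apply: le_ereal_inf_tmp => _ [m /= nm <-]; rewrite lee_fin.
  - by move=> t _; rewrite lee_fin.
  - rewrite (_ : (fun t => _) = (fun t => - limn_esup (fun n => (- v n t)%:E))%E); last first.
      by apply/funext => t.
    apply: measurableT_comp => //; apply: measurable_fun_limn_esup => n.
    have /measurable_EFinP h := mv n; apply/measurable_EFinP; exact: measurableT_comp.
  have f0 n t : `[a, b]%classic t -> (0 <= (EFin \o v n) t)%E by move=> _; rewrite lee_fin.
  apply: le_trans (fatou mu mI mv f0) _.
  rewrite limn_einf_lim; apply: lime_le; first exact: is_cvg_einfs.
  apply: nearW => n; apply: (@le_trans _ _ (\int[mu]_(t in `[a, b]) (v n t)%:E)%E).
    by apply: ereal_inf_lbound; exists n => /=.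
  have fi : (\int[mu]_(t in `[a, b]) (v n t)%:E)%E \is a fin_num by exact: integrable_fin_num (iv n).
  by rewrite -(fineK fi) lee_fin; exact: vK.
have iw : intg a b w.
  apply/integrableP; split => //; apply: le_lt_trans (ltry K).
  apply: le_trans key; rewrite le_eqVlt; apply/orP; left; apply/eqP.
  by apply: eq_integral => t _; rewrite /= ger0_norm.
split => //; have fi : (\int[mu]_(t in `[a, b]) (w t)%:E)%E \is a fin_num by exact: integrable_fin_num iw.
by rewrite -lee_fin /rint /Rintegral fineK.
Qed.

(** A sequence of radii, as Fatou's lemma needs a sequence while radial limits run over all r. *)
Definition rad (n : nat) : R := 1 - n.+2%:R^-1.

Lemma rad_itv n : 0 <= rad n < 1.
Proof.
rewrite /rad subr_ge0 invf_le1 ?ltr0n // ler1n /= ltrBlDr ltrDl.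
by rewrite invr_gt0 ltr0n.
Qed.

Lemma rad_cvg : rad n @[n --> \oo] --> (1 : R)^'-.
Proof.
move=> A [d /= d0 hA]; exists (Num.bound d^-1) => // n /= hn; apply: hA.
  rewrite /ball /= /rad opprB addrC subrK ger0_norm ?invr_ge0 ?ler0n //.
  rewrite invf_plt ?posrE ?ltr0n //; apply: lt_le_trans (archi_boundP _) _.
    by rewrite invr_ge0 ltW.
  by rewrite ler_nat (leq_trans hn) // ltnW.
by have /andP[] := rad_itv n.
Qed.

Definition tail N (a : nat -> C) k : C := if (k < N)%N then 0 else a k.

Lemma psum_tail_coef (a : nat -> C) m n z : (m <= n)%N ->
  psum (tail m a) n z = psum a n z - psum a m z.
Proof.
move=> mn; rewrite -(subnKC mn); elim: (n - m)%N => [|k IH].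
  by rewrite addn0 subrr /psum big1 // => j _; rewrite /tail ltn_ord mul0r.
by rewrite addnS !psumS IH /tail ltnNge leq_addr /= addrAC.
Qed.

Lemma energy_tailE (a : nat -> C) m n : (m <= n)%N -> energy (tail m a) n = energy a n - energy a m.
Proof.
move=> mn; rewrite -(subnKC mn); elim: (n - m)%N => [|k IH].
  by rewrite addn0 subrr /energy big1 // => j _; rewrite /tail ltn_ord cabs0 expr0n.
by rewrite addnS !energyS IH /tail ltnNge leq_addr /= addrAC.
Qed.

Lemma powser_tail N a f : powser a f -> powser (tail N a) (fun z => f z - psum a N z).
Proof.
move=> h rho hr; have [K [q [K0 q01 hK]]] := h rho hr; exists K, q; split => // n z hz.
have [nN|Nn] := ltnP n N.
  rewrite big1 ?subr0; last first.
    by move=> k _; rewrite /tail (ltn_trans (ltn_ord k) nN) mul0r.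
  apply: le_trans (hK N z hz) _; rewrite ler_wpM2l //.
  by case/andP: q01 => q0 q1; apply: ler_wiXn2l => //; [exact: ltW|exact: ltnW].
rewrite -/(psum (tail N a) n z) psum_tail_coef //.
by rewrite opprB addrA addrNK hK.
Qed.

Lemma energy_tail_coef N a (M : R) : (forall n, (N <= n)%N -> energy a n - energy a N <= M) ->
  forall n, energy (tail N a) n <= M.
Proof.
move=> h n; have [nN|Nn] := ltnP n N; last by rewrite energy_tailE // h.
by apply: le_trans (energy_le (tail N a) (ltnW nN)) _; rewrite energy_tailE // h.
Qed.

Lemma radial_ccvg (g : C -> C) (w l : C) : g (r%:C * w) @[r --> (1 : R)^'-] --> l ->
  ccvg (fun n => g ((rad n)%:C * w)) l.
Proof.
move=> h e e0.
have : \forall r \near (1 : R)^'-, cabs (l - g (r%:C * w)) < e by apply: (cabs_cvgP _ _ _).1 h e e0.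
by move=> /rad_cvg [N _ hN]; exists N => n Nn; rewrite cabs_distC; apply: hN.
Qed.

Lemma rad_ccvg (w : C) : ccvg (fun n => (rad n)%:C * w) w.
Proof.
move=> e e0; exists (Num.bound (cabs w / e)) => n hn.
have -> : (rad n)%:C * w - w = (- n.+2%:R^-1 : R)%:C * w.
  by rewrite -{2}[w]mul1r -mulrBl -(rmorph1 (real_complex R)) -rmorphB /rad addrAC subrr add0r.
rewrite cabsM cabs_real normrN ger0_norm ?invr_ge0 ?ler0n //.
rewrite mulrC ltr_pdivrMr ?ltr0n // mulrC -ltr_pdivrMr //.
apply: lt_le_trans (archi_boundP _) _; first by rewrite divr_ge0 ?cabs_ge0 // ltW.
by rewrite ler_nat (leq_trans hn) // -addn2 leq_addr.
Qed.

Lemma circle_intg_sqr a g (r : R) : powser a g -> 0 <= r < 1 ->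
  intg 0 T (fun t => cabs (g (r%:C * cis t)) ^+ 2).
Proof.
move=> ha hr; have ic := ccont_cintg (ccontM (powser_cper ha hr) (ccontJ (powser_cper ha hr))).
by case: ic => + _; apply: eq_intg => t _ /=; rewrite mulJ_cabs.
Qed.

Lemma circle_rmean_sqr_le a g (r M : R) : powser a g -> 0 <= r < 1 ->
  (forall n, energy a n <= M) -> rmean (fun t => cabs (g (r%:C * cis t)) ^+ 2) <= M.
Proof.
move=> ha hr hM; have := (hardy_sqnorm_le M ha).2 hM.
have : (circle_sqnorm (dilation r g) <= hardy_sqnorm g)%E.
  by apply: ereal_sup_ubound; exists r => //=; rewrite in_itv.
move=> h1 h2; have := le_trans h1 h2; rewrite (circle_sqnormE ha hr) lee_fin.
apply: le_trans; rewrite le_eqVlt; apply/orP; left; apply/eqP.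
by rewrite Re_cmean /rmean; congr (_ * _); apply: eq_rint => t _; rewrite mulJ_cabs.
Qed.

Lemma ccvg_cabs_sqr (p : nat -> C) (l : C) : ccvg p l ->
  cabs (p n) ^+ 2 @[n --> \oo] --> cabs l ^+ 2.
Proof.
move=> h; have hc : cabs (p n) @[n --> \oo] --> cabs l.
  apply/cvgrPdist_lt => e e0; have [N hN] := h e e0; exists N => // n /= Nn.
  by apply: le_lt_trans (hN n Nn); rewrite distrC; exact: cabs_dist_norm.
by rewrite expr2; under eq_fun do rewrite expr2; exact: cvgM.
Qed.

Lemma ccvg_psum a N (p : nat -> C) l : ccvg p l -> ccvg (fun n => psum a N (p n)) (psum a N l).
Proof.
move=> h; have hX k : ccvg (fun n => p n ^+ k) (l ^+ k).
  elim: k => [|k IH]; first exact: ccvg_cst.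
  rewrite exprS; apply: (ccvg_ext (u := fun n => p n * p n ^+ k)); last exact: ccvgM.
  by move=> n; rewrite exprS.
elim: N => [|N IH].
  by rewrite psum0; apply: (ccvg_ext (u := fun=> 0)) => [n|]; [rewrite psum0|exact: ccvg_cst].
rewrite psumS; apply: (ccvg_ext (u := fun n => psum a N (p n) + a N * p n ^+ N)).
  by move=> n; rewrite psumS.
by apply: ccvgD => //; apply: ccvgZ.
Qed.

Lemma cmeas_psum a N : cmeas (fun t : R => psum a N (cis t)).
Proof.
rewrite /psum; elim: N => [|N IH].
  by under eq_fun do rewrite big_ord0; exact: cmeas_cst.
under eq_fun do rewrite big_ord_recr /=; apply: cmeasD => //.
apply: cmeasM; first exact: cmeas_cst.
elim: N {IH} => [|N IH]; first by under eq_fun do rewrite expr0; exact: cmeas_cst.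
by under eq_fun do rewrite exprS; apply: cmeasM => //; exact: cmeas_cis.
Qed.

(** Fatou's lemma along the radii [rad n] for [g] minus its Taylor polynomial, whose circle means
    are bounded by the tail energy. *)
Lemma boundary_L2_diff a g F N (M : R) : powser a g ->
  (forall n, (N <= n)%N -> energy a n - energy a N <= M) -> boundary_value g F ->
  intg 0 T (fun t => cabs (F (cis t) - psum a N (cis t)) ^+ 2) /\
  rmean (fun t => cabs (F (cis t) - psum a N (cis t)) ^+ 2) <= M.
Proof.
move=> ha hM hF; have hb := powser_tail N ha; have hE := energy_tail_coef hM.
have T0 := twopi_gt0 R.
pose v n t := cabs (g ((rad n)%:C * cis t) - psum a N ((rad n)%:C * cis t)) ^+ 2.
have [] := @rint_fatou 0 T (T * M) v (fun t => cabs (F (cis t) - psum a N (cis t)) ^+ 2).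
- apply: measurable_funX.
  exact: (cmeas_cabs (cmeasB (hF.1 : cmeas (F \o @cis R)) (cmeas_psum a N))).
- by move=> n; have := circle_intg_sqr hb (rad_itv n); exact.
- by move=> n t; rewrite sqr_ge0.
- by move=> t; rewrite sqr_ge0.
- move=> n; have := circle_rmean_sqr_le hb (rad_itv n) hE.
  by rewrite /rmean mulrC ler_pdivrMr // [M * _]mulrC.
- apply: ae_imp hF.2 => t ht _; apply: ccvg_cabs_sqr; apply: ccvgB.
    exact: radial_ccvg.
  by apply: ccvg_psum; exact: rad_ccvg.
by move=> i1 i2; split => //; rewrite /rmean mulrC ler_pdivrMr // [M * _]mulrC.
Qed.

(** Makes the Taylor polynomials the Lipschitz approximants required by the John-Nirenberg
    argument. *)
Lemma psum_cis_lip a N : exists2 K : R, 0 <= K & forall s t : R,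
  cabs (psum a N (cis s) - psum a N (cis t)) <= K * `|s - t|.
Proof.
have hX k s t : cabs (cis s ^+ k - cis t ^+ k : C) <= (2 * k%:R) * `|s - t|.
  elim: k => [|k IH]; first by rewrite subrr cabs0 mulr0 mul0r.
  have -> : cis s ^+ k.+1 - cis t ^+ k.+1 =
            cis s * (cis s ^+ k - cis t ^+ k) + (cis s - cis t) * cis t ^+ k :> C.
    by rewrite !exprS; ring.
  apply: le_trans (cabsD _ _) _; rewrite !cabsM cabsX !cabs_cis expr1n mul1r mulr1.
  apply: le_trans (lerD IH (cis_lip s t)) _.
  by rewrite -mulrDl -[k.+1%:R]natr1 (mulrDr 2) mulr1.
elim: N => [|N [K K0 IH]]; first by exists 0 => // s t; rewrite !psum0 subr0 cabs0 mul0r.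
exists (K + cabs (a N) * (2 * N%:R)) => [|s t].
  by rewrite addr_ge0 // mulr_ge0 ?cabs_ge0 // mulr_ge0.
rewrite !psumS (_ : _ - _ = psum a N (cis s) - psum a N (cis t) + a N * (cis s ^+ N - cis t ^+ N)).
  apply: le_trans (cabsD _ _) _; rewrite cabsM mulrDl; apply: lerD => //.
  by rewrite -mulrA ler_wpM2l ?cabs_ge0.
by ring.
Qed.

Lemma boundary_approx a g F (M e : R) : powser a g -> (forall n, energy a n <= M) ->
  boundary_value g F -> 0 < e -> exists N, forall n, (N <= n)%N ->
  intg 0 T (fun t => cabs (F (cis t) - psum a n (cis t)) ^+ 2) /\
  rmean (fun t => cabs (F (cis t) - psum a n (cis t)) ^+ 2) <= e.
Proof.
move=> ha hM hF e0; have [N hN] := energy_tail hM e0; exists N => n Nn.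
apply: boundary_L2_diff ha _ hF => m nm; apply: ltW; apply: le_lt_trans (hN m (leq_trans Nn nm)).
by rewrite lerD2l lerN2 energy_le.
Qed.

End Boundary.

(** * The John-Nirenberg inequality *)

Section Averages.
Variable R : realType.
Local Notation C := R[i].
Implicit Types (a b : R) (p : R -> C) (w : R -> R).

Definition av a b p : C := ((b - a)^-1)%:C * cint a b p.
Definition rav a b w : R := (b - a)^-1 * rint a b w.

Lemma ravK a b w : a < b -> rint a b w = (b - a) * rav a b w.
Proof.
move=> ab; rewrite /rav mulrA divff ?mul1r // subr_eq0.
by apply: contraTneq ab => ->; rewrite ltxx.
Qed.

Lemma avB_cst a b p c : a < b -> cintg a b p -> av a b (fun t => p t - c) = av a b p - c.
Proof.
move=> ab ip; rewrite /av cintB //; last exact: cintg_cst.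
rewrite cint_cst ?ltW // mulrBr; congr (_ - _); rewrite mulrCA -rmorphM mulVf ?mulr1 //.
by rewrite subr_eq0; apply: contraTneq ab => ->; rewrite ltxx.
Qed.

Lemma cabs_av_le a b p : a < b -> cmeas p -> cintg a b p ->
  cabs (av a b p) <= rav a b (@cabs R \o p).
Proof.
move=> ab mp ip; have b0 : 0 <= (b - a)^-1 by rewrite invr_ge0 subr_ge0 ltW.
rewrite /av cabsM cabs_real ger0_norm // /rav ler_wpM2l //.
by apply: cabs_cint => //; exact: intg_cabs.
Qed.

Lemma midP a b : a < b -> [/\ a < (a + b) / 2, (a + b) / 2 < b,
  (a + b) / 2 - a = (b - a) / 2 & b - (a + b) / 2 = (b - a) / 2].
Proof. by move=> ab; split; lra. Qed.

Lemma av_half a b p : a < b -> cintg a b p ->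
  av a b p = 2^-1 * (av a ((a + b) / 2) p + av ((a + b) / 2) b p).
Proof.
move=> ab ip; have [h1 h2 h3 h4] := midP ab.
rewrite {1}/av (cint_chasles (ltW h1) (ltW h2) ip) /av h3 h4 invf_div -mulrDr.
rewrite mulrA; congr (_ * _); rewrite [RHS]mulrC rmorphM /= -(rmorph_nat (real_complex R)).
by rewrite mulrAC -(fmorphV (real_complex R)) -rmorphM divff ?mul1r // pnatr_eq0.
Qed.

Lemma rav_half a b w : a < b -> intg a b w ->
  rav a b w = (rav a ((a + b) / 2) w + rav ((a + b) / 2) b w) / 2.
Proof.
move=> ab ip; have [h1 h2 h3 h4] := midP ab.
rewrite {1}/rav (rint_chasles (ltW h1) (ltW h2) ip) /rav h3 h4 invf_div -mulrDr.
by field; rewrite subr_eq0; apply: contraTneq ab => ->; rewrite ltxx.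
Qed.

Lemma rav_le a b w v : a < b -> intg a b w -> intg a b v ->
  (forall t, a <= t <= b -> w t <= v t) -> rav a b w <= rav a b v.
Proof.
by move=> ab iw iv h; rewrite /rav ler_wpM2l ?ler_rint // invr_ge0 subr_ge0 ltW.
Qed.

Lemma rav_ge0 a b w : a < b -> (forall t, a <= t <= b -> 0 <= w t) -> 0 <= rav a b w.
Proof. by move=> ab h; rewrite /rav mulr_ge0 ?rint_ge0 // invr_ge0 subr_ge0 ltW. Qed.

Lemma rav_cst a b k : a < b -> rav a b (fun=> k) = k.
Proof.
move=> ab; rewrite /rav rint_cst ?ltW // mulrCA mulVf ?mulr1 // subr_eq0.
by apply: contraTneq ab => ->; rewrite ltxx.
Qed.

(** Cauchy-Schwarz, from the nonnegative average of (w - s)^2 with s the average of [w]. *)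
Lemma sqr_rav_le a b w : a < b -> intg a b w -> intg a b (fun t => w t ^+ 2) ->
  rav a b w ^+ 2 <= rav a b (fun t => w t ^+ 2).
Proof.
move=> ab iw iw2; set s := rav a b w.
have : 0 <= rav a b (fun t => (w t ^+ 2 - 2 * s * w t) + s ^+ 2).
  apply: rav_ge0 => // t _; rewrite (_ : _ + _ = (w t - s) ^+ 2) ?sqr_ge0 //; ring.
have i1 := intgZ (2 * s) iw; have i2 := intgB iw2 i1; have i3 := intg_cst a b (s ^+ 2).
have -> : rav a b (fun t => (w t ^+ 2 - 2 * s * w t) + s ^+ 2) =
    rav a b (fun t => w t ^+ 2) - 2 * s * rav a b w + rav a b (fun=> s ^+ 2).
  by rewrite /rav (rintD i2 i3) (rintB iw2 i1) (rintZ _ iw); ring.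
rewrite rav_cst // -/s; move: (rav a b _) => x; clearbody s => h; nra.
Qed.

End Averages.

Lemma child_arith (R : realType) (M x y z v : R) : z <= 64 * M * M -> v <= 36 * (M * M) ->
  64 * M * (4 * M) <= 64 * M * x -> y <= 2 * z + 2 * v -> 0 <= M * M -> y <= 64 * M * x.
Proof.
by rewrite -!mulrA [M * (4 * M)]mulrCA; move: (M * M) (M * x) => q r; lra.
Qed.

Lemma osc_arith (R : realType) (d S x p q : R) : d * S <= x ->
  4 * (x + (p + S + q) * d) <= 8 * x + 4 * d * p + 4 * d * q.
Proof. by nra. Qed.

(** * Dyadic oscillations, in mean and in mean square *)

Section JohnNirenberg.
Variable R : realType.
Local Notation C := R[i].
Variable T M : R.
Variable u : R -> C.
Hypothesis M0 : 0 <= M.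
Hypothesis mu' : cmeas u.
Hypothesis iu : forall a b, cintg a b u.
Hypothesis bmo : forall a b, a < b -> b <= a + T ->
  rav a b (fun t => cabs (u t - av a b u)) <= M.
Implicit Types (a b : R) (c : C).

Let M4 : M <= 4 * M. Proof. by have h := M0; lra. Qed.
Let M64 : 4 * M <= 64 * M. Proof. by have h := M0; lra. Qed.

Local Notation mid a b := ((a + b) / 2).

(** Average of |u_I - c| over the 2^N dyadic subintervals I, where u_I is the average of [u] on I.
    With finitely many generations the stopping-time argument becomes an induction on N. *)
Fixpoint dy1 N a b c : R := if N is N'.+1
  then (dy1 N' a (mid a b) c + dy1 N' (mid a b) b c) / 2 else cabs (av a b u - c).

Fixpoint dy2 N a b c : R := if N is N'.+1
  then (dy2 N' a (mid a b) c + dy2 N' (mid a b) b c) / 2 else cabs (av a b u - c) ^+ 2.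

Let iuc a b c : intg a b (fun t => cabs (u t - c)).
Proof.
by apply: (intg_cabs (p := fun t => u t - c)); [apply: cmeasB => //; exact: cmeas_cst|
  apply: cintgB => //; exact: cintg_cst].
Qed.

Lemma av_dist a b c : a < b -> cabs (av a b u - c) <= rav a b (fun t => cabs (u t - c)).
Proof.
move=> ab; rewrite -avB_cst //; apply: (cabs_av_le ab).
  by apply: cmeasB => //; exact: cmeas_cst.
by apply: cintgB => //; exact: cintg_cst.
Qed.

Lemma av_half_sub a b c : a < b -> av a b u - c =
  2^-1 * ((av a (mid a b) u - c) + (av (mid a b) b u - c)).
Proof.
by move=> ab; rewrite (av_half ab (iu a b)); field.
Qed.

Lemma av_le_dy1 N a b c : a < b -> cabs (av a b u - c) <= dy1 N a b c.
Proof.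
elim: N a b c => [|N IH] a b c ab //=; have [h1 h2 _ _] := midP ab.
rewrite av_half_sub // cabsM mulrC (_ : cabs 2^-1 = 2^-1); last by rewrite cabsV cabs_nat.
by rewrite ler_wpM2r ?invr_ge0 //; apply: le_trans (cabsD _ _) _; apply: lerD; exact: IH.
Qed.

Lemma dy1_le N a b c : a < b -> dy1 N a b c <= rav a b (fun t => cabs (u t - c)).
Proof.
elim: N a b c => [|N IH] a b c ab /=; first exact: av_dist.
have [h1 h2 _ _] := midP ab; rewrite (rav_half ab (iuc _ _ _)).
by rewrite ler_wpM2r ?invr_ge0 // lerD ?IH.
Qed.

Lemma sqr_cabsD_le (z w : C) : cabs (z + w) ^+ 2 <= 2 * cabs z ^+ 2 + 2 * cabs w ^+ 2.
Proof.
have := cabsD z w; have := cabs_ge0 (z + w); have := cabs_ge0 z; have := cabs_ge0 w.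
move: (cabs (z + w)) (cabs z) (cabs w) => s x y x0 y0 s0 h.
have h1 : s * s <= (x + y) * (x + y) by rewrite ler_pM // addrC.
have h2 := sqr_ge0 (y - x); rewrite !expr2 in h2 *; lra.
Qed.

Lemma dy2_recenter N a b c d : dy2 N a b c <= 2 * dy2 N a b d + 2 * cabs (d - c) ^+ 2.
Proof.
elim: N a b => [|N IH] a b /=.
  by apply: le_trans (sqr_cabsD_le _ _); rewrite addrA subrK.
have := IH a (mid a b); have := IH (mid a b) b.
move: (dy2 _ _ _ _) (dy2 _ _ _ _) (dy2 _ _ _ _) (dy2 _ _ _ _) (cabs _) => x1 x2 x3 x4 x5; lra.
Qed.

(** Passing to a subinterval of half the length at most doubles an average of nonnegative terms. *)
Lemma child_dist a b a' b' : a < b -> b <= a + T -> a <= a' -> b' <= b -> b' - a' = (b - a) / 2 ->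
  cabs (av a' b' u - av a b u) <= 2 * M.
Proof.
move=> ab bT h1 h2 h3; have ab' : a' < b' by lra.
have ba0 : 0 < b - a by rewrite subr_gt0.
apply: le_trans (av_dist _ ab') _.
apply: (@le_trans _ _ (2 * rav a b (fun t => cabs (u t - av a b u)))); last first.
  by rewrite ler_wpM2l // bmo.
rewrite /rav h3 invf_div mulrA ler_wpM2l ?divr_ge0 ?(ltW ba0) //.
have l1 : a' <= b by lra.
rewrite (rint_chasles h1 l1 (iuc _ _ _)) (rint_chasles (ltW ab') h2 (iuc _ _ _)).
have p1 : 0 <= rint a a' (fun t => cabs (u t - av a b u)) by apply: rint_ge0 => t _; exact: cabs_ge0.
have p2 : 0 <= rint b' b (fun t => cabs (u t - av a b u)) by apply: rint_ge0 => t _; exact: cabs_ge0.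
by rewrite addrCA lerDl addr_ge0.
Qed.

(** If the mean oscillation about [c] exceeds 4 M, restart from the mean m of the child: there [dy2]
    is at most 64 M^2, and |m - c| <= 2 M + 4 M. Recentring costs 2 * 64 M^2 + 2 * 36 M^2, which is
    below 64 M * 4 M. Any constant A with 2 A + 72 <= 4 A could replace 64 in this step. *)
Lemma dy2_child N a b a' b' c : a < b -> b <= a + T -> a <= a' -> b' <= b -> b' - a' = (b - a) / 2 ->
  (forall c', dy1 N a' b' c' <= 4 * M -> dy2 N a' b' c' <= 64 * M * dy1 N a' b' c') ->
  cabs (av a b u - c) <= 4 * M -> dy2 N a' b' c <= 64 * M * dy1 N a' b' c.
Proof.
move=> ab bT h1 h2 h3 IH hc; have [h|/ltW h] := leP (dy1 N a' b' c) (4 * M); first exact: IH.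
have ab' : a' < b' by lra.
have bT' : b' <= a' + T by lra.
set m := av a' b' u; have hm : dy1 N a' b' m <= M.
  by apply: le_trans (dy1_le _ _ ab') _; exact: bmo.
have k1 : dy2 N a' b' m <= 64 * M * M.
  apply: le_trans (IH m _) _; first exact: le_trans hm M4.
  by apply: ler_wpM2l => //; rewrite mulr_ge0.
have k2 : cabs (m - c) <= 6 * M.
  rewrite (_ : m - c = (m - av a b u) + (av a b u - c)); last by ring.
  apply: le_trans (cabsD _ _) _.
  rewrite (_ : 6 * M = 2 * M + 4 * M); last by ring.
  by apply: lerD => //; apply: child_dist.
have k3 : cabs (m - c) ^+ 2 <= 36 * (M * M).
  rewrite expr2 (_ : 36 * (M * M) = (6 * M) * (6 * M)); last by ring.
  by rewrite ler_pM ?cabs_ge0.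
have k4 : 64 * M * (4 * M) <= 64 * M * dy1 N a' b' c by rewrite ler_wpM2l ?mulr_ge0.
have k5 := dy2_recenter N a' b' c m; have k6 := mulr_ge0 M0 M0.
exact: child_arith k1 k3 k4 k5 k6.
Qed.

(* Stopping-time form of the John-Nirenberg inequality: the recursion continues
   on the halves where the average oscillation is still at most [4 M], and
   restarts from their mean on the other ones, on which it exceeds [4 M]. *)
Lemma dy2_le_dy1 N a b c : a < b -> b <= a + T ->
  dy1 N a b c <= 4 * M -> dy2 N a b c <= 64 * M * dy1 N a b c.
Proof.
elim: N a b c => [|N IH] a b c ab bT /= h.
  rewrite expr2 ler_wpM2r ?cabs_ge0 //; exact: le_trans h M64.
have [h1 h2 h3 h4] := midP ab.
have hc : cabs (av a b u - c) <= 4 * M by apply: le_trans (av_le_dy1 N.+1 c ab) h.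
have k1 : dy2 N a (mid a b) c <= 64 * M * dy1 N a (mid a b) c.
  apply: dy2_child hc => //; first exact: ltW.
  by move=> c'; apply: IH => //; apply: le_trans (ltW h2) bT.
have k2 : dy2 N (mid a b) b c <= 64 * M * dy1 N (mid a b) b c.
  apply: dy2_child hc => //; first exact: ltW.
  by move=> c'; apply: IH => //; apply: le_trans bT _; rewrite lerD2r ltW.
by rewrite [leRHS]mulrA ler_wpM2r ?invr_ge0 // mulrDr lerD.
Qed.

Lemma dy2_mean N a b : a < b -> b <= a + T -> dy2 N a b (av a b u) <= 64 * M ^+ 2.
Proof.
move=> ab bT; have hm : dy1 N a b (av a b u) <= M.
  by apply: le_trans (dy1_le _ _ ab) _; exact: bmo.
apply: le_trans (dy2_le_dy1 ab bT (le_trans hm M4)) _.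
by rewrite expr2 mulrA ler_wpM2l // mulr_ge0.
Qed.

Variable v : R -> C.
Variable K : R.
Hypothesis K0 : 0 <= K.
Hypothesis mv : cmeas v.
Hypothesis lv : forall s t, cabs (v s - v t) <= K * `|s - t|.
Hypothesis iuv : forall a b, intg a b (fun t => cabs (u t - v t) ^+ 2).

Let iv a b : cintg a b v.
Proof. by apply/ccont_cintg/ccont_lip => s t _ _; exact: lv. Qed.

Let iu2 a b c : intg a b (fun t => cabs (u t - c) ^+ 2).
Proof.
have [Kb hKb] : exists Kb, forall t, a <= t <= b -> cabs (v t - c) <= Kb.
  exists (cabs (v a - c) + K * (b - a)) => t /andP[at' tb].
  rewrite (_ : v t - c = (v a - c) + (v t - v a)); last by ring.
  apply: le_trans (cabsD _ _) _; rewrite lerD2l; apply: le_trans (lv _ _) _.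
  by rewrite ler_wpM2l // ger0_norm ?subr_ge0 // lerD2r.
apply: (@intg_le _ _ _ _ (fun t => 2 * cabs (u t - v t) ^+ 2 + 2 * Kb ^+ 2)).
- by apply: measurable_funX; exact: (cmeas_cabs (cmeasB mu' (cmeas_cst c))).
- by apply: intgD; [exact: intgZ|exact: intg_cst].
move=> t ht; rewrite ger0_norm ?sqr_ge0 // (_ : u t - c = (u t - v t) + (v t - c)); last by ring.
apply: le_trans (sqr_cabsD_le _ _) _; rewrite lerD2l ler_wpM2l //.
by have := hKb t ht; have := cabs_ge0 (v t - c); move: (cabs _) => x x0 xK; rewrite ler_pXn2r ?nnegrE // (le_trans x0).
Qed.

Lemma sqr_cabsD4_le (x y z w : C) :
  cabs (x + y + z + w) ^+ 2 <= 4 * (cabs x ^+ 2 + cabs y ^+ 2 + cabs z ^+ 2 + cabs w ^+ 2).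
Proof.
rewrite -addrA; apply: le_trans (sqr_cabsD_le _ _) _.
have := sqr_cabsD_le x y; have := sqr_cabsD_le z w.
move: (cabs _ ^+ 2) (cabs _ ^+ 2) (cabs _ ^+ 2) (cabs _ ^+ 2) (cabs _ ^+ 2) (cabs _ ^+ 2).
move=> ? ? ? ? ? ?; lra.
Qed.

(** Passes from averages to [u] without differentiation of integrals: on a subinterval of generation
    N the approximant [v] varies by at most K (b - a) / 2^N. The factor 8 is 4 for u - v and 4 for
    the difference of the averages of [u] and [v], bounded by Cauchy-Schwarz. *)
Lemma rint_sqr_dy2 N a b c : a < b ->
  rint a b (fun t => cabs (u t - c) ^+ 2) <=
  8 * rint a b (fun t => cabs (u t - v t) ^+ 2) + 4 * (b - a) * (K * (b - a) / 2 ^+ N) ^+ 2 +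
  4 * (b - a) * dy2 N a b c.
Proof.
elim: N a b => [|N IH] a b ab; last first.
  have [h1 h2 h3 h4] := midP ab.
  rewrite /= (rint_chasles (ltW h1) (ltW h2) (iu2 a b c)) (rint_chasles (ltW h1) (ltW h2) (iuv a b)).
  apply: le_trans (lerD (IH _ _ h1) (IH _ _ h2)) _; rewrite h3 h4 le_eqVlt; apply/orP; left; apply/eqP.
  rewrite [2 ^+ N.+1]exprSr; have : (2 : R) ^+ N != 0 by rewrite expf_neq0.
  by move: (2 ^+ N) => q q0; field.
rewrite /= expr0 divr1; have ba : 0 < b - a by rewrite subr_gt0.
have iuv1 : cintg a b (fun t => u t - v t) by apply: cintgB.
have muv : cmeas (fun t => u t - v t) by apply: cmeasB.
have E : av a b (fun t => u t - v t) = av a b u - av a b v by rewrite /av cintB // mulrBr.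
pose S := cabs (av a b u - av a b v) ^+ 2.
have hS : (b - a) * S <= rint a b (fun t => cabs (u t - v t) ^+ 2).
  rewrite (ravK _ ab) ler_pM2l //; apply: le_trans (sqr_rav_le ab (intg_cabs muv iuv1) (iuv a b)).
  rewrite /S -E; have h := cabs_av_le ab muv iuv1; have h0 := cabs_ge0 (av a b (fun t => u t - v t)).
  by move: (cabs _) (rav _ _ _) h h0 => x y xy x0; rewrite ler_pXn2r ?nnegrE // (le_trans x0).
have hv t : a <= t <= b -> cabs (v t - av a b v) ^+ 2 <= (K * (b - a)) ^+ 2.
  move=> /andP[h1 h2]; have h : cabs (v t - av a b v) <= K * (b - a).
    rewrite cabs_distC -avB_cst //.
    apply: le_trans (cabs_av_le ab _ _) _; [by apply: cmeasB => //; exact: cmeas_cst| |].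
      by apply: cintgB => //; exact: cintg_cst.
    rewrite -[leRHS](rav_cst (K * (b - a)) ab); apply: rav_le => //.
    - apply: intg_cabs; first by apply: cmeasB => //; exact: cmeas_cst.
      by apply: cintgB => //; exact: cintg_cst.
    - exact: intg_cst.
    move=> s /andP[s1 s2] /=; apply: le_trans (lv _ _) _; rewrite ler_wpM2l // ler_norml; apply/andP; split; lra.
  have h0 := cabs_ge0 (v t - av a b v).
  by move: (cabs _) h h0 => x xy x0; rewrite ler_pXn2r ?nnegrE // (le_trans x0).
pose w t := 4 * (cabs (u t - v t) ^+ 2 + ((K * (b - a)) ^+ 2 + S + cabs (av a b u - c) ^+ 2)).
apply: (@le_trans _ _ (rint a b w)).
  apply: ler_rint => //; first by apply: intgZ; apply: intgD => //; exact: intg_cst.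
  move=> t ht; rewrite (_ : u t - c = (u t - v t) + (v t - av a b v) + (av a b v - av a b u) + (av a b u - c)).
    apply: le_trans (sqr_cabsD4_le _ _ _ _) _; rewrite /w ler_wpM2l // -!addrA lerD2l lerD ?hv //.
    by rewrite /S cabs_distC.
  by ring.
rewrite /w rintZ; last by apply: intgD => //; exact: intg_cst.
rewrite rintD //; last exact: intg_cst.
rewrite (rint_cst _ (ltW ab)).
exact: osc_arith hS.
Qed.

(** The generation N tends to infinity; 256 = 4 * 64 by [dy2_mean]. *)
Lemma rint_sqr_osc a b : a < b -> b <= a + T ->
  rint a b (fun t => cabs (u t - av a b u) ^+ 2) <=
  8 * rint a b (fun t => cabs (u t - v t) ^+ 2) + 256 * M ^+ 2 * (b - a).
Proof.
move=> ab bT; apply/ler_addgt0Pl => e e0.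
have ba : 0 < b - a by rewrite subr_gt0.
have [N hN] : exists N, 4 * (b - a) * (K * (b - a) / 2 ^+ N) ^+ 2 <= e.
  have A0 : 0 <= 4 * (b - a) * (K * (b - a)) ^+ 2 by rewrite !mulr_ge0 ?sqr_ge0 ?(ltW ba).
  have [N hN] := exists_pow2_lt (4 * (b - a) * (K * (b - a)) ^+ 2) e0; exists N.
  rewrite expr_div_n mulrA; apply: le_trans (ltW hN).
  rewrite ler_wpM2l // lef_pV2 ?posrE ?exprn_gt0 // expr2 ler_peMl ?exprn_ge0 //.
  by rewrite exprn_ege1 // ler1n.
apply: le_trans (rint_sqr_dy2 N _ ab) _.
have h := dy2_mean N ab bT.
have h2 : 4 * (b - a) * dy2 N a b (av a b u) <= 256 * M ^+ 2 * (b - a).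
  rewrite (_ : 256 * M ^+ 2 * (b - a) = 4 * (b - a) * (64 * M ^+ 2)); last by ring.
  by rewrite ler_wpM2l // mulr_ge0 // ltW.
rewrite addrCA addrAC -addrA; apply: lerD => //.
by rewrite addrC lerD.
Qed.

End JohnNirenberg.

(** * Garsia's bound for Poisson means of BMO functions *)

Section SineBound.
Variable R : realType.

Lemma one_sub_cos_le (x : R) : 0 <= x -> 1 - x ^+ 2 / 2 <= cos x.
Proof.
move=> x0; have h : rint 0 x (fun t => sin t) = - cos x - - cos 0.
  apply: (@FTC _ 0 x (fun t => sin t) (fun t => - cos t)) => //; first exact: continuous_sin.
  by move=> t; rewrite -[sin t]opprK; apply: is_deriveN.
have h2 : rint 0 x (fun t => t) = x ^+ 2 / 2 - 0 ^+ 2 / 2.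
  apply: (@FTC _ 0 x (fun t => t) (fun t => t ^+ 2 / 2)) => //; first by move=> t; exact: cvg_id.
  move=> t; apply: is_derive_eq; rewrite /GRing.scale /=.
  by field.
have : rint 0 x (fun t => sin t) <= rint 0 x (fun t => t).
  apply: ler_rint.
  - by apply: intg_cont; apply: continuous_subspaceT; exact: continuous_sin.
  - by apply: intg_cont; apply: continuous_subspaceT; by move=> s; exact: cvg_id.
  move=> t /andP[t0 _]; have := @sin_lip R t 0; rewrite sin0 !subr0 (ger0_norm t0).
  by apply: le_trans; exact: ler_norm.
rewrite h h2 cos0 expr0n /= mul0r; lra.
Qed.

Lemma sin_ge_cubic (x : R) : 0 <= x -> x - x ^+ 3 / 6 <= sin x.
Proof.
move=> x0; have h : rint 0 x (fun t => cos t) = sin x - sin 0.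
  by apply: (@FTC _ 0 x (fun t => cos t) (fun t => sin t)) => //; exact: continuous_cos.
have ic : continuous (fun t : R => 1 - t ^+ 2 / 2).
  move=> t; apply: cvgB; first exact: cvg_cst.
  by apply: cvgM; [apply: cvgM|exact: cvg_cst]; exact: cvg_id.
have h2 : rint 0 x (fun t => 1 - t ^+ 2 / 2) = (x - x ^+ 3 / 6) - (0 - 0 ^+ 3 / 6).
  apply: (@FTC _ 0 x _ (fun t => t - t ^+ 3 / 6)) => //.
  by move=> t; apply: is_derive_eq; rewrite /GRing.scale /=; field.
have : rint 0 x (fun t => 1 - t ^+ 2 / 2) <= rint 0 x (fun t => cos t).
  apply: ler_rint.
  - by apply: intg_cont; apply: continuous_subspaceT.
  - by apply: intg_cont; apply: continuous_subspaceT; exact: continuous_cos.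
  by move=> t /andP[t0 _]; exact: one_sub_cos_le.
by rewrite h h2 sin0 expr0n /= mul0r !subr0.
Qed.

(** From cos t = 1 - 2 (sin x)^2 with x = t / 2, and sin x >= x - x^3 / 6 >= x / 3 as long as x <=
    2. *)
Lemma cos_le_quadratic (t : R) : `|t| <= pi -> cos t <= 1 - t ^+ 2 / 18.
Proof.
wlog t0 : t / 0 <= t.
  move=> H; have [|/ltW t0] := leP 0 t; first exact: H.
  by move=> tp; rewrite -cosN -sqrrN; apply: H; rewrite ?oppr_ge0 ?normrN.
rewrite ger0_norm // => tp; set x := t / 2.
have x0 : 0 <= x by rewrite divr_ge0.
have x2 : x <= 2.
  rewrite ler_pdivrMr // (le_trans tp) // -ler_pdivrMr //.
  by have /andP[_ /ltW] := @pihalf_02 R; lra.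
have h := sin_ge_cubic x0.
have h3 : x / 3 <= sin x.
  apply: le_trans h; have : x ^+ 2 <= 4 by rewrite expr2; nra.
  by rewrite (_ : x ^+ 3 = x * x ^+ 2) ?exprS //; move: (x ^+ 2) => y; nra.
have E : cos t = 1 - 2 * sin x ^+ 2.
  rewrite (_ : t = x *+ 2); last by rewrite /x -mulr_natr mulfVK .
  by rewrite cos_mulr2n cos2sin2; ring.
rewrite E lerD2l lerN2 (_ : t = 2 * x); last by rewrite /x; field.
have : (x / 3) ^+ 2 <= sin x ^+ 2 by rewrite ler_pXn2r ?nnegrE ?(le_trans _ h3) ?divr_ge0.
by rewrite !exprMn exprVn; lra.
Qed.

End SineBound.

(** * Decay of the Poisson kernel *)

Section PoissonDecay.
Variable R : realType.
Local Notation C := R[i].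

Lemma sqr_cabs_1sub_polar (r t : R) :
  cabs (1 - r%:C * cis t) ^+ 2 = (1 - r) ^+ 2 + 2 * r * (1 - cos t).
Proof.
rewrite sqr_cabs /= /cis; simpc => /=.
have := cos2Dsin2 t; move: (cos t) (sin t) => x y h.
apply/eqP; rewrite -subr_eq0; apply/eqP.
by transitivity (r ^+ 2 * (x ^+ 2 + y ^+ 2 - 1)); [ring|rewrite h; ring].
Qed.

(** For r >= 1/2 the term in 1 - cos t controls t^2. For r < 1/2 the term (1 - r)^2 >= 1/4 alone
    controls everything, since t^2 <= 16; this case requires the large constant. *)
Lemma poisson_decay (r t : R) : 0 <= r < 1 -> `|t| <= pi ->
  ((1 - r) ^+ 2 + t ^+ 2) / 72 <= cabs (1 - r%:C * cis t) ^+ 2.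
Proof.
move=> /andP[r0 r1] ht; rewrite sqr_cabs_1sub_polar.
have h := cos_le_quadratic ht.
have t4 : t ^+ 2 <= 16.
  have p4 : `|t| <= 4.
    by apply: (le_trans ht); have /andP[_ /ltW] := @pihalf_02 R; lra.
  by rewrite -real_normK ?num_real // expr2; have := normr_ge0 t; move: (`|t|) p4 => y; nra.
move: (cos t) (t ^+ 2) h t4 (sqr_ge0 t) => c q h1 h2 h3.
have [h4|h4] := leP (2^-1) r; rewrite expr2; nra.
Qed.

End PoissonDecay.

Lemma arc_arith (R : realType) (x y p m q : R) : x <= 256 * m * (2 * p) -> y <= 4 * m * q -> 0 < p ->
  2 * x + 2 * y * (2 * p) <= p * (m * (1024 + 16 * q)).
Proof.
move=> h1 h2 p1; have : p * y <= p * (4 * m * q) by rewrite ler_wpM2l // ltW.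
by lra.
Qed.

(** Closed form, up to the factor [m], of 2048 plus the sum of 2 / 2^i * (1024 + 16 (i + 1)^2) over
    i < j, with y = 2^j; the limit of these sums is 6528. *)
Lemma dyadic_arith (R : realType) (W q p m j y A D : R) : 0 <= q -> 0 <= m ->
  0 < y -> W <= p * (m * (1024 + 16 * (j + 1) ^+ 2)) -> q * p <= 2 / y ->
  D <= A + q * W -> A <= m * (6528 - (4480 + 256 * j + 64 * j ^+ 2) / y) ->
  D <= m * (6528 - (4480 + 256 * (j + 1) + 64 * (j + 1) ^+ 2) / (y * 2)).
Proof.
move=> q0 m0 y0 hw hq hD hA.
have z0 : 0 <= 1024 + 16 * (j + 1) ^+ 2 by have := sqr_ge0 (j + 1); move: (_ ^+ 2) => v; lra.
have e : m * (6528 - (4480 + 256 * (j + 1) + 64 * (j + 1) ^+ 2) / (y * 2)) =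
   m * (6528 - (4480 + 256 * j + 64 * j ^+ 2) / y) + 2 / y * (m * (1024 + 16 * (j + 1) ^+ 2)).
  by field; rewrite gt_eqF.
rewrite {}e; move: (1024 + 16 * (j + 1) ^+ 2) z0 hw => z z0 hw.
have h1 : q * W <= q * (p * (m * z)) by rewrite ler_wpM2l.
have h2 : q * p * (m * z) <= 2 / y * (m * z) by rewrite ler_wpM2r // mulr_ge0.
rewrite mulrA in h1; apply: (le_trans hD); apply: lerD => //; exact: le_trans h2.
Qed.

(** * Dyadic splitting of an integral against a kernel of width d *)

Section DyadicKernel.
Variable R : realType.
Variable w : R -> R.
Hypothesis mw : measurable_fun setT w.
Hypothesis iw : forall a b, intg a b w.
Hypothesis w0 : forall t, 0 <= w t.
Variables th s d : R.
Hypothesis d0 : 0 < d.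
Hypothesis ds : d <= s.
Implicit Types (a b t : R) (j : nat).

Local Notation lo j := (th - 2 ^+ j * s).
Local Notation hi j := (th + 2 ^+ j * s).
(** The Poisson kernel of a half-plane at height [d], up to a constant; for d = 1 - r it dominates
    the kernel of the disk, by [poisson_polar_le]. *)
Let Q t := d / (d ^+ 2 + (t - th) ^+ 2).

Let s0 : 0 < s. Proof. exact: lt_le_trans d0 ds. Qed.
Let p0 j : 0 < 2 ^+ j * s. Proof. by rewrite mulr_gt0 // exprn_gt0. Qed.
Let lohi j : lo j < hi j. Proof. by have := p0 j; lra. Qed.
Let D0 t : 0 < d ^+ 2 + (t - th) ^+ 2.
Proof. by rewrite ltr_pwDl ?sqr_ge0 // exprn_gt0. Qed.
Let Q0 t : 0 <= Q t. Proof. by rewrite /Q divr_ge0 ?(ltW d0) // ltW. Qed.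

Let mQ : continuous Q.
Proof.
move=> t; apply: cvgM; first exact: cvg_cst.
apply: cvgV; first by rewrite gt_eqF.
have h : (t' - th) @[t' --> t] --> t - th by apply: cvgB; [exact: cvg_id|exact: cvg_cst].
by apply: cvgD; [exact: cvg_cst|apply: cvgM].
Qed.

Let Qd t : Q t <= d^-1.
Proof.
rewrite /Q ler_pdivrMr // mulrDr expr2 mulKf ?gt_eqF // lerDl mulr_ge0 ?sqr_ge0 //.
by rewrite invr_ge0 ltW.
Qed.

Lemma intg_wQ a b : intg a b (fun t => w t * Q t).
Proof.
apply: (@intg_le _ _ _ _ (fun t => d^-1 * w t)).
- by apply: measurable_funM => //; exact: continuous_measurable_fun.
- exact: intgZ.
move=> t _; rewrite ger0_norm; last by apply: mulr_ge0.
by rewrite [leLHS]mulrC ler_wpM2r.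
Qed.

Lemma rint_wQ_le_inv a b : rint a b (fun t => w t * Q t) <= d^-1 * rint a b w.
Proof.
rewrite -rintZ //; apply: ler_rint; [exact: intg_wQ|exact: intgZ|move=> t _].
by rewrite mulrC ler_wpM2r.
Qed.

Lemma rint_wQ_far a b c : 0 < c -> (forall t, a <= t <= b -> c <= `|t - th|) ->
  rint a b (fun t => w t * Q t) <= d / c ^+ 2 * rint a b w.
Proof.
move=> c0 hab; rewrite -rintZ //; apply: ler_rint; [exact: intg_wQ|exact: intgZ|move=> t /hab ht].
rewrite mulrC ler_wpM2r // /Q ler_pM2l // lef_pV2 ?posrE ?exprn_gt0 //.
apply: (@le_trans _ _ (`|t - th| ^+ 2)); first by rewrite ler_pXn2r ?nnegrE // ltW.
by rewrite real_normK ?num_real // lerDr sqr_ge0.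
Qed.

(** Outside the inner interval the kernel is at most d / c^2; the integral of [w] over the inner one
    is added on the right to restore a full interval. *)
Lemma rint_wQ_split c c' : 0 < c -> c <= c' ->
  rint (th - c') (th + c') (fun t => w t * Q t) <=
  rint (th - c) (th + c) (fun t => w t * Q t) + d / c ^+ 2 * rint (th - c') (th + c') w.
Proof.
move=> c0 cc.
have l1 : th - c' <= th - c by lra.
have l2 : th - c <= th + c by lra.
have l3 : th + c <= th + c' by lra.
rewrite (rint_chasles l1 (le_trans l2 l3) (intg_wQ _ _)) (rint_chasles l2 l3 (intg_wQ _ _)).
rewrite (rint_chasles l1 (le_trans l2 l3) (iw _ _)) (rint_chasles l2 l3 (iw _ _)).
have s1 : rint (th - c') (th - c) (fun t => w t * Q t) <= d / c ^+ 2 * rint (th - c') (th - c) w.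
  by apply: rint_wQ_far => // t /andP[_ t2]; rewrite distrC (le_trans _ (ler_norm _)) // lerBrDl -lerBrDr.
have s2 : rint (th + c) (th + c') (fun t => w t * Q t) <= d / c ^+ 2 * rint (th + c) (th + c') w.
  by apply: rint_wQ_far => // t /andP[t1 _]; rewrite (le_trans _ (ler_norm _)) // lerBrDl.
have s3 : 0 <= d / c ^+ 2 * rint (th - c) (th + c) w.
  by rewrite mulr_ge0 ?divr_ge0 ?(ltW d0) ?sqr_ge0 // rint_ge0.
rewrite !mulrDr addrCA lerD2l; apply: lerD => //; apply: (le_trans s2).
by rewrite lerDr.
Qed.

Lemma dyadic_weight j : d / (2 ^+ j * s) ^+ 2 * (2 ^+ j.+1 * s) <= 2 / 2 ^+ j.
Proof.
rewrite (_ : _ * _ = 2 / 2 ^+ j * (d / s)).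
  by rewrite ler_piMr ?divr_ge0 ?exprn_ge0 // ler_pdivrMr // mul1r.
by rewrite [2 ^+ j.+1]exprS; field; rewrite gt_eqF // expf_neq0.
Qed.

Lemma rint_wQ_step j : rint (lo j.+1) (hi j.+1) (fun t => w t * Q t) <=
  rint (lo j) (hi j) (fun t => w t * Q t) + d / (2 ^+ j * s) ^+ 2 * rint (lo j.+1) (hi j.+1) w.
Proof.
apply: rint_wQ_split => //; rewrite ler_wpM2r ?(ltW s0) // exprS ler_peMl ?exprn_ge0 //.
by rewrite ler1n.
Qed.

(** The central interval contributes 2 and the i-th doubling 2 / 2^i, here in closed form. This
    version serves at Lebesgue points, where the averages of [w] are small. *)
Lemma rint_wQ_small e j : s < 2 * d -> 0 <= e ->
  (forall i, (i <= j)%N -> rint (lo i) (hi i) w <= e * (2 ^+ i * s)) ->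
  rint (lo j) (hi j) (fun t => w t * Q t) <= e * (6 - 4 / 2 ^+ j).
Proof.
move=> sd e0; elim: j => [|j IH] h.
  apply: (le_trans (rint_wQ_le_inv _ _)); apply: le_trans (ler_wpM2l _ (h 0%N isT)) _.
    by rewrite invr_ge0 ltW.
  rewrite expr0 mul1r mulrCA ler_wpM2l // divr1 mulrC ler_pdivrMr //.
  by apply: ltW; apply: lt_le_trans sd _; rewrite ler_wpM2r ?(ltW d0) // lerBrDr -natrD.
apply: (le_trans (rint_wQ_step j)); apply: le_trans (lerD (IH _) (ler_wpM2l _ (h j.+1 (leqnn _)))) _.
- by move=> i ij; apply: h; exact: leqW.
- by rewrite divr_ge0 ?(ltW d0) ?sqr_ge0.
rewrite mulrCA -mulrDr ler_wpM2l //.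
apply: (@le_trans _ _ (6 - 4 / 2 ^+ j + 2 / 2 ^+ j)); first by rewrite lerD2l dyadic_weight.
rewrite [2 ^+ j.+1]exprS le_eqVlt; apply/orP; left; apply/eqP.
by field; rewrite expf_neq0.
Qed.

End DyadicKernel.

(** * BMO oscillations against the kernel *)

Section PoissonDyadic.
Variable R : realType.
Local Notation C := R[i].
Variable T M : R.
Variable u : R -> C.
Hypothesis M0 : 0 <= M.
Hypothesis mu' : cmeas u.
Hypothesis iu : forall a b, cintg a b u.
Hypothesis iu2 : forall a b c, intg a b (fun t => cabs (u t - c) ^+ 2).
Hypothesis bmo : forall a b, a < b -> b <= a + T ->
  rav a b (fun t => cabs (u t - av a b u)) <= M.
Hypothesis osc : forall a b, a < b -> b <= a + T ->
  rint a b (fun t => cabs (u t - av a b u) ^+ 2) <= 256 * M ^+ 2 * (b - a).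
Variables th s d : R.
Hypothesis d0 : 0 < d.
Hypothesis ds : d <= s.
Hypothesis sd : s < 2 * d.

Local Notation lo j := (th - 2 ^+ j * s).
Local Notation hi j := (th + 2 ^+ j * s).
Let c0 := av (lo 0) (hi 0) u.
Let Q t := d / (d ^+ 2 + (t - th) ^+ 2).
Let w t := cabs (u t - c0) ^+ 2.

Let s0 : 0 < s. Proof. exact: lt_le_trans d0 ds. Qed.
Let p0 j : 0 < 2 ^+ j * s. Proof. by rewrite mulr_gt0 // exprn_gt0. Qed.
Let lohi j : lo j < hi j. Proof. by have := p0 j; lra. Qed.
Let w0 t : 0 <= w t. Proof. exact: sqr_ge0. Qed.

(** Telescoping: each doubling of the arc moves the average by at most 2 M. *)
Lemma center_dist j : 2 * (2 ^+ j * s) <= T -> cabs (av (lo j) (hi j) u - c0) <= 2 * M * j%:R.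
Proof.
elim: j => [|j IH] hj; first by rewrite subrr cabs0 mulr0.
have e2 : 2 ^+ j.+1 * s = 2 * (2 ^+ j * s) by rewrite exprS mulrA.
have := p0 j; have := lohi j.+1; rewrite !e2 in hj *; move: hj IH; set x := 2 ^+ j * s => hj IH k1 k2.
rewrite (_ : _ - c0 = - (av (th - x) (th + x) u - av (th - 2 * x) (th + 2 * x) u) + (av (th - x) (th + x) u - c0)); last by ring.
apply: le_trans (cabsD _ _) _; rewrite cabsN -[j.+1%:R]natr1 (mulrDr (2 * M)) mulr1 addrC; apply: lerD.
  by apply: IH; lra.
apply: (@child_dist _ T M u) => //; lra.
Qed.

(** Recentre at the average over the arc: 1024 = 2 * 256 * 2 comes from the square oscillation and
    16 = 2 * 4 * 2 from [center_dist]; the last factor 2 is the length of the arc in units of 2^j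
    s. *)
Lemma rint_w_le j : 2 * (2 ^+ j * s) <= T ->
  rint (lo j) (hi j) w <= 2 ^+ j * s * (M ^+ 2 * (1024 + 16 * j%:R ^+ 2)).
Proof.
move=> hj; have lh := lohi j; have hT : hi j <= lo j + T by lra.
set c := av (lo j) (hi j) u.
have i1 := iu2 (lo j) (hi j) c.
apply: (@le_trans _ _ (rint (lo j) (hi j) (fun t => 2 * cabs (u t - c) ^+ 2 + 2 * cabs (c - c0) ^+ 2))).
  apply: ler_rint; first exact: iu2.
    by apply: intgD; [exact: intgZ|exact: intg_cst].
  by move=> t _; apply: le_trans (sqr_cabsD_le _ _); rewrite addrA subrK.
rewrite rintD; [|exact: intgZ|exact: intg_cst].
rewrite rintZ // rint_cst ?(ltW lh) //.
have h1 := osc lh hT; rewrite -/c in h1.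
have h2 : cabs (c - c0) ^+ 2 <= 4 * M ^+ 2 * j%:R ^+ 2.
  rewrite (_ : 4 * M ^+ 2 * j%:R ^+ 2 = (2 * M * j%:R) ^+ 2); last by ring.
  by rewrite ler_pXn2r ?nnegrE ?cabs_ge0 ?center_dist // !mulr_ge0.
have hw : hi j - lo j = 2 * (2 ^+ j * s) by ring.
rewrite hw in h1 *; exact: arc_arith h1 h2 (p0 j).
Qed.

Let mw : measurable_fun setT w.
Proof. by apply: measurable_funX; exact: (cmeas_cabs (cmeasB mu' (cmeas_cst c0))). Qed.

(** The j-th doubling has weight at most 2 / 2^j, while the square oscillation about the central
    average grows only like j^2. *)
Lemma rint_wQ_dyadic j : 2 * (2 ^+ j * s) <= T ->
  rint (lo j) (hi j) (fun t => w t * Q t) <=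
  M ^+ 2 * (6528 - (4480 + 256 * j%:R + 64 * j%:R ^+ 2) / 2 ^+ j).
Proof.
have iw a b : intg a b w by exact: iu2.
elim: j => [|j IH] hj.
  apply: le_trans (rint_wQ_le_inv mw iw w0 th d0 _ _) _.
  apply: le_trans (ler_wpM2l _ (rint_w_le hj)) _; first by rewrite invr_ge0 ltW.
  have k : s / d <= 2 by rewrite ler_pdivrMr // ltW.
  rewrite expr0 (_ : d^-1 * _ = M ^+ 2 * (1024 * (s / d))).
    rewrite (_ : _ - _ / 1 = 2048); last by field.
    by rewrite ler_wpM2l ?sqr_ge0 //; lra.
  by field; rewrite gt_eqF.
have h := rint_w_le hj; have e2 : 2 ^+ j.+1 * s = 2 * (2 ^+ j * s) by rewrite exprS mulrA.
have IH' : 2 * (2 ^+ j * s) <= T by have := p0 j; rewrite e2 in hj; lra.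
rewrite [2 ^+ j.+1 in leRHS]exprSr -[j.+1%:R in leRHS]natr1; rewrite -[j.+1%:R]natr1 in h.
have q0 : 0 <= d / (2 ^+ j * s) ^+ 2 by rewrite divr_ge0 ?(ltW d0) // sqr_ge0.
exact: (dyadic_arith q0 (sqr_ge0 M) (exprn_gt0 _ _) h (dyadic_weight d0 ds j)
  (rint_wQ_step mw iw w0 th d0 ds j) (IH IH')).
Qed.

Lemma rint_wQ_le j : 2 * (2 ^+ j * s) <= T ->
  rint (lo j) (hi j) (fun t => w t * Q t) <= 6528 * M ^+ 2.
Proof.
move=> hj; apply: le_trans (rint_wQ_dyadic hj) _; rewrite mulrC ler_wpM2r ?sqr_ge0 //.
have n0 : 0 <= 4480 + 256 * j%:R + 64 * j%:R ^+ 2 :> R.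
  by have := ler0n R j; have := sqr_ge0 (j%:R : R); move: (j%:R ^+ 2 : R) (j%:R : R) => x y; lra.
by rewrite gerBl divr_ge0 // exprn_ge0.
Qed.

End PoissonDyadic.

(** Doubling starts at a scale comparable with the width [d] of the kernel and must end exactly at
    [p]; the least n with p / 2^n < d overshoots by one step. *)
Lemma exists_dyadic_scale (R : realType) (p d : R) : 0 < d -> d <= p ->
  exists j s, [/\ 2 ^+ j * s = p, d <= s & s < 2 * d].
Proof.
move=> d0 dp; have hex : exists n, p / 2 ^+ n < d by exact: exists_pow2_lt.
case: (ex_minnP hex) => n hn hmin; case: n hn hmin => [|n] hn hmin.
  by move: hn; rewrite expr0 divr1 ltNge dp.
exists n, (p / 2 ^+ n); split.
- by rewrite mulrC divfK // expf_neq0.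
- by rewrite leNgt; apply/negP => /hmin; rewrite ltnn.
move: hn; rewrite exprS invfM mulrCA; lra.
Qed.

(** * The Szego and Poisson kernels *)

Section Kernels.
Variable R : realType.
Local Notation C := R[i].
Implicit Types (z : C) (s t : R).

Lemma polar_form (z : C) : exists r t : R, [/\ 0 <= r, `|t| <= pi & z = r%:C * cis t].
Proof.
have [/eqP|z0] := eqVneq (cabs z) 0.
  by rewrite cabs_eq0 => /eqP ->; exists 0, 0; rewrite normr0 pi_ge0 mul0r.
have zp : 0 < cabs z by rewrite lt_neqAle eq_sym z0 cabs_ge0.
pose x := Re z / cabs z; pose y := Im z / cabs z.
have hxy : x ^+ 2 + y ^+ 2 = 1.
  by rewrite /x /y !exprMn -mulrDl -sqr_cabs -exprMn divff // expr1n.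
have hx : -1 <= x <= 1.
  by have := sqr_ge0 y; apply: contraTT; rewrite negb_and -!ltNge => /orP[]; nra.
have hs : sin (acos x) = `|y|.
  by rewrite sin_acos // -hxy addrC addKr sqrtr_sqr.
have E t : cos t = x -> sin t = y -> z = (cabs z)%:C * cis t.
  move=> h1 h2; apply: complex_eq; rewrite /cis h1 h2 /x /y; simpc => /=;
    by rewrite mulrC divfK.
have ha : `|acos x| <= pi by rewrite ger0_norm ?acos_ge0 ?acos_lepi.
have [y0|y0] := leP 0 y.
  by exists (cabs z), (acos x); split=> //; [exact: ltW|apply: E; rewrite ?acosK ?hs ?ger0_norm].
exists (cabs z), (- acos x); split=> //; [exact: ltW|by rewrite normrN|].
by apply: E; rewrite ?cosN ?acosK // sinN hs ltr0_norm ?opprK.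
Qed.

Definition szego (z : C) t : C := (1 - z * (cis t)^*)^-1.
Definition poisson (z : C) t : R := (1 - cabs z ^+ 2) / cabs (1 - z * (cis t)^*) ^+ 2.

Lemma szego_den z t : 1 - cabs z <= cabs (1 - z * (cis t)^*).
Proof.
have := cabs_dist 1 (z * (cis t)^*); rewrite cabs1 cabsM cabsJ cabs_cis mulr1.
by rewrite lerBlDl.
Qed.

Lemma szego_den_gt0 z t : cabs z < 1 -> 0 < cabs (1 - z * (cis t)^*).
Proof. by move=> z1; apply: lt_le_trans (szego_den z t); rewrite subr_gt0. Qed.

Lemma szego_le z t : cabs z < 1 -> cabs (szego z t) <= (1 - cabs z)^-1.
Proof.
move=> z1; rewrite /szego cabsV lef_pV2 ?posrE ?szego_den_gt0 ?subr_gt0 //.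
exact: szego_den.
Qed.

Lemma poissonE z t : poisson z t = (1 - cabs z ^+ 2) * cabs (szego z t) ^+ 2.
Proof. by rewrite /poisson /szego cabsV exprVn. Qed.

Lemma szego_lip z s t : cabs z < 1 ->
  cabs (szego z s - szego z t) <= (2 * (1 - cabs z)^-1 ^+ 2) * `|s - t|.
Proof.
move=> z1; have n1 : 1 - z * (cis s)^* != 0 by rewrite -cabs_gt0 szego_den_gt0.
have n2 : 1 - z * (cis t)^* != 0 by rewrite -cabs_gt0 szego_den_gt0.
rewrite (_ : _ - _ = szego z s * szego z t * (z * (cis s - cis t)^*)); last first.
  by rewrite /szego conjB; field; rewrite n1 n2.
have h1 := szego_le s z1; have h2 := szego_le t z1; have h3 := @cis_lip R s t.
rewrite !cabsM cabsJ; have d0 : 0 <= (1 - cabs z)^-1 by rewrite invr_ge0 subr_ge0 ltW.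
move: (cabs (szego z s)) (cabs (szego z t)) (cabs (cis s - cis t)) (cabs_ge0 (szego z s)) (cabs_ge0 (szego z t)) (cabs_ge0 (cis s - cis t : C)) h1 h2 h3 d0.
move: (cabs_ge0 z) (ltW z1); move: (cabs z) (`|s - t|) => x y x0 x1 p q v p0 q0 v0 pD qD hv.
move: pD qD; set D := (1 - x)^-1 => pD qD D0.
apply: (@le_trans _ _ (D * D * (1 * (2 * y)))).
  by rewrite ler_pM ?mulr_ge0 // ler_pM.
by rewrite le_eqVlt; apply/orP; left; apply/eqP; ring.
Qed.

Lemma ccont_szego z (A : set R) : cabs z < 1 -> ccont A (szego z).
Proof. by move=> z1; apply: ccont_lip => s t _ _; exact: szego_lip. Qed.

Lemma cmeas_szego z : cabs z < 1 -> cmeas (szego z).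
Proof.
move=> z1; have [h1 h2] := ccont_szego setT z1.
by apply: cmeas_cont; apply/continuous_subspace_setT.
Qed.

Lemma poisson_ge0 z t : cabs z < 1 -> 0 <= poisson z t.
Proof.
move=> z1; rewrite /poisson divr_ge0 ?sqr_ge0 // subr_ge0.
by rewrite -[leRHS](expr1n _ 2) ler_pXn2r ?nnegrE ?cabs_ge0 // ltW.
Qed.

Lemma poisson_le z t : cabs z < 1 -> poisson z t <= (1 - cabs z)^-1 ^+ 2.
Proof.
move=> z1; rewrite poissonE; have h := szego_le t z1; have h0 := cabs_ge0 (szego z t).
rewrite -[leRHS]mul1r ler_pM ?sqr_ge0 //.
- by rewrite subr_ge0 -[leRHS](expr1n _ 2) ler_pXn2r ?nnegrE ?cabs_ge0 // ltW.
- by rewrite gerBl sqr_ge0.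
by rewrite ler_pXn2r ?nnegrE // (le_trans h0).
Qed.

Lemma measurable_poisson z : cabs z < 1 -> measurable_fun setT (poisson z).
Proof.
move=> z1; rewrite (funext (poissonE z)); apply: measurable_funM; first exact: measurable_cst.
by apply: measurable_funX; exact: (cmeas_cabs (cmeas_szego z1)).
Qed.

(** 144 = 2 * 72, from 1 - r^2 <= 2 (1 - r) and [poisson_decay]. *)
Lemma poisson_polar_le r th t : 0 <= r < 1 -> `|t - th| <= pi ->
  poisson (r%:C * cis th) t <= 144 * ((1 - r) / ((1 - r) ^+ 2 + (t - th) ^+ 2)).
Proof.
move=> hr ht; have /andP[r0 r1] := hr; rewrite /poisson cabs_polar //.
have -> : r%:C * cis th * (cis t)^* = r%:C * cis (th - t) :> C.
  by rewrite cisD cisN mulrA.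
have := @poisson_decay R r (th - t) hr; rewrite distrC => /(_ ht).
rewrite -[(th - t) ^+ 2]sqrrN opprB.
have d0 : 0 < (1 - r) ^+ 2 + (t - th) ^+ 2 by rewrite ltr_pwDl ?sqr_ge0 // exprn_gt0 // subr_gt0.
move: (_ + _) d0 => D d0; move: (cabs _ ^+ 2) => Y h.
have Y0 : 0 < Y by apply: lt_le_trans h; rewrite divr_gt0.
rewrite ler_pdivrMr // mulrA mulrAC ler_pdivlMr //.
have h2 : D <= 72 * Y by rewrite mulrC -ler_pdivrMr.
rewrite (_ : 1 - r ^+ 2 = (1 - r) * (1 + r)); last by ring.
have k1 : 0 <= 1 - r by lra.
apply: (@le_trans _ _ ((1 - r) * (2 * (72 * Y)))); last by rewrite le_eqVlt; apply/orP; left; apply/eqP; ring.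
by rewrite -mulrA ler_wpM2l // ler_pM // ?ltW //; lra.
Qed.

End Kernels.

(** * Poisson means of the square oscillation *)

Section GarsiaBound.
Variable R : realType.
Local Notation C := R[i].
Local Notation T := (2 * pi : R).
Variable M : R.
Variable u : R -> C.
Hypothesis M0 : 0 <= M.
Hypothesis mu' : cmeas u.
Hypothesis pu : forall t, u (t + T) = u t.
Hypothesis iu : cintg 0 T u.
Hypothesis iu2 : intg 0 T (fun t => cabs (u t) ^+ 2).
Hypothesis bmo : forall a b, a < b -> b <= a + T ->
  rav a b (fun t => cabs (u t - av a b u)) <= M.
Hypothesis approx : forall e : R, 0 < e -> exists (v : R -> C) K,
  [/\ cmeas v, 0 <= K, forall s t, cabs (v s - v t) <= K * `|s - t|, forall t, v (t + T) = v t &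
    intg 0 T (fun t => cabs (u t - v t) ^+ 2) /\ rint 0 T (fun t => cabs (u t - v t) ^+ 2) <= e].

Lemma cintg_periodic a b : cintg a b u.
Proof.
by split; apply: intg_periodic; [case: mu'|move=> t /=; rewrite pu|case: iu|
  case: mu'|move=> t /=; rewrite pu|case: iu].
Qed.

Lemma intg_sqr_periodic a b c : intg a b (fun t => cabs (u t - c) ^+ 2).
Proof.
have mc : measurable_fun setT (fun t => cabs (u t - c) ^+ 2).
  by apply: measurable_funX; exact: (cmeas_cabs (cmeasB mu' (cmeas_cst c))).
apply: intg_periodic => // [t|]; first by rewrite pu.
apply: (@intg_le _ _ _ _ (fun t => 2 * cabs (u t) ^+ 2 + 2 * cabs (- c) ^+ 2)) => //.
  by apply: intgD; [exact: intgZ|exact: intg_cst].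
by move=> t _; rewrite ger0_norm ?sqr_ge0 // sqr_cabsD_le.
Qed.

Lemma sqr_osc_periodic a b : a < b -> b <= a + T ->
  rint a b (fun t => cabs (u t - av a b u) ^+ 2) <= 256 * M ^+ 2 * (b - a).
Proof.
move=> ab bT; apply/ler_addgt0Pl => e e0.
(* The error of approximation enters [rint_sqr_osc] with the factor 8. *)
have [v [K [mv K0 lv pv [i1 i2]]]] := approx (divr_gt0 e0 (ltr0n R 8)).
have mw : measurable_fun setT (fun t => cabs (u t - v t) ^+ 2).
  by apply: measurable_funX; exact: (cmeas_cabs (cmeasB mu' mv)).
have pw t : cabs (u (t + T) - v (t + T)) ^+ 2 = cabs (u t - v t) ^+ 2 by rewrite pu pv.
have iw x y := intg_periodic mw pw i1 x y.
apply: le_trans (rint_sqr_osc M0 mu' cintg_periodic bmo K0 mv lv iw ab bT) _.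
rewrite lerD2r -ler_pdivlMl // mulrC; apply: le_trans i2.
rewrite -(rint_periodic mw pw i1 a) (rint_chasles (ltW ab) bT (iw _ _)) lerDl.
by apply: rint_ge0 => t _; exact: sqr_ge0.
Qed.

(** The constant is the average of [u] over the arc centred at the argument of [z] whose half-length
    is between 1 - |z| and twice that. *)
Lemma garsia_bound z : cabs z < 1 -> exists c,
  rint 0 T (fun t => cabs (u t - c) ^+ 2 * poisson z t) <= 144 * (6528 * M ^+ 2).
Proof.
have [r [th [r0 hth ->]]] := polar_form z; rewrite cabs_polar // => r1.
have p0 := pi_gt0 R.
have d0 : 0 < 1 - r by rewrite subr_gt0.
have dp : 1 - r <= pi by have := pi_ge2 R; lra.
have [j [s [hs ds sd]]] := exists_dyadic_scale d0 dp.
pose c := av (th - 2 ^+ 0 * s) (th + 2 ^+ 0 * s) u; exists c.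
have hj : 2 * (2 ^+ j * s) <= T by rewrite hs.
have K := rint_wQ_le M0 mu' cintg_periodic intg_sqr_periodic bmo sqr_osc_periodic th d0 ds sd hj.
rewrite hs -/c in K.
have pz1 : cabs (r%:C * cis th : C) < 1 by rewrite cabs_polar.
have mw : measurable_fun setT (fun t => cabs (u t - c) ^+ 2 * poisson (r%:C * cis th) t).
  apply: measurable_funM; last exact: measurable_poisson.
  by apply: measurable_funX; exact: (cmeas_cabs (cmeasB mu' (cmeas_cst c))).
have iw a b : intg a b (fun t => cabs (u t - c) ^+ 2 * poisson (r%:C * cis th) t).
  apply: (@intg_le _ _ _ _ (fun t => (1 - r)^-1 ^+ 2 * cabs (u t - c) ^+ 2)) => //.
    by apply: intgZ; exact: intg_sqr_periodic.
  move=> t _; rewrite ger0_norm; last by apply: mulr_ge0; [exact: sqr_ge0|exact: poisson_ge0].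
  rewrite [leLHS]mulrC; apply: ler_wpM2r; first exact: sqr_ge0.
  by have := poisson_le t pz1; rewrite cabs_polar.
have pw t : cabs (u (t + T) - c) ^+ 2 * poisson (r%:C * cis th) (t + T) =
    cabs (u t - c) ^+ 2 * poisson (r%:C * cis th) t.
  by rewrite pu /poisson cis_periodic.
(* The period is centred at [th], since the decay bound needs |t - th| <= pi. *)
rewrite -(@rint_periodic _ _ mw pw (iw _ _) (th - pi)).
rewrite (_ : th - pi + T = th + pi); last by ring.
apply: le_trans (ler_wpM2l _ K); last by rewrite ler0n.
have mc : measurable_fun setT (fun t => cabs (u t - c) ^+ 2).
  by apply: measurable_funX; exact: (cmeas_cabs (cmeasB mu' (cmeas_cst c))).
have iQ : intg (th - pi) (th + pi) (fun t => cabs (u t - c) ^+ 2 * ((1 - r) / ((1 - r) ^+ 2 + (t - th) ^+ 2))).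
  exact: (intg_wQ mc (fun a b => intg_sqr_periodic a b c) (fun t => sqr_ge0 _) th d0).
rewrite -rintZ //; apply: ler_rint => //; first exact: intgZ.
move=> t ht; rewrite [leRHS]mulrCA; apply: ler_wpM2l; first exact: sqr_ge0.
 apply: poisson_polar_le; first by rewrite r0.
by rewrite ler_norml; lra.
Qed.

End GarsiaBound.

(** * Cauchy transforms and their Taylor coefficients *)

Section CauchyTransform.
Variable R : realType.
Local Notation C := R[i].
Local Notation T := (2 * pi : R).
Local Notation cper p := (cintg 0 T p).
Implicit Types (p q : R -> C) (z : C) (t : R).

Definition cauchy_transform p z : C := cmean (fun t => p t * szego z t).
Definition fourier p k : C := cmean (fun t => p t * (cis t)^* ^+ k).

Lemma cper_mul_bounded p q K : cmeas p -> cper p -> cmeas q -> (forall t, cabs (q t) <= K) ->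
  cper (fun t => p t * q t).
Proof.
move=> mp ip mq hq; apply: (cintg_le (v := fun t => K * cabs (p t))).
- exact: cmeasM.
- by apply: intgZ; exact: intg_cabs.
by move=> t _; rewrite cabsM mulrC ler_wpM2r ?cabs_ge0.
Qed.

Lemma cmeasX p k : cmeas p -> cmeas (fun t => p t ^+ k).
Proof.
move=> mp; elim: k => [|k IH]; first by under eq_fun do rewrite expr0; exact: cmeas_cst.
by under eq_fun do rewrite exprS; apply: cmeasM.
Qed.

Lemma cmeas_cisJX k : cmeas (fun t : R => (cis t)^* ^+ k).
Proof. by apply/cmeasX/cmeasJ/cmeas_cis. Qed.

Lemma cabs_cisJX k t : cabs ((cis t)^* ^+ k : C) = 1.
Proof. by rewrite cabsX cabsJ cabs_cis expr1n. Qed.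

Lemma cper_fourier p k : cmeas p -> cper p -> cper (fun t => p t * (cis t)^* ^+ k).
Proof.
move=> mp ip; apply: (cper_mul_bounded (K := 1)) => //; first exact: cmeas_cisJX.
by move=> t; rewrite cabs_cisJX.
Qed.

Lemma cper_szego p z : cmeas p -> cper p -> cabs z < 1 -> cper (fun t => p t * szego z t).
Proof.
move=> mp ip z1; apply: (cper_mul_bounded (K := (1 - cabs z)^-1)) => //; first exact: cmeas_szego.
by move=> t; exact: szego_le.
Qed.

Lemma szego_geometric z t n : cabs z < 1 ->
  szego z t - \sum_(k < n) (cis t)^* ^+ k * z ^+ k = szego z t * (z * (cis t)^*) ^+ n.
Proof.
move=> z1; have n1 : 1 - z * (cis t)^* != 0 by rewrite -cabs_gt0 szego_den_gt0.
apply: (mulfI n1); rewrite mulrBr [RHS]mulrA /szego !divff // mul1r.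
have -> : \sum_(k < n) (cis t)^* ^+ k * z ^+ k = \sum_(k < n) (z * (cis t)^*) ^+ k.
  by apply: eq_bigr => k _; rewrite exprMn mulrC.
by rewrite -[1 - z * _]opprB mulNr opprK -subrX1 addrCA subrr addr0.
Qed.

(** Geometric expansion of the Szego kernel; this is how a holomorphic function is produced from
    data on the circle, in particular the [B] of [bmo_carleson_symbol]. *)
Lemma powser_cauchy_transform p : cmeas p -> cper p -> powser (fourier p) (cauchy_transform p).
Proof.
move=> mp ip rho /andP[r0 r1]; have icp := intg_cabs mp ip.
exists (rmean (@cabs R \o p) * (1 - rho)^-1), rho; split.
- rewrite mulr_ge0 ?invr_ge0 ?subr_ge0 ?(ltW r1) //.
  by rewrite /rmean mulr_ge0 ?invr_ge0 ?(ltW (twopi_gt0 R)) // rint_ge0 // => t _; exact: cabs_ge0.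
- by rewrite r0.
move=> n z zr; have z1 : cabs z < 1 by exact: le_lt_trans zr r1.
have ik k : cper (fun t => z ^+ k * (p t * (cis t)^* ^+ k)) by apply: cintgZ; exact: cper_fourier.
have [is1 es] := cint_sum (fun k (_ : (k < n)%N) => ik k).
have E : cauchy_transform p z - \sum_(k < n) fourier p k * z ^+ k =
    cmean (fun t => p t * (szego z t * (z * (cis t)^*) ^+ n)).
  have -> : \sum_(k < n) fourier p k * z ^+ k = cmean (fun t => \sum_(k < n) z ^+ k * (p t * (cis t)^* ^+ k)).
    rewrite (cmean_sum (p := fun k t => z ^+ k * (p t * (cis t)^* ^+ k)) (fun k _ => ik k)).
    by apply: eq_bigr => k _; rewrite (cmeanZ _ (cper_fourier k mp ip)) -/(fourier p k) mulrC.
  rewrite -cmeanB //; last exact: cper_szego.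
  apply: eq_cmean => t _; rewrite -szego_geometric // mulrBr; congr (_ - _).
  by rewrite mulr_sumr; apply: eq_bigr => k _; ring.
have ms : cmeas (fun t => szego z t * (z * (cis t)^*) ^+ n).
  apply: cmeasM; first exact: cmeas_szego.
  by apply/cmeasX/cmeasM; [exact: cmeas_cst|exact/cmeasJ/cmeas_cis].
have hs t : cabs (szego z t * (z * (cis t)^*) ^+ n) <= (1 - rho)^-1 * rho ^+ n.
  rewrite cabsM cabsX cabsM cabsJ cabs_cis mulr1 ler_pM ?cabs_ge0 ?exprn_ge0 ?cabs_ge0 //.
    apply: le_trans (szego_le t z1) _; rewrite lef_pV2 ?posrE ?subr_gt0 //.
    by rewrite lerD2l lerN2.
  by rewrite lerXn2r ?nnegrE ?cabs_ge0.
rewrite E; apply: le_trans (cabs_cmean_le _ (v := fun t => ((1 - rho)^-1 * rho ^+ n) * cabs (p t)) _ _) _.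
- exact: cper_mul_bounded ms hs.
- exact: intgZ.
- by move=> t _; rewrite cabsM mulrC ler_wpM2r ?cabs_ge0.
by rewrite /rmean rintZ // le_eqVlt; apply/orP; left; apply/eqP; ring.
Qed.

End CauchyTransform.

(** * Poisson means *)

Section PoissonMean.
Variable R : realType.
Local Notation C := R[i].
Local Notation T := (2 * pi : R).
Local Notation cper p := (cintg 0 T p).
Implicit Types (p q : R -> C) (z : C) (t : R).

(** Twice the real part of the Szego kernel minus 1: a Poisson mean splits into a holomorphic part,
    an antiholomorphic part and a constant. *)
Lemma poisson_szego z t : cabs z < 1 ->
  (poisson z t)%:C = szego z t + (szego z t)^* - 1 :> C.
Proof.
move=> z1; have n1 : 1 - z * (cis t)^* != 0 by rewrite -cabs_gt0 szego_den_gt0.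
have n2 : (1 - z * (cis t)^*)^* != 0 by rewrite -cabs_gt0 cabsJ szego_den_gt0.
have h1 : (1 - cabs z ^+ 2)%:C = 1 - z * z^* :> C by rewrite mulJ_cabs (rmorphB (real_complex R)) rmorph1.
have h2 : (poisson z t)%:C = (1 - z * z^*) / ((1 - z * (cis t)^*) * (1 - z * (cis t)^*)^*).
  by rewrite [_ * (1 - z * _)^*]mulJ_cabs -h1 /poisson (rmorphM (real_complex R)) (fmorphV (real_complex R)).
have h3 : (szego z t)^* = ((1 - z * (cis t)^*)^*)^-1 by exact: (fmorphV (Num.conj : {rmorphism C -> C})).
rewrite h2 h3 /szego; have cc : cis t * (cis t)^* = 1 :> C by rewrite mulJ_cabs cabs_cis expr1n.
move: n2; rewrite conjB conjM conjCK rmorph1 {h1 h2 h3}.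
move: (cis t) (cis t)^* cc n1 (z^*) => c d cc n1 w n2.
have E : 1 - z * w = (1 - z * d) + (1 - w * c) - (1 - z * d) * (1 - w * c).
  by transitivity (1 - z * w * (c * d)); [rewrite cc mulr1|ring].
by rewrite E; field; rewrite n1 n2.
Qed.

Definition pmean p z : C := cmean (fun t => p t * (poisson z t)%:C).

Lemma cmeas_poisson z : cabs z < 1 -> cmeas (fun t => (poisson z t)%:C).
Proof. by move=> z1; split; [exact: measurable_poisson|exact: measurable_cst]. Qed.

Lemma cper_poisson p z : cmeas p -> cper p -> cabs z < 1 -> cper (fun t => p t * (poisson z t)%:C).
Proof.
move=> mp ip z1; apply: (cper_mul_bounded (K := (1 - cabs z)^-1 ^+ 2)) => //; first exact: cmeas_poisson.
by move=> t; rewrite cabs_real ger0_norm ?poisson_ge0 ?poisson_le.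
Qed.

Lemma pmeanE p z : cmeas p -> cper p -> cabs z < 1 ->
  pmean p z = cauchy_transform p z + (cauchy_transform (fun t => (p t)^*) z)^* - cmean p.
Proof.
move=> mp ip z1; have mJ := cmeasJ mp; have iJ := cintgJ ip.
have i1 := cper_szego mp ip z1; have i2 := cper_szego mJ iJ z1.
rewrite /cauchy_transform -cmeanJ // -cmeanD //; last exact: cintgJ.
rewrite -cmeanB //; last by apply: cintgD => //; exact: cintgJ.
apply: eq_cmean => t _; rewrite poisson_szego // conjM conjCK; ring.
Qed.

Lemma pmeanD p q z : cmeas p -> cper p -> cmeas q -> cper q -> cabs z < 1 ->
  pmean (fun t => p t + q t) z = pmean p z + pmean q z.
Proof.
move=> mp ip mq iq z1; rewrite /pmean -cmeanD; [|exact: cper_poisson|exact: cper_poisson].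
by apply: eq_cmean => t _; rewrite mulrDl.
Qed.

Lemma pmeanZ k p z : cmeas p -> cper p -> cabs z < 1 ->
  pmean (fun t => k * p t) z = k * pmean p z.
Proof.
move=> mp ip z1; rewrite /pmean -cmeanZ; last exact: cper_poisson.
by apply: eq_cmean => t _; rewrite mulrA.
Qed.

Lemma pmeanJ p z : cmeas p -> cper p -> cabs z < 1 ->
  pmean (fun t => (p t)^*) z = (pmean p z)^*.
Proof.
move=> mp ip z1; rewrite /pmean -cmeanJ; last exact: cper_poisson.
by apply: eq_cmean => t _; rewrite conjM conjRe.
Qed.

Lemma Re_pmean_ge0 (w : R -> R) z : (forall t, 0 <= w t) -> cabs z < 1 -> 0 <= Re (pmean (fun t => (w t)%:C) z).
Proof.
move=> w0 z1; rewrite /pmean Re_cmean /rmean mulr_ge0 ?invr_ge0 ?(ltW (twopi_gt0 R)) //.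
by apply: rint_ge0 => t _; simpc => /=; rewrite mulr_ge0 // poisson_ge0.
Qed.

Lemma powser_cst (c : C) : powser (fun k => if k == 0%N then c else 0) (fun=> c).
Proof.
move=> rho /andP[r0 r1]; exists (cabs c), 0; split; rewrite ?cabs_ge0 ?lexx ?ltr01 // => n z _.
case: n => [|n]; first by rewrite big_ord0 subr0 expr0 mulr1.
rewrite big_ord_recl /= expr0 mulr1 big1 ?addr0 ?subrr ?cabs0 => [|j _]; last by rewrite mul0r.
by rewrite mulr_ge0 ?cabs_ge0 // exprn_ge0.
Qed.

Lemma powser_cst_coef (a : nat -> C) f z : powser a f -> (forall k, a k.+1 = 0) -> cabs z < 1 -> f z = a 0%N.
Proof.
move=> ha h z1; apply: ccvg_uniq (powser_cvg ha z1) _ => e e0; exists 1%N => n n1.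
rewrite /psum (bigD1 (Ordinal n1)) //= expr0 mulr1 big1 ?addr0 ?subrr ?cabs0 // => -[[|j] jn] //= _.
by rewrite h mul0r.
Qed.

Lemma pmean1 z : cabs z < 1 -> pmean (fun=> 1) z = 1.
Proof.
move=> z1; have h1 : cmeas (fun=> 1 : C) by exact: cmeas_cst.
have h2 : cper (fun=> 1 : C) by exact: cintg_cst.
have hf k : fourier (fun=> 1) k = (k == 0%N)%:R :> C.
  by rewrite /fourier -cmean_cisVX; apply: eq_cmean => t _; rewrite mul1r cisV.
have hc : cauchy_transform (fun=> 1) z = 1 :> C.
  by rewrite (powser_cst_coef (powser_cauchy_transform h1 h2)) ?hf // => k; rewrite hf.
rewrite pmeanE // (_ : (fun=> 1^*) = (fun=> 1)); last by apply/funext => t; exact: rmorph1.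
rewrite hc cmean_cst (_ : 1^* = 1); last exact: rmorph1.
by rewrite addrK.
Qed.

End PoissonMean.

(** * Functions on the circle approximated by Taylor polynomials *)

Section BoundaryFourier.
Variable R : realType.
Local Notation C := R[i].
Local Notation T := (2 * pi : R).
Local Notation cper p := (cintg 0 T p).
Variables (a : nat -> C) (g : C -> C) (u : R -> C).
Hypothesis hg : powser a g.
Hypothesis boundary_cmeas : cmeas u.
(** This holds for radial boundary values, and also for the function of [riesz_fischer], whose
    radial limits are not known beforehand; hence the hypothesis in place of [boundary_value]. *)
Hypothesis approx : forall e : R, 0 < e -> exists N, forall n, (N <= n)%N ->
  intg 0 T (fun t => cabs (u t - psum a n (cis t)) ^+ 2) /\
  rmean (fun t => cabs (u t - psum a n (cis t)) ^+ 2) <= e.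

Lemma boundary_intg_sqr : intg 0 T (fun t => cabs (u t) ^+ 2).
Proof.
have [N hN] := approx ltr01; have [i1 _] := hN N (leqnn N).
have i2 : intg 0 T (fun t => cabs (psum a N (cis t)) ^+ 2).
  have [[h _] _] := parseval_psum a a N 1; apply: eq_intg h => t _.
  by rewrite /= mul1r mulJ_cabs.
apply: (@intg_le _ _ _ _ (fun t => 2 * cabs (u t - psum a N (cis t)) ^+ 2 + 2 * cabs (psum a N (cis t)) ^+ 2)).
- by apply: measurable_funX; exact: (cmeas_cabs boundary_cmeas).
- by apply: intgD; apply: intgZ.
move=> t _; rewrite ger0_norm ?sqr_ge0 //.
by apply: le_trans (sqr_cabsD_le _ _); rewrite subrK.
Qed.

Lemma boundary_cper : cper u.
Proof.
apply: (cintg_le (v := fun t => 1 + cabs (u t) ^+ 2)); first exact: boundary_cmeas.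
  by apply: intgD; [exact: intg_cst|exact: boundary_intg_sqr].
move=> t _; move: (cabs _) (cabs_ge0 (u t)) => x x0; have := sqr_ge0 (x - 1); rewrite expr2; nra.
Qed.

Lemma cmean_boundary_cvg (q : R -> C) : cmeas q -> (forall t, cabs (q t) <= 1) ->
  ccvg (fun n => cmean (fun t => psum a n (cis t) * q t)) (cmean (fun t => u t * q t)).
Proof.
move=> mq hq e e0; have e2 : 0 < e / 2 by rewrite divr_gt0.
have [N hN] := approx (exprn_gt0 2 e2); exists N => n Nn.
have [i2 r2] := hN n Nn; have mu' := boundary_cmeas; have iu := boundary_cper.
have mp := @cmeas_psum R a n.
have ip : cper (fun t => psum a n (cis t)).
  by have [K K0 hK] := psum_cis_lip a n; apply/ccont_cintg/ccont_lip => s t _ _; exact: hK.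
have mB := cmeasB mu' mp; have iB := cintgB iu ip; have iC := intg_cabs mB iB.
have i1 : cper (fun t => u t * q t) by exact: cper_mul_bounded mq hq.
have i3 : cper (fun t => psum a n (cis t) * q t) by exact: cper_mul_bounded mq hq.
have i4 : cper (fun t => (u t - psum a n (cis t)) * q t) by exact: cper_mul_bounded mB iB mq hq.
rewrite cabs_distC -cmeanB // (eq_cmean (q := fun t => (u t - psum a n (cis t)) * q t)); last first.
  by move=> t _; rewrite mulrBl.
apply: le_lt_trans (_ : e / 2 < e); last by rewrite ltr_pdivrMr // ltr_pMr // ltr1n.
apply: le_trans (cabs_cmean_le i4 iC _) _.
  by move=> t _; rewrite cabsM ler_piMr ?cabs_ge0.
have T0 := twopi_gt0 R.
have := sqr_rav_le T0 iC i2; rewrite /rav subr0 -/(rmean _) -/(rmean _) => h.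
have h2 := le_trans h r2.
have h0 : 0 <= rmean (fun t => cabs (u t - psum a n (cis t))).
  by rewrite /rmean mulr_ge0 ?invr_ge0 ?(ltW T0) // rint_ge0 // => t _; exact: cabs_ge0.
by rewrite -(ler_pXn2r (ltn0Sn 1)) ?nnegrE // ltW.
Qed.

Lemma cmean_psum n (q : R -> C) : cmeas q -> (forall t, cabs (q t) <= 1) ->
  cmean (fun t => psum a n (cis t) * q t) = \sum_(k < n) a k * cmean (fun t => cis t ^+ k * q t).
Proof.
move=> mq hq; have ik k : cper (fun t => cis t ^+ k * q t).
  apply: (cper_mul_bounded _ _ mq hq); first by apply/cmeasX/cmeas_cis.
  exact: cper_cisX.
rewrite (eq_cmean (q := fun t => \sum_(k < n) a k * (cis t ^+ k * q t))); last first.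
  by move=> t _; rewrite /psum mulr_suml; apply: eq_bigr => k _; rewrite mulrA.
rewrite (cmean_sum (p := fun k t => a k * (cis t ^+ k * q t))); last by move=> k _; apply: cintgZ.
by apply: eq_bigr => k _; rewrite cmeanZ.
Qed.

Lemma cmean_cisXJ k l : cmean (fun t => cis t ^+ k * (cis t)^* ^+ l) = (k == l)%:R :> C.
Proof.
have [_] := circle_monomials (1 : R) k l; rewrite expr1n.
rewrite (eq_cmean (q := fun t => cis t ^+ k * (cis t)^* ^+ l)); last by move=> t _; rewrite !mul1r conjX.
by move=> ->; case: eqP.
Qed.

Lemma boundary_fourier k : fourier u k = a k.
Proof.
have hX t : cabs ((cis t)^* ^+ k : C) <= 1 by rewrite cabs_cisJX.
apply: ccvg_uniq (cmean_boundary_cvg (cmeas_cisJX R k) hX) _.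
move=> e e0; exists k.+1 => n kn; rewrite (cmean_psum n (cmeas_cisJX R k) hX).
rewrite (bigD1 (Ordinal kn)) //= cmean_cisXJ eqxx mulr1 big1 ?addr0 ?subrr ?cabs0 // => j jk.
by rewrite cmean_cisXJ (_ : _ == _ = false) ?mulr0 //; apply/negP => /eqP jk'; case/eqP: jk; apply/val_inj.
Qed.

Lemma boundary_fourierJ k : fourier (fun t => (u t)^*) k = if k == 0%N then (a 0%N)^* else 0.
Proof.
have mX : cmeas (fun t : R => cis t ^+ k) by apply/cmeasX/cmeas_cis.
have hX t : cabs (cis t ^+ k : C) <= 1 by rewrite cabsX cabs_cis expr1n.
have -> : fourier (fun t => (u t)^*) k = (cmean (fun t => u t * cis t ^+ k))^*.
  rewrite -cmeanJ; last exact: cper_mul_bounded boundary_cmeas boundary_cper mX hX.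
  by apply: eq_cmean => t _; rewrite conjM conjX.
rewrite (_ : cmean _ = if k == 0%N then a 0%N else 0); first by case: ifP => // _; exact: rmorph0.
apply: ccvg_uniq (cmean_boundary_cvg mX hX) _ => e e0; exists 1%N => n n1.
rewrite cmean_psum // (eq_bigr (fun j : 'I_n => if (j + k)%N == 0%N then a j else 0)); last first.
  move=> j _; rewrite (eq_cmean (q := fun t => cis t ^+ (j + k))); last by move=> t _; rewrite exprD.
  by rewrite cmean_cisX; case: eqP => _; rewrite ?mulr1 ?mulr0.
case: k {mX hX} => [|k]; last first.
  by rewrite big1 ?subrr ?cabs0 // => j _; rewrite addnS.
rewrite (bigD1 (Ordinal n1)) //= big1 ?addr0 ?subrr ?cabs0 // => j jk.
by rewrite addn0 ifN //; apply: contraNneq jk => jk'; apply/eqP/val_inj.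
Qed.

(** The Fourier coefficients of [u] of negative index vanish, so the antiholomorphic part reduces to
    the constant [a 0], which the mean cancels. *)
Lemma pmean_boundary z : cabs z < 1 -> pmean u z = g z.
Proof.
move=> z1; have mu' := boundary_cmeas; have iu := boundary_cper.
rewrite pmeanE //.
have -> : cauchy_transform u z = g z.
  by apply: (powser_eq _ hg z1); apply: powser_extl (powser_cauchy_transform mu' iu); exact: boundary_fourier.
have h := powser_cauchy_transform (cmeasJ mu') (cintgJ iu).
have -> : cauchy_transform (fun t => (u t)^*) z = (a 0%N)^*.
  by rewrite (powser_cst_coef h) ?boundary_fourierJ // => k; rewrite boundary_fourierJ.
have -> : cmean u = a 0%N.
  by rewrite -boundary_fourier /fourier; apply: eq_cmean => t _; rewrite expr0 mulr1.
by rewrite conjCK addrK.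
Qed.

Lemma boundary_sqr_cper : cmeas (fun t => (cabs (u t) ^+ 2)%:C) /\ cper (fun t => (cabs (u t) ^+ 2)%:C).
Proof.
have i2 := boundary_intg_sqr; have mu' := boundary_cmeas; split.
  by split; [apply: measurable_funX; exact: cmeas_cabs|exact: measurable_cst].
by split => //; exact: intg_cst.
Qed.

(** The Poisson mean of the square distance to [c] is that to [g z] plus |g z - c|^2, as for a
    variance; so a bound for any single [c] bounds the one at [g z]. *)
Lemma pmean_sqr_shift z c : cabs z < 1 ->
  pmean (fun t => (cabs (u t - c) ^+ 2)%:C) z =
  pmean (fun t => (cabs (u t) ^+ 2)%:C) z - (cabs (g z) ^+ 2)%:C + (cabs (g z - c) ^+ 2)%:C.
Proof.
move=> z1; have mu' := boundary_cmeas; have iu := boundary_cper.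
have [m2 i2] := boundary_sqr_cper; have mJ := cmeasJ mu'; have iJ := cintgJ iu.
have h1 : cmeas (fun=> 1 : C) by exact: cmeas_cst.
have h2 : cper (fun=> 1 : C) by exact: cintg_cst.
have p1 := pmean1 z1.
rewrite (_ : (fun t => (cabs (u t - c) ^+ 2)%:C) = (fun t => ((cabs (u t) ^+ 2)%:C + - c^* * u t) +
    (- c * (u t)^* + (c * c^*) * 1))); last first.
  by apply/funext => t; rewrite -!mulJ_cabs conjB; ring.
have j1 : cmeas (fun t => - c^* * u t) by apply: cmeasM => //; exact: cmeas_cst.
have j2 : cper (fun t => - c^* * u t) by exact: cintgZ.
have j3 : cmeas (fun t => - c * (u t)^*) by apply: cmeasM => //; exact: cmeas_cst.
have j4 : cper (fun t => - c * (u t)^*) by exact: cintgZ.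
have j5 : cmeas (fun t : R => c * c^* * 1) by exact: cmeas_cst.
have j6 : cper (fun t : R => c * c^* * 1) by exact: cintg_cst.
rewrite pmeanD //; [|exact: cmeasD|exact: cintgD|exact: cmeasD|exact: cintgD].
rewrite pmeanD // [pmean (fun t => - c * _ + _) _]pmeanD // !pmeanZ // pmeanJ //.
by rewrite pmean_boundary // p1 -!mulJ_cabs conjB; ring.
Qed.

End BoundaryFourier.

(** * The holomorphic correction b for a function of BMOA *)

Section GarsiaSymbol.
Variable R : realType.
Local Notation C := R[i].
Local Notation T := (2 * pi : R).

(* [b = 1 + K - B], where [Re B] is the Poisson integral of [|F|^2]. *)
Lemma bmo_carleson_symbol (a : nat -> C) (g F : C -> C) (E : R) :
  powser a g -> (forall n, energy a n <= E) -> boundary_value g F -> BMO_circle F ->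
  exists cb b L, powser cb b /\ forall z, cabs z < 1 -> 1 <= Re (b z) + cabs (g z) ^+ 2 <= L.
Proof.
move=> hg hE hF [_ _ [M0 hM0]]; pose M := `|M0|; have M0' : 0 <= M by exact: normr_ge0.
pose u t := F (cis t); have mu' : cmeas u := hF.1.
have happ := boundary_approx hg hE hF.
have iu : cintg 0 T u := boundary_cper mu' happ.
have T0 := twopi_gt0 R.
have pu t : u (t + T) = u t by rewrite /u cis_periodic.
have i2 := boundary_intg_sqr mu' happ.
have iup a' b' := cintg_periodic mu' pu iu a' b'.
have bmo a' b' : a' < b' -> b' <= a' + T -> rav a' b' (fun t => cabs (u t - av a' b' u)) <= M.
  move=> ab abT; have ba : 0 < b' - a' by rewrite subr_gt0.
  have h := hM0 a' b' ab abT; rewrite /rav mulrC ler_pdivrMr //.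
  apply: (@le_trans _ _ (M0 * (b' - a'))); last by rewrite ler_wpM2r ?(ltW ba) // ler_norm.
  have ii : intg a' b' (fun t => cabs (u t - av a' b' u)).
    apply: (intg_cabs (p := fun t => u t - av a' b' u)); first by apply: cmeasB => //; exact: cmeas_cst.
    by apply: cintgB => //; exact: cintg_cst.
  rewrite -lee_fin /rint /Rintegral fineK //; exact: integrable_fin_num ii.
have approx e : 0 < e -> exists (v : R -> C) K,
    [/\ cmeas v, 0 <= K, forall s t, cabs (v s - v t) <= K * `|s - t|, forall t, v (t + T) = v t &
    intg 0 T (fun t => cabs (u t - v t) ^+ 2) /\ rint 0 T (fun t => cabs (u t - v t) ^+ 2) <= e].
  move=> e0; have [N hN] := happ _ (divr_gt0 e0 T0).
  have [K K0 hK] := psum_cis_lip a N.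
  exists (fun t => psum a N (cis t)), K; split => //; first exact: cmeas_psum.
    by move=> t; rewrite cis_periodic.
  have [k1 k2] := hN N (leqnn N); split => //.
  by move: k2; rewrite /rmean mulrC ler_pdivrMr // divfK // gt_eqF.
have G := garsia_bound M0' mu' pu iu i2 bmo approx.
have [m2 ip2] := boundary_sqr_cper mu' happ.
(* The bound of [garsia_bound], divided by 2 pi because [pmean] is normalized. *)
pose Kc := 144 * (6528 * M ^+ 2) / T.
pose w t := (cabs (u t) ^+ 2)%:C.
(* For a real function this holomorphic function has the Poisson mean as its real part. *)
pose B z := 2 * cauchy_transform w z - cmean w.
have ReBp z : cabs z < 1 -> Re (B z) = Re (pmean w z).
  move=> z1; rewrite pmeanE //.
  rewrite (_ : (fun t => (w t)^*) = w); last by apply/funext => t; rewrite conjRe.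
  by rewrite /B mulr_natl mulr2n !ReB !ReD ReJ.
(* The lower bound takes c = [g z] in [pmean_sqr_shift], the upper one the constant given by
   [garsia_bound]. *)
have hA z : cabs z < 1 -> cabs (g z) ^+ 2 <= Re (B z) <= cabs (g z) ^+ 2 + Kc.
  move=> z1; rewrite ReBp //.
  have key c : Re (pmean (fun t => (cabs (u t - c) ^+ 2)%:C) z) =
      Re (pmean w z) - cabs (g z) ^+ 2 + cabs (g z - c) ^+ 2.
    by rewrite (pmean_sqr_shift hg mu' happ c z1) ReD ReB.
  have pos' c := @Re_pmean_ge0 R (fun t => cabs (u t - c) ^+ 2) z (fun t => sqr_ge0 _) z1.
  apply/andP; split.
    have := pos' (g z); rewrite key subrr cabs0 expr0n addr0.
    by rewrite subr_ge0.
  have [c hc] := G z z1; have kc := key c.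
  rewrite -lerBlDl; apply: (@le_trans _ _ (Re (pmean (fun t => (cabs (u t - c) ^+ 2)%:C) z))).
    by rewrite kc lerDl sqr_ge0.
  rewrite /pmean Re_cmean /rmean /Kc mulrC ler_wpM2r ?invr_ge0 ?(ltW T0) //.
  apply: le_trans hc; rewrite le_eqVlt; apply/orP; left; apply/eqP.
  by apply: eq_rint => t _; rewrite -(rmorphM (real_complex R)).
exists (fun k => (if k == 0%N then (1 + Kc)%:C + cmean w else 0) + -2 * fourier w k).
exists (fun z => ((1 + Kc)%:C + cmean w) + -2 * cauchy_transform w z), (1 + Kc); split.
  apply: powserD; last exact/powserZ/powser_cauchy_transform.
  exact: powser_cst.
move=> z z1; have := hA z z1.
rewrite (_ : _ + -2 * _ = (1 + Kc)%:C - B z); last by rewrite /B; ring.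
by rewrite ReD ReN /=; move: (Re (B z)) (cabs (g z) ^+ 2) => x y; lra.
Qed.

End GarsiaSymbol.

(** * Radial limits *)

Section RieszFischer.
Variable R : realType.
Local Notation C := R[i].
Local Notation mu := (@lebesgue_measure R).
Local Notation T := (2 * pi : R).

Lemma ccvg_summable (p : nat -> C) (K : R) :
  (forall n, \sum_(j < n) cabs (p j.+1 - p j) <= K) -> exists l, ccvg p l.
Proof.
move=> hK; pose S n := \sum_(j < n) cabs (p j.+1 - p j).
have hS n m : (n <= m)%N -> S n <= S m.
  by move=> nm; rewrite -(subnKC nm); elim: (m - n)%N => [|k IH];
    rewrite ?addn0 // addnS /S big_ord_recr /=; apply: ler_wpDr; rewrite ?cabs_ge0.
apply: ccvg_cauchy => e e0; have [N hN] := bounded_tail hS hK e0; exists N => n Nn.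
apply: le_lt_trans (hN n); rewrite lerBrDl -(subnKC Nn); elim: (n - N)%N => [|k IH].
  by rewrite addn0 subrr cabs0 addr0.
rewrite addnS /S big_ord_recr /= -/(S (N + k)%N); apply: le_trans (lerD IH (lexx _)).
by rewrite -addrA lerD2l [leRHS]addrC; apply: (le_trans _ (cabsD _ _)); rewrite addrA subrK.
Qed.

(** The sum of the series has a finite integral, by monotone convergence, and so is finite almost
    everywhere. *)
Lemma ae_summable (b K : R) (D : nat -> R -> R) : 0 <= b ->
  (forall j, measurable_fun setT (D j)) -> (forall j t, 0 <= D j t) ->
  (forall j, intg 0 b (D j)) ->
  (forall n, \sum_(j < n) rint 0 b (D j) <= K) ->
  {ae mu, forall t, 0 <= t <= b -> exists Kt, forall n, \sum_(j < n) D j t <= Kt}.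
Proof.
move=> b0 mD D0 iD hK; pose f j t := (D j t)%:E.
have mf j : measurable_fun `[0, b] (f j) by apply/measurable_EFinP/measurable_funTS.
have mI : measurable `[0 : R, b]%classic by [].
have f0 j t : `[0, b]%classic t -> (0 <= f j t)%E by move=> _; rewrite lee_fin.
have hI := integral_nneseries mu mI mf f0.
have hle : (\int[mu]_(t in `[0%R, b]) (\sum_(n <oo) f n t) <= K%:E)%E.
  rewrite hI; apply: lime_le; first by apply: is_cvg_nneseries => n _ _; apply: integral_ge0 => t; exact: f0.
  apply: nearW => n; rewrite big_mkord.
  rewrite (eq_bigr (fun j : 'I_n => (rint 0 b (D j))%:E)); last first.
    move=> j _; rewrite /rint /Rintegral fineK //.
    exact: integrable_fin_num (iD j).
  rewrite sumEFin lee_fin; exact: hK.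
have s0 t : `[0, b]%classic t -> (0 <= \sum_(n <oo) f n t)%E.
  by move=> ht; apply: nneseries_ge0 => n _ _; exact: f0.
have ii : mu.-integrable `[0%R, b] (fun t => \sum_(n <oo) f n t)%E.
  apply/integrableP; split.
    by apply: (@ge0_emeasurable_sum _ _ _ _ f xpredT) => [j t ht _|j _]; [exact: f0|exact: mf].
  apply: (@le_lt_trans _ _ K%:E); last exact: ltry.
  apply: le_trans hle; rewrite le_eqVlt; apply/orP; left; apply/eqP.
  by apply: eq_integral => t; rewrite inE => ht; rewrite gee0_abs ?s0.
have hfin : {ae mu, forall t, `[0, b]%classic t -> (\sum_(n <oo) f n t)%E \is a fin_num}.
  by apply: integrable_ae => //; exact: ii.
apply: ae_imp hfin => t ht tb.
have tI : `[0, b]%classic t by rewrite /= in_itv.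
exists (fine (\sum_(n <oo) f n t)%E) => n; rewrite -lee_fin fineK ?ht //.
rewrite -sumEFin -(big_mkord xpredT (fun j => f j t)).
by apply: nneseries_lim_ge => j _ _; exact: f0.
Qed.

Lemma psum_dist_L2 (a : nat -> C) m n : (m <= n)%N ->
  intg 0 T (fun t => cabs (psum a n (cis t) - psum a m (cis t)) ^+ 2) /\
  rmean (fun t => cabs (psum a n (cis t) - psum a m (cis t)) ^+ 2) = energy a n - energy a m.
Proof.
move=> mn; have [[i1 _] e1] := parseval_psum (tail m a) (tail m a) n 1.
have E t : cabs (psum a n (cis t) - psum a m (cis t)) ^+ 2 =
    Re (psum (tail m a) n (1%:C * cis t) * (psum (tail m a) n (1%:C * cis t))^*).
  by rewrite mulJ_cabs mul1r psum_tail_coef.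
split; first by apply: eq_intg i1 => t _; rewrite E.
rewrite /rmean (eq_rint (fun t _ => E t)) -/(rmean _) -Re_cmean e1.
rewrite (_ : dil_coef 1 (tail m a) = tail m a) ?sesq_diag ?energy_tailE //.
by apply/funext => k; rewrite /dil_coef expr1n mulr1.
Qed.

(** Upper limits of the real and imaginary parts are measurable and defined everywhere; they give
    the limit at the points where it exists. *)
Definition series_boundary (a : nat -> C) (N : nat -> nat) (w : C) : C :=
  fine (limn_esup (fun j => (Re (psum a (N j) w))%:E)) +i*
  fine (limn_esup (fun j => (Im (psum a (N j) w))%:E)).

Lemma series_boundary_meas a N : circle_measurable (series_boundary a N).
Proof.
by split; apply: measurableT_comp => //; apply: measurable_fun_limn_esup => j;
  apply/measurable_EFinP; have [] := cmeas_psum a (N j).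
Qed.

Lemma series_boundary_ccvg a N w l : ccvg (fun j => psum a (N j) w) l -> series_boundary a N w = l.
Proof.
move=> h; rewrite /series_boundary.
have hR : (Re (psum a (N j) w))%:E @[j --> \oo] --> (Re l)%:E.
  apply: cvg_EFin; [by apply: nearW|apply/cvgrPdist_lt => e e0].
  have [M hM] := h e e0; exists M => // n /= Mn; apply: le_lt_trans (hM n Mn).
  by rewrite distrC /= -ReB; exact: normr_Re_le.
have hI : (Im (psum a (N j) w))%:E @[j --> \oo] --> (Im l)%:E.
  apply: cvg_EFin; [by apply: nearW|apply/cvgrPdist_lt => e e0].
  have [M hM] := h e e0; exists M => // n /= Mn; apply: le_lt_trans (hM n Mn).
  by rewrite distrC /= -ImB; exact: normr_Im_le.
have [_ ->] := cvg_limn_einf_sup hR; have [_ ->] := cvg_limn_einf_sup hI.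
by rewrite /=; case: (l).
Qed.

(** Tail energies below 4^(- j) give mean distances below 2^(- j) by Cauchy-Schwarz, so the
    increments along the subsequence are summable almost everywhere; Fatou's lemma then bounds the
    distance of the limit to every Taylor polynomial. *)
Lemma riesz_fischer (a : nat -> C) (E : R) : (forall n, energy a n <= E) ->
  exists F : C -> C, circle_measurable F /\ forall e : R, 0 < e -> exists N, forall n, (N <= n)%N ->
    intg 0 T (fun t => cabs (F (cis t) - psum a n (cis t)) ^+ 2) /\
    rmean (fun t => cabs (F (cis t) - psum a n (cis t)) ^+ 2) <= e.
Proof.
move=> hE; have T0 := twopi_gt0 R.
have p4 j : 0 < (4 : R)^-1 ^+ j by rewrite exprn_gt0 // invr_gt0.
have [N0 hN0] := choice (fun j => energy_tail hE (p4 j)).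
(* Summing the thresholds makes the sequence of indices nondecreasing; the successors make it at
   least j. *)
pose N j := (\sum_(i < j.+1) (N0 i).+1)%N.
have Nge j : (N0 j <= N j)%N by rewrite /N big_ord_recr /= (leq_trans (leqnSn _)) // leq_addl.
have NS j : (N j <= N j.+1)%N by rewrite /N [in X in (_ <= X)%N]big_ord_recr /= leq_addr.
have Nj j : (j <= N j)%N.
  elim: j => // j IH; rewrite /N big_ord_recr /= -/(N j); apply: leq_trans (leq_add IH (ltn0Sn _)).
  by rewrite addn1.
pose D j t := cabs (psum a (N j.+1) (cis t) - psum a (N j) (cis t)).
have mB n m : cmeas (fun t => psum a n (cis t) - psum a m (cis t)).
  by apply: cmeasB; exact: cmeas_psum.
have iB n m : cintg 0 T (fun t => psum a n (cis t) - psum a m (cis t)).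
  apply: cintgB; [have [K K0 hK] := psum_cis_lip a n|have [K K0 hK] := psum_cis_lip a m];
  by apply/ccont_cintg/ccont_lip => s t _ _; exact: hK.
have iD j : intg 0 T (D j) by exact: intg_cabs (mB _ _) (iB _ _).
have hD j : rint 0 T (D j) <= T * 2^-1 ^+ j.
  have [i2 e2] := psum_dist_L2 a (NS j).
  have r2 : rmean (fun t => D j t ^+ 2) <= 4^-1 ^+ j.
    rewrite /D e2; apply: ltW; apply: le_lt_trans (hN0 j (N j.+1) _); last exact: leq_trans (Nge j) (NS j).
    by rewrite lerD2l lerN2 energy_le.
  have := sqr_rav_le T0 (iD j) i2; rewrite /rav subr0 -/(rmean _) -/(rmean _) => h.
  have h2 := le_trans h r2.
  have h0 : 0 <= rmean (D j).
    by rewrite /rmean mulr_ge0 ?invr_ge0 ?(ltW T0) // rint_ge0 // => t _; exact: cabs_ge0.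
  have h3 : rmean (D j) <= 2^-1 ^+ j.
    rewrite -(ler_pXn2r (ltn0Sn 1)) ?nnegrE ?exprn_ge0 ?invr_ge0 //; apply: (le_trans h2).
    by rewrite exprAC (_ : 2^-1 ^+ 2 = 4^-1 :> R) // exprVn; congr (_^-1); ring.
  by move: h3; rewrite /rmean mulrC ler_pdivrMr // [_ * (2 * pi)]mulrC.
have hS n : \sum_(j < n) rint 0 T (D j) <= T * 2.
  apply: (@le_trans _ _ (T * \sum_(j < n) 2^-1 ^+ j)); first by rewrite mulr_sumr; apply: ler_sum => j _; exact: hD.
  rewrite ler_wpM2l ?(ltW T0) // -(big_mkord xpredT (fun j => (2 : R)^-1 ^+ j)).
  have h12 : 0 <= (2 : R)^-1 < 1 by apply/andP; split; lra.
  apply: le_trans (sum_geometric h12 (leq0n n)) _.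
  by rewrite expr0 le_eqVlt; apply/orP; left; apply/eqP; field.
have mD j : measurable_fun setT (D j) by exact: (cmeas_cabs (mB _ _)).
have D0 j t : 0 <= D j t by exact: cabs_ge0.
have hae := ae_summable (ltW T0) mD D0 iD hS.
pose F := series_boundary a N; exists F; split; first exact: series_boundary_meas.
move=> e e0; have [M hM] := energy_tail hE e0; exists M => m Mm.
pose v j t := cabs (psum a (N (j + m)%N) (cis t) - psum a m (cis t)) ^+ 2.
have mN j : (m <= N (j + m))%N by apply: leq_trans (Nj _); rewrite leq_addl.
have [] := @rint_fatou R 0 T (T * e) v (fun t => cabs (F (cis t) - psum a m (cis t)) ^+ 2).
- apply: measurable_funX.
  exact: (cmeas_cabs (cmeasB (series_boundary_meas a N : cmeas (F \o @cis R)) (cmeas_psum a m))).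
- by move=> j; have [] := psum_dist_L2 a (mN j).
- by move=> j t; exact: sqr_ge0.
- by move=> t; exact: sqr_ge0.
- move=> j; have [_] := psum_dist_L2 a (mN j); rewrite -/(v j) => ej.
  have : rmean (v j) <= e.
    rewrite ej; apply: ltW; apply: le_lt_trans (hM (N (j + m)%N) _); last exact: leq_trans (mN j).
    by rewrite lerD2l lerN2 energy_le.
  by rewrite /rmean mulrC ler_pdivrMr // [e * _]mulrC.
- apply: ae_imp hae => t ht tT; have [Kt hK] := ht tT.
  have [l hl] := ccvg_summable (p := fun j => psum a (N j) (cis t)) hK.
  rewrite /F (series_boundary_ccvg hl); apply: ccvg_cabs_sqr; apply: ccvgB; last exact: ccvg_cst.
  exact: (ccvg_shift m hl).
by move=> k1 k2; split => //; rewrite /rmean mulrC ler_pdivrMr // [e * _]mulrC.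
Qed.

End RieszFischer.

(** * Poisson means at Lebesgue points *)

Section PoissonVanish.
Variable R : realType.
Local Notation C := R[i].
Local Notation mu := (@lebesgue_measure R).
Local Notation T := (2 * pi : R).

(** Within distance [h1] of [th] small averages make the dyadic sum small; beyond it the kernel is
    at most a multiple of (1 - r) / h1^2, which tends to 0. *)
Lemma poisson_vanish (w : R -> R) (th : R) : measurable_fun setT w -> (forall t, 0 <= w t) ->
  (forall t, w (t + T) = w t) -> intg 0 T w ->
  (forall e, 0 < e -> exists2 h0, 0 < h0 & forall h, 0 < h -> h <= h0 ->
     rint (th - h) (th + h) w <= e * h) ->
  forall e, 0 < e -> exists2 d, 0 < d & forall r, 0 <= r < 1 -> 1 - r < d ->
    rmean (fun t => w t * poisson (r%:C * cis th) t) <= e.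
Proof.
move=> mw w0 pw iw hL e e0; have T0 := twopi_gt0 R; have p0 := pi_gt0 R.
have iwp a b : intg a b w by exact: intg_periodic.
have [c c0 hP] : exists2 c : R, 0 < c & forall r t, 0 <= r < 1 -> `|t - th| <= pi ->
    poisson (r%:C * cis th) t <= c * ((1 - r) / ((1 - r) ^+ 2 + (t - th) ^+ 2)).
  by exists 144; [rewrite ltr0n|move=> r t; exact: poisson_polar_le].
(* The near and the far part may each cost [X], and 2 c X = T e; the 6 in [e1] is the bound of the
   factor in [rint_wQ_small]. *)
pose X := T * e / (2 * c); have X0 : 0 < X by rewrite divr_gt0 // mulr_gt0.
pose e1 := X / 6; have e10 : 0 < e1 by rewrite divr_gt0.
have [h0 h00 hh] := hL e1 e10.
pose h1 := Num.min h0 pi; have h10 : 0 < h1 by rewrite lt_min h00 p0.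
pose W := rint 0 T w; have W0 : 0 <= W by exact: rint_ge0.
(* Makes the far part at most [X]; [W + 1] keeps the denominator positive when [w] has integral
   0. *)
pose d1 := h1 ^+ 2 * X / (W + 1).
have d10 : 0 < d1 by rewrite /d1 divr_gt0 ?ltr_wpDl // mulr_gt0 ?exprn_gt0.
exists (Num.min h1 d1) => [|r hr]; first by rewrite lt_min h10 d10.
rewrite lt_min => /andP[rh rd]; have /andP[r0 r1] := hr.
have d0 : 0 < 1 - r by rewrite subr_gt0.
have [j [s [hs ds sd]]] := exists_dyadic_scale d0 (ltW rh).
have hsmall i : (i <= j)%N -> rint (th - 2 ^+ i * s) (th + 2 ^+ i * s) w <= e1 * (2 ^+ i * s).
  move=> ij; have s0 : 0 < s by exact: lt_le_trans d0 ds.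
  apply: hh; first by rewrite mulr_gt0 // exprn_gt0.
  have h1h : h1 <= h0 by rewrite ge_min lexx.
  apply: le_trans h1h; rewrite -hs ler_wpM2r ?(ltW s0) //.
  by apply: ler_weXn2l => //; rewrite ler1n.
have K := rint_wQ_small mw iwp w0 d0 ds sd (ltW e10) hsmall; rewrite hs in K.
have h1p : h1 <= pi by rewrite ge_min lexx orbT.
have K2 := rint_wQ_split mw iwp w0 th d0 h10 h1p.
have EW : rint (th - pi) (th + pi) w = W.
  by rewrite /W -(rint_periodic mw pw iw (th - pi)); congr (rint _ _ _); ring.
rewrite EW in K2.
have pz1 : cabs (r%:C * cis th : C) < 1 by rewrite cabs_polar.
have mwP : measurable_fun setT (fun t => w t * poisson (r%:C * cis th) t).
  by apply: measurable_funM => //; exact: measurable_poisson.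
have iwP a b : intg a b (fun t => w t * poisson (r%:C * cis th) t).
  apply: (@intg_le _ _ _ _ (fun t => (1 - r)^-1 ^+ 2 * w t)) => //; first exact: intgZ.
  move=> t _; rewrite ger0_norm; last by apply: mulr_ge0 => //; exact: poisson_ge0.
  rewrite [leLHS]mulrC; apply: ler_wpM2r => //.
  by have := poisson_le t pz1; rewrite cabs_polar.
have pwP t : w (t + T) * poisson (r%:C * cis th) (t + T) = w t * poisson (r%:C * cis th) t.
  by rewrite pw /poisson cis_periodic.
rewrite /rmean mulrC ler_pdivrMr // -(@rint_periodic _ _ mwP pwP (iwP _ _) (th - pi)).
rewrite (_ : th - pi + T = th + pi); last by ring.
have iQ := intg_wQ mw iwp w0 th d0 (th - pi) (th + pi).
apply: (@le_trans _ _ (c * rint (th - pi) (th + pi) (fun t => w t * ((1 - r) / ((1 - r) ^+ 2 + (t - th) ^+ 2))))).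
  rewrite -rintZ //; apply: ler_rint => //; first exact: intgZ.
  move=> t ht; rewrite [leRHS]mulrCA; apply: ler_wpM2l => //; apply: hP => //.
  by move: ht => /andP[]; rewrite ler_norml; lra.
have k1 : e1 * (6 - 4 / 2 ^+ j) <= X.
  rewrite -[leRHS](divfK (_ : 6 != 0)) ?pnatr_eq0 // -/e1 ler_wpM2l ?(ltW e10) // gerBl.
  by rewrite divr_ge0 ?exprn_ge0.
have k2 : (1 - r) / h1 ^+ 2 * W <= X.
  apply: (@le_trans _ _ (d1 / h1 ^+ 2 * (W + 1))).
    rewrite ler_pM ?divr_ge0 ?sqr_ge0 ?(ltW d0) ?lerDl ?ler01 //.
    by rewrite ler_wpM2r ?invr_ge0 ?sqr_ge0 // ltW.
  rewrite /d1 le_eqVlt; apply/orP; left; apply/eqP; field.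
  by rewrite !gt_eqF // ltr_wpDl.
apply: le_trans (ler_wpM2l (ltW c0) (le_trans K2 (lerD (le_trans K k1) k2))) _.
by rewrite /X [e * _]mulrC le_eqVlt; apply/orP; left; apply/eqP; field; rewrite gt_eqF.
Qed.

(** The open ball of radius 2 h contains the closed segment of radius h and has measure 4 h, hence
    the tolerance e / 4. *)
Lemma lebesgue_pt_small (f : R -> R) (th : R) : measurable_fun setT f ->
  (forall a b, intg a b f) -> lebesgue_pt f th ->
  forall e, 0 < e -> exists2 h0, 0 < h0 & forall h, 0 < h -> h <= h0 ->
     rint (th - h) (th + h) (fun t => `|f t - f th|) <= e * h.
Proof.
move=> mf if_ hl e e0; have e4 : 0 < e / 4 by rewrite divr_gt0.
have [fin hc] := (fine_cvgP _ _).1 hl.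
move/cvgrPdist_lt: hc => /(_ _ e4) hlt.
case: fin => d1 /= d10 fin; case: hlt => d2 /= d20 hlt.
exists (Num.min d1 d2 / 4) => [|h h0]; first by rewrite divr_gt0 // lt_min d10.
rewrite ler_pdivlMr // le_min => /andP[hd1 hd2].
have h20 : 0 < 2 * h by rewrite mulr_gt0.
have b1 : ball (0 : R) d1 (2 * h) by rewrite /ball /= sub0r normrN (ger0_norm (ltW h20)); lra.
have b2 : ball (0 : R) d2 (2 * h) by rewrite /ball /= sub0r normrN (ger0_norm (ltW h20)); lra.
have fin2 := fin _ b1 h20; have hI0 := hlt _ b2 h20.
have : fine (davg f th (2 * h)) < e / 4 by apply: le_lt_trans hI0; rewrite sub0r normrN; exact: ler_norm.
rewrite -lte_fin fineK // /davg /iavg lebesgue_measure_ball; last by lra.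
set I := (X in (_ * X)%E) => hI.
have h4 : 0 < (2 * h) *+ 2 by rewrite mulrn_wgt0 // mulr_gt0.
have I1 : (I <= (e * h)%:E)%E.
  move: hI; rewrite inver (gt_eqF h4) lte_pdivrMl // -EFinM => /ltW.
  by rewrite (_ : 2 * h *+ 2 * (e / 4) = e * h) // -mulr_natr; field.
have ii : intg (th - h) (th + h) (fun t => `|f t - f th|).
  by apply: intg_norm; apply: intgB => //; exact: intg_cst.
rewrite -lee_fin /rint /Rintegral fineK; last exact: integrable_fin_num ii.
apply: le_trans I1; rewrite /I; apply: ge0_subset_integral => //.
- exact: measurable_ball.
- apply/measurable_EFinP/measurable_funTS; apply: (measurableT_comp (f := @Num.norm R R)) => //.
  by apply: measurable_funB => //; exact: measurable_cst.
- move=> t /=; rewrite in_itv /= /ball /= => /andP[t1 t2].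
  by apply: (@le_lt_trans _ _ h); [rewrite ler_norml; apply/andP; split; lra|lra].
Qed.

Lemma locally_integrable_intg (f : R -> R) : measurable_fun setT f ->
  (forall a b, intg a b f) -> locally_integrable setT f.
Proof.
move=> mf if_; split=> // [|K _ cK]; first exact: openT.
have [M [_ hM]] := compact_bounded cK.
have KM : K `<=` `[- (`|M| + 1), `|M| + 1]%classic.
  move=> t Kt; rewrite /= in_itv /= -ler_norml; apply: hM => //.
  by apply: le_lt_trans (ler_norm M) _; rewrite ltrDl.
have /integrableP[_] := if_ (- (`|M| + 1)) (`|M| + 1); apply: le_lt_trans.
apply: ge0_subset_integral => //; first exact: compact_measurable.
apply/measurable_EFinP/measurable_funTS; exact: (measurableT_comp (f := @Num.norm R R)).
Qed.

Section RadialLimit.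
Variables (a : nat -> C) (g : C -> C) (u : R -> C).
Hypothesis hg : powser a g.
Hypothesis mu' : cmeas u.
Hypothesis pu : forall t, u (t + T) = u t.
Hypothesis approx : forall e : R, 0 < e -> exists N, forall n, (N <= n)%N ->
  intg 0 T (fun t => cabs (u t - psum a n (cis t)) ^+ 2) /\
  rmean (fun t => cabs (u t - psum a n (cis t)) ^+ 2) <= e.

Let iu : cintg 0 T u := boundary_cper mu' approx.
Let mw c : measurable_fun setT (fun t => cabs (u t - c)).
Proof. exact: (cmeas_cabs (cmeasB mu' (cmeas_cst c))). Qed.

Let iw c : intg 0 T (fun t => cabs (u t - c)).
Proof.
by apply: (intg_cabs (p := fun t => u t - c)); [apply: cmeasB => //; exact: cmeas_cst|
  apply: cintgB => //; exact: cintg_cst].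
Qed.

Lemma poisson_mean_dist z c : cabs z < 1 -> cabs (g z - c) <= rmean (fun t => cabs (u t - c) * poisson z t).
Proof.
move=> z1; have m1 : cmeas (fun t => u t - c) by apply: cmeasB => //; exact: cmeas_cst.
have i1 : cintg 0 T (fun t => u t - c) by apply: cintgB => //; exact: cintg_cst.
have e : pmean (fun t => u t - c) z = g z - c.
  rewrite (_ : (fun t => u t - c) = (fun t => u t + - c * 1)); last by apply/funext => t; rewrite mulr1.
  have j1 : cmeas (fun=> 1 : C) by exact: cmeas_cst.
  have j2 : cintg 0 T (fun=> 1 : C) by exact: cintg_cst.
  have j3 : cmeas (fun t : R => - c * 1) by exact: cmeas_cst.
  have j4 : cintg 0 T (fun t : R => - c * 1) by exact: cintg_cst.
  by rewrite pmeanD // pmeanZ // pmean1 // (pmean_boundary hg) // mulr1.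
rewrite -e; apply: cabs_cmean_le.
- exact: cper_poisson.
- have := intg_cabs (cmeasM m1 (cmeas_poisson z1)) (cper_poisson m1 i1 z1).
  by apply: eq_intg => t _ /=; rewrite cabsM cabs_real ger0_norm ?poisson_ge0.
by move=> t _; rewrite cabsM cabs_real ger0_norm ?poisson_ge0.
Qed.

(** Lebesgue differentiation is applied to the real and imaginary parts; at a common Lebesgue point
    [th] the function |u - u(th)| meets the hypothesis of [poisson_vanish]. *)
Lemma radial_limit : {ae mu, forall t, g (r%:C * cis t) @[r --> (1 : R)^'-] --> u t}.
Proof.
have [mR mI] := mu'; have [iR iI] := iu.
have aR a' b' : intg a' b' (Re \o u) by apply: intg_periodic => // t; rewrite /= pu.
have aI a' b' : intg a' b' (Im \o u) by apply: intg_periodic => // t; rewrite /= pu.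
have lR := lebesgue_differentiation (locally_integrable_intg mR aR).
have lI := lebesgue_differentiation (locally_integrable_intg mI aI).
apply: ae_imp (ae_and lR lI) => th [hR hI]; apply/(@cabs_cvgP R _ _ _) => e e0.
have hL e' : 0 < e' -> exists2 h0, 0 < h0 & forall h, 0 < h -> h <= h0 ->
    rint (th - h) (th + h) (fun t => cabs (u t - u th)) <= e' * h.
  move=> e'0; have e2 : 0 < e' / 2 by rewrite divr_gt0.
  have [h1 h10 H1] := lebesgue_pt_small mR aR hR e2.
  have [h2 h20 H2] := lebesgue_pt_small mI aI hI e2.
  exists (Num.min h1 h2) => [|h h0]; first by rewrite lt_min h10.
  rewrite le_min => /andP[hh1 hh2].
  have i1 : intg (th - h) (th + h) (fun t => `|(Re \o u) t - (Re \o u) th|).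
    by apply: intg_norm; apply: intgB => //; exact: intg_cst.
  have i2 : intg (th - h) (th + h) (fun t => `|(Im \o u) t - (Im \o u) th|).
    by apply: intg_norm; apply: intgB => //; exact: intg_cst.
  apply: (@le_trans _ _ (rint (th - h) (th + h) (fun t => `|(Re \o u) t - (Re \o u) th| + `|(Im \o u) t - (Im \o u) th|))).
    apply: ler_rint; last by move=> t _; apply: (le_trans (cabs_le_ReIm _)); rewrite ReB ImB.
      by apply: intg_periodic => // t; rewrite pu.
    exact: intgD.
  rewrite rintD // (_ : e' * h = e' / 2 * h + e' / 2 * h); last by field.
  by rewrite lerD ?H1 ?H2.
have pw t : cabs (u (t + T) - u th) = cabs (u t - u th) by rewrite pu.
have e2 : 0 < e / 2 by rewrite divr_gt0.
have [d d0 hd] := poisson_vanish (mw (u th)) (fun t => cabs_ge0 _) pw (iw (u th)) hL e2.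
(* The 1 ensures r >= 0, so that the point has modulus r. *)
exists (Num.min d 1) => [|r /=]; first by rewrite /= lt_min d0 ltr01.
rewrite lt_min => /andP[rd r1'] r1.
have rpos : 0 <= r < 1 by rewrite r1 andbT; move: r1'; rewrite ger0_norm ?subr_ge0 ?(ltW r1) //; lra.
have rd' : 1 - r < d by move: rd; rewrite ger0_norm ?subr_ge0 ?(ltW r1).
have z1 : cabs (r%:C * cis th : C) < 1 by rewrite cabs_polar; case/andP: rpos.
rewrite cabs_distC; apply: le_lt_trans (poisson_mean_dist (u th) z1) _.
by apply: le_lt_trans (hd r rpos rd') _; rewrite ltr_pdivrMr // ltr_pMr // ltr1n.
Qed.

End RadialLimit.

Lemma fatou_H2 (a : nat -> C) (g : C -> C) (E : R) : powser a g -> (forall n, energy a n <= E) ->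
  exists F, boundary_value g F.
Proof.
move=> hg hE; have [F [mF hF]] := riesz_fischer hE; exists F; split => //.
apply: (radial_limit hg (u := fun t => F (cis t))) => // t.
by rewrite cis_periodic.
Qed.

End PoissonVanish.

(** * Asymptotic symbols *)

Section CoefficientOperators.
Variable R : realType.
Local Notation C := R[i].
Local Notation T := (2 * pi : R).
Local Notation mu := (@lebesgue_measure R).
Implicit Types (a b c : nat -> C) (f g h : C -> C) (n m k : nat).

(** The action of the operator on Taylor coefficients; linearity is required separately, in
    [bounded_operator_matrix]. *)
Definition has_matrix (Op : (C -> C) -> C -> C) (t : (nat -> C) -> nat -> C) : Prop :=
  forall a f, powser a f -> powser (t a) (Op f).

Definition energy_bounded (t : (nat -> C) -> nat -> C) (K : R) : Prop :=
  forall a (M : R), (forall n, energy a n <= M) -> forall n, energy (t a) n <= K * M.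

Lemma bounded_operator_matrix Op t K : has_matrix Op t ->
  (forall x a b k, t (fun n => x * a n + b n) k = x * t a k + t b k) ->
  0 <= K -> energy_bounded t K -> bounded_operator Op.
Proof.
move=> hOp lin K0 hK; split.
- by move=> f /H2P[a [M [ha _ _ hM]]]; apply: powser_H2 (hOp _ _ ha) (hK _ _ hM).
- move=> x f h /H2P[a [M [ha _ _ _]]] /H2P[b [N [hb _ _ _]]] z /diskE z1.
  have h1 := hOp _ _ (powserD (powserZ x ha) hb).
  have h2 := powserD (powserZ x (hOp _ _ ha)) (hOp _ _ hb).
  exact: (powser_eq (powser_extl (lin x a b) h1) h2 z1).
exists (Num.sqrt K) => f /H2P[a [M [ha -> M0 hM]]]; rewrite sqr_sqrtr // -EFinM.
by apply/(hardy_sqnorm_le _ (hOp _ _ ha)); exact: hK.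
Qed.

Definition shiftn_coef n a k : C := if (k < n)%N then 0 else a (k - n)%N.

Lemma powser_iter_shift a f n : powser a f -> powser (shiftn_coef n a) (iter n (@Defs.shift R) f).
Proof.
move=> ha; elim: n => [|n IH]; first by apply: powser_extl ha => k; rewrite /shiftn_coef subn0.
by apply: powser_extl (powser_shift IH) => -[|k].
Qed.

Lemma powser_iter_backward a f n : powser a f ->
  powser (fun k => a (k + n)%N) (iter n (@backward_shift R) f).
Proof.
move=> ha; elim: n => [|n IH]; first by apply: powser_extl ha => k; rewrite addn0.
by apply: powser_extl (powser_backward IH) => k; rewrite addSn addnS.
Qed.

Lemma energy_shiftn n a (M : R) : (forall m, energy a m <= M) -> forall m, energy (shiftn_coef n a) m <= M.
Proof.
move=> hM m; have E k : energy (shiftn_coef n a) (n + k) = energy a k.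
  elim: k => [|k IH].
    rewrite addn0 /energy big1 ?big_ord0 // => j _.
    by rewrite /shiftn_coef ltn_ord cabs0 expr0n.
  by rewrite addnS !energyS IH /shiftn_coef ltnNge leq_addr /= addKn.
by apply: le_trans (energy_le _ (leq_addl n m)) _; rewrite E.
Qed.

Lemma energy_drop n a m : energy (fun k => a (k + n)%N) m <= energy a (m + n).
Proof.
elim: m => [|m IH]; first by rewrite /energy big_ord0; exact: energy_ge0.
by rewrite addSn !energyS lerD2r.
Qed.

Lemma powser_compression Op t a f n : has_matrix Op t -> powser a f ->
  powser (fun k => t (shiftn_coef n a) (k + n)%N) (shift_compression Op n f).
Proof. by move=> hOp ha; apply/powser_iter_backward/hOp/powser_iter_shift. Qed.

(** Neither shift increases a bound on energies, so all compressions share the bound of [Op] and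
    convergence of each coefficient suffices. *)
Lemma wot_cvg_matrix Op t K L tL KL : has_matrix Op t -> energy_bounded t K ->
  has_matrix L tL -> energy_bounded tL KL ->
  (forall a k, ccvg (fun n => t (shiftn_coef n a) (k + n)%N) (tL a k)) ->
  wot_cvg (shift_compression Op) L.
Proof.
move=> hOp hK hL hKL hc; apply: wot_cvgP => a f M ha hM.
exists (fun n k => t (shiftn_coef n a) (k + n)%N), (tL a), (Num.max (K * M) (KL * M)); split.
- by move=> n; exact: powser_compression.
- exact: hL.
- move=> n m; apply: le_trans (energy_drop n _ m) _; rewrite le_max; apply/orP; left.
  by apply: hK; exact: energy_shiftn.
- by move=> m; rewrite le_max hKL ?orbT.
exact: hc.
Qed.

Definition V_coef c a := prim_coef (conv a (deriv_coef c)).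
Definition S_coef c a := prim_coef (conv (deriv_coef a) c).

Lemma V_op_matrix c g : powser c g -> has_matrix (V_op g) (V_coef c).
Proof. by move=> hc a f ha; apply/powser_primitive/powserM/powser_derive1. Qed.

Lemma S_op_matrix c g : powser c g -> has_matrix (S_op g) (S_coef c).
Proof. by move=> hc a f ha; apply/powser_primitive/powserM => //; exact: powser_derive1. Qed.

(** Multiplication by a holomorphic function is unchanged by the compression: the factor z^n is
    taken out and put back. *)
Lemma conv_shiftn a b n k : conv (shiftn_coef n a) b (k + n) = conv a b k.
Proof.
rewrite /conv -addSn addnC -(big_mkord xpredT (fun j => shiftn_coef n a j * b (k + n - j)%N)).
rewrite (big_cat_nat (leq0n n) (leq_addr _ n)) /= big_nat_cond big1 ?add0r.
  rewrite -{1}[n]add0n [(n + k.+1)%N]addnC big_addn addnK big_mkord; apply: eq_bigr => j _.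
  by rewrite /shiftn_coef ltnNge leq_addl /= addnK subnDr.
by move=> j /andP[/andP[_ jn] _]; rewrite /shiftn_coef jn mul0r.
Qed.

Lemma V_coef_shiftn c a n k : V_coef c (shiftn_coef n a) (k.+1 + n) = conv a (deriv_coef c) k / (k + n).+1%:R.
Proof. by rewrite /V_coef addSn /= conv_shiftn. Qed.

(** A product with z^n has no term of degree below n, so its primitive starts at degree n + 1. *)
Lemma V_coef_shiftn0 c a n : V_coef c (shiftn_coef n a) n = 0.
Proof.
case: n => [|n] //=; rewrite /conv big1 ?mul0r // => j _.
by rewrite /shiftn_coef ltn_ord mul0r.
Qed.

Lemma ccvg_div_nat (x : C) k : ccvg (fun n => x / (k + n).+1%:R) 0.
Proof.
move=> e e0; exists (Num.bound (cabs x / e)) => n hn.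
rewrite subr0 cabsM cabsV cabs_nat ltr_pdivrMr ?ltr0n // mulrC -ltr_pdivrMr //.
apply: lt_le_trans (archi_boundP _) _; first by rewrite divr_ge0 ?cabs_ge0 // ltW.
by rewrite ler_nat (leq_trans hn) // leqW // leq_addl.
Qed.

Lemma V_coef_cvg c a k : ccvg (fun n => V_coef c (shiftn_coef n a) (k + n)%N) 0.
Proof.
case: k => [|k]; first by apply: ccvg_ext (ccvg_cst 0) => n; rewrite V_coef_shiftn0.
by apply: ccvg_ext (ccvg_div_nat (conv a (deriv_coef c) k) k) => n; rewrite V_coef_shiftn.
Qed.

(** Leibniz' rule: in each term the factor n + 1 splits as j plus n + 1 - j. *)
Lemma deriv_conv a b n :
  deriv_coef (conv a b) n = conv (deriv_coef a) b n + conv a (deriv_coef b) n.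
Proof.
have -> : conv (deriv_coef a) b n = \sum_(j < n.+2) j%:R * (a j * b (n.+1 - j)%N).
  rewrite [RHS]big_ord_recl mul0r add0r /conv; apply: eq_bigr => j _.
  by rewrite /deriv_coef /= /bump leq0n add1n subSS mulrA.
have -> : conv a (deriv_coef b) n = \sum_(j < n.+2) (n.+1 - j)%:R * (a j * b (n.+1 - j)%N).
  rewrite [RHS]big_ord_recr /= subnn mul0r addr0 /conv; apply: eq_bigr => j _.
  by rewrite /deriv_coef -subSn 1?mulrCA // -ltnS.
rewrite /deriv_coef /conv mulr_sumr -big_split; apply: eq_bigr => j _ /=.
by rewrite -mulrDl -natrD subnKC // -ltnS.
Qed.

(* [S_g f = f g - f(0) g(0) - V_g f]. *)
Lemma S_coefE c a k : S_coef c a k = (if k == 0%N then 0 else conv a c k) - V_coef c a k.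
Proof.
case: k => [|k]; rewrite /S_coef /V_coef /=; first by rewrite subr0.
have k0 : k.+1%:R != 0 :> C by rewrite pnatr_eq0.
have := deriv_conv a c k; rewrite {1}/deriv_coef => E.
by apply: (mulIf k0); rewrite mulrBl !divfK // mulrC E addrK.
Qed.

Lemma S_coef_cvg c a k : ccvg (fun n => S_coef c (shiftn_coef n a) (k + n)%N) (conv a c k).
Proof.
rewrite -[conv a c k]subr0; have h := ccvgB (ccvg_cst (conv a c k)) (@V_coef_cvg c a k).
(* From N + 1 on the index k + n is positive, which avoids the exceptional term f(0) g(0) at index
   0. *)
move=> e /h[N hN]; exists N.+1 => n Nn; have := hN n (ltnW Nn).
by rewrite S_coefE conv_shiftn addn_eq0 (gtn_eqF (leq_trans _ Nn)) ?andbF.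
Qed.

Lemma hardy_energy_le a f (M : R) : powser a f ->
  (forall r : R, 0 <= r < 1 -> rmean (fun t => cabs (f (r%:C * cis t)) ^+ 2) <= M) ->
  forall n, energy a n <= M.
Proof.
move=> ha h; apply/(hardy_sqnorm_le _ ha); apply: ge_ereal_sup => _ [r + <-].
rewrite /= in_itv /= => hr; rewrite (circle_sqnormE ha hr) lee_fin.
apply: le_trans (h r hr); rewrite Re_cmean le_eqVlt; apply/orP; left; apply/eqP.
by rewrite /rmean; congr (_ * _); apply: eq_rint => t _; rewrite mulJ_cabs.
Qed.

(** On circles |f g| <= G |f|, which the Hardy norm carries over to energies; a sequence of bounded
    energy is first realized by a function [f]. *)
Lemma conv_energy_bounded c g (G : R) : powser c g -> (forall z, cabs z < 1 -> cabs (g z) <= G) ->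
  energy_bounded (fun a => conv a c) (G ^+ 2).
Proof.
move=> hc hG a M hM; have M0 : 0 <= M by apply: le_trans (hM 0%N); exact: energy_ge0.
have [f ha] : exists f, powser a f.
  apply: powser_exists => r /andP[r0 r1]; exists (M + 1) => k.
  have h1 : cabs (a k) ^+ 2 <= M.
    by apply: le_trans (hM k.+1); rewrite energyS lerDr energy_ge0.
  have h2 : cabs (a k) <= M + 1.
    by move: h1 (cabs_ge0 (a k)); move: (cabs _) => x; rewrite expr2; nra.
  rewrite -[leRHS]mulr1; apply: ler_pM => //; [exact: cabs_ge0|exact: exprn_ge0|].
  by apply: exprn_ile1 => //; exact: ltW.
apply: (hardy_energy_le (powserM ha hc)) => r hr.
have i1 := circle_intg_sqr ha hr; have i2 := circle_intg_sqr (powserM ha hc) hr.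
apply: (@le_trans _ _ (G ^+ 2 * rmean (fun t => cabs (f (r%:C * cis t)) ^+ 2))).
  rewrite /rmean mulrCA ler_wpM2l ?invr_ge0 ?(ltW (twopi_gt0 R)) // -rintZ //.
  apply: ler_rint => //; first exact: intgZ.
  move=> t _; rewrite cabsM exprMn mulrC ler_wpM2r ?sqr_ge0 //.
  have := hG (r%:C * cis t); case/andP: hr => r0 r1; rewrite cabs_polar // => /(_ r1) h.
  by rewrite ler_pXn2r ?nnegrE ?cabs_ge0 // (le_trans (cabs_ge0 _) h).
by rewrite ler_wpM2l ?sqr_ge0 // (circle_rmean_sqr_le ha hr hM).
Qed.

Lemma S_coef_bounded c K G : 0 <= K -> energy_bounded (V_coef c) K ->
  energy_bounded (fun a => conv a c) G -> energy_bounded (S_coef c) (2 * G + 2 * K).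
Proof.
move=> K0 hV hG a M hM n.
apply: (@le_trans _ _ (2 * energy (conv a c) n + 2 * energy (V_coef c a) n)).
  rewrite /energy !mulr_sumr -big_split; apply: ler_sum => k _ /=.
  rewrite S_coefE; apply: (le_trans (sqr_cabsD_le _ _)); rewrite cabsN lerD2r ler_wpM2l //.
  by case: eqP => _ //; rewrite cabs0 expr0n sqr_ge0.
rewrite (mulrDl (2 * G)) -(mulrA 2 G) -(mulrA 2 K).
by apply: lerD; apply: ler_wpM2l => //; [exact: hG|exact: hV].
Qed.

Lemma V_coef_linear c x a b k : V_coef c (fun n => x * a n + b n) k = x * V_coef c a k + V_coef c b k.
Proof.
case: k => [|k]; rewrite /V_coef /=; first by rewrite mulr0 addr0.
rewrite mulrA -mulrDl; congr (_ / _); rewrite /conv mulr_sumr -big_split.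
by apply: eq_bigr => j _ /=; rewrite mulrDl mulrA.
Qed.

Lemma conv_linear c x a b k : conv (fun n => x * a n + b n) c k = x * conv a c k + conv b c k.
Proof.
rewrite /conv mulr_sumr -big_split.
by apply: eq_bigr => j _ /=; rewrite mulrDl mulrA.
Qed.

Lemma S_coef_linear c x a b k : S_coef c (fun n => x * a n + b n) k = x * S_coef c a k + S_coef c b k.
Proof.
rewrite !S_coefE V_coef_linear; case: eqP => _; last rewrite conv_linear; ring.
Qed.

Lemma V_coef_bounded c g (b : C -> C) cb (L : R) : powser c g -> powser cb b ->
  (forall z, cabs z < 1 -> 1 <= Re (b z) + cabs (g z) ^+ 2 <= L) ->
  energy_bounded (V_coef c) (2 * (L + 1) ^+ 2).
Proof. by move=> hc hb h a M hM n; exact: (carleson_powser hc hb h hM). Qed.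

Lemma boundary_intg2 a f F (M : R) : powser a f -> (forall n, energy a n <= M) -> boundary_value f F ->
  intg 0 T (fun t => cabs (F (cis t)) ^+ 2).
Proof.
move=> ha hM hF; have mF : cmeas (fun t => F (cis t)) := hF.1.
exact: (boundary_intg_sqr mF (fun e e0 => boundary_approx ha hM hF e0)).
Qed.

(** The boundary function of an element of H2 is its own projection. Both symbols reduce to this
    case, since the product of the symbol with [F] is again such a boundary function. *)
Lemma riesz_projection_boundary (u U : C -> C) : H2 u -> boundary_value u U -> riesz_projection U u.
Proof.
move=> hu hU; have [a [M [ha _ _ hM]]] := H2P hu; split => //.
  split; first exact: hU.1.
  have i2 := boundary_intg2 ha hM hU; rewrite /circle_sqnorm.
  rewrite -(@fineK _ (\int[mu]_(t in `[0%R, (2 * pi)%R]) ((cabs (U (cis t))) ^+ 2)%:E)%E).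
    by rewrite -EFinM ltry.
  exact: integrable_fin_num i2.
exists U => // h H _ _; rewrite /circle_inner (_ : (fun t => _) = (fun=> 0)); last first.
  by apply/funext => t; rewrite subrr mul0r.
by rewrite -[cintegral _ _]/(cint 0 T (fun=> 0)) cint_cst ?(ltW (twopi_gt0 R)) // mul0r mulr0.
Qed.

Lemma H2_boundary f : H2 f -> exists F, boundary_value f F.
Proof. by move=> /H2P[a [M [ha _ _ hM]]]; exact: fatou_H2 ha hM. Qed.

Lemma ae_all (P : R -> Prop) : (forall t, P t) -> {ae mu, forall t, P t}.
Proof.
move=> h; exists set0; split; [exact: measurable0|by rewrite measure0|].
by move=> t /= /(_ (h t)).
Qed.

Lemma toeplitz_operator0 : toeplitz_operator (fun=> 0 : C) (fun _ _ => 0).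
Proof.
have h0 : powser (fun=> 0) (fun=> 0 : C).
  by apply: powser_extl (powser_cst 0) => -[|k].
have H0 : H2 (fun=> 0 : C).
  by apply: (powser_H2 (M := 0) h0) => n; rewrite /energy big1 // => k _; rewrite cabs0 expr0n.
have m0 : circle_measurable (fun=> 0 : C) by split; exact: measurable_cst.
split.
  by split => //; exists 0; apply: ae_all => t; rewrite cabs0.
move=> f /H2_boundary[F hF]; exists F => //.
rewrite (_ : (fun w => 0 * F w) = (fun=> 0)); last by apply/funext => w; rewrite mul0r.
apply: (riesz_projection_boundary H0); split; first exact: m0.
apply: ae_all => t; apply/(@cabs_cvgP R _ _ _) => e e0; apply: nearW => r.
by rewrite subrr cabs0.
Qed.

Lemma bounded_energy c g (G : R) : powser c g -> (forall z, cabs z < 1 -> cabs (g z) <= G) ->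
  forall n, energy c n <= G ^+ 2.
Proof.
move=> hc hG; apply: (hardy_energy_le hc) => r hr; have i1 := circle_intg_sqr hc hr.
rewrite -[leRHS](rmean_cst (G ^+ 2)) /rmean ler_wpM2l ?invr_ge0 ?(ltW (twopi_gt0 R)) //.
apply: ler_rint => //; first exact: intg_cst.
move=> t _; have := hG (r%:C * cis t); case/andP: hr => r0 r1; rewrite cabs_polar // => /(_ r1) h.
by rewrite ler_pXn2r ?nnegrE ?cabs_ge0 // (le_trans (cabs_ge0 _) h).
Qed.

Lemma boundary_Linfty g F (G : R) : (forall z, cabs z < 1 -> cabs (g z) <= G) ->
  boundary_value g F -> Linfty_circle F.
Proof.
move=> hG hF; split; first exact: hF.1.
exists G; apply: ae_imp hF.2 => t ht; have h := radial_ccvg ht.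
have := ccvg_le (z := 0) (K := G) _ h; rewrite subr0; apply => n.
by rewrite subr0; apply: hG; case/andP: (rad_itv R n) => r0 r1; rewrite cabs_polar.
Qed.

Lemma boundary_valueM f g F G : boundary_value f F -> boundary_value g G ->
  boundary_value (fun z => f z * g z) (fun w => F w * G w).
Proof.
move=> [mF hF] [mG hG]; split; first exact: (cmeasM (p := F \o @cis R) (q := G \o @cis R)).
by apply: ae_imp (ae_and hF hG) => t [h1 h2]; exact: (cvgM h1 h2).
Qed.

Lemma V_op_asymptotic g cg (L : R) cb (b : C -> C) : powser cg g -> powser cb b ->
  (forall z, cabs z < 1 -> 1 <= Re (b z) + cabs (g z) ^+ 2 <= L) ->
  weakly_asymptotically_toeplitz (V_op g) /\ weak_asymptotic_symbol (V_op g) (fun=> 0).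
Proof.
move=> hg hb hL; have hK := V_coef_bounded hg hb hL.
have K0 : 0 <= 2 * (L + 1) ^+ 2 by rewrite mulr_ge0 ?sqr_ge0.
have hV := V_op_matrix hg.
have bV := bounded_operator_matrix hV (fun x a b k => V_coef_linear cg x a b k) K0 hK.
pose L0 : (C -> C) -> C -> C := fun _ _ => 0; pose t0 (a : nat -> C) (k : nat) : C := 0.
have h0 : has_matrix L0 t0.
  by move=> a f _; apply: powser_extl (powser_cst 0) => -[|k].
have k0 : energy_bounded t0 0.
  by move=> a M hM n; rewrite mul0r /energy big1 // => k _; rewrite cabs0 expr0n.
have b0 : bounded_operator L0.
  by apply: (bounded_operator_matrix h0 _ (lexx 0) k0) => x a b' k; rewrite /t0 mulr0 addr0.
have w0 := wot_cvg_matrix hV hK h0 k0 (fun a k => @V_coef_cvg cg a k).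
split; first by split=> //; exists L0.
by exists L0; split => //; exact: toeplitz_operator0.
Qed.

Lemma S_op_asymptotic g cg (G : R) : powser cg g -> (forall z, cabs z < 1 -> cabs (g z) <= G) ->
  weakly_asymptotically_toeplitz (S_op g) /\
  exists2 b : C -> C, boundary_value g b & weak_asymptotic_symbol (S_op g) b.
Proof.
move=> hg hG.
have hb z : cabs z < 1 -> 1 <= Re (1 : C) + cabs (g z) ^+ 2 <= 1 + G ^+ 2.
  move=> /hG h; rewrite lerDl sqr_ge0 lerD2l ler_pXn2r ?nnegrE ?cabs_ge0 //.
  exact: le_trans (cabs_ge0 _) h.
have hK := V_coef_bounded hg (powser_cst 1) hb.
set KV := 2 * _ in hK; have K0 : 0 <= KV by rewrite mulr_ge0 ?sqr_ge0.
have hM := conv_energy_bounded hg hG.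
have hS := S_coef_bounded K0 hK hM.
have KS0 : 0 <= 2 * G ^+ 2 + 2 * KV by rewrite addr_ge0 // mulr_ge0 ?sqr_ge0.
have mS := S_op_matrix hg.
have bS := bounded_operator_matrix mS (fun x a b k => S_coef_linear cg x a b k) KS0 hS.
pose L (f : C -> C) z := f z * g z.
have mL : has_matrix L (fun a => conv a cg) by move=> a f ha; exact: powserM.
have bL := bounded_operator_matrix mL (fun x a b k => conv_linear cg x a b k) (sqr_ge0 G) hM.
have w := wot_cvg_matrix mS hS mL hM (fun a k => @S_coef_cvg cg a k).
split; first by split=> //; exists L.
have [b hbv] := fatou_H2 hg (bounded_energy hg hG); exists b => //.
exists L; split => //; split; first exact: boundary_Linfty hG hbv.
move=> f hf; have [F hF] := H2_boundary hf; exists F => //.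
rewrite (_ : (fun w => b w * F w) = (fun w => F w * b w)); last first.
  by apply/funext => w'; rewrite mulrC.
apply: riesz_projection_boundary; last exact: boundary_valueM.
by case: bL => h _ _; exact: h.
Qed.

End CoefficientOperators.

Theorem theorem3p4 (R : realType) :
  (forall g : R[i] -> R[i], BMOA g ->
     weakly_asymptotically_toeplitz (V_op g) /\
     weak_asymptotic_symbol (V_op g) (fun _ : R[i] => 0)) /\
  (forall g : R[i] -> R[i], Hinfty g ->
     weakly_asymptotically_toeplitz (S_op g) /\
     exists2 b : R[i] -> R[i], boundary_value g b &
       weak_asymptotic_symbol (S_op g) b).
Proof.
split => g.
  move=> [/H2P[a [E [ha _ _ hE]]] [F hF bF]].
  have [cb [b [L [hb hL]]]] := bmo_carleson_symbol ha hE hF bF.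
  exact: V_op_asymptotic ha hb hL.
move=> [/holomorphic_has_powser[a ha] [G hG]].
by apply: (S_op_asymptotic (G := G) ha) => z /diskE; exact: hG.
Qed.
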